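(* Let $1<p,q<\infty$, $0\le\alpha<n$, $1/q=1/p-\alpha/n$, $m\in\mathbb{Z}^+$ and $\omega\in A_{p,q}$. Let $T_{K_\alpha}$ be a $\rho$-type Calderón–Zygmund operator (if $\alpha=0$) or a $\rho$-type fractional integral operator (if $0<\alpha<n$), with real-valued kernel $K_\alpha$. If $b\in\mathrm{CMO}(\mathbb{R}^n)$ ($b$ real-valued if $m\ge2$), then the iterated commutator $(T_{K_\alpha})_b^m$ is a compact operator from $L^p(\omega^p)$ to $L^q(\omega^q)$.
   Context: Cubes $Q\subset\mathbb{R}^n$ have sides parallel to the axes. $\mathrm{BMO}(\mathbb{R}^n)$ is the space of $f\in L^1_{loc}(\mathbb{R}^n)$ with $\|f\|_{\mathrm{BMO}}:=\sup_Q \frac1{|Q|}\int_Q|f(x)-f_Q|\,dx<\infty$, $f_Q=\frac1{|Q|}\int_Q f$. $\mathrm{CMO}(\mathbb{R}^n)$ is the closure of $C_c^\infty(\mathbb{R}^n)$ in the $\mathrm{BMO}(\mathbb{R}^n)$ topology. Weights: for $1<p,q<\infty$ with $1/q=1/p-\alpha/n$, $0\le\alpha<n$, a weight $\omega$ belongs to $A_{p,q}$ if $$[\omega]_{A_{p,q}}^{1/q}:=\sup_Q\Big(\frac1{|Q|}\int_Q\omega^q\,dx\Big)^{1/q}\Big(\frac1{|Q|}\int_Q\omega^{-p'}\,dx\Big)^{1/p'}<\infty,\qquad \frac1p+\frac1{p'}=1.$$ $L^p(\omega^p)$ has norm $(\int|f|^p\omega^p\,dx)^{1/p}$, and similarly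 for $L^q(\omega^q)$. Modulus of continuity: $\rho:[0,1]\to[0,\infty)$ is continuous, increasing, subadditive, $\rho(0)=0$, and satisfies the Dini condition $\int_0^1\rho(t)\frac{dt}{t}<\infty$. Operators: for $0\le\alpha<n$ the operator satisfies $$T_{K_\alpha}f(x)=\int_{\mathbb{R}^n}K_\alpha(x,y)f(y)\,dy\quad\text{for all }x\notin\operatorname{supp}f,$$ with $|K_\alpha(x,y)|\le \frac{C_{K_\alpha}}{|x-y|^{n-\alpha}}$ and $$|K_\alpha(x,y)-K_\alpha(x',y)|+|K_\alpha(y,x)-K_\alpha(y,x')|\le\rho\Big(\frac{|x-x'|}{|x-y|}\Big)\frac1{|x-y|^{n-\alpha}}\quad\text{whenever }|x-y|>2|x-x'|.$$ When $\alpha=0$, $T_{K_0}$ is called a $\rho$-type Calderón–Zygmund operator and is in addition assumed bounded on $L^2(\mathbb{R}^n)$. When $0<\alpha<n$, $T_{K_\alpha}$ is called a $\rho$-type fractional integral operator and is given by the (absolutely convergent) integral above, so that $|T_{K_\alpha}f|\le C_{K_\alpha}I_\alpha(|f|)$, where $I_\alpha g(x)=\int_{\mathbb{R}^n} g(y)|x-y|^{\alpha-n}\,dy$. Commutators: for suitable functions $f$, $T_b^1f=[b,T]f:=b\,T(f)-T(bf)$, and $T_b^m:=[b,T_b^{m-1}]$ for $m\ge2$. *)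

(* Defs.v *)
From HB Require Import structures.
From mathcomp Require Import all_boot all_order all_algebra.
From mathcomp Require Import complex.
From mathcomp Require Import all_classical all_reals all_analysis.
From mathcomp Require Import measurable_realfun.

Set Implicit Arguments.
Unset Strict Implicit.
Unset Printing Implicit Defensive.

Import Order.TTheory GRing.Theory Num.Theory.
Import numFieldNormedType.Exports.

Local Open Scope complex_scope.
Local Open Scope classical_set_scope.
Local Open Scope ring_scope.

Notation cabs := ComplexField.Normc.normc.

(* R^n is 'rV[R]_n with the sigma-algebra generated by the coordinates, i.e.
   the Borel sigma-algebra. *)
Section measurable_rV.
Context {R : realType} (n : nat).

Let coord (i : 'I_n) (v : 'rV[R]_n) : R := v ord0 i.

Let rV_set0 : g_sigma_preimage coord set0.
Proof. exact: sigma_algebra0. Qed.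

Let rV_setC A : g_sigma_preimage coord A -> g_sigma_preimage coord (~` A).
Proof. exact: sigma_algebraC. Qed.

Let rV_bigcup (F : _^nat) : (forall i, g_sigma_preimage coord (F i)) ->
  g_sigma_preimage coord (\bigcup_i (F i)).
Proof. exact: sigma_algebra_bigcup. Qed.

HB.instance Definition _ :=
  @isMeasurable.Build (measure_tuple_display default_measure_display)
    'rV[R]_n (g_sigma_preimage coord) rV_set0 rV_setC rV_bigcup.

End measurable_rV.

Lemma measurable_coord {R : realType} (n : nat) (i : 'I_n) :
  measurable_fun [set: 'rV[R]_n] (fun v : 'rV[R]_n => v ord0 i).
Proof.
move=> _ Y mY; rewrite setTI; apply: sub_sigma_algebra => /=.
rewrite -bigcup_seq/=; exists i => /=; first by rewrite mem_index_enum.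
by exists Y => //; rewrite setTI.
Qed.

Lemma measurable_fun_rV {R : realType} (n : nat) d (T : measurableType d)
    (f : T -> 'rV[R]_n) :
  (forall i, measurable_fun [set: T] (fun t => f t ord0 i)) ->
  measurable_fun [set: T] f.
Proof.
move=> mf.
suff: g_sigma_preimage (fun i => (fun v : 'rV[R]_n => v ord0 i) \o f)
    `<=` measurable.
  by rewrite g_sigma_preimage_comp => h _ A mA; apply: h; exists A.
apply: smallest_sub; first exact: sigma_algebra_measurable.
case: n f mf => [|k] f mf; first by rewrite big_ord0.
rewrite -bigcup_mkord_ord; apply: bigcup_sub => i Ii.
by move=> A [B mB <-]; exact: mf.
Qed.

(* The measure on R^(n+1) obtained from R^1 x R^n. *)
Section lebesgue_succ.
Context {R : realType} (n : nat) (mu : {sigma_finite_measure set 'rV[R]_n -> \bar R}).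

Definition rV_cons (z : measurableTypeR R * 'rV[R]_n) : 'rV[R]_n.+1 :=
  row_mx (const_mx z.1 : 'rV[R]_1) z.2.
Definition rV_uncons (v : 'rV[R]_n.+1) : measurableTypeR R * 'rV[R]_n :=
  (v ord0 ord0, rsubmx (v : 'rV_(1 + n))).

Lemma rV_consK : cancel rV_cons rV_uncons.
Proof.
move=> [x v]; rewrite /rV_uncons /rV_cons/= row_mxKr; congr pair.
rewrite (_ : ord0 = lshift n (ord0 : 'I_1) :> 'I_(1 + n)); last exact/val_inj.
by rewrite (@row_mxEl _ 1 1 n) mxE.
Qed.

Lemma measurable_rV_cons : measurable_fun setT rV_cons.
Proof.
apply: measurable_fun_rV => i; case: (split_ordP (i : 'I_(1 + n))) => j ->.
  rewrite (_ : (fun _ => _) = fst); first exact: measurable_fst.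
  by apply/funext => z /=; rewrite /rV_cons (@row_mxEl _ 1 1 n) mxE.
rewrite (_ : (fun _ => _) = (fun v : 'rV[R]_n => v ord0 j) \o snd).
  exact: (measurableT_comp (measurable_coord j) measurable_snd).
by apply/funext => z /=; rewrite /rV_cons (@row_mxEr _ 1 1 n).
Qed.

Lemma measurable_rV_uncons : measurable_fun setT rV_uncons.
Proof.
apply/measurable_fun_pairP; split; first exact: measurable_coord.
apply: measurable_fun_rV => i.
rewrite (_ : (fun _ => _) = fun v : 'rV[R]_n.+1 => v ord0 (rshift 1 i)).
  exact: measurable_coord.
by apply/funext => v /=; rewrite mxE.
Qed.

Let leb1 : {sigma_finite_measure set (measurableTypeR R) -> \bar R} :=
  lebesgue_measure.

Definition lebesgue_succ := pushforward (leb1 \x mu)%E rV_cons.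

Let ls0 : lebesgue_succ set0 = 0%E.
Proof. by rewrite /lebesgue_succ /pushforward preimage_set0 measure0. Qed.

Let ls_ge0 A : (0 <= lebesgue_succ A)%E.
Proof. by rewrite /lebesgue_succ /pushforward measure_ge0. Qed.

Let ls_sigma_additive : semi_sigma_additive lebesgue_succ.
Proof.
have mc A : measurable A -> measurable (rV_cons @^-1` A).
  by move=> mA; rewrite -[X in measurable X]setTI; exact: measurable_rV_cons.
move=> F mF tF mUF; rewrite /lebesgue_succ /pushforward preimage_bigcup.
apply: measure_semi_sigma_additive.
- by move=> k; exact: mc.
- apply/trivIsetP => /= i j _ _ ij; rewrite -preimage_setI.
  by move/trivIsetP : tF => /(_ _ _ _ _ ij) ->//; rewrite preimage_set0.
- by rewrite -preimage_bigcup; exact: mc.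
Qed.

HB.instance Definition _ := isMeasure.Build _ _ _ lebesgue_succ
  ls0 ls_ge0 ls_sigma_additive.

Let ls_sigma_finite : sigma_finite setT lebesgue_succ.
Proof.
have mU A : measurable A -> measurable (rV_uncons @^-1` A).
  by move=> mA; rewrite -[X in measurable X]setTI; exact: measurable_rV_uncons.
have /sigma_finiteP[F [TF ndF Foo]] := sigma_finiteT leb1.
have /sigma_finiteP[G [TG ndG Goo]] := sigma_finiteT mu.
exists (fun k => rV_uncons @^-1` (F k `*` G k)).
  rewrite -preimage_bigcup -(preimage_setT rV_uncons); congr (_ @^-1` _).
  rewrite -setXTT TF TG predeqE => -[x y]; split.
    move=> [/= [i _ Fix] [k _ Gky]]; exists (maxn i k) => //; split.
    - by move: x Fix; exact/subsetPset/ndF/leq_maxl.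
    - by move: y Gky; exact/subsetPset/ndG/leq_maxr.
  by move=> [i _ []/= ? ?]; split; exists i.
move=> k; have [mF Fk] := Foo k; have [mG Gk] := Goo k.
split; first by apply: mU; exact: measurableX.
rewrite /lebesgue_succ /pushforward -comp_preimage.
rewrite (_ : _ \o _ = id); last by apply/funext => z /=; rewrite rV_consK.
by rewrite preimage_id product_measure1E// lte_mul_pinfty// ge0_fin_numE.
Qed.

HB.instance Definition _ := Measure_isSigmaFinite.Build _ _ _ lebesgue_succ
  ls_sigma_finite.

End lebesgue_succ.

(* n-dimensional Lebesgue measure *)
Fixpoint lebesgue_rV {R : realType} (n : nat) :
    {sigma_finite_measure set 'rV[R]_n -> \bar R} :=
  match n with
  | 0 => \d_ (0 : 'rV[R]_0)
  | n'.+1 => lebesgue_succ (lebesgue_rV n')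
  end.

Section function_classes.
Context {R : realType} {n : nat}.
Local Notation X := 'rV[R]_n.
Local Notation C := R[i].
Local Notation mu := (@lebesgue_rV R n).

Definition enorm (x : X) : R := Num.sqrt (\sum_(i < n) x ord0 i ^+ 2).

Definition cmeasurable (f : X -> C) :=
  measurable_fun setT (fun x => complex.Re (f x)) /\
  measurable_fun setT (fun x => complex.Im (f x)).

Definition cintegrable (D : set X) (f : X -> C) :=
  mu.-integrable D (fun x => (complex.Re (f x))%:E) /\
  mu.-integrable D (fun x => (complex.Im (f x))%:E).

Definition cintegral (D : set X) (f : X -> C) : C :=
  (\int[mu]_(x in D) complex.Re (f x)) +i* (\int[mu]_(x in D) complex.Im (f x)).

Definition locally_integrable_rV (f : X -> C) :=
  cmeasurable f /\
  forall D, compact D -> (\int[mu]_(x in D) (cabs (f x))%:E < +oo)%E.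

Definition compactly_supported (f : X -> C) :=
  compact (closure [set x | f x != 0]).

(* the partial derivative of g along the successive coordinates in s *)
Definition partial (s : seq 'I_n) (g : X -> R) : X -> R :=
  foldr (fun i h => 'D_(delta_mx ord0 i) h) g s.

Definition smooth (g : X -> R) :=
  forall s : seq 'I_n, continuous (partial s g) /\
    forall (i : 'I_n) x, derivable (partial s g) x (delta_mx ord0 i).

Definition test_function (f : X -> C) :=
  [/\ smooth (fun x => complex.Re (f x)), smooth (fun x => complex.Im (f x))
    & compactly_supported f].

Definition cube (a : X) (l : R) : set X :=
  [set x | forall i, a ord0 i <= x ord0 i <= a ord0 i + l].

Definition cubes : set (set X) :=
  [set Q | exists a l, 0 < l /\ Q = cube a l].

Definition vol (Q : set X) : R := fine (mu Q).

Definition average (Q : set X) (f : X -> C) : C :=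
  ((vol Q)^-1)%:C * cintegral Q f.

Definition bmo_norm (f : X -> C) : \bar R :=
  ereal_sup [set ((vol Q)^-1)%:E *
    \int[mu]_(x in Q) (cabs (f x - average Q f))%:E | Q in cubes]%E.

Definition bmo (f : X -> C) :=
  locally_integrable_rV f /\ (bmo_norm f < +oo)%E.

Definition cmo (f : X -> C) :=
  bmo f /\ forall e : R, 0 < e ->
    exists2 g, test_function g & (bmo_norm (f \- g)%R < e%:E)%E.

End function_classes.

Lemma lebesgue_rV_cube {R : realType} n (a : 'rV[R]_n) (l : R) : 0 <= l ->
  lebesgue_rV n (cube a l) = (l ^+ n)%:E.
Proof.
move=> l0; elim: n a => [|n ih] a /=.
  rewrite (_ : cube a l = setT); first by rewrite diracT.
  by apply/seteqP; split => // x _ [].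
rewrite /lebesgue_succ /pushforward.
set a' := (rsubmx (a : 'rV_(1 + n))).
rewrite (_ : _ @^-1` _ = `[a ord0 ord0, a ord0 ord0 + l] `*` cube a' l).
  rewrite product_measure1E//=.
  - rewrite ih lebesgue_measure_itv/= lte_fin ltrDl.
    move: l0; rewrite le_eqVlt => /predU1P[<-|l0].
      by rewrite ltxx mul0e expr0n.
    by rewrite l0 -EFinD addrAC subrr add0r -EFinM exprS.
  - have -> : cube a' l = \bigcap_(i in [set: 'I_n])
       ((fun v : 'rV[R]_n => v ord0 i) @^-1` `[a' ord0 i, a' ord0 i + l]).
      apply/seteqP; split => x /=.
        by move=> h i _ /=; rewrite in_itv/=; exact: h.
      by move=> h i; have := h i Logic.I; rewrite /= in_itv.
    apply: fin_bigcap_measurable => // i _.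
    rewrite -[X in measurable X]setTI; exact: measurable_coord.
apply/seteqP; split => -[x v] /=.
  move=> h; split.
    rewrite in_itv/=; have := h ord0.
    by have -> : rV_cons (x, v) ord0 ord0 = x by exact: (congr1 fst (rV_consK (x,v))).
  move=> i; have := h (rshift 1 i).
  by rewrite /rV_cons (@row_mxEr _ 1 1 n) /a' mxE.
move=> [+ h] i; rewrite in_itv/= => hx.
case: (split_ordP (i : 'I_(1 + n))) => j ->.
  rewrite /rV_cons (@row_mxEl _ 1 1 n) mxE/=.
  by have -> : lshift n j = ord0 by apply/val_inj; case: j => -[].
rewrite /rV_cons (@row_mxEr _ 1 1 n) /=.
by have := h j; rewrite /a' mxE.
Qed.

Record weight (R : realType) (n : nat) := Weight {
  weight_fun :> 'rV[R]_n -> R ;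
  weight_measurable : measurable_fun setT weight_fun ;
  weight_ge0 : forall x, 0 <= weight_fun x ;
  weight_gt0 : {ae @lebesgue_rV R n, forall x, 0 < weight_fun x} ;
  weight_locally_integrable : forall D : set 'rV[R]_n, compact D ->
    (\int[@lebesgue_rV R n]_(x in D) (weight_fun x)%:E < +oo)%E }.

(* [w]_{A_{p,q}}^{1/q}; the inverse of (1 - p^-1) is the exponent p' conjugate
   to p *)
Definition Apq_constant (R : realType) (n : nat) (p q : R) (w : weight R n) :
    \bar R :=
  let p' := (1 - p^-1)^-1 in
  let mu := @lebesgue_rV R n in
  ereal_sup [set
    (((vol Q)^-1)%:E * \int[mu]_(x in Q) (w x `^ q)%:E) `^ q^-1 *
    (((vol Q)^-1)%:E * \int[mu]_(x in Q) (w x `^ (- p'))%:E) `^ p'^-1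
    | Q in cubes]%E.

Section lebesgue_spaces.
Context {R : realType} {n : nat}.
Local Notation X := 'rV[R]_n.
Local Notation C := R[i].
Local Notation mu := (@lebesgue_rV R n).

(* the norm of L^p(w^p) *)
Definition wnorm (p : R) (w : X -> R) (f : X -> C) : \bar R :=
  ((\int[mu]_x (cabs (f x) `^ p * w x `^ p)%:E) `^ p^-1)%E.

Definition in_wLp (p : R) (w : X -> R) (f : X -> C) :=
  cmeasurable f /\ (wnorm p w f < +oo)%E.

Definition in_L2 : (X -> C) -> Prop := in_wLp 2 (fun=> 1).

Definition L2norm : (X -> C) -> \bar R := wnorm 2 (fun=> 1).

Lemma cabs_ge0 (z : C) : 0 <= cabs z.
Proof. by case: z => a b; exact: sqrtr_ge0. Qed.

Lemma measurable_cabs (f : X -> C) :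
  cmeasurable f -> measurable_fun setT (fun x => cabs (f x)).
Proof.
move=> [mr mi].
rewrite (_ : (fun _ => _) = (fun x => (complex.Re (f x) ^+ 2 +
    complex.Im (f x) ^+ 2) `^ 2^-1)).
  apply: (measurableT_comp (measurable_powR 2^-1)).
  by apply: measurable_funD; apply: measurable_funX.
apply/funext => x; rewrite powR12_sqrt ?addr_ge0 ?sqr_ge0//.
by case: (f x).
Qed.

Lemma wnormE p (w : weight R n) f :
  wnorm p w f = ('N[mu]_p%:E [EFin \o (fun x => cabs (f x) * w x)%R])%E.
Proof.
rewrite unlock /wnorm; congr (_ `^ _)%E; apply: eq_integral => x _ /=.
by rewrite ger0_norm ?mulr_ge0 ?cabs_ge0 ?weight_ge0// powRM ?cabs_ge0 ?weight_ge0.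
Qed.

Lemma wnorm_distC p (w : X -> R) (g h : X -> C) :
  wnorm p w (fun x => g x - h x) = wnorm p w (fun x => h x - g x).
Proof.
suff gh x : cabs (g x - h x) = cabs (h x - g x).
  by rewrite /wnorm; under eq_integral => x _ do rewrite gh.
by rewrite -opprB; exact: normcN.
Qed.

Lemma le_wnorm p (w : weight R n) f g : 1 < p ->
  cmeasurable f -> cmeasurable g ->
  (wnorm p w (f \+ g)%R <= wnorm p w f + wnorm p w g)%E.
Proof.
move=> p1 mf mg; have p0 : 0 < p by exact: lt_trans p1.
have mw (h : X -> C) : cmeasurable h -> measurable_fun setT (fun x => cabs (h x) * w x).
  move=> mh; apply: measurable_funM; first exact: measurable_cabs.
  exact: weight_measurable.
apply: (@le_trans _ _ ('N[mu]_p%:E [EFin \o ((fun x => cabs (f x) * w x)%R \+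
    (fun x => cabs (g x) * w x))%R])%E); last first.
  by rewrite 2!wnormE; apply: minkowski_EFin; [exact: mw|exact: mw|exact: ltW].
rewrite wnormE unlock; apply: gt0_ler_poweR.
- by rewrite invr_ge0 ltW.
- by rewrite in_itv/= leey andbT integral_ge0// => x _; exact: poweR_ge0.
- by rewrite in_itv/= leey andbT integral_ge0// => x _; exact: poweR_ge0.
have mp (h : X -> R) : measurable_fun setT h ->
    measurable_fun setT (fun x => `|(h x)%:E| `^ p)%E.
  move=> mh; suff: measurable_fun setT (fun x => `|h x| `^ p).
    by move/measurable_EFinP.
  apply: (measurableT_comp (measurable_powR p)).
  exact: measurableT_comp.
have mfg : cmeasurable (f \+ g).
  case: mf mg => [rf jf] [rg jg]; split.
    have -> : (fun x => complex.Re ((f \+ g) x)) =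
      (fun x => complex.Re (f x)) \+ (fun x => complex.Re (g x)).
      by apply/funext => x /=; rewrite raddfD.
    exact: measurable_funD.
  have -> : (fun x => complex.Im ((f \+ g) x)) =
    (fun x => complex.Im (f x)) \+ (fun x => complex.Im (g x)).
    by apply/funext => x /=; rewrite raddfD.
  exact: measurable_funD.
apply: ge0_le_integral => //=.
- by apply: mp; exact: mw.
- by apply: mp; apply: measurable_funD; exact: mw.
move=> x _; rewrite lee_fin.
have h0 (h : X -> C) : 0 <= cabs (h x) * w x by rewrite mulr_ge0 ?cabs_ge0 ?weight_ge0.
rewrite !ger0_norm ?addr_ge0// ?(h0 (f \+ g))//.
apply: ge0_ler_powR; rewrite ?nnegrE ?addr_ge0 ?(h0 (f \+ g))//; first exact: ltW.
rewrite -mulrDl ler_wpM2r ?weight_ge0//; exact: le_normcD.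
Qed.

Lemma wnormZ p (w : weight R n) c f : 1 < p -> cmeasurable f ->
  wnorm p w (fun x => c * f x)%R = ((cabs c)%:E * wnorm p w f)%E.
Proof.
move=> p1 mf; have p0 : 0 < p by exact: lt_trans p1.
rewrite /wnorm.
under eq_integral => x _.
  rewrite ComplexField.Normc.normcM powRM ?cabs_ge0// -mulrA EFinM.
  over.
rewrite ge0_integralZl//=.
- rewrite poweRM ?lee_fin ?powR_ge0//; last first.
    by apply: integral_ge0 => x _; rewrite lee_fin mulr_ge0 ?powR_ge0.
  by rewrite poweR_EFin -powRrM mulfV ?gt_eqF// powRr1 ?cabs_ge0.
- apply/measurable_EFinP; apply: measurable_funM.
    by apply: (measurableT_comp (measurable_powR p)); exact: measurable_cabs.
  by apply: (measurableT_comp (measurable_powR p)); exact: weight_measurable.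
- by move=> x _; rewrite lee_fin mulr_ge0 ?powR_ge0.
- by rewrite lee_fin powR_ge0.
Qed.

End lebesgue_spaces.

(* The space L^p(w^p) of complex-valued functions, as a module over the complex
   numbers with the pseudometric of its seminorm.  Functions are not identified
   when equal almost everywhere: they are at distance 0 from each other. *)
Section wLp_type.
Context {R : realType} {n : nat}.
Local Notation X := 'rV[R]_n.
Local Notation C := R[i].

Definition wLp_pred (p : R) (p1 : 1 < p) (w : weight R n) :
    {pred (X -> C^o)} := fun f => `[< in_wLp p w f >].

Section wLp.
Variables (p : R) (p1 : 1 < p) (w : weight R n).

Let wLp_submod_closed : submod_closed (wLp_pred p1 w).
Proof.
have p0 : 0 < p by exact: lt_trans p1.
split.
  apply/asboolP; split; first by split => /=; exact: measurable_cst.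
  rewrite /wnorm (eq_integral (cst 0%E)) ?integral0 ?poweR0r ?gt_eqF ?invr_gt0//.
  by move=> x _; rewrite (_ : cabs _ = 0) ?powR0 ?mul0r ?gt_eqF//;
    exact: ComplexField.Normc.normc0.
move=> a f g /asboolP[mf nf] /asboolP[mg ng].
have maf : cmeasurable (fun x => a * (f : X -> C) x).
  case: a mf => a b [rf jf]; split.
    have -> : (fun x => complex.Re (((a +i* b) : C) * (f : X -> C) x)) =
        (fun x => a * complex.Re (f x)) \- (fun x => b * complex.Im (f x)).
      by apply/funext => x /=; case: (f x).
    by apply: measurable_funB; apply: measurable_funM => //; exact: measurable_cst.
  have -> : (fun x => complex.Im (((a +i* b) : C) * (f : X -> C) x)) =
      (fun x => a * complex.Im (f x)) \+ (fun x => b * complex.Re (f x)).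
    by apply/funext => x /=; case: (f x) => ? ? /=; rewrite addrC.
  by apply: measurable_funD; apply: measurable_funM => //; exact: measurable_cst.
apply/asboolP; split; last first.
  apply: le_lt_trans (@le_wnorm _ _ p w _ _ p1 maf mg) _.
  apply: lte_add_pinfty; last exact: ng.
  rewrite (@wnormZ _ _ p w a f p1 mf).
  apply: lte_mul_pinfty; [by rewrite lee_fin cabs_ge0|by []|exact: nf].
case: maf mg => [rf jf] [rg jg]; split.
  have -> : (fun x => complex.Re ((a *: f + g) x)) =
    (fun x => complex.Re (a * (f : X -> C) x)) \+ (fun x => complex.Re (g x)).
    by apply/funext => x /=; rewrite -raddfD.
  exact: measurable_funD.
have -> : (fun x => complex.Im ((a *: f + g) x)) =
  (fun x => complex.Im (a * (f : X -> C) x)) \+ (fun x => complex.Im (g x)).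
  by apply/funext => x /=; rewrite -raddfD.
exact: measurable_funD.
Qed.

HB.instance Definition _ :=
  GRing.isSubmodClosed.Build _ _ (wLp_pred p1 w) wLp_submod_closed.

Record wLp := WLp { wLp_fun :> X -> C^o ; _ : wLp_fun \in wLp_pred p1 w }.

HB.instance Definition _ := [isSub for wLp_fun].
HB.instance Definition _ := [Choice of wLp by <:].
HB.instance Definition _ := [SubChoice_isSubLmodule of wLp by <:].

Lemma wLpP (f : wLp) : in_wLp p w f.
Proof. by have /asboolP := valP f. Qed.

Definition wLp_ball (f : wLp) (e : R) : set wLp :=
  [set g | (wnorm p w (fun x => f x - g x)%R < e%:E)%E].

Let wLp_ball_center (f : wLp) e : 0 < e -> wLp_ball f e f.
Proof.
move=> e0; have p0 : 0 < p by exact: lt_trans p1.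
rewrite /wLp_ball/= /wnorm (eq_integral (cst 0%E)).
  by rewrite integral0 poweR0r ?gt_eqF ?invr_gt0.
move=> x _; rewrite subrr (_ : cabs _ = 0) ?powR0 ?mul0r ?gt_eqF//.
exact: ComplexField.Normc.normc0.
Qed.

Let wLp_ball_sym (f g : wLp) e : wLp_ball f e g -> wLp_ball g e f.
Proof.
rewrite /wLp_ball/= => fg.
by have -> := @wnorm_distC _ _ p w (fun x => g x) (fun x => f x).
Qed.

Let wLp_ball_triangle (f g h : wLp) e1 e2 :
  wLp_ball f e1 g -> wLp_ball g e2 h -> wLp_ball f (e1 + e2) h.
Proof.
rewrite /wLp_ball/= => fg gh; rewrite EFinD.
have -> : (fun x => f x - h x) =
    (fun x => (f x : C) - g x) \+ (fun x => (g x : C) - h x).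
  by apply/funext => x /=; rewrite subrKA.
have mB (u v : wLp) : cmeasurable (fun x => (u x : C) - v x).
  exact: (wLpP (u - v)).1.
apply: le_lt_trans (@le_wnorm _ _ p w _ _ p1 (mB f g) (mB g h)) _.
exact: lteD.
Qed.

HB.instance Definition _ := hasNbhs.Build wLp (nbhs_ (entourage_ wLp_ball)).

HB.instance Definition _ := @Nbhs_isPseudoMetric.Build R wLp
  (entourage_ wLp_ball) erefl wLp_ball wLp_ball_center wLp_ball_sym
  wLp_ball_triangle erefl.

Definition wLp_bounded (A : set wLp) :=
  exists M : R, forall f, A f -> (wnorm p w f <= M%:E)%E.

End wLp.
End wLp_type.

Definition compact_operator {R : realType} {n : nat} {p q : R}
    {p1 : 1 < p} {q1 : 1 < q} {v w : weight R n}
    (S : {linear wLp p1 v -> wLp q1 w}) :=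
  forall A, wLp_bounded A -> precompact (S @` A).

Section operators.
Context {R : realType} {n : nat}.
Local Notation X := 'rV[R]_n.
Local Notation C := R[i].
Local Notation mu := (@lebesgue_rV R n).

(* only the restriction of rho to [0, 1] matters *)
Definition dini_modulus (rho : R -> R) :=
  [/\ {within `[0, 1], continuous rho} /\ (forall t, 0 <= t <= 1 -> 0 <= rho t),
      rho 0 = 0,
      {in `[0, 1] &, {homo rho : s t / s <= t}},
      forall s t, 0 <= s -> 0 <= t -> s + t <= 1 -> rho (s + t) <= rho s + rho t
    & (\int[@lebesgue_measure R]_(t in `]0%R, 1%R]) (rho t / t)%:E < +oo)%E].

Definition size_condition (alpha : R) (K : X -> X -> R) :=
  exists c : R, forall x y, x != y ->
    `|K x y| <= c / enorm (x - y) `^ (n%:R - alpha).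

Definition regularity_condition (rho : R -> R) (alpha : R) (K : X -> X -> R) :=
  forall x x' y, 2 * enorm (x - x') < enorm (x - y) ->
    `|K x y - K x' y| + `|K y x - K y x'| <=
    rho (enorm (x - x') / enorm (x - y)) / enorm (x - y) `^ (n%:R - alpha).

(* T is a linear operator on L^2, acting on functions up to equality almost
   everywhere; its values outside L^2 are irrelevant. *)
Definition L2_bounded (T : (X -> C) -> X -> C) :=
  [/\ forall f, in_L2 f -> in_L2 (T f),
      forall (c : C) f g, in_L2 f -> in_L2 g ->
        {ae mu, forall x, T (fun y => c * f y + g y) x = c * T f x + T g x}
    & exists A : R, forall f, in_L2 f -> (L2norm (T f) <= A%:E * L2norm f)%E].

Definition kernel_integral (K : X -> X -> R) (f : X -> C) (x : X) : C :=
  cintegral setT (fun y => (K x y)%:C * f y).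

Definition calderon_zygmund_operator (rho : R -> R) (K : X -> X -> R)
    (T : (X -> C) -> X -> C) :=
  [/\ size_condition 0 K, regularity_condition rho 0 K, L2_bounded T
    & forall f, in_L2 f ->
        {ae mu, forall x, ~ closure [set y | f y != 0] x ->
          T f x = kernel_integral K f x}].

Definition fractional_integral_operator (rho : R -> R) (alpha : R)
    (K : X -> X -> R) (T : (X -> C) -> X -> C) :=
  [/\ size_condition alpha K, regularity_condition rho alpha K
    & forall f x, cmeasurable f ->
        cintegrable setT (fun y => (K x y)%:C * f y) ->
        T f x = kernel_integral K f x].

Definition rho_type_operator (rho : R -> R) (alpha : R) (K : X -> X -> R)
    (T : (X -> C) -> X -> C) :=
  if alpha == 0 then calderon_zygmund_operator rho K T
  else fractional_integral_operator rho alpha K T.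

Definition commutator (b : X -> C) (T : (X -> C) -> X -> C) :
    (X -> C) -> X -> C :=
  fun f x => b x * T f x - T (fun y => b y * f y) x.

Definition iterated_commutator (m : nat) (b : X -> C)
    (T : (X -> C) -> X -> C) : (X -> C) -> X -> C :=
  iter m (commutator b) T.

Definition bounded_compactly_supported (f : X -> C) :=
  [/\ cmeasurable f, exists M : R, forall x, cabs (f x) <= M
    & compactly_supported f].

(* S is the operator from L^p(v^p) to L^q(w^q) given by the formula U on bounded
   compactly supported functions.  When v is in A_{p,q}, v^p is locally
   integrable, so these functions are dense in L^p(v^p) and a bounded S is
   determined by U up to equality almost everywhere. *)
Definition extends {p q : R} {p1 : 1 < p} {q1 : 1 < q} {v w : weight R n}
    (U : (X -> C) -> X -> C) (S : {linear wLp p1 v -> wLp q1 w}) :=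
  forall f : wLp p1 v, bounded_compactly_supported f ->
    {ae mu, forall x, S f x = U f x}.

End operators.

(* Main.v *)
Require Import Defs.
From HB Require Import structures.
From mathcomp Require Import all_boot all_order all_algebra.
From mathcomp Require Import complex.
From mathcomp Require Import all_classical all_reals all_analysis.
From mathcomp Require Import measurable_realfun ring lra zify.

Set Implicit Arguments.
Unset Strict Implicit.
Unset Printing Implicit Defensive.

Import Order.TTheory GRing.Theory Num.Theory.
Import numFieldNormedType.Exports.

Local Open Scope classical_set_scope.
Local Open Scope ring_scope.

(* A Dini kernel is dyadically smooth with summable moduli, so the operator is of
   weak type (1,1), resp. (1, n/(n-alpha)), and a stopping time argument on dyadic
   cubes dominates its iterated commutators by averages over tripled cubes of
   products of functions b - <b>.  By the John-Nirenberg inequality these products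
   have moments of all orders; the reverse Hoelder inequality for w^q and w^-p'
   leaves room for them in Hoelder's inequality, and a maximal function bound then
   gives the weighted estimate, with a constant proportional to the product of the
   mean oscillations of the symbols.  By telescoping the symbol may thus be replaced
   by a test function.  For it, the part of the operator near the diagonal has
   symbols of small oscillation, hence small norm; the rest is an integral operator
   with a continuous kernel, which is approximated by functions of x that are
   constant on finitely many small cubes, its tail being controlled by the growth of
   w^q.  Thus the images of bounded sets are totally bounded. The extension to all of
   L^p(w^p) is a linear selection from the closure of the graph. *)

(** Commutators are formed with lists of possibly different symbols: replacing [b] by a test
    function one factor at a time needs the estimate for mixed lists, with the product of the
    oscillations as constant. No sparse family is collected: the contribution of a cube is charged
    at once to the at least half of it that lies off its stopping cubes, where a product of maximal
    functions dominates it. All cubes come from grids with sides [s / 2 ^ j]; a cell with its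
    neighbours serves as dilated cube, and integer arithmetic on indices replaces covering lemmas.
    Exponents enter only through [a = 1 / q] and [b = 1 / p'], with [alpha = n (1 - a - b)], so that
    [w ^ q] and [w ^ (- p')] play symmetric roles. Two obstacles shape the rest. The operator is
    known only almost everywhere and the kernel comes without measurability, which is recovered from
    smoothness by freezing points to corners of small cubes. And elements of the spaces are
    functions, not classes, so that limits determine images only up to null functions. *)

Local Notation leb R n := (@lebesgue_rV R n : {measure set 'rV[R]_n -> \bar R}).

Lemma eq_leW d (T : porderType d) (x y : T) : x = y -> (x <= y)%O.
Proof. by move->. Qed.

(** * Nonnegative integrals: comparison, countable decompositions, Hoelder inequalities *)

Section nonneg_integral.
Context d (T : measurableType d) (R : realType) (mu : {measure set T -> \bar R}).
Implicit Types (A B : set T).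

(** The integral of a nonnegative function is a supremum over the simple functions below it, so the
    comparison holds without measurability. It is used throughout to enlarge the domain and the
    integrand in one move. *)
Lemma le_int A B (f g : T -> \bar R) : A `<=` B ->
  (forall x, A x -> 0 <= f x)%E -> (forall x, B x -> 0 <= g x)%E ->
  (forall x, A x -> f x <= g x)%E ->
  (\int[mu]_(x in A) f x <= \int[mu]_(x in B) g x)%E.
Proof.
move=> AB f0 g0 fg; rewrite integral_mkcond [leRHS]integral_mkcond.
have f0' x : (0 <= (f \_ A) x)%E by apply: erestrict_ge0.
have g0' x : (0 <= (g \_ B) x)%E by apply: erestrict_ge0.
rewrite !ge0_integralTE//; apply: le_ereal_sup => _ /= [h hf <-].
exists h => // x; apply: le_trans (hf x) _; rewrite !patchE.
case: ifPn => [/set_mem Ax|_]; first by rewrite (mem_set (AB _ Ax)); exact: fg.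
by case: ifPn => // /set_mem; exact: g0.
Qed.

(* [measureD] is stated for contents; this form rewrites in terms of measures. *)
Lemma measure_setD A B : measurable A -> measurable B -> (mu A < +oo)%E ->
  mu (A `\` B) = (mu A - mu (A `&` B))%E.
Proof. exact: measureD. Qed.

Lemma measure_mono A B : measurable A -> measurable B -> A `<=` B ->
  (mu A <= mu B)%E.
Proof. by move=> mA mB AB; apply: le_measure; rewrite ?inE. Qed.

Lemma measure_sub0 A B : measurable A -> measurable B -> A `<=` B ->
  mu B = 0%E -> mu A = 0%E.
Proof.
move=> mA mB AB B0; apply/eqP; rewrite eq_le measure_ge0 andbT -B0.
exact: measure_mono.
Qed.

Lemma measure_setU_le A B : measurable A -> measurable B ->
  (mu (A `|` B) <= mu A + mu B)%E.
Proof. exact: measureU2. Qed.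

Lemma integral_1 A : measurable A -> (\int[mu]_(x in A) 1 = mu A)%E.
Proof. by move=> mA; rewrite -[RHS]mul1e -(integral_cst mu mA). Qed.

Lemma int_scale A (f : T -> \bar R) (k : R) : measurable A ->
  measurable_fun setT f -> (forall x, 0 <= f x)%E -> 0 <= k ->
  (\int[mu]_(x in A) (k%:E * f x) = k%:E * \int[mu]_(x in A) f x)%E.
Proof.
by move=> mA mf f0 k0; rewrite ge0_integralZl//; exact: measurable_funTS.
Qed.

Lemma int_add A (f g : T -> \bar R) : measurable A ->
  measurable_fun setT f -> measurable_fun setT g ->
  (forall x, 0 <= f x)%E -> (forall x, 0 <= g x)%E ->
  (\int[mu]_(x in A) (f x + g x) =
   \int[mu]_(x in A) f x + \int[mu]_(x in A) g x)%E.
Proof.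
by move=> mA mf mg f0 g0; rewrite ge0_integralD//; exact: measurable_funTS.
Qed.

Lemma int_setU_le A B (f : T -> \bar R) : measurable A -> measurable B ->
  measurable_fun setT f -> (forall x, 0 <= f x)%E ->
  (\int[mu]_(x in A `|` B) f x <=
   \int[mu]_(x in A) f x + \int[mu]_(x in B) f x)%E.
Proof.
move=> mA mB mf f0; have -> : A `|` B = A `|` (B `\` A).
  apply/seteqP; split => x; last by case=> [|[]]; [left|right].
  by case=> [|Bx]; [left|case: (pselect (A x)) => ?; [left|right]].
rewrite ge0_integral_setU//.
- by rewrite leeD2l//; apply: le_int => // x [].
- exact: measurableD.
- exact: measurable_funS mf.
- by rewrite disj_set2E setDE setICA setICr setI0.
Qed.

(** Reindexing by natural numbers through [pickle], with the empty set at integers that decode to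
    nothing, makes countable additivity for sequences available for families of cubes indexed by
    levels and integer vectors. *)
Lemma bigcup_pickle (I : countType) (P : set I) (C : I -> set T) :
  \bigcup_(i in P) C i = \bigcup_m
    (if @pickle_inv I m is Some i then (if i \in P then C i else set0) else set0).
Proof.
apply/seteqP; split => x.
  by move=> [i Pi Cix]; exists (pickle i) => //; rewrite pickleK_inv mem_set.
move=> [m _]; case: pickle_inv => // i; case: ifPn => // /set_mem Pi Cix.
by exists i.
Qed.

Lemma trivIset_pickle (I : countType) (P : set I) (C : I -> set T) : trivIset P C ->
  trivIset setT (fun m =>
    if @pickle_inv I m is Some i then (if i \in P then C i else set0) else set0).
Proof.
move=> tC a b _ _ [x []]; have := @pickle_invK I a; have := @pickle_invK I b.
case: pickle_inv => //= i; case: pickle_inv => //= j <- <-.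
case: ifPn => // /set_mem Pj Cjx; case: ifPn => // /set_mem Pi Cix.
by congr pickle; apply: tC => //; exists x.
Qed.

Lemma setD_setI (Q B O : set T) : B `<=` Q -> Q `\` (B `&` O) = (Q `\` B) `|` (B `&` ~` O).
Proof.
move=> BQ; apply/seteqP; split => x; last by case=> [[Qx Bx]|[Bx Ox]]; split; [|case|exact: BQ|case].
by move=> [Qx h]; have [Bx|Bx] := pselect (B x); [right; split => // Ox; apply: h|left].
Qed.

Lemma measurable_cbigcup (I : countType) (P : set I) (C : I -> set T) :
  (forall i, P i -> measurable (C i)) -> measurable (\bigcup_(i in P) C i).
Proof.
move=> mC; rewrite bigcup_pickle; apply: bigcup_measurable => m _.
by case: pickle_inv => // i; case: ifPn => // /set_mem; exact: mC.
Qed.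

(** Countable additivity reduces the comparison to the cells; the separate sets [A] and [B] allow an
    exceptional set to be removed on the left only. *)
Lemma le_int_bigcup (I : countType) (P : set I) (C : I -> set T) A B (f h : T -> \bar R) :
  (forall i, P i -> measurable (C i)) -> trivIset P C ->
  measurable A -> measurable B ->
  measurable_fun setT f -> measurable_fun setT h ->
  (forall x, 0 <= f x)%E -> (forall x, 0 <= h x)%E ->
  (forall i, P i ->
    \int[mu]_(x in C i `&` A) f x <= \int[mu]_(x in C i `&` B) h x)%E ->
  (\int[mu]_(x in (\bigcup_(i in P) C i) `&` A) f x <=
   \int[mu]_(x in (\bigcup_(i in P) C i) `&` B) h x)%E.
Proof.
move=> mC tC mA mB mf mh f0 h0 fh; rewrite bigcup_pickle.
set F := fun m : nat => _.
have mF m : measurable (F m).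
  by rewrite /F; case: pickle_inv => // i; case: ifPn => // /set_mem; exact: mC.
have tF : trivIset setT F by exact: trivIset_pickle.
have tI D : trivIset setT (fun i => F i `&` D).
  by under eq_fun do rewrite setIC; exact: trivIset_setIl.
rewrite !setI_bigcupl ge0_integral_bigcup//; last 2 first.
- by move=> k; exact: measurableI (mF k) mA.
- exact: measurable_funS mf.
rewrite ge0_integral_bigcup//; last 2 first.
- by move=> k; exact: measurableI (mF k) mB.
- exact: measurable_funS mh.
apply: lee_nneseries => [i _ _|i _]; first by apply: integral_ge0 => x _; exact: f0.
rewrite /F.
case: pickle_inv => [j|]; last by rewrite !set0I !integral_set0.
case: ifPn => [/set_mem Pj|_]; last by rewrite !set0I !integral_set0.
by have := fh _ Pj.
Qed.

(** The sets [C' i], typically tripled cubes, may overlap and are handled by subadditivity; only the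
    disjoint [C i] carry the integral. *)
Lemma le_measure_bigcup (I : countType) (P : set I) (C' C : I -> set T)
    (h : T -> \bar R) :
  (forall i, P i -> measurable (C' i)) -> (forall i, P i -> measurable (C i)) ->
  trivIset P C -> measurable_fun setT h -> (forall x, 0 <= h x)%E ->
  (forall i, P i -> mu (C' i) <= \int[mu]_(x in C i) h x)%E ->
  (mu (\bigcup_(i in P) C' i) <= \int[mu]_(x in \bigcup_(i in P) C i) h x)%E.
Proof.
move=> mC' mC tC mh h0 fh; rewrite (bigcup_pickle _ C') (bigcup_pickle _ C).
set F' := fun m : nat => _; set F := (F in (_ <= integral _ (\bigcup_m F m) _)%E).
have mF' m : measurable (F' m).
  by rewrite /F'; case: pickle_inv => // i; case: ifPn => // /set_mem; exact: mC'.
have mF m : measurable (F m).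
  by rewrite /F; case: pickle_inv => // i; case: ifPn => // /set_mem; exact: mC.
have tF : trivIset setT F by exact: trivIset_pickle.
rewrite ge0_integral_bigcup//; last exact: measurable_funS mh.
have := @measure_sigma_subadditive _ _ _ mu (\bigcup_m F' m) F' mF'.
move=> /(_ (bigcup_measurable (fun k _ => mF' k)) (@subset_refl _ _)) /le_trans; apply.
apply: lee_nneseries => // m _; rewrite /F /F'.
case: pickle_inv => [j|]; last by rewrite measure0 integral_set0.
by case: ifPn => [/set_mem Pj|_]; [exact: fh|rewrite measure0 integral_set0].
Qed.

(** By Borel-Cantelli the upper limit of the [E k] is null, and off it [A] is the increasing union
    of the sets that avoid all [E j] with [j >= k], on which the assumed bound applies. *)
Lemma int_eq_lim (A : set T) (f : T -> \bar R) (E : (set T)^nat) (b : \bar R) :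
  measurable A -> (forall k, measurable (E k)) ->
  measurable_fun setT f -> (forall x, 0 <= f x)%E ->
  (\sum_(k <oo) mu (E k) < +oo)%E ->
  (forall k, \int[mu]_(x in A `\` E k) f x <= b)%E ->
  (\int[mu]_(x in A) f x <= b)%E.
Proof.
move=> mA mE mf f0 Eoo Eb.
have b0 : (0 <= b)%E by apply: le_trans (Eb 0%N); apply: integral_ge0.
pose N := lim_sup_set E.
have N0 : mu N = 0%E by exact: lim_sup_set_cvg0.
have mN : measurable N by apply: bigcap_measurable => // k _; exact: bigcup_measurable.
rewrite (ge0_negligible_integral mN)//; last exact: measurable_funS mf.
pose G k := A `\` \bigcup_(j >= k) E j.
have mG k : measurable (G k).
  by apply: measurableD => //; apply: bigcup_measurable.
have -> : A `\` N = \bigcup_k G k.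
  rewrite /N /lim_sup_set eqEsubset; split => x.
    move=> [Ax NEx]; move: NEx; rewrite -[X in ~ X]/((\bigcap_i _) x).
    rewrite -existsNE => -[k]; rewrite not_implyE => -[_ h].
    by exists k.
  by move=> [k _ [Ax h]]; split => // /(_ k Logic.I).
have ndG : nondecreasing_seq G.
  move=> i j ij; apply/subsetPset => x [Ax h]; split => // -[k /= jk Ekx].
  by apply: h; exists k => //=; exact: leq_trans jk.
have := @ge0_nondecreasing_set_cvg_integral _ _ _ G f mu ndG mG
  (fun i => measurable_funS measurableT (@subsetT _ _) mf) (fun _ x _ => f0 x).
move=> /cvg_lim <-//; apply: lime_le.
  apply: ereal_nondecreasing_is_cvgn => i j ij; apply: le_int => //.
  exact/subsetPset/ndG.
apply: nearW => k; apply: le_trans (Eb k); apply: le_int => //.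
by move=> x [Ax h]; split => // Ekx; apply: h; exists k => /=.
Qed.

Lemma cheby A (f : T -> \bar R) (t : R) : measurable A -> measurable_fun setT f ->
  (forall x, 0 <= f x)%E -> 0 <= t ->
  (t%:E * mu (A `&` [set x | (t%:E < f x)%E]) <= \int[mu]_(x in A) f x)%E.
Proof.
move=> mA mf f0 t0; rewrite -integral_cst; last first.
  apply: measurableI => //; rewrite -[X in measurable X]setTI.
  exact: emeasurable_fun_o_infty.
apply: le_int => //.
by move=> x [_ /= /ltW].
Qed.

Lemma hoelder_int A (f g : T -> R) (a b : R) : measurable A ->
  measurable_fun setT f -> measurable_fun setT g ->
  (forall x, 0 <= f x) -> (forall x, 0 <= g x) ->
  0 < a -> 0 < b -> a + b = 1 ->
  (\int[mu]_(x in A) (f x `^ a * g x `^ b)%:E <=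
   (\int[mu]_(x in A) (f x)%:E) `^ a * (\int[mu]_(x in A) (g x)%:E) `^ b)%E.
Proof.
move=> mA mf mg f0 g0 a0 b0 ab.
pose F := (fun x => f x `^ a) \_ A; pose G := (fun x => g x `^ b) \_ A.
have mF : measurable_fun setT F.
  apply/(measurable_restrictT _ mA); apply: measurable_funS (subsetT A) _ => //.
  exact: (measurableT_comp (measurable_powR a)).
have mG : measurable_fun setT G.
  apply/(measurable_restrictT _ mA); apply: measurable_funS (subsetT A) _ => //.
  exact: (measurableT_comp (measurable_powR b)).
have E (h : T -> R) c : (forall x, 0 <= h x) -> 0 < c ->
    ('N[mu]_(c^-1)%:E[EFin \o ((fun x => (h x `^ c)%R) \_ A)] =
      (\int[mu]_(x in A) (h x)%:E) `^ c)%E.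
  move=> h0 c0; rewrite unlock invrK; congr (_ `^ _)%E.
  rewrite [RHS]integral_mkcond; apply: eq_integral => x _ /=.
  rewrite /patch; case: ifPn => xA.
    by rewrite ger0_norm ?powR_ge0// -powRrM mulfV ?gt_eqF// powRr1.
  by rewrite normr0 powR0// gt_eqF// invr_gt0.
have := hoelder mu mF mG (p := a^-1) (q := b^-1).
rewrite !invr_gt0 !invrK => /(_ a0 b0 ab); rewrite !E//.
apply: le_trans; rewrite Lnorm1 integral_mkcond.
apply: le_int => // x _ /=; rewrite ?lee_fin// /patch /F /G /patch.
  by case: ifPn => // _; rewrite lee_fin mulr_ge0 ?powR_ge0.
by case: ifPn => // _; rewrite lee_fin// ler_norm.
Qed.

(** Two applications of Hoelder: [f] and [g] are first merged into their geometric mean [k], with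
    exponents normalised to sum 1. *)
Lemma hoelder3_int A (f g h : T -> R) (a b c : R) : measurable A ->
  measurable_fun setT f -> measurable_fun setT g -> measurable_fun setT h ->
  (forall x, 0 <= f x) -> (forall x, 0 <= g x) -> (forall x, 0 <= h x) ->
  0 < a -> 0 < b -> 0 < c -> a + b + c = 1 ->
  (\int[mu]_(x in A) (f x `^ a * g x `^ b * h x `^ c)%:E <=
   (\int[mu]_(x in A) (f x)%:E) `^ a * (\int[mu]_(x in A) (g x)%:E) `^ b *
     (\int[mu]_(x in A) (h x)%:E) `^ c)%E.
Proof.
move=> mA mf mg mh f0 g0 h0 a0 b0 c0 abc.
have ab0 : 0 < a + b by rewrite addr_gt0.
pose k x := (f x `^ (a / (a + b)) * g x `^ (b / (a + b))).
have mk : measurable_fun setT k.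
  by apply: measurable_funM; apply: (measurableT_comp (measurable_powR _)).
have k0 x : 0 <= k x by rewrite mulr_ge0 ?powR_ge0.
have := hoelder_int mA mk mh k0 h0 ab0 c0 abc.
rewrite (eq_integral (fun x => (f x `^ a * g x `^ b * h x `^ c)%:E)); last first.
  move=> x _; rewrite /k powRM ?powR_ge0// -!powRrM.
  by rewrite !divfK// gt_eqF.
move/le_trans; apply; rewrite lee_wpmul2r ?poweR_ge0//.
have := hoelder_int mA mf mg f0 g0 (divr_gt0 a0 ab0) (divr_gt0 b0 ab0).
rewrite -mulrDl mulfV ?gt_eqF// => /(_ erefl) H.
have I0 (u : T -> R) : (forall x, 0 <= u x) -> (0 <= \int[mu]_(x in A) (u x)%:E)%E.
  by move=> u0; apply: integral_ge0 => x _; rewrite lee_fin.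
apply: (@le_trans _ _ (((\int[mu]_(x in A) (f x)%:E) `^ (a / (a + b)) *
   (\int[mu]_(x in A) (g x)%:E) `^ (b / (a + b))) `^ (a + b))%E).
  apply: gt0_ler_poweR => //; first exact: ltW.
    by rewrite in_itv/= leey andbT I0.
  by rewrite in_itv/= leey andbT mule_ge0 ?poweR_ge0.
by rewrite poweRM ?poweR_ge0// -!poweRrM !divfK// gt_eqF.
Qed.

Lemma jensen_int A (f : T -> R) (t : R) : measurable A ->
  measurable_fun setT f -> (forall x, 0 <= f x) -> 1 < t ->
  (\int[mu]_(x in A) (f x)%:E <=
   (\int[mu]_(x in A) (f x `^ t)%:E) `^ t^-1 * (mu A) `^ (1 - t^-1))%E.
Proof.
move=> mA mf f0 t1; have t0 : 0 < t by exact: lt_trans t1.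
have := @hoelder_int A (fun x => f x `^ t) (cst 1) t^-1 (1 - t^-1) mA.
move=> /(_ (measurableT_comp (measurable_powR t) mf) (measurable_cst _)).
move=> /(_ (fun=> powR_ge0 _ _) (fun=> ler01)).
rewrite invr_gt0 subr_gt0 invf_lt1// => /(_ t0 t1 (subrKC _ _)).
rewrite (eq_integral (fun x => (f x)%:E)); last first.
  by move=> x _; rewrite powR1 mulr1 -powRrM mulfV ?gt_eqF// powRr1.
have -> // : (\int[mu]_(x in A) (cst 1 x)%:E = mu A)%E.
by rewrite -[RHS]mul1e -(integral_cst mu mA).
Qed.

End nonneg_integral.

(** * Grid cells, their indices and their neighbours *)

Section grid.
Context {R : realType} {n : nat}.
Local Notation X := 'rV[R]_n.
Local Notation mu := (leb R n).
Implicit Types (s : R) (k : 'rV[int]_n) (x y : X).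

Lemma rV_norm_le x (r : R) : 0 <= r ->
  (`|x| <= r) <-> (forall i, `|x ord0 i| <= r).
Proof.
move=> r0; rewrite /Num.norm/= mx_normrE; split => [h i|h].
  apply: le_trans h.
  exact: (le_bigmax (0 : R) (fun ij : 'I_1 * 'I_n => `|x ij.1 ij.2|) (ord0, i)).
by apply/bigmax_leP; split => // -[i j] _ /=; rewrite (ord1 i); exact: h.
Qed.

Lemma rV_norm_lt x (r : R) : 0 < r ->
  (`|x| < r) <-> (forall i, `|x ord0 i| < r).
Proof.
move=> r0; rewrite /Num.norm/= mx_normrE; split => [h i|h].
  apply: le_lt_trans h.
  exact: (le_bigmax (0 : R) (fun ij : 'I_1 * 'I_n => `|x ij.1 ij.2|) (ord0, i)).
by apply/bigmax_ltP; split => // -[i j] _ /=; rewrite (ord1 i); exact: h.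
Qed.

Lemma rV_coord_le x i : `|x ord0 i| <= `|x|.
Proof. by have [+ _] := @rV_norm_le x `|x| (normr_ge0 x); apply. Qed.

Definition idx s x : 'rV[int]_n := \row_i Num.floor (x ord0 i / s).

Definition dcube s k : set X := [set x | idx s x = k].

Definition adjacent (a b : int) : bool := (a <= b + 1) && (b <= a + 1).

(** Adjacency of integer indices, rather than a geometric dilation, keeps the tripled cube a union
    of cells of the same grid and makes the neighbour relation symmetric. *)
Definition triple s k : set X :=
  [set x | forall i, adjacent (idx s x ord0 i) (k ord0 i)].

Definition corner s k : X := \row_i (s * (k ord0 i)%:~R).

Lemma dcube_idx s x : dcube s (idx s x) x. Proof. by []. Qed.

Lemma dcube_triple s k : dcube s k `<=` triple s k.
Proof. by move=> x /= <- i; rewrite /adjacent lerDl. Qed.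

Lemma floor_itvP (t : R) (m : int) : (Num.floor t = m) <-> m%:~R <= t < m%:~R + 1.
Proof.
split=> [<-|]; first by have := floor_itv t; rewrite intrD.
by move=> h; apply: floor_def; rewrite intrD.
Qed.

Lemma dcubeE s k x : 0 < s ->
  dcube s k x <-> forall i, s * (k ord0 i)%:~R <= x ord0 i < s * (k ord0 i)%:~R + s.
Proof.
move=> s0; split=> [/= <- i|h].
  rewrite mxE; have /floor_itvP/andP[h1 h2] := erefl (Num.floor (x ord0 i / s)).
  by rewrite mulrC -ler_pdivlMr// h1/= -{3}(mul1r s) -mulrDl -ltr_pdivrMr.
apply/rowP => i; rewrite mxE; apply/floor_itvP; have /andP[h1 h2] := h i.
by rewrite ler_pdivlMr// ltr_pdivrMr// mulrDl mul1r mulrC h1.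
Qed.

Lemma dcube_corner s k : 0 < s -> dcube s k (corner s k).
Proof. by move=> s0; apply/dcubeE => // i; rewrite mxE lexx ltrDl s0. Qed.

Lemma measurable_coordP (A : 'I_n -> set R) : (forall i, measurable (A i)) ->
  measurable [set x : X | forall i, A i (x ord0 i)].
Proof.
move=> mA; have -> : [set x : X | forall i, A i (x ord0 i)] =
    \bigcap_(i in [set: 'I_n]) ((fun x : X => x ord0 i) @^-1` (A i)).
  by apply/seteqP; split => x /= h i //; [move=> _|]; exact: h.
apply: fin_bigcap_measurable => // i _.
by rewrite -[X in measurable X]setTI; exact: measurable_coord.
Qed.

Lemma measurable_dcube s k : 0 < s -> measurable (dcube s k).
Proof.
move=> s0; pose A i := `[s * (k ord0 i)%:~R, s * (k ord0 i)%:~R + s[%classic.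
rewrite (_ : dcube s k = [set x : X | forall i, A i (x ord0 i)]).
  by apply: measurable_coordP => i; exact: measurable_itv.
by apply/seteqP; split => x; rewrite dcubeE// => h i; have := h i; rewrite /A /= in_itv.
Qed.

Lemma measurable_cube (a : X) (l : R) : measurable (cube a l).
Proof.
pose A i := `[a ord0 i, a ord0 i + l]%classic.
rewrite (_ : cube a l = [set x : X | forall i, A i (x ord0 i)]).
  by apply: measurable_coordP => i; exact: measurable_itv.
by apply/seteqP; split => x h i; have := h i; rewrite /A /= in_itv.
Qed.

Lemma measurable_triple s k : 0 < s -> measurable (triple s k).
Proof.
move=> s0; rewrite (_ : triple s k = \bigcup_(d in
    [set d : 'rV[int]_n | forall i, adjacent (d ord0 i) (k ord0 i)]) dcube s d).
  by apply: measurable_cbigcup => d _; exact: measurable_dcube.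
by apply/seteqP; split => [x h|x [d dk] dx i]; [by exists (idx s x)|rewrite dx; exact: dk].
Qed.

Lemma dcube_sub_cube s k : 0 < s -> dcube s k `<=` cube (corner s k) s.
Proof.
by move=> s0 x /(dcubeE _ _ s0) h i; have /andP[? /ltW ?] := h i; rewrite mxE; apply/andP.
Qed.

Lemma triple_sub_cube s k : 0 < s ->
  triple s k `<=` cube (corner s k - const_mx s) (3 * s).
Proof.
move=> s0 x h i; have /(dcubeE _ _ s0)/(_ i) := dcube_idx s x.
move: (h i); rewrite !mxE /adjacent; set a := Num.floor _; set b := k ord0 i.
rewrite -(ler_int R) -(ler_int R b) !intrD => /andP[ab1 ab2] /andP[h1 h2].
have : s * b%:~R <= s * (a%:~R + 1) by rewrite ler_pM2l.
have : s * a%:~R <= s * (b%:~R + 1) by rewrite ler_pM2l.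
lra.
Qed.

End grid.

Lemma lebesgue_rV_box {R : realType} n (A : 'I_n -> set R) :
  (forall i, measurable (A i)) ->
  lebesgue_rV n [set x : 'rV[R]_n | forall i, A i (x ord0 i)] =
  (\prod_(i < n) lebesgue_measure (A i))%E.
Proof.
elim: n A => [|n ih] A mA /=.
  by rewrite big_ord0 (_ : mkset _ = setT) ?diracT//; apply/seteqP; split => // x _ [].
rewrite /lebesgue_succ /pushforward.
rewrite (_ : _ @^-1` _ = A ord0 `*` [set x : 'rV[R]_n | forall i, A (lift ord0 i) (x ord0 i)]).
  rewrite product_measure1E//=; first by rewrite big_ord_recl (ih (fun i => A (lift ord0 i))).
  exact: mA.
  by apply: (measurable_coordP (A := fun i => A (lift ord0 i))) => i; exact: mA.
have E x (v : 'rV[R]_n) i : rV_cons (x, v) ord0 (lift ord0 i) = v ord0 i.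
  have -> : lift ord0 i = rshift 1 i :> 'I_(1 + n) by exact: val_inj.
  by rewrite /rV_cons (@row_mxEr _ 1 1 n).
apply/seteqP; split => -[x v] /=.
  move=> h; split.
    have := h ord0.
    by have -> : rV_cons (x, v) ord0 ord0 = x by exact: (congr1 fst (rV_consK (x,v))).
  move=> i; have := h (lift ord0 i).
  by rewrite E.
move=> [Ax h] i; case: (unliftP ord0 i) => [j|] ->.
  by rewrite E; exact: h.
by have -> : rV_cons (x, v) ord0 ord0 = x by exact: (congr1 fst (rV_consK (x,v))).
Qed.

Section grid_measure.
Context {R : realType} {n : nat}.
Local Notation X := 'rV[R]_n.
Local Notation mu := (leb R n).
Implicit Types (s : R) (k : 'rV[int]_n) (x y : X).

Lemma measure_cube (a : X) (l : R) : 0 <= l -> mu (cube a l) = (l ^+ n)%:E.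
Proof. exact: lebesgue_rV_cube. Qed.

Lemma measure_dcube s k : 0 < s -> mu (dcube s k) = (s ^+ n)%:E.
Proof.
move=> s0; pose A i := `[s * (k ord0 i)%:~R, s * (k ord0 i)%:~R + s[%classic.
rewrite (_ : dcube s k = [set x : X | forall i, A i (x ord0 i)]).
  apply: etrans (lebesgue_rV_box (A := A) _) _ => [i|]; first exact: measurable_itv.
  rewrite (eq_bigr (fun=> s%:E)); last first.
    by move=> i _; rewrite lebesgue_measure_itv/= lte_fin ltrDl s0 -EFinD addrAC subrr add0r.
  by rewrite prodEFin prodr_const card_ord.
by apply/seteqP; split => x; rewrite dcubeE// => h i; have := h i; rewrite /A /= in_itv.
Qed.

Lemma measure_triple_le s k : 0 < s -> (mu (triple s k) <= ((3 * s) ^+ n)%:E)%E.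
Proof.
move=> s0; have s30 : 0 <= 3 * s by rewrite mulr_ge0// ltW.
rewrite -(measure_cube (corner s k - const_mx s) s30).
by rewrite le_measure ?inE//;
  [exact: measurable_triple|exact: measurable_cube|exact: triple_sub_cube].
Qed.

(** Closed cubes define the oscillation and the weight condition while the grid is half-open; both
    cubes have measure [s ^ n], so their difference is null. *)
Lemma int_cube_dcube s k (f : X -> \bar R) : 0 < s -> measurable_fun setT f ->
  (forall x, 0 <= f x)%E ->
  (\int[mu]_(x in cube (corner s k) s) f x = \int[mu]_(x in dcube s k) f x)%E.
Proof.
move=> s0 mf f0.
have mD := measurable_dcube k s0; have mC := measurable_cube (corner s k) s.
have DC := dcube_sub_cube (k := k) s0.
rewrite (@ge0_negligible_integral _ _ _ mu _ (cube (corner s k) s `\` dcube s k))//.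
- by rewrite setDD setIidr.
- exact: measurableD.
- exact: measurable_funS mf.
- have E : mu (cube (corner s k) s) = (s ^+ n)%:E by rewrite measure_cube ?ltW.
  have := @measure_setD _ _ _ mu _ _ mC mD; rewrite E ltry setIidr// => ->//.
  by rewrite measure_dcube// -EFinB subrr.
Qed.

(* The index of the parent cube, of twice the side. *)
Definition par k : 'rV[int]_n := \row_i (k ord0 i %/ 2)%Z.

Lemma idx_par s x : 0 < s -> idx (2 * s) x = par (idx s x).
Proof.
move=> s0; apply/rowP => i; rewrite !mxE.
set t := x ord0 i; apply/floor_itvP.
have /floor_itvP := erefl (Num.floor (t / s)).
set m := Num.floor _; rewrite ler_pdivlMr// -ltrBlDr ltrBlDr ltr_pdivrMr// => /andP[h1 h2].
rewrite ler_pdivlMr ?mulr_gt0// ltr_pdivrMr ?mulr_gt0//.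
have := divz_eq m 2; set q := (m %/ 2)%Z => E.
have r0 : 0 <= (m %% 2)%Z by rewrite modz_ge0.
have r1 : (m %% 2)%Z <= 1 by have := @ltz_pmod m 2 isT; lia.
have {}E : m%:~R = q%:~R * 2 + (m %% 2)%Z%:~R :> R by rewrite {1}E intrD intrM.
rewrite -(ler_int R) in r0; rewrite -(ler_int R) in r1.
set r : R := (_ %% _)%Z%:~R in E r0 r1.
rewrite E in h1 h2.
have h3 : r * s <= s by rewrite ler_piMl// ltW.
have h4 : 0 <= r * s by rewrite mulr_ge0// ltW.
apply/andP; split; lra.
Qed.

Lemma idx_iter_par i s x : 0 < s -> idx (2 ^+ i * s) x = iter i par (idx s x).
Proof.
move=> s0; elim: i => [|i ih]; first by rewrite expr0 mul1r.
by rewrite exprS -mulrA idx_par ?ih//= mulr_gt0// exprn_gt0.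
Qed.

Lemma triple_par s k : 0 < s -> triple s k `<=` triple (2 * s) (par k).
Proof.
move=> s0 y h i; rewrite idx_par// !mxE; have := h i; rewrite !mxE /adjacent.
set a := Num.floor _; set b := k ord0 i => ab.
have := divz_eq a 2; have := divz_eq b 2.
have := @ltz_pmod a 2 isT; have := @ltz_pmod b 2 isT.
have := @modz_ge0 a 2 isT; have := @modz_ge0 b 2 isT.
lia.
Qed.

Lemma triple_iter_par i s k : 0 < s ->
  triple s k `<=` triple (2 ^+ i * s) (iter i par k).
Proof.
move=> s0; elim: i => [|i ih]; first by rewrite expr0 mul1r.
rewrite exprS -mulrA /=; apply: subset_trans ih _.
by apply: triple_par; rewrite mulr_gt0// exprn_gt0.
Qed.

Lemma dcube_dist s k x y : 0 < s -> dcube s k x -> dcube s k y -> `|x - y| < s.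
Proof.
move=> s0 /(dcubeE _ _ s0) hx /(dcubeE _ _ s0) hy; apply/rV_norm_lt => // i.
rewrite !mxE ltr_norml; have /andP[? ?] := hx i; have /andP[? ?] := hy i.
apply/andP; split; lra.
Qed.

Lemma triple_dist s k x y : 0 < s -> dcube s k x -> triple s k y ->
  `|x - y| < 2 * s.
Proof.
move=> s0 /(dcubeE _ _ s0) hx hy; apply/rV_norm_lt => [|i]; first exact: mulr_gt0.
rewrite !mxE ltr_norml; have /andP[h1 h2] := hx i.
have /(dcubeE _ _ s0)/(_ i)/andP[h3 h4] := dcube_idx s y.
have := hy i; rewrite /adjacent; set a := idx s y ord0 i in h3 h4 *.
set b := k ord0 i in h1 h2 *.
rewrite -(ler_int R) -(ler_int R b) !intrD => /andP[h5 h6].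
have : s * b%:~R <= s * (a%:~R + 1) by rewrite ler_pM2l.
have : s * a%:~R <= s * (b%:~R + 1) by rewrite ler_pM2l.
move=> h7 h8; apply/andP; split; lra.
Qed.

Lemma ntriple_dist s k x y : 0 < s -> dcube s k x -> ~ triple s k y ->
  s <= `|x - y|.
Proof.
move=> s0 hx hy; rewrite leNgt; apply/negP => /(rV_norm_lt _ s0) h; apply: hy => i.
have /(dcubeE _ _ s0)/(_ i)/andP[h1 h2] := hx.
have /(dcubeE _ _ s0)/(_ i)/andP[h3 h4] := dcube_idx s y.
have := h i; rewrite !mxE ltr_norml => /andP[h5 h6].
move: h3 h4; rewrite mxE; set a := Num.floor _ => h3 h4.
set b := k ord0 i in h1 h2 *.
have A : (a%:~R : R) < (b + 1 + 1)%:~R by rewrite !intrD -(ltr_pM2l s0) !mulrDr; lra.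
have B : (b%:~R : R) < (a + 1 + 1)%:~R by rewrite !intrD -(ltr_pM2l s0) !mulrDr; lra.
by apply/andP; split; rewrite -ltzD1 -(ltr_int R).
Qed.

End grid_measure.

(** * Dyadic subdivision and a density theorem *)

Section dyadic.
Context {R : realType} {n : nat}.
Local Notation X := 'rV[R]_n.
Local Notation mu := (leb R n).
Implicit Types (s : R) (k : 'rV[int]_n) (x y : X).

Definition side s (j : nat) : R := s / 2 ^+ j.

Lemma side_gt0 s j : 0 < s -> 0 < side s j.
Proof. by move=> s0; rewrite divr_gt0// exprn_gt0. Qed.

Lemma side0 s : side s 0 = s. Proof. by rewrite /side expr0 divr1. Qed.

Lemma side_side s i j : side (side s i) j = side s (i + j).
Proof. by rewrite /side exprD invfM mulrA. Qed.

Lemma sideD s i j : side s i = 2 ^+ j * side s (i + j).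
Proof.
rewrite /side exprD invfM mulrCA (mulrCA (2 ^+ j)) mulfV ?mulr1//.
Qed.

Lemma idx_side s i j x : 0 < s ->
  idx (side s i) x = iter j par (idx (side s (i + j)) x).
Proof. by move=> s0; rewrite (sideD _ i j) idx_iter_par// side_gt0. Qed.

Definition dset s j (V : set 'rV[int]_n) : set X := idx (side s j) @^-1` V.

Lemma measurable_dset s j V : 0 < s -> measurable (dset s j V).
Proof.
move=> s0; rewrite (_ : dset s j V = \bigcup_(d in V) dcube (side s j) d).
  by apply: measurable_cbigcup => d _; apply: measurable_dcube; exact: side_gt0.
apply/seteqP; split => x; first by exists (idx (side s j) x).
by move=> [d Vd h]; rewrite /dset/= h.
Qed.

Lemma dset_refine s j i V : 0 < s ->
  dset s j V = dset s (j + i) (iter i par @^-1` V).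
Proof. by move=> s0; apply/seteqP; split => x; rewrite /dset/= (idx_side j i). Qed.

Lemma measurable_dset_fun s j d (T : measurableType d) (g : 'rV[int]_n -> T) :
  0 < s -> measurable_fun setT (g \o idx (side s j)).
Proof. by move=> s0 _ Y mY; rewrite setTI; exact: (measurable_dset _ (g @^-1` Y)). Qed.

Section density.
Variables (s : R) (k0 : 'rV[int]_n).
Hypothesis s0 : 0 < s.
Let D := dcube s k0.

Let mD : measurable D. Proof. exact: measurable_dcube. Qed.

Let Doo : (mu D < +oo)%E. Proof. by rewrite measure_dcube// ltry. Qed.

(** Approximability in measure, inside the cube [D], by a union of cells of a single level. Such
    sets form a sigma-algebra, since two levels have a common refinement and [D] has finite
    measure. *)
Let approx (A : set X) := measurable A /\ forall e : R, 0 < e -> exists j V,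
  (mu (D `&` (A `\` dset s j V)) < e%:E)%E /\
  (mu (D `&` (dset s j V `\` A)) < e%:E)%E.

Let mV j V : measurable (dset s j V). Proof. exact: measurable_dset. Qed.

Let approxC A : approx A -> approx (~` A).
Proof.
move=> [mA hA]; split; first exact: measurableC.
move=> e /hA[j [V [h1 h2]]]; exists j, (~` V); split.
  rewrite (_ : dset s j (~` V) = ~` dset s j V)// !setDE setCK (setIC (~` A)).
  by rewrite -setDE.
rewrite (_ : dset s j (~` V) = ~` dset s j V)// !setDE setCK (setIC _ A).
by rewrite -setDE.
Qed.

Let approxU A B : approx A -> approx B -> approx (A `|` B).
Proof.
move=> [mA hA] [mB hB]; split; first exact: measurableU.
move=> e e0; have e20 : 0 < e / 2 by rewrite divr_gt0.
have [i [V [hA1 hA2]]] := hA _ e20; have [j [W [hB1 hB2]]] := hB _ e20.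
rewrite (dset_refine i j) // in hA1 hA2; rewrite (dset_refine j i) // addnC in hB1 hB2.
set V' := _ @^-1` V in hA1 hA2; set W' := _ @^-1` W in hB1 hB2.
exists (i + j)%N, (V' `|` W').
have -> : dset s (i + j) (V' `|` W') = dset s (i + j) V' `|` dset s (i + j) W' by [].
have EE : e%:E = ((e / 2)%:E + (e / 2)%:E)%E by rewrite -EFinD -splitr.
have K (P Q S : set X) : measurable P -> measurable Q -> measurable S ->
   S `<=` P `|` Q -> (mu P < (e / 2)%:E)%E -> (mu Q < (e / 2)%:E)%E -> (mu S < e%:E)%E.
  move=> mP mQ mS sub h1 h2; rewrite EE; apply: le_lt_trans (lteD h1 h2).
  apply: le_trans (measure_setU_le mu mP mQ); apply: measure_mono => //.
  exact: measurableU.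
have MD P Q : measurable P -> measurable Q -> measurable (D `&` (P `\` Q)).
  by move=> mP mQ; apply: measurableI => //; exact: measurableD.
split.
  apply: (K _ _ _ _ _ _ _ hA1 hB1); try (apply: MD => //; exact: measurableU).
  by move=> x [Dx [[Ax|Bx] h]]; [left|right]; split => //; split => // ?; apply: h; [left|right].
apply: (K _ _ _ _ _ _ _ hA2 hB2); try (apply: MD => //; exact: measurableU).
by move=> x [Dx [[Ax|Bx] h]]; [left|right]; split => //; split => // ?; apply: h; [left|right].
Qed.

Let approx_nd (F : (set X)^nat) : nondecreasing_seq F -> (forall i, approx (F i)) ->
  approx (\bigcup_i F i).
Proof.
move=> ndF aF; have mF i : measurable (F i) by case: (aF i).
have mU : measurable (\bigcup_i F i) by exact: bigcup_measurable.
split => // e e0; have e20 : 0 < e / 2 by rewrite divr_gt0.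
pose G i := D `&` F i.
have mG i : measurable (G i) by exact: measurableI.
have mUG : measurable (\bigcup_i G i) by exact: bigcup_measurable.
have ndG : nondecreasing_seq G.
  by move=> i j ij; apply/subsetPset; apply: setIS; exact/subsetPset/ndF.
have UGoo : (mu (\bigcup_i G i) < +oo)%E.
  apply: le_lt_trans Doo; apply: measure_mono => //.
  by move=> x [i _ []].
have UGfin : mu (\bigcup_i G i) \is a fin_num by rewrite ge0_fin_numE.
have : (mu (\bigcup_i G i) - (e / 2)%:E < mu (\bigcup_i G i))%E.
  by rewrite lteBlDr// lteDl// lte_fin.
have := nondecreasing_cvg_mu mG mUG ndG (mu := mu).
move=> H /open_ereal_gt' /H [i _ /(_ i (leqnn i)) /= Hi].
have [_ /(_ _ e20)[j [V [h1 h2]]]] := aF i.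
exists j, V; split; last first.
  apply: le_lt_trans (lt_le_trans h2 _); last by rewrite lee_fin; lra.
  apply: measure_mono; try (by apply: measurableI => //; exact: measurableD).
  by move=> x [Dx [Vx h]]; split => //; split => // ?; apply: h; exists i.
have mI : measurable ((\bigcup_i G i) `\` G i) by exact: measurableD.
have h3 : (mu ((\bigcup_i G i) `\` G i) < (e / 2)%:E)%E.
  rewrite measure_setD// setIidr; last exact: bigcup_sup.
  rewrite lteBlDr; last first.
    by rewrite ge0_fin_numE//; apply: le_lt_trans UGoo; apply: measure_mono => //; exact: bigcup_sup.
  by rewrite addeC -lteBlDr.
have -> : e%:E = ((e / 2)%:E + (e / 2)%:E)%E by rewrite -EFinD -splitr.
apply: le_lt_trans (lteD h1 h3).
have mI' : measurable (D `&` (F i `\` dset s j V)).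
  by apply: measurableI => //; exact: measurableD.
apply: le_trans (measure_setU_le mu mI' mI); apply: measure_mono => //.
- by apply: measurableI => //; exact: measurableD.
- exact: measurableU.
move=> x [Dx [[l _ Fx] h]]; have [Fix|Fix] := pselect (F i x); first by left.
by right; split; [exists l|case].
Qed.

Let approx_sigma : sigma_algebra setT approx.
Proof.
have a0 : approx set0.
  split => // e e0; exists 0%N, set0.
  have -> : dset s 0 set0 = set0 by [].
  by rewrite setDv setI0 measure0 lte_fin.
split => // [A aA|F aF]; first by rewrite setTD; exact: approxC.
rewrite -bigcup_bigsetU_bigcup; apply: approx_nd => [i j ij|i].
  exact/subsetPset/subset_bigsetU.
by elim/big_ind : _ => // A B; exact: approxU.
Qed.

(** A half-space is the increasing union of the cells of all levels whose upper end in the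
    coordinate [i] does not exceed [t]. *)
Let approx_ray (i : 'I_n) (t : R) : approx [set x : X | x ord0 i < t].
Proof.
pose V j : set 'rV[int]_n := [set k | side s j * ((k ord0 i)%:~R + 1) <= t].
have -> : [set x : X | x ord0 i < t] = \bigcup_j dset s j (V j).
  apply/seteqP; split => x /=.
    move=> xt; have tx : 0 < t - x ord0 i by rewrite subr_gt0.
    have [j _ hj] : \forall j \near \oo, side s j < t - x ord0 i.
      near=> j; rewrite /side ltr_pdivrMr ?exprn_gt0// mulrC -ltr_pdivrMr//.
      have : s / (t - x ord0 i) < j%:R.
        near: j; exists (Num.truncn (s / (t - x ord0 i))).+1 => // j /= hj.
        have := truncnS_gt (s / (t - x ord0 i)).
        by move=> /lt_le_trans; apply; rewrite ler_nat.
      move=> /lt_trans; apply; rewrite -natrX ltr_nat.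
      exact: ltn_expl.
    exists j => //; have /(dcubeE _ _ (side_gt0 j s0))/(_ i)/andP[h1 h2] := dcube_idx (side s j) x.
    rewrite /dset/= /V/= mulrDr mulr1; have := hj j (leqnn j) => /=; lra.
  move=> [j _]; rewrite /dset/= /V/= => h.
  have /(dcubeE _ _ (side_gt0 j s0))/(_ i)/andP[h1 h2] := dcube_idx (side s j) x.
  by rewrite mulrDr mulr1 in h; apply: lt_le_trans h2 _.
apply: approx_nd => [|j].
  apply/nondecreasing_seqP => j; apply/subsetPset => x.
  rewrite /dset/= /V/= => h; apply: le_trans h.
  have /(dcubeE _ _ (side_gt0 j s0))/(_ i)/andP[h1 h2] := dcube_idx (side s j) x.
  have /(dcubeE _ _ (side_gt0 j.+1 s0))/(_ i)/andP[h3 h4] := dcube_idx (side s j.+1) x.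
  have E := idx_side j 1 x s0; rewrite addn1 /= in E.
  have Es := sideD s j 1; rewrite addn1 expr1 in Es.
  rewrite E Es [par _ _ _]mxE; set a := idx _ _ _ _.
  rewrite -mulrA mulrCA ler_pM2l ?side_gt0// mulrDr mulr1.
  have := divz_eq a 2; have := @ltz_pmod a 2 isT => r1 r2.
  have : a + 1 <= 2 * (a %/ 2)%Z + 2 by lia.
  by rewrite -(ler_int R) !intrD intrM; lra.
split => // e e0; exists j, (V j).
by rewrite setDv setI0 measure0 lte_fin.
Unshelve. all: by end_near. Qed.

Let approx_all A : measurable A -> approx A.
Proof.
(* With the approximable sets as sigma-algebra on the source, the identity is measurable because its
   coordinates are; hence every measurable set is approximable. *)
move=> mA; pose T := g_sigma_algebraType approx.
have EA B : @measurable _ T B -> approx B.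
  by move=> mB; apply: (smallest_sub approx_sigma _ mB).
apply: EA; have := @measurable_fun_rV R n _ T (fun t : T => (t : X)).
move=> /(_ _ measurableT A mA); rewrite setTI; apply => i mT.
apply: (measurability _ (RGenInftyO.measurableE R)) => // B [C [t ->] <-].
rewrite setTI; apply: sub_sigma_algebra.
rewrite (_ : _ @^-1` _ = [set x : X | x ord0 i < t]); first exact: approx_ray.
by apply/seteqP; split => x /=; rewrite in_itv.
Qed.

(** If a union of cells approximates [N] up to [e], summing the hypothesis over these cells gives
    [|N| <= th (|N| + e) + e]; as [th < 1], letting [e] tend to 0 forces [|N| = 0]. This takes the
    place of the Lebesgue density theorem. *)
Lemma dyadic_density (N : set X) (th : R) : measurable N -> N `<=` dcube s k0 ->
  0 <= th < 1 ->
  (forall j k, dcube (side s j) k `<=` dcube s k0 ->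
    mu (dcube (side s j) k `&` N) <= (th * side s j ^+ n)%:E)%E ->
  mu N = 0%E.
Proof.
move=> mN ND /andP[th0 th1] hN.
have Nfin : mu N \is a fin_num.
  by rewrite ge0_fin_numE//; apply: le_lt_trans Doo; exact: measure_mono.
have key (e : R) : 0 < e -> fine (mu N) <= th * (fine (mu N) + e) + e.
  move=> e0; have [_ /(_ _ e0)[j [V [h1 h2]]]] := approx_all mN.
  pose W := [set d | V d /\ iter j par d = k0].
  have WE : dset s j W = D `&` dset s j V.
    apply/seteqP; split => x; rewrite /dset /W /D /dcube/=.
      by move=> [? <-]; rewrite -[in LHS](side0 s) (idx_side 0 j).
    by move=> [<- ?]; split => //; rewrite -[in RHS](side0 s) (idx_side 0 j).
  have FE : dset s j W = \bigcup_(d in W) dcube (side s j) d.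
    apply/seteqP; split => x; first by exists (idx (side s j) x).
    by move=> [d Wd h]; rewrite /dset/= h.
  have : (mu (dset s j W `&` N) <= th%:E * mu (dset s j W))%E.
    rewrite -integral_1; last by apply: measurableI => //; exact: measurable_dset.
    rewrite -integral_cst; last exact: measurable_dset.
    rewrite -[X in (_ <= \int[_]_(_ in X) _)%E]setIT FE.
    apply: le_int_bigcup => //= [d _|d e' _ _ [x [<- <-//]]|d dW].
      by apply: measurable_dcube; exact: side_gt0.
    have md : measurable (dcube (side s j) d) by apply: measurable_dcube; exact: side_gt0.
    rewrite integral_1; last exact: measurableI.
    rewrite integral_cst ?setIT//.
    rewrite measure_dcube ?side_gt0// -EFinM; apply: hN => x hx.
    have : dset s j W x by rewrite /dset/= hx.
    by rewrite WE => -[].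
  have mW : measurable (dset s j W) by exact: measurable_dset.
  have WNe : (mu (dset s j W) <= mu N + e%:E)%E.
    apply: (@le_trans _ _ (mu (N `|` (D `&` (dset s j V `\` N))))%E).
      apply: measure_mono => //.
        apply: measurableU => //; apply: measurableI => //.
        by apply: measurableD => //; exact: measurable_dset.
      rewrite WE => x [Dx Vx]; have [Nx|Nx] := pselect (N x); [by left|by right].
    apply: le_trans (measure_setU_le mu _ _) _ => //.
      apply: measurableI => //.
      by apply: measurableD => //; exact: measurable_dset.
    by rewrite leeD2l// ltW.
  have NWe : (mu N <= mu (dset s j W `&` N) + e%:E)%E.
    apply: (@le_trans _ _ (mu ((dset s j W `&` N) `|` (D `&` (N `\` dset s j V))))%E).
      apply: measure_mono => //.
        apply: measurableU; apply: measurableI => //.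
        by apply: measurableD => //; exact: measurable_dset.
      rewrite WE => x Nx; have Dx := ND _ Nx.
      by have [Vx|Vx] := pselect (dset s j V x); [left|right].
    apply: le_trans (measure_setU_le mu _ _) _ => //.
    - exact: measurableI.
    - apply: measurableI => //.
      by apply: measurableD => //; exact: measurable_dset.
    - by rewrite leeD2l// ltW.
  move=> h3; rewrite -lee_fin !EFinD EFinM fineK//.
  apply: (le_trans NWe); rewrite leeD2r//; apply: (le_trans h3).
  by rewrite EFinD fineK//; apply: lee_wpmul2l.
apply/eqP; rewrite -(fineK Nfin) eqe eq_le fine_ge0 ?measure_ge0// andbT.
apply/ler_addgt0Pl => e e0; rewrite addr0.
have c0 : 0 < (1 - th) / 2 * e by rewrite mulr_gt0// divr_gt0// subr_gt0.
have := key _ c0; set N' := fine _ => h.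
have : (1 - th) * N' <= (1 - th) * e.
  have : th * ((1 - th) / 2 * e) <= 1 * ((1 - th) / 2 * e).
    by rewrite ler_wpM2r// ltW.
  lra.
by rewrite ler_pM2l// subr_gt0.
Qed.

End density.
End dyadic.

(** * Stopping cubes and the Calderon-Zygmund decomposition *)

Section stopping.
Context {R : realType} {n : nat}.
Local Notation X := 'rV[R]_n.
Local Notation mu := (leb R n).
Implicit Types (s : R) (k : 'rV[int]_n) (x y : X).
Variable s : R.
Hypothesis s0 : 0 < s.

Lemma idx_sub j x : idx s x = iter j par (idx (side s j) x).
Proof. by rewrite -[in LHS](side0 s) (idx_side 0 j). Qed.

Section bad.
Variable bad : nat -> 'rV[int]_n -> Prop.

(** These are the maximal bad cubes, as pairs of a level and an index: ancestors are the iterates of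
    [par], and levels count halvings from the side [s]. *)
Definition first_bad (c : nat * 'rV[int]_n) : Prop :=
  bad c.1 c.2 /\ forall i, (i < c.1)%N -> ~ bad i (iter (c.1 - i) par c.2).

Definition bad_set : set X := [set x | exists j, bad j (idx (side s j) x)].

Lemma first_bad_ancestor j k : bad j k ->
  exists i, (i <= j)%N /\ first_bad (i, iter (j - i) par k).
Proof.
move=> bj; have : exists i, `[< (i <= j)%N /\ bad i (iter (j - i) par k) >].
  by exists j; apply/asboolP; rewrite leqnn subnn.
move=> /ex_minnP[i /asboolP[ij bi] mi]; exists i; split => //; split => //= l li bl.
have : (i <= l)%N; last by rewrite leqNgt li.
apply: mi; apply/asboolP; split; first by rewrite (leq_trans (ltnW li)).
by move: bl; rewrite -iterD; congr (bad _ (iter _ _ _)); lia.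
Qed.

Lemma bad_setE :
  bad_set = \bigcup_(c in first_bad) dcube (side s c.1) c.2.
Proof.
apply/seteqP; split => x.
  move=> [j /first_bad_ancestor[i [ij h]]]; exists (i, iter (j - i) par (idx (side s j) x)) => //=.
  by rewrite /dcube/= (idx_side i (j - i))// subnKC.
by move=> [[j k] [bj _] h]; exists j; rewrite (_ : idx _ _ = k).
Qed.

Lemma first_bad_disj : trivIset first_bad (fun c => dcube (side s c.1) c.2).
Proof.
suff H (c d : nat * 'rV[int]_n) x : first_bad c -> first_bad d ->
    dcube (side s c.1) c.2 x -> dcube (side s d.1) d.2 x -> (d.1 <= c.1)%N.
  move=> c d fc fd [x [cx dx]].
  have E : c.1 = d.1 by apply/eqP; rewrite eqn_leq (H _ _ _ fc fd cx dx) (H _ _ _ fd fc dx cx).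
  by rewrite (surjective_pairing c) (surjective_pairing d) E; congr pair; rewrite -cx -dx E.
move=> [bc _] [bd hd] cx dx; rewrite leqNgt; apply/negP => cd.
apply: (hd _ cd); rewrite -dx.
have -> : iter (d.1 - c.1) par (idx (side s d.1) x) = idx (side s c.1) x.
  by rewrite (idx_side c.1 (d.1 - c.1))// subnKC// ltnW.
by rewrite cx.
Qed.

Lemma measurable_bad_set : measurable bad_set.
Proof.
rewrite bad_setE; apply: measurable_cbigcup => c _.
by apply: measurable_dcube; exact: side_gt0.
Qed.

Lemma le_int_bad A B (f h : X -> \bar R) : measurable A -> measurable B ->
  measurable_fun setT f -> measurable_fun setT h ->
  (forall x, 0 <= f x)%E -> (forall x, 0 <= h x)%E ->
  (forall j k, first_bad (j, k) ->
     \int[mu]_(x in dcube (side s j) k `&` A) f x <=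
     \int[mu]_(x in dcube (side s j) k `&` B) h x)%E ->
  (\int[mu]_(x in bad_set `&` A) f x <= \int[mu]_(x in bad_set `&` B) h x)%E.
Proof.
move=> mA mB mf mh f0 h0 fh; rewrite bad_setE.
apply: le_int_bigcup => // [c _| |[j k]].
- by apply: measurable_dcube; exact: side_gt0.
- exact: first_bad_disj.
- exact: fh.
Qed.

End bad.

Lemma sub_dcube_iter j k d : iter j par d = k -> dcube (side s j) d `<=` dcube s k.
Proof. by move=> <- y <-; rewrite /dcube/= (idx_sub j). Qed.

Section calderon_zygmund_stopping.
Variables (k : 'rV[int]_n) (f : X -> \bar R) (lam : R).
Hypotheses (mf : measurable_fun setT f) (f0 : forall x, (0 <= f x)%E).
Hypotheses (lam0 : 0 < lam).
Hypothesis fle : (\int[mu]_(x in dcube s k) f x <= (lam * s ^+ n)%:E)%E.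

Definition cz_bad j d : Prop := iter j par d = k /\
  ((lam * side s j ^+ n)%:E < \int[mu]_(x in dcube (side s j) d) f x)%E.

Let mdc j d : measurable (dcube (side s j) d : set X).
Proof. by apply: measurable_dcube; exact: side_gt0. Qed.

(** The parent of a stopping cube was not selected and has [2 ^ n] times its volume; at level 0 the
    hypothesis [fle] excludes stopping. *)
Lemma cz_first_le j d : first_bad cz_bad (j, d) ->
  (\int[mu]_(x in dcube (side s j) d) f x <= (2 ^+ n * lam * side s j ^+ n)%:E)%E.
Proof.
case: j => [[/= [dk bd] _]|j [/= [dk bd] /(_ j (ltnSn _)) nb]].
  by move: bd; rewrite side0 (_ : d = k)// ltNge fle.
have {nb} : (\int[mu]_(x in dcube (side s j) (par d)) f x <= (lam * side s j ^+ n)%:E)%E.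
  rewrite leNgt; apply/negP => h; apply: nb; rewrite subSnn/=; split => //.
  by rewrite -iterSr.
have E : side s j = 2 * side s j.+1 by rewrite (sideD s j 1) addn1 expr1.
rewrite [X in (_ <= (_ * X ^+ _)%:E)%E]E exprMn mulrA (mulrC lam).
move=> h; apply: le_trans h; apply: le_int => // x /= <-.
by rewrite /dcube/= (idx_side j 1)// addn1.
Qed.

Lemma cz_set_sub : bad_set cz_bad `<=` dcube s k.
Proof. by move=> x [j [<- _]]; rewrite /dcube/= (idx_sub j). Qed.

Lemma cz_set_measure :
  (lam%:E * mu (bad_set cz_bad) <= \int[mu]_(x in bad_set cz_bad) f x)%E.
Proof.
have mB := measurable_bad_set cz_bad.
rewrite -integral_cst// -[X in (\int[_]_(_ in X) _ <= _)%E]setIT.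
rewrite -[X in (_ <= \int[_]_(_ in X) _)%E]setIT.
apply: le_int_bad => // [x|j d [[_ /ltW + _]]]; first by rewrite lee_fin ltW.
by rewrite !setIT integral_cst// measure_dcube ?side_gt0// -EFinM.
Qed.

(** For each [m], the part [N m] of the good set where [f] exceeds [lam + 1 / (m + 1)] fills, by
    Chebyshev, at most the fraction [lam / (lam + 1 / (m + 1))] of any cell that meets it, so
    [dyadic_density] makes it null. This replaces Lebesgue differentiation. *)
Lemma cz_good_ae :
  mu ((dcube s k `\` bad_set cz_bad) `&` [set x | (lam%:E < f x)%E]) = 0%E.
Proof.
have mB := measurable_bad_set cz_bad.
have mD : measurable (dcube s k : set X) by exact: measurable_dcube.
have mray t : measurable [set x | (t < f x)%E].
  by rewrite -[X in measurable X]setTI; exact: emeasurable_fun_o_infty.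
pose N (m : nat) := (dcube s k `\` bad_set cz_bad) `&` [set x | ((lam + m.+1%:R^-1)%:E < f x)%E].
have mN m : measurable (N m) by apply: measurableI => //; exact: measurableD.
have N0 m : mu (N m) = 0%E.
  have l1 : 0 < lam + m.+1%:R^-1 by rewrite addr_gt0// invr_gt0.
  apply: (@dyadic_density _ _ s k s0 (N m) (lam / (lam + m.+1%:R^-1))) => //.
  - by move=> x [[]].
  - by rewrite divr_ge0 ?ltW//= ltr_pdivrMr// mul1r ltrDl invr_gt0.
  move=> j d dk.
  have [/eqP|] := boolP (dcube (side s j) d `&` N m == set0).
    by move=> ->; rewrite measure0 lee_fin !mulr_ge0 ?invr_ge0 ?exprn_ge0 ?ltW ?side_gt0.
  move=> /set0P[x [dx [[kx nb] _]]].
  have : ~ cz_bad j d by move=> bd; apply: nb; exists j; rewrite dx.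
  have -> : cz_bad j d = ((lam * side s j ^+ n)%:E < \int[mu]_(x in dcube (side s j) d) f x)%E :> Prop.
    rewrite propeqE; split => [[]//|h]; split => //.
    by rewrite -kx -dx -idx_sub.
  move/negP; rewrite -leNgt => h.
  rewrite -mulrA mulrCA EFinM lee_pdivlMl//.
  apply: le_trans h; rewrite -integral_cst; last exact: measurableI.
  apply: le_int => // y; first by rewrite lee_fin ltW.
  by move=> [_ [_ /ltW]].
rewrite (_ : _ `&` _ = \bigcup_m N m); last first.
  apply/seteqP; split => x; last first.
    move=> [m _ [h1 h2]]; split => //=; apply: lt_trans h2.
    by rewrite lte_fin ltrDl invr_gt0.
  move=> [h1 /= h2].
  suff [m hm] : exists m : nat, ((lam + m.+1%:R^-1)%:E < f x)%E by exists m.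
  move: h2; case: (f x) => [r| |]// => [|_]; last by exists 0%N; rewrite ltry.
  rewrite lte_fin => lr; exists (Num.truncn (r - lam)^-1).
  have rl : 0 < r - lam by rewrite subr_gt0.
  rewrite lte_fin -ltrBrDl -[ltRHS]invrK ltf_pV2 ?posrE ?invr_gt0//.
  exact: truncnS_gt.
apply: measure_negligible; first exact: bigcup_measurable.
by apply: negligible_bigcup => m; apply/negligibleP; [exact: mN|exact: N0].
Qed.

End calderon_zygmund_stopping.

End stopping.

(** * Induction over generations of stopping cubes *)

Section stopping_induction.
Context {R : realType} {n : nat}.
Local Notation X := 'rV[R]_n.
Local Notation mu := (leb R n).

(* Iterating the hypothesis K times gives the bound off a set of measure at most
   2^-K |Q|. *)
Lemma stopping_induction (P : R -> Prop) (Phi : R -> 'rV[int]_n -> X -> \bar R)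
    (beta : R -> 'rV[int]_n -> \bar R) :
  (forall s i, P s -> P (side s i)) -> (forall s, P s -> 0 < s) ->
  (forall s k, measurable_fun setT (Phi s k)) ->
  (forall s k x, 0 <= Phi s k x)%E -> (forall s k, P s -> 0 <= beta s k)%E ->
  (forall s k, P s -> exists bad,
     (mu (bad_set s bad) <= (2^-1 * s ^+ n)%:E)%E /\
     forall Om, measurable Om ->
       (forall i d, first_bad bad (i, d) ->
         \int[mu]_(x in dcube (side s i) d `\` Om) Phi (side s i) d x
           <= beta (side s i) d)%E ->
       (\int[mu]_(x in dcube s k `\` (bad_set s bad `&` Om)) Phi s k x
          <= beta s k)%E) ->
  forall s k, P s -> (\int[mu]_(x in dcube s k) Phi s k x <= beta s k)%E.
Proof.
move=> Pside P0' mP P0 b0 H.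
have mdc s k : P s -> measurable (dcube s k : set X).
  by move=> /P0' s0; exact: measurable_dcube.
have key (K : nat) s k : P s -> exists Om, [/\ measurable Om,
    (mu Om <= ((2^-1) ^+ K * s ^+ n)%:E)%E &
    (\int[mu]_(x in dcube s k `\` Om) Phi s k x <= beta s k)%E].
  elim: K s k => [|K ih] s k Ps; have s0 := P0' _ Ps.
    exists (dcube s k); split; first exact: mdc.
      by rewrite measure_dcube// expr0 mul1r.
    by rewrite setDv integral_set0; exact: b0.
  have [bad [bm bP]] := H s k Ps.
  have /choice[W hW] : forall c : nat * 'rV[int]_n, exists Om, [/\ measurable Om,
    (mu Om <= ((2^-1) ^+ K * side s c.1 ^+ n)%:E)%E &
    (\int[mu]_(x in dcube (side s c.1) c.2 `\` Om) Phi (side s c.1) c.2 x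
       <= beta (side s c.1) c.2)%E].
    by move=> [i d]; apply: ih; exact: Pside.
  have mdc' i d : measurable (dcube (side s i) d : set X) by apply: mdc; exact: Pside.
  (* The exceptional set of the cube collects those of generation [K] in its stopping cubes; since
     the stopping cubes fill at most half of the cube, one factor [1 / 2] is gained. *)
  pose Om := \bigcup_(c in first_bad bad) (dcube (side s c.1) c.2 `&` W c).
  have mOm : measurable Om.
    by apply: measurable_cbigcup => c _; apply: measurableI => //; case: (hW c).
  have OmE i d : first_bad bad (i, d) ->
      dcube (side s i) d `&` Om = dcube (side s i) d `&` W (i, d).
    move=> fb; apply/seteqP; split => x [dx].
      move=> [c fc [cx Ox]]; split => //.
      by rewrite (first_bad_disj s0 fb fc)//; exists x.
    by move=> Ox; split => //; exists (i, d).
  have Omsub : bad_set s bad `&` Om = Om.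
    by rewrite setIidr// bad_setE// => x [c fc [cx _]]; exists c.
  exists Om; split => //.
    have : (\int[mu]_(x in bad_set s bad `&` Om) 1 <=
        \int[mu]_(x in bad_set s bad `&` setT) (cst ((2^-1) ^+ K)%:E x))%E.
      apply: le_int_bad => // [x|i d fb]; first by rewrite lee_fin exprn_ge0.
      rewrite OmE// setIT integral_1; last by apply: measurableI => //; case: (hW (i, d)).
      rewrite integral_cst// measure_dcube ?side_gt0// -EFinM.
      have [mO mO' _] := hW (i, d); apply: le_trans mO'.
      by apply: measure_mono => //; exact: measurableI.
    rewrite Omsub setIT integral_1// integral_cst; last exact: measurable_bad_set.
    move=> /le_trans; apply; rewrite exprSr -mulrA EFinM lee_wpmul2l// ?lee_fin ?exprn_ge0// invr_ge0.
  have := bP Om mOm; rewrite Omsub; apply => i d fb.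
  have [_ _] := hW (i, d).
  rewrite (_ : dcube (side s i) d `\` Om = dcube (side s i) d `\` W (i, d))//.
  by apply/seteqP; split => x [dx h]; split => // Ox; apply: h;
    have := OmE i d fb => /seteqP[h1 h2]; [have [] := h2 x (conj dx Ox)|have [] := h1 x (conj dx Ox)].
(* The exceptional sets of all generations have summable measures, so [int_eq_lim] carries the bound
   to the whole cube. *)
move=> s k Ps; have /choice[E hE] := (fun K => key K s k Ps).
have mE K : measurable (E K) by case: (hE K).
apply: (int_eq_lim (E := E)) => //; first exact: mdc; last by move=> K; case: (hE K).
have s20 : 0 <= 2 * s ^+ n by rewrite mulr_ge0// exprn_ge0// ltW// P0'.
apply: (@le_lt_trans _ _ (2 * s ^+ n)%:E); last exact: ltry.
apply: le_trans (epsilon_trick0 xpredT s20); apply: lee_nneseries => // K _.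
have [_ + _] := hE K; move=> /le_trans; apply; rewrite lee_fin.
rewrite natrX exprS invfM mulrACA mulfV// mul1r mulrC exprVn; lra.
Qed.

Lemma int_le_cst (A : set X) (h : X -> \bar R) (K : R) : measurable A ->
  measurable_fun setT h -> (forall x, 0 <= h x)%E -> 0 <= K ->
  mu (A `&` [set x | (K%:E < h x)%E]) = 0%E ->
  (\int[mu]_(x in A) h x <= K%:E * mu A)%E.
Proof.
move=> mA mh h0 K0 N0.
have mN : measurable (A `&` [set x | (K%:E < h x)%E]).
  apply: measurableI => //; rewrite -[X in measurable X]setTI.
  exact: emeasurable_fun_o_infty.
rewrite (ge0_negligible_integral mN)//; last exact: measurable_funS mh.
rewrite -integral_cst//; apply: le_int => // x; rewrite ?lee_fin//.
by move=> [Ax /not_andP[//|/negP]]; rewrite -leNgt.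
Qed.

End stopping_induction.

(** * The dyadic maximal function over tripled cubes *)

Section maximal.
Context {R : realType} {n : nat}.
Local Notation X := 'rV[R]_n.
Local Notation mu := (leb R n).
Implicit Types (s : R) (k : 'rV[int]_n) (x y : X).

Definition avg3 s (f : X -> \bar R) k : \bar R :=
  (((s ^+ n)^-1)%:E * \int[mu]_(x in triple s k) f x)%E.

(** Only scales at most [s] enter, which suffices for local estimates and makes the supremum
    countable. Note that [avg3] divides by the volume of the central cell, not of the tripled
    cube. *)
Definition maxf s (f : X -> \bar R) x : \bar R :=
  esups (fun j => avg3 (side s j) f (idx (side s j) x)) 0.

Lemma avg3_ge0 s f k : 0 < s -> (forall x, 0 <= f x)%E -> (0 <= avg3 s f k)%E.
Proof.
move=> s0 f0; apply: mule_ge0; first by rewrite lee_fin invr_ge0 exprn_ge0// ltW.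
by apply: integral_ge0 => x _.
Qed.

Lemma avg3_le_maxf s f j x : (avg3 (side s j) f (idx (side s j) x) <= maxf s f x)%E.
Proof. by apply: ereal_sup_ubound; exists j. Qed.

Lemma maxf_ge0 s f x : 0 < s -> (forall x, 0 <= f x)%E -> (0 <= maxf s f x)%E.
Proof.
move=> s0 f0; apply: le_trans (avg3_le_maxf s f 0 x).
by apply: avg3_ge0 => //; exact: side_gt0.
Qed.

Lemma measurable_maxf s f : 0 < s -> measurable_fun setT (maxf s f).
Proof.
move=> s0; apply: measurable_fun_esups => j.
exact: (@measurable_dset_fun _ _ s j _ _ (avg3 (side s j) f)).
Qed.

Lemma lt_maxfP s f x (t : \bar R) : (t < maxf s f x)%E ->
  exists j, (t < avg3 (side s j) f (idx (side s j) x))%E.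
Proof. by move=> /ereal_sup_gt[_ [j _ <-] h]; exists j. Qed.

Lemma triple_bigcup s k : triple s k =
  (\bigcup_(d in [set d : 'rV[int]_n | forall i, adjacent (d ord0 i) (k ord0 i)]) dcube s d) `&` setT.
Proof.
rewrite setIT; apply/seteqP; split => x; first by move=> h; exists (idx s x).
by move=> [d Pd dx] i; rewrite (_ : idx s x = d).
Qed.

(** A pigeonhole argument: the volume of a tripled cube is at most [3 ^ n] cells, so some
    neighbouring cell has an average of at least the share [3 ^- n] of the total. *)
Lemma lt_avg3_neighbor s f k (t : R) : 0 < s -> measurable_fun setT f ->
  (forall x, 0 <= f x)%E -> 0 <= t -> (t%:E < avg3 s f k)%E ->
  exists d : 'rV[int]_n, (forall i, adjacent (d ord0 i) (k ord0 i)) /\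
    ((t / 3 ^+ n * s ^+ n)%:E < \int[mu]_(x in dcube s d) f x)%E.
Proof.
move=> s0 mf f0 t0 h; apply/not_existsP => H; move: h; apply/negP; rewrite -leNgt.
rewrite /avg3 lee_pdivrMl ?exprn_gt0// -EFinM.
have t30 : 0 <= t / 3 ^+ n by rewrite divr_ge0// exprn_ge0.
have mT : measurable (triple s k : set X) by exact: measurable_triple.
apply: (@le_trans _ _ ((t / 3 ^+ n)%:E * mu (triple s k))%E); last first.
  apply: (@le_trans _ _ ((t / 3 ^+ n)%:E * ((3 * s) ^+ n)%:E)%E).
    by apply: lee_wpmul2l; [rewrite lee_fin|exact: measure_triple_le].
  by rewrite -EFinM lee_fin exprMn mulrA divfK ?expf_neq0// mulrC.
rewrite -integral_cst//.
rewrite triple_bigcup; apply: le_int_bigcup => //= [d _|d d' _ _ [x [<- <-//]]|d Pd].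
  exact: measurable_dcube.
rewrite !setIT integral_cst; last exact: measurable_dcube.
rewrite measure_dcube// -EFinM leNgt; apply/negP => h; apply: (H d); split => //.
Qed.

(** A point with large maximal function has a neighbouring cell of large average, and the triple of
    the maximal bad ancestor of that cell contains the point. One factor [3 ^ n] comes from the
    choice of the neighbour, the other from tripling disjoint cubes. *)
Lemma maxf_weak s f (t : R) : 0 < s -> measurable_fun setT f ->
  (forall x, 0 <= f x)%E -> 0 < t ->
  (mu [set x | t%:E < maxf s f x] <= (9 ^+ n / t)%:E * \int[mu]_x f x)%E.
Proof.
move=> s0 mf f0 t0; pose c := t / 3 ^+ n.
have c0 : 0 < c by rewrite divr_gt0// exprn_gt0.
pose bad j d := ((c * side s j ^+ n)%:E < \int[mu]_(x in dcube (side s j) d) f x)%E : Prop.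
have sj j : 0 < side s j by exact: side_gt0.
have mdc j d : measurable (dcube (side s j) d : set X) by exact: measurable_dcube.
have mT j d : measurable (triple (side s j) d : set X) by exact: measurable_triple.
apply: (@le_trans _ _ (mu (\bigcup_(e in first_bad bad) triple (side s e.1) e.2))).
  apply: measure_mono; first 1 last.
  - by apply: measurable_cbigcup => e _.
  - move=> x /= /lt_maxfP[j] /(lt_avg3_neighbor (sj j) mf f0 (ltW t0))[d [ad dl]].
    have [i [ij fb]] := @first_bad_ancestor _ _ s s0 bad j d dl.
    exists (i, iter (j - i) par d) => //=.
    have := @triple_iter_par R n (j - i) (side s j) d (sj j).
    have -> : 2 ^+ (j - i) * side s j = side s i by rewrite (sideD s i (j - i)) subnKC.
    apply => l; have : adjacent (d ord0 l) (idx (side s j) x ord0 l) by exact: ad.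
    by rewrite /adjacent andbC.
  - rewrite -[X in measurable X]setTI; apply: emeasurable_fun_o_infty => //.
    exact: measurable_maxf.
apply: (@le_trans _ _ (\int[mu]_(x in \bigcup_(e in first_bad bad) dcube (side s e.1) e.2)
   ((9 ^+ n / t)%:E * f x))%E).
  have k0 : 0 <= 9 ^+ n / t by rewrite divr_ge0 ?exprn_ge0// ltW.
  apply: (@le_measure_bigcup _ _ _ mu _ _ _ (fun e : nat * 'rV[int]_n =>
    dcube (side s e.1) e.2)) => //.
  - exact: first_bad_disj.
  - by apply: emeasurable_funM.
  - by move=> x; rewrite mule_ge0// lee_fin.
  move=> [j d] [/= bd _].
  rewrite int_scale//.
  apply: le_trans (measure_triple_le _ _) _; first exact: sj.
  apply: (@le_trans _ _ ((9 ^+ n / t)%:E * (c * side s j ^+ n)%:E)%E); last first.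
    by apply: lee_wpmul2l; [rewrite lee_fin|exact: ltW].
  rewrite -EFinM lee_fin exprMn mulrA ler_wpM2r ?exprn_ge0 ?(ltW (sj j))//.
  rewrite /c mulrA divfK ?gt_eqF//.
  have -> : 9 ^+ n = 3 ^+ n * 3 ^+ n :> R by rewrite -exprMn; congr (_ ^+ _); lra.
  by rewrite mulfK ?expf_neq0.
have k0 : 0 <= 9 ^+ n / t by rewrite divr_ge0 ?exprn_ge0// ltW.
rewrite int_scale//; last by apply: measurable_cbigcup => e _.
by apply: lee_wpmul2l; [rewrite lee_fin|apply: le_int].
Qed.

Lemma maxf_split s (f g : X -> \bar R) (c : R) x : 0 < s ->
  measurable_fun setT g -> (forall x, 0 <= f x)%E -> (forall x, 0 <= g x)%E ->
  0 <= c -> (forall x, f x <= g x + c%:E)%E ->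
  (maxf s f x <= maxf s g x + (3 ^+ n * c)%:E)%E.
Proof.
move=> s0 mg f0 g0 c0 fg; apply: ge_ereal_sup => _ [j _ <-].
have sj := side_gt0 j s0.
set k := idx _ _; apply: (@le_trans _ _ (avg3 (side s j) g k + (3 ^+ n * c)%:E)%E); last first.
  by rewrite leeD2r//; exact: avg3_le_maxf.
have mT : measurable (triple (side s j) k : set X) by exact: measurable_triple.
have sn : 0 < side s j ^+ n by rewrite exprn_gt0.
rewrite /avg3 lee_pdivrMl// ge0_muleDr; last 2 first.
- by apply: avg3_ge0.
- by rewrite lee_fin mulr_ge0// exprn_ge0.
rewrite muleA -EFinM mulfV ?gt_eqF// mul1e.
apply: (@le_trans _ _ (\int[mu]_(x in triple (side s j) k) (g x + (cst c%:E) x))%E).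
  by apply: le_int => // y _; rewrite adde_ge0// lee_fin.
rewrite int_add//.
rewrite leeD2l// integral_cst// -EFinM.
apply: (@le_trans _ _ (c%:E * ((3 * side s j) ^+ n)%:E)%E).
  by apply: lee_wpmul2l; [rewrite lee_fin|exact: measure_triple_le].
by rewrite -EFinM lee_fin exprMn; apply: eq_leW; ring.
Qed.

End maximal.

(** * Interpolation from truncated weak type bounds *)

Section marcinkiewicz.
Context d (T : measurableType d) (R : realType) (mu : {measure set T -> \bar R}).

(** A geometric sum is controlled by its last term, and the last term kept is below [z]. The
    induction also carries the bound by the next term, which serves when that term is still kept. *)
Lemma geometric_truncated (b r z : R) (M : nat) : 0 < b -> 1 < r -> 0 <= z ->
  \sum_(i < M) (if b * r ^+ i < z then b * r ^+ i else 0) <= z * r / (r - 1).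
Proof.
move=> b0 r1 z0; have r10 : 0 < r - 1 by rewrite subr_gt0.
have r0 : 0 < r by exact: lt_trans r1.
suff [] : \sum_(i < M) (if b * r ^+ i < z then b * r ^+ i else 0) <= b * r ^+ M / (r - 1) /\
  \sum_(i < M) (if b * r ^+ i < z then b * r ^+ i else 0) <= z * r / (r - 1) by [].
elim: M => [|M [ih1 ih2]].
  by rewrite big_ord0; split; rewrite divr_ge0 ?(ltW r10)// mulr_ge0 ?exprn_ge0 ?(ltW r0) ?(ltW b0).
have E : b * r ^+ M / (r - 1) + b * r ^+ M = b * r ^+ M.+1 / (r - 1).
  by rewrite exprS; field; rewrite gt_eqF.
have b1 : 0 <= b * r ^+ M by rewrite mulr_ge0 ?exprn_ge0 ?ltW.
have S1 : \sum_(i < M.+1) (if b * r ^+ i < z then b * r ^+ i else 0) <= b * r ^+ M.+1 / (r - 1).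
  by rewrite big_ord_recr/= -E lerD//; case: ifP.
split => //; rewrite big_ord_recr/=; case: ifPn => [bz|_]; last by rewrite addr0.
have := S1; rewrite big_ord_recr/= bz => /le_trans; apply.
by rewrite ler_pM2r ?invr_gt0// exprSr mulrA ler_pM2r// ltW.
Qed.

(** A dyadic layer-cake bound: the largest level [2 ^ i / 2 ^ N] below [y] equals [y] up to a factor
    2, and values below the lowest level are covered by the first summand. *)
Lemma powR_layer (t : R) (N : nat) (y : \bar R) : 1 < t -> (0 <= y)%E ->
  (y `^ t <= ((2 ^+ N)^-1 `^ t)%:E +
   \sum_(i <oo) (if ((2 ^+ i / 2 ^+ N)%:E < y)%E then (2 * (2 ^+ i / 2 ^+ N)) `^ t else 0)%:E)%E.
Proof.
move=> t1 y0; have t0 : 0 < t by exact: lt_trans t1.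
pose u i : R := 2 ^+ i / 2 ^+ N.
have u0 i : 0 < u i by rewrite divr_gt0// exprn_gt0.
pose F i : \bar R := (if ((u i)%:E < y)%E then (2 * u i) `^ t else 0)%:E.
have F0 i : (0 <= F i)%E by rewrite lee_fin; case: ifP => // _; exact: powR_ge0.
have Fle i : (F i <= \sum_(i <oo) F i)%E.
  by apply: le_trans (nneseries_lim_ge i.+1 _) => //; rewrite big_nat_recr//= leeDr// sume_ge0.
have a0 : (0 <= ((2 ^+ N)^-1 `^ t)%:E :> \bar R)%E by rewrite lee_fin powR_ge0.
move: y y0 @F F0 Fle => [r| |]// r0 F F0 Fle.
  have [ru|ur] := leP r (u 0%N).
    apply: (@le_trans _ _ ((2 ^+ N)^-1 `^ t)%:E); last by rewrite leeDl//; apply: nneseries_ge0 => i _ _; exact: F0.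
    have E : u 0%N = (2 ^+ N)^-1 by rewrite /u expr0 mul1r.
    by rewrite poweR_EFin lee_fin -E; apply: ge0_ler_powR => //; rewrite ?nnegrE; exact: ltW.
  have : exists i, r <= u i.
    have [i hi] : exists i : nat, r * 2 ^+ N <= 2 ^+ i.
      exists (Num.truncn (r * 2 ^+ N)).+1; apply: (ltW (lt_trans (truncnS_gt _) _)).
      by rewrite -[ltRHS]natrX ltr_nat ltn_expl.
    by exists i; rewrite ler_pdivlMr// exprn_gt0.
  move=> /ex_minnP[[|i] ri mi]; first by move: ur; rewrite ltNge ri.
  apply: (@le_trans _ _ (F i)); last by apply: le_trans (Fle i) _; rewrite leeDr.
  rewrite /F lte_fin; have -> : u i < r.
    by rewrite ltNge; apply/negP => /mi; rewrite ltnn.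
  rewrite poweR_EFin lee_fin; apply: ge0_ler_powR; rewrite ?nnegrE//; first exact: ltW.
    by rewrite mulr_ge0 ?ltW.
  by apply: le_trans ri _; rewrite /u exprS mulrA.
rewrite [X in (_ <= X)%E](_ : _ = +oo%E) ?leey//.
apply: eq_infty => r; apply: (@le_trans _ _ (\sum_(i <oo) F i)%E); last by rewrite leeDr.
pose i := (Num.truncn ((`|r| + 1) * 2 ^+ N)).+1.
apply: le_trans (Fle i); rewrite /F ltry lee_fin.
have ri : `|r| + 1 <= u i.
  rewrite ler_pdivlMr ?exprn_gt0//; apply: (ltW (lt_trans (truncnS_gt _) _)).
  by rewrite -[ltRHS]natrX ltr_nat ltn_expl.
have rn := normr_ge0 r; have rr := ler_norm r.
have u1 : 1 <= 2 * u i by lra.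
apply: (@le_trans _ _ (2 * u i)); first by lra.
by rewrite -[leLHS]powRr1 ?ler_powR ?(ltW t1)//; lra.
Qed.

(** Each layer of [g] is estimated by the part of [F] above [c * l], and exchanging sum and integral
    leaves a truncated geometric sum. Starting the layers at [2 ^- N] costs [2 ^- (N t)] times the
    measure of [A], which is finite, so the cost vanishes as [N] grows. *)
Lemma marcinkiewicz (A : set T) (g : T -> \bar R) (F : T -> R) (c K t : R) :
  measurable A -> (mu A < +oo)%E -> measurable_fun setT g ->
  (forall x, 0 <= g x)%E -> measurable_fun setT F -> (forall x, 0 <= F x) ->
  0 < c -> 0 <= K -> 1 < t ->
  (forall l : R, (0 < l)%R -> mu (A `&` [set x | (l%:E < g x)%E]) <=
     (K / l)%:E * \int[mu]_(x in [set x | (c * l < F x)%R]) (F x)%:E)%E ->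
  (\int[mu]_(x in A) (g x `^ t) <=
   (K * 2 `^ t * c^-1 `^ (t - 1) * (2 `^ (t - 1) / (2 `^ (t - 1) - 1)))%:E *
     \int[mu]_x (F x `^ t)%:E)%E.
Proof.
move=> mA Aoo mg g0 mF F0 c0 K0 t1 wk.
have t0 : 0 < t by exact: lt_trans t1.
have t10 : 0 < t - 1 by rewrite subr_gt0.
set C := (K * _ * _ * _).
have r1 : 1 < 2 `^ (t - 1) :> R by rewrite /powR pnatr_eq0/= expR_gt1 mulr_gt0// ln_gt0// ltr1n.
have C0 : 0 <= C.
  by rewrite !mulr_ge0 ?powR_ge0// invr_ge0 subr_ge0 ltW.
have mFt : measurable_fun setT (fun x => (F x `^ t)%:E).
  by apply/measurable_EFinP; exact: (measurableT_comp (measurable_powR t)).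
have mlt (h : T -> \bar R) (b : \bar R) : measurable_fun setT h -> measurable [set x | (b < h x)%E].
  by move=> mh; rewrite -[X in measurable X]setTI; exact: emeasurable_fun_o_infty.
have main N : (\int[mu]_(x in A) (g x `^ t) <= ((2 ^+ N)^-1 `^ t)%:E * mu A +
    C%:E * \int[mu]_x (F x `^ t)%:E)%E.
  pose u i : R := 2 ^+ i / 2 ^+ N.
  have u0 i : 0 < u i by rewrite divr_gt0// exprn_gt0.
  pose G i x : \bar R := (if ((u i)%:E < g x)%E then (2 * u i) `^ t else 0)%:E.
  have GE i : G i = fun x => (((2 * u i) `^ t)%:E * (\1_[set x | ((u i)%:E < g x)%E] x)%:E)%E.
    apply/funext => x; rewrite /G indicE; case: ifPn => h.
      by rewrite mem_set// mule1.
    by rewrite memNset ?mule0//=; apply/negP.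
  have mi i : measurable_fun setT (fun x => (\1_[set x | ((u i)%:E < g x)%E] x : R)%:E).
    by apply/measurable_EFinP; apply: measurable_indic; exact: mlt.
  have i0 i (x : T) : (0 <= (\1_[set x | ((u i)%:E < g x)%E] x : R)%:E)%E by rewrite lee_fin.
  have G0 i x : (0 <= G i x)%E by rewrite lee_fin; case: ifP => // _; exact: powR_ge0.
  have mG i : measurable_fun setT (G i).
    by rewrite GE; apply: emeasurable_funM => //.
  have mS : measurable_fun setT (fun x => \sum_(i <oo) G i x)%E.
    by apply: ge0_emeasurable_sum => //.
  have S0 x : (0 <= \sum_(i <oo) G i x)%E by exact: nneseries_ge0.
  have p0 (x : T) : (0 <= ((2 ^+ N)^-1 `^ t)%:E :> \bar R)%E by rewrite lee_fin powR_ge0.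
  apply: (@le_trans _ _ (\int[mu]_(x in A) (((2 ^+ N)^-1 `^ t)%:E + \sum_(i <oo) G i x))%E).
    apply: le_int => // x _; first exact: poweR_ge0.
      by rewrite adde_ge0 ?nneseries_ge0// lee_fin powR_ge0.
    exact: powR_layer.
  rewrite int_add//.
  apply: leeD; first by rewrite integral_cst.
  rewrite integral_nneseries//; last by move=> i; exact: measurable_funS (mG i).
  pose H i x : \bar R := ((if c * u i < F x then K * 2 `^ t * u i `^ (t - 1) else 0) * F x)%:E.
  have H0 i x : (0 <= H i x)%E.
    by rewrite lee_fin mulr_ge0//; case: ifP => // _; rewrite !mulr_ge0 ?powR_ge0.
  have mFl i : measurable [set x | (c * u i < F x)%R].
    rewrite (_ : mkset _ = [set x | ((c * u i)%:E < (F x)%:E)%E])//.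
    by apply: mlt; apply/measurable_EFinP.
  have HE i : H i = fun x => ((K * 2 `^ t * u i `^ (t - 1))%:E *
      ((F x)%:E * (\1_[set x | (c * u i < F x)%R] x)%:E))%E.
    apply/funext => x; rewrite /H indicE -!EFinM; case: ifPn => h.
      by rewrite mem_set// mulr1.
    by rewrite memNset ?mul0r ?mulr0//=; apply/negP.
  have mFi i : measurable_fun setT (fun x => (F x)%:E * (\1_[set x | (c * u i < F x)%R] x)%:E)%E.
    apply: emeasurable_funM; first exact/measurable_EFinP.
    by apply/measurable_EFinP; apply: measurable_indic; exact: mFl.
  have mH i : measurable_fun setT (H i).
    by rewrite HE; apply: emeasurable_funM.
  apply: (@le_trans _ _ (\sum_(i <oo) \int[mu]_x H i x)%E).
    apply: lee_nneseries => [i _ _|i _]; first exact: integral_ge0.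
    rewrite GE int_scale ?powR_ge0//.
    rewrite integral_indic//; last exact: mlt.
    rewrite HE int_scale ?mulr_ge0 ?powR_ge0//; last first.
      by move=> x; rewrite -EFinM lee_fin mulr_ge0.
    rewrite [X in (_ <= _ * X)%E](_ : _ = \int[mu]_(x in [set x | (c * u i < F x)%R]) (F x)%:E)%E; last first.
      rewrite [RHS]integral_mkcond; apply: eq_integral => x _.
      by rewrite /patch indicE; case: ifPn => h; rewrite ?mule1 ?mule0.
    rewrite setIC; apply: le_trans (lee_wpmul2l _ (wk _ (u0 i))) _.
      by rewrite lee_fin powR_ge0.
    rewrite muleA -EFinM; apply: lee_wpmul2r.
      by apply: integral_ge0 => x _; rewrite lee_fin.
    rewrite lee_fin powRM// ?(ltW (u0 i))//.
    rewrite -(mulr_powRB1 (ltW (u0 i)) t0).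
    apply: eq_leW.
    move: (u i) (u0 i) (u i `^ (t - 1)) (2 `^ t) => a a0 v b0.
    by field; rewrite gt_eqF.
  rewrite -integral_nneseries//.
  rewrite -int_scale//; last by move=> x; rewrite lee_fin powR_ge0.
  apply: le_int => // x _.
  - exact: nneseries_ge0.
  - by rewrite -EFinM lee_fin mulr_ge0// powR_ge0.
  apply: lime_le; first exact: is_cvg_nneseries.
  apply: nearW => M; rewrite -EFinM /H sumEFin lee_fin.
  rewrite -mulr_suml big_mkord.
  have [->|Fx0] := eqVneq (F x) 0; first by rewrite mulr0 powR0 ?mulr0// gt_eqF.
  have Fx : 0 < F x by rewrite lt_neqAle eq_sym Fx0 F0.
  have -> : \sum_(i < M) (if c * u i < F x then K * 2 `^ t * u i `^ (t - 1) else 0) =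
      K * 2 `^ t * \sum_(i < M) (if (2 ^+ N)^-1 `^ (t - 1) * (2 `^ (t - 1)) ^+ i < (F x / c) `^ (t - 1)
        then (2 ^+ N)^-1 `^ (t - 1) * (2 `^ (t - 1)) ^+ i else 0).
    rewrite mulr_sumr; apply: eq_bigr => i _.
    have E : u i `^ (t - 1) = (2 ^+ N)^-1 `^ (t - 1) * (2 `^ (t - 1)) ^+ i.
      rewrite /u mulrC powRM ?invr_ge0 ?exprn_ge0//; congr (_ * _).
      elim: (i : nat) => [|j ih]; first by rewrite !expr0 powR1.
      by rewrite !exprS powRM ?exprn_ge0// ih.
    rewrite -E.
    have -> : (u i `^ (t - 1) < (F x / c) `^ (t - 1)) = (c * u i < F x).
      rewrite [c * _]mulrC -ltr_pdivlMr//.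
      have Fc0 : 0 <= F x / c by rewrite divr_ge0// ltW.
      have ui := ltW (u0 i).
      apply/idP/idP => [|h]; last by apply: gt0_ltr_powR; rewrite ?nnegrE.
      by apply: contraTT; rewrite -!leNgt => h; apply: ge0_ler_powR; rewrite ?nnegrE ?(ltW t10).
    by case: ifP => // _; rewrite mulr0.
  apply: (@le_trans _ _ (K * 2 `^ t * ((F x / c) `^ (t - 1) * 2 `^ (t - 1) / (2 `^ (t - 1) - 1)) * F x)).
    rewrite ler_wpM2r ?F0// ler_wpM2l ?mulr_ge0 ?powR_ge0//.
    by apply: geometric_truncated => //; rewrite ?powR_gt0 ?powR_ge0// invr_gt0 exprn_gt0.
  rewrite powRM ?invr_ge0 ?(ltW c0)//.
  have -> : F x `^ t = F x `^ (t - 1) * F x.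
    by rewrite mulrC mulr_powRB1// ltW.
  apply: eq_leW; rewrite /C; ring.
have muA : mu A \is a fin_num by rewrite ge0_fin_numE.
have cv : (((2 ^+ N)^-1 `^ t)%:E * mu A + C%:E * \int[mu]_x (F x `^ t)%:E)%E
    @[N --> \oo] --> (0%:E * mu A + C%:E * \int[mu]_x (F x `^ t)%:E)%E.
  rewrite -(fineK muA); under eq_fun do rewrite -EFinM.
  apply: cvgeD.
  - by rewrite -EFinM mul0r; apply: fin_num_adde_defr.
  - rewrite -EFinM; apply: cvg_EFin; first exact: nearW.
    apply: cvgMl => /=.
    apply: (@squeeze_cvgr _ _ _ _ (cst 0) (fun N => (2^-1) ^+ N : R)).
    + apply: nearW => N; rewrite powR_ge0/=.
      rewrite -exprVn; set y := _ ^+ N.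
      have y0 : 0 < y by rewrite exprn_gt0// invr_gt0.
      have y1 : y <= 1 by rewrite exprn_ile1// ?invr_ge0// invf_le1//; lra.
      rewrite -(mulr_powRB1 (ltW y0) t0) ler_piMr ?(ltW y0)//.
      have := @ge0_ler_powR R (t - 1) (ltW t10) y 1.
      by rewrite powR1 !nnegrE; apply => //; exact: ltW.
    + exact: cvg_cst.
    + by apply: cvg_expr; rewrite ger0_norm ?invr_ge0// invf_lt1//; lra.
  - exact: cvg_cst.
rewrite mul0e add0e in cv; rewrite -(cvg_lim _ cv)//.
apply: lime_ge; first by apply/cvg_ex; eexists; exact: cv.
exact: nearW.
Qed.

End marcinkiewicz.

Section maximal_strong.
Context {R : realType} {n : nat}.
Local Notation X := 'rV[R]_n.
Local Notation mu := (leb R n).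

Lemma maxf_strong (t : R) : 1 < t -> exists2 C : R, 0 <= C &
  forall (s : R) (A : set X) (F : X -> R), 0 < s -> measurable A -> (mu A < +oo)%E ->
  measurable_fun setT F -> (forall x, 0 <= F x) ->
  (\int[mu]_(x in A) (maxf s (fun x => (F x)%:E) x `^ t) <=
     C%:E * \int[mu]_x (F x `^ t)%:E)%E.
Proof.
(* Values of [F] below [c * l] raise the maximal function by at most [3 ^ n * c * l = l / 2], so the
   weak bound at level [l / 2] concerns only the part of [F] above [c * l]. *)
move=> t1; pose c : R := (2 * 3 ^+ n)^-1.
have c0 : 0 < c by rewrite invr_gt0 mulr_gt0// exprn_gt0.
have K0 : 0 <= 2 * 9 ^+ n :> R by rewrite mulr_ge0// exprn_ge0.
have r1 : 1 < 2 `^ (t - 1) :> R.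
  by rewrite /powR pnatr_eq0/= expR_gt1 mulr_gt0 ?subr_gt0// ln_gt0// ltr1n.
eexists; last first.
  move=> s A F s0 mA Aoo mF F0.
  have mFE : measurable_fun setT (fun x => (F x)%:E) by exact/measurable_EFinP.
  have FE0 x : (0 <= (F x)%:E)%E by rewrite lee_fin.
  apply: (marcinkiewicz (c := c) (K := 2 * 9 ^+ n)) => //.
  - exact: measurable_maxf.
  - by move=> x; exact: maxf_ge0.
  move=> l l0; pose B := [set x | c * l < F x].
  have mB : measurable B.
    rewrite (_ : B = [set x | ((c * l)%:E < (F x)%:E)%E])//.
    by rewrite -[X in measurable X]setTI; exact: emeasurable_fun_o_infty.
  pose G := (fun x => (F x)%:E) \_ B.
  have mG : measurable_fun setT G.
    by apply/(measurable_restrictT _ mB); exact: measurable_funTS.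
  have G0 x : (0 <= G x)%E by exact: erestrict_ge0.
  have l20 : 0 < l / 2 by rewrite divr_gt0.
  apply: (@le_trans _ _ (mu [set x | ((l / 2)%:E < maxf s G x)%E])).
    apply: measure_mono.
    - apply: measurableI => //; rewrite -[X in measurable X]setTI.
      by apply: emeasurable_fun_o_infty => //; exact: measurable_maxf.
    - rewrite -[X in measurable X]setTI.
      by apply: emeasurable_fun_o_infty => //; exact: measurable_maxf.
    move=> x [_ /= h].
    have cl0 : 0 <= c * l by rewrite mulr_ge0 ?ltW.
    have : (maxf s (fun x => (F x)%:E) x <= maxf s G x + (3 ^+ n * (c * l))%:E)%E.
      apply: maxf_split => // y; rewrite /G /patch; case: ifPn => yB.
        by rewrite leeDl// lee_fin.
      by rewrite add0e lee_fin leNgt; apply: contra yB => yB; rewrite inE.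
    have -> : 3 ^+ n * (c * l) = l / 2.
      rewrite /c invfM mulrA mulrCA mulfV ?expf_neq0//; ring.
    move/(lt_le_trans h); rewrite [X in (X%:E < _)%E](splitr l) EFinD.
    by rewrite lteD2rE.
  apply: le_trans (maxf_weak _ _ _ _) _ => //.
  rewrite invf_div mulrCA mulrA -integral_mkcond.
  by apply: eq_leW; congr (_%:E * _)%E; ring.
by rewrite !mulr_ge0 ?powR_ge0// ?exprn_ge0// invr_ge0 subr_ge0 ltW.
Qed.

End maximal_strong.

(** * Complex-valued functions and their integrals *)

Section complex_functions.
Context {R : realType} {n : nat}.
Local Notation X := 'rV[R]_n.
Local Notation C := R[i].
Local Notation mu := (leb R n).
Implicit Types (f g : X -> C) (A : set X) (z : C).

Lemma cabsD (z w : C) : cabs (z + w) <= cabs z + cabs w.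
Proof. exact: le_normcD. Qed.

Lemma cabsN z : cabs (- z) = cabs z.
Proof. exact: normcN. Qed.

Lemma cabsM (z w : C) : cabs (z * w) = cabs z * cabs w.
Proof. exact: ComplexField.Normc.normcM. Qed.

Lemma cabs0 : cabs (0 : C) = 0.
Proof. exact: ComplexField.Normc.normc0. Qed.

Lemma cabs_real (r : R) : cabs (r%:C)%C = `|r|.
Proof. by rewrite /ComplexField.Normc.normc/= expr0n/= addr0 sqrtr_sqr. Qed.

Lemma cabs_eq0 z : cabs z = 0 -> z = 0.
Proof. exact: ComplexField.Normc.eq0_normc. Qed.

Lemma Re_le_cabs z : `|complex.Re z| <= cabs z.
Proof.
case: z => a b /=; rewrite -sqrtr_sqr ler_sqrt ?addr_ge0 ?sqr_ge0//.
by rewrite lerDl sqr_ge0.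
Qed.

Lemma Im_le_cabs z : `|complex.Im z| <= cabs z.
Proof.
case: z => a b /=; rewrite -sqrtr_sqr ler_sqrt ?addr_ge0 ?sqr_ge0//.
by rewrite lerDr sqr_ge0.
Qed.

Lemma cabs_le_ReIm z : cabs z <= `|complex.Re z| + `|complex.Im z|.
Proof.
case: z => a b /=.
rewrite -[leRHS]ger0_norm ?addr_ge0// -sqrtr_sqr ler_sqrt ?sqr_ge0//.
rewrite sqrrD -!normrX !(ger0_norm (sqr_ge0 _)) addrAC lerDl.
by rewrite mulrn_wge0// mulr_ge0.
Qed.

Lemma cabs_sum I (r : seq I) (F : I -> C) :
  cabs (\sum_(i <- r) F i) <= \sum_(i <- r) cabs (F i).
Proof.
elim: r => [|i r ih]; first by rewrite !big_nil cabs0.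
by rewrite !big_cons; apply: le_trans (cabsD _ _) _; rewrite lerD2l.
Qed.

Lemma cmeasurable_cst z : cmeasurable (cst z : X -> C).
Proof. by split; exact: measurable_cst. Qed.

Lemma cmeasurableD f g : cmeasurable f -> cmeasurable g ->
  cmeasurable (fun x => f x + g x).
Proof.
move=> [fr fi] [gr gi]; split.
  rewrite (_ : (fun _ => _) = (fun x => complex.Re (f x)) \+ (fun x => complex.Re (g x))).
    exact: measurable_funD.
  by apply/funext => x /=; case: (f x) (g x) => ? ? [].
rewrite (_ : (fun _ => _) = (fun x => complex.Im (f x)) \+ (fun x => complex.Im (g x))).
  exact: measurable_funD.
by apply/funext => x /=; case: (f x) (g x) => ? ? [].
Qed.

Lemma cmeasurableM f g : cmeasurable f -> cmeasurable g ->
  cmeasurable (fun x => f x * g x).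
Proof.
move=> [fr fi] [gr gi]; split.
  rewrite (_ : (fun _ => _) = (fun x => complex.Re (f x) * complex.Re (g x)) \-
     (fun x => complex.Im (f x) * complex.Im (g x))).
    by apply: measurable_funB; exact: measurable_funM.
  by apply/funext => x /=; case: (f x) (g x) => ? ? [].
rewrite (_ : (fun _ => _) = (fun x => complex.Re (f x) * complex.Im (g x)) \+
     (fun x => complex.Im (f x) * complex.Re (g x))).
  by apply: measurable_funD; exact: measurable_funM.
by apply/funext => x /=; case: (f x) (g x) => ? ? [].
Qed.

Lemma cmeasurableN f : cmeasurable f -> cmeasurable (fun x => - f x).
Proof.
move=> mf; rewrite (_ : (fun _ => _) = (fun x => (-1) * f x)); last first.
  by apply/funext => x; rewrite mulN1r.
by apply: cmeasurableM => //; exact: cmeasurable_cst.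
Qed.

Lemma cmeasurableB f g : cmeasurable f -> cmeasurable g ->
  cmeasurable (fun x => f x - g x).
Proof. by move=> mf mg; apply: cmeasurableD => //; exact: cmeasurableN. Qed.

Lemma cmeasurable_real (h : X -> R) : measurable_fun setT h ->
  cmeasurable (fun x => (h x)%:C%C).
Proof. by move=> mh; split => //=; exact: measurable_cst. Qed.

Definition crestr A f : X -> C := fun x => if x \in A then f x else 0.

Lemma crestrE A f x : crestr A f x = ((\1_A x : R)%:C)%C * f x.
Proof.
rewrite /crestr indicE; case: (x \in A).
  by rewrite (_ : (_ : R)%:C%C = 1) ?mul1r.
by rewrite (_ : (_ : R)%:C%C = 0) ?mul0r.
Qed.

Lemma cmeasurable_restr A f : measurable A -> cmeasurable f -> cmeasurable (crestr A f).
Proof.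
move=> mA mf; rewrite (_ : crestr A f = fun x => ((\1_A x : R)%:C)%C * f x).
  by apply: cmeasurableM => //; apply: cmeasurable_real; exact: measurable_indic.
by apply/funext => x; exact: crestrE.
Qed.

Lemma cabs_restr A f x : cabs (crestr A f x) = \1_A x * cabs (f x).
Proof. by rewrite crestrE cabsM cabs_real ger0_norm. Qed.

Lemma measurable_cabsE f : cmeasurable f ->
  measurable_fun setT (fun x => (cabs (f x))%:E).
Proof. by move=> mf; apply/measurable_EFinP; exact: measurable_cabs. Qed.

Definition cint A f := cmeasurable f /\ (\int[mu]_(x in A) (cabs (f x))%:E < +oo)%E.

Lemma cint_Re A f : measurable A -> cint A f ->
  mu.-integrable A (EFin \o (fun x => complex.Re (f x))).
Proof.
move=> mA [mf foo]; apply/integrableP; split.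
  by apply/measurable_EFinP; apply: measurable_funTS; case: mf.
apply: le_lt_trans foo; apply: le_int => // x _; rewrite /= lee_fin ?cabs_ge0//.
exact: Re_le_cabs.
Qed.

Lemma cint_Im A f : measurable A -> cint A f ->
  mu.-integrable A (EFin \o (fun x => complex.Im (f x))).
Proof.
move=> mA [mf foo]; apply/integrableP; split.
  by apply/measurable_EFinP; apply: measurable_funTS; case: mf.
apply: le_lt_trans foo; apply: le_int => // x _; rewrite /= lee_fin ?cabs_ge0//.
exact: Im_le_cabs.
Qed.

Lemma cintD A f g : measurable A -> cint A f -> cint A g ->
  cint A (fun x => f x + g x).
Proof.
move=> mA [mf fo] [mg go]; split; first exact: cmeasurableD.
apply: (@le_lt_trans _ _ (\int[mu]_(x in A) ((cabs (f x))%:E + (cabs (g x))%:E))%E).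
  apply: le_int => // x _; rewrite -?EFinD lee_fin ?addr_ge0 ?cabs_ge0//.
  exact: cabsD.
have cf0 x : (0 <= (cabs (f x))%:E)%E by rewrite lee_fin cabs_ge0.
have cg0 x : (0 <= (cabs (g x))%:E)%E by rewrite lee_fin cabs_ge0.
have mcf := measurable_cabsE mf; have mcg := measurable_cabsE mg.
by rewrite int_add//; exact: lte_add_pinfty.
Qed.

Lemma cint_cst A z : measurable A -> (mu A < +oo)%E -> cint A (fun=> z).
Proof.
move=> mA Aoo; split; first exact: cmeasurable_cst.
by rewrite integral_cst//; apply: lte_mul_pinfty; rewrite ?lee_fin ?cabs_ge0.
Qed.

Lemma cint_le A f g : cint A f -> cmeasurable g ->
  (forall x, A x -> cabs (g x) <= cabs (f x)) -> cint A g.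
Proof.
move=> [_ foo] mg gf; split => //; apply: le_lt_trans foo.
by apply: le_int => // x Ax; rewrite lee_fin ?cabs_ge0// gf.
Qed.

Lemma cintN A f : cint A f -> cint A (fun x => - f x).
Proof. by move=> cf; apply: (cint_le cf) => [|x _]; [apply: cmeasurableN; case: cf|rewrite cabsN]. Qed.

Lemma cintegralD A f g : measurable A -> cint A f -> cint A g ->
  cintegral A (fun x => f x + g x) = cintegral A f + cintegral A g.
Proof.
move=> mA cf cg; rewrite /cintegral; apply/eqP; rewrite eq_complex/=.
rewrite -RintegralD//; try exact: cint_Re.
rewrite -RintegralD//; try exact: cint_Im.
by apply/andP; split; apply/eqP; apply: eq_Rintegral => x _; case: (f x) (g x) => ? ? [].
Qed.

Lemma cintegral_cst A z : measurable A -> cintegral A (fun=> z) = (vol A)%:C%C * z.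
Proof.
move=> mA; rewrite /cintegral /vol !Rintegral_cst//.
by case: z => a b /=; apply/eqP; rewrite eq_complex/= !mul0r subr0 addr0 !(mulrC (fine _)) !eqxx.
Qed.

Lemma cintegralN A f : measurable A -> cint A f ->
  cintegral A (fun x => - f x) = - cintegral A f.
Proof.
move=> mA cf; apply/eqP; rewrite -addr_eq0 -cintegralD//; last exact: cintN.
under [X in cintegral _ X]eq_fun do rewrite addNr.
by rewrite cintegral_cst// mulr0.
Qed.

(** Real and imaginary parts are bounded separately, which costs the factor 2 that later constants
    carry. *)
Lemma cabs_cintegral_le A f : measurable A -> cint A f ->
  ((cabs (cintegral A f))%:E <= 2%:E * \int[mu]_(x in A) (cabs (f x))%:E)%E.
Proof.
move=> mA cf.
have Iint : (\int[mu]_(x in A) (cabs (f x))%:E)%E \is a fin_num.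
  rewrite ge0_fin_numE; first by case: cf.
  by apply: integral_ge0 => x _; rewrite lee_fin cabs_ge0.
have H (h : X -> R) : mu.-integrable A (EFin \o h) -> (forall x, `|h x| <= cabs (f x)) ->
    `|\int[mu]_(x in A) h x| <= fine (\int[mu]_(x in A) (cabs (f x))%:E).
  move=> ih hf; apply: le_trans (le_normr_Rintegral mA ih) _.
  apply: fine_le => //.
    rewrite ge0_fin_numE; last by apply: integral_ge0 => x _; rewrite lee_fin.
    by have /integrableP[_] := ih.
  by apply: le_int => // x _; rewrite lee_fin ?cabs_ge0.
rewrite -(fineK Iint) -EFinM lee_fin; apply: le_trans (cabs_le_ReIm _) _.
rewrite mulr_natl mulr2n lerD//=; apply: H; [exact: cint_Re| |exact: cint_Im|] => x.
  exact: Re_le_cabs.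
exact: Im_le_cabs.
Qed.

Lemma averageB A f z : measurable A -> cint A f -> (mu A < +oo)%E -> 0 < vol A ->
  average A (fun x => f x - z) = average A f - z.
Proof.
move=> mA cf Aoo vA; rewrite /average cintegralD//; last exact: cint_cst.
rewrite cintegral_cst// mulrDr; congr (_ + _); rewrite mulrA.
rewrite (_ : (_%:C * _%:C)%C = 1) ?mul1r//.
by rewrite -[LHS](rmorphM (real_complex R))/= mulVf ?gt_eqF.
Qed.

Lemma cabs_averageB A f z : measurable A -> cint A f -> (mu A < +oo)%E -> 0 < vol A ->
  ((cabs (average A f - z))%:E <=
   (2 / vol A)%:E * \int[mu]_(x in A) (cabs (f x - z))%:E)%E.
Proof.
move=> mA cf Aoo vA; rewrite -averageB// /average cabsM cabs_real.
rewrite gtr0_norm ?invr_gt0// EFinM mulrC EFinM -muleA.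
apply: lee_wpmul2l; first by rewrite lee_fin invr_ge0 ltW.
apply: cabs_cintegral_le => //; apply: cintD => //; exact: cint_cst.
Qed.

End complex_functions.

(** * The John-Nirenberg inequality *)

Section john_nirenberg.
Context {R : realType} {n : nat}.
Local Notation X := 'rV[R]_n.
Local Notation C := R[i].
Local Notation mu := (leb R n).

Definition cavg (s : R) (k : 'rV[int]_n) (u : X -> C) : C :=
  average (cube (corner s k) s) u.

(** The bound [M] on the BMO norm with the volume multiplied out; integrability on cubes is included
    so that the averages are meaningful. *)
Definition osc_le (M : R) (u : X -> C) := forall (a : X) (l : R), 0 < l ->
  cint (cube a l) u /\
  (\int[mu]_(x in cube a l) (cabs (u x - average (cube a l) u))%:E <= (M * l ^+ n)%:E)%E.

Lemma vol_cube (a : X) (l : R) : 0 <= l -> vol (cube a l) = l ^+ n.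
Proof. by move=> l0; rewrite /vol lebesgue_rV_cube. Qed.

Lemma osc_le_cmeasurable M u : osc_le M u -> cmeasurable u.
Proof. by move=> /(_ 0 1 ltr01)[[]]. Qed.

Lemma cube_fin (a : X) (l : R) : 0 <= l -> (mu (cube a l) < +oo)%E.
Proof. by move=> l0; rewrite measure_cube// ltry. Qed.

Lemma cabs_cavgB M s k u z : osc_le M u -> 0 < s ->
  ((cabs (cavg s k u - z))%:E <=
    (2 / s ^+ n)%:E * \int[mu]_(x in dcube s k) (cabs (u x - z))%:E)%E.
Proof.
move=> ou s0; have sn : 0 < s ^+ n by rewrite exprn_gt0.
have [cu _] := ou (corner s k) s s0.
rewrite -int_cube_dcube//; last 2 first.
- apply: measurable_cabsE; apply: cmeasurableB; first by case: cu.
  exact: cmeasurable_cst.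
- by move=> x; rewrite lee_fin cabs_ge0.
rewrite -(vol_cube (corner s k) (ltW s0)); apply: cabs_averageB => //.
- exact: measurable_cube.
- exact: cube_fin (ltW s0).
- by rewrite vol_cube// ltW.
Qed.

Lemma john_nirenberg : exists2 c : R, 0 < c &
  forall u, osc_le 1 u -> forall s k, 0 < s ->
  (\int[mu]_(x in dcube s k) (expR (c * cabs (u x - cavg s k u)))%:E <=
    (6 * s ^+ n)%:E)%E.
Proof.
have l32 : 0 < ln (3 / 2 : R) by rewrite ln_gt0//; lra.
(* At a stopping cube of level 2 the average moves by at most [2 * 2 ^ n * 2 = 2 ^ (n + 2)], so with
   this [c] one generation costs the factor [3 / 2]. The constant 6 closes the recursion: [3 / 2]
   from the good part plus [6 * (3 / 2) / 2] from stopping cubes that fill at most half. *)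
pose c : R := ln (3 / 2) / 2 ^+ n.+2.
have c0 : 0 < c by rewrite divr_gt0// exprn_gt0.
exists c => // u ou; have mu' := osc_le_cmeasurable ou.
have mcu z : measurable_fun setT (fun x => cabs (u x - z)).
  by apply: measurable_cabs; apply: cmeasurableB => //; exact: cmeasurable_cst.
have mcuE z : measurable_fun setT (fun x => (cabs (u x - z))%:E).
  exact/measurable_EFinP.
have c20 z x : (0 <= (cabs (u x - z))%:E)%E by rewrite lee_fin cabs_ge0.
have mexp z : measurable_fun setT (fun x => (expR (c * cabs (u x - z)))%:E).
  apply/measurable_EFinP; apply: measurableT_comp => //.
  by apply: measurable_funM.
have e0 z x : (0 <= (expR (c * cabs (u x - z)))%:E)%E by rewrite lee_fin expR_ge0.
move=> s k s0.
apply: (stopping_induction (P := fun s => 0 < s)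
  (Phi := fun s k x => (expR (c * cabs (u x - cavg s k u)))%:E)
  (beta := fun s k => (6 * s ^+ n)%:E)) => //.
- by move=> s' i; exact: side_gt0.
- by move=> s' k' s'0; rewrite lee_fin mulr_ge0// exprn_ge0// ltW.
move=> {s k s0} s k s0; set z := cavg s k u.
have sn : 0 < s ^+ n by rewrite exprn_gt0.
have osc : (\int[mu]_(x in dcube s k) (cabs (u x - z))%:E <= (s ^+ n)%:E)%E.
  rewrite -int_cube_dcube//; have [_] := ou (corner s k) s s0.
  by rewrite mul1r.
have osc2 : (\int[mu]_(x in dcube s k) (cabs (u x - z))%:E <= (2 * s ^+ n)%:E)%E.
  by apply: le_trans osc _; rewrite lee_fin; lra.
pose bad := cz_bad s k (fun x => (cabs (u x - z))%:E) 2.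
have bsub : bad_set s bad `<=` dcube s k by exact: cz_set_sub.
have mB : measurable (bad_set s bad) by exact: measurable_bad_set.
have mD : measurable (dcube s k : set X) by exact: measurable_dcube.
have muB : (mu (bad_set s bad) <= (2^-1 * s ^+ n)%:E)%E.
  rewrite EFinM lee_pdivlMl//; apply: le_trans (cz_set_measure _ _ _ _ _) _ => //.
  by apply: le_trans osc; apply: le_int.
exists bad; split => // Om mOm HOm.
have good : (\int[mu]_(x in dcube s k `\` bad_set s bad) (expR (c * cabs (u x - z)))%:E
    <= ((3 / 2) * s ^+ n)%:E)%E.
  apply: (@le_trans _ _ ((3 / 2)%:E * mu (dcube s k `\` bad_set s bad))%E).
    have h32 : 0 <= 3 / 2 :> R by lra.
    apply: int_le_cst => //.
    + exact: measurableD.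
    have G0 : mu ((dcube s k `\` bad_set s bad) `&`
        [set x | (2%:E < (cabs (u x - z))%:E)%E]) = 0%E by exact: cz_good_ae.
    apply: measure_sub0 G0 => //.
    + apply: measurableI; first exact: measurableD.
      by rewrite -[X in measurable X]setTI; exact: emeasurable_fun_o_infty.
    + apply: measurableI; first exact: measurableD.
      by rewrite -[X in measurable X]setTI; exact: emeasurable_fun_o_infty.
    move=> x [xd /=]; rewrite lte_fin => h; split => //=; rewrite lte_fin ltNge; apply/negP => h2.
    move: h; apply/negP; rewrite -leNgt -[leRHS]lnK ?posrE; last by lra.
    rewrite ler_expR /c mulrAC -mulrA ler_piMr ?(ltW l32)//.
    rewrite ler_pdivrMr ?exprn_gt0// mul1r; apply: le_trans h2 _.
    by rewrite exprS ler_peMr// exprn_ege1// ler1n.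
  rewrite [X in (_ <= X)%E]EFinM; apply: lee_wpmul2l => //.
  by rewrite -(measure_dcube k)//; apply: measure_mono => //; exact: measurableD.
have bd : (\int[mu]_(x in bad_set s bad `&` ~` Om) (expR (c * cabs (u x - z)))%:E
    <= (9 / 2 * s ^+ n)%:E)%E.
  apply: (@le_trans _ _ (\int[mu]_(x in bad_set s bad `&` setT) (cst 9%:E x))%E).
    apply: le_int_bad => //; first exact: measurableC.
    + by move=> x; rewrite lee_fin.
    move=> j d fb; rewrite setIT.
    have sj := side_gt0 j s0; have mdj : measurable (dcube (side s j) d : set X) by exact: measurable_dcube.
    set z' := cavg (side s j) d u.
    have zz : cabs (z' - z) <= 2 ^+ n.+2.
      rewrite -lee_fin; apply: le_trans (cabs_cavgB d z ou sj) _.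
      apply: (@le_trans _ _ ((2 / side s j ^+ n)%:E * (2 ^+ n * 2 * side s j ^+ n)%:E)%E).
        apply: lee_wpmul2l; first by rewrite lee_fin divr_ge0// exprn_ge0// ltW.
        by apply: cz_first_le fb.
      rewrite -EFinM lee_fin [_ * (_ * side s j ^+ n)]mulrC -mulrA mulrCA mulrA.
      apply: eq_leW.
      rewrite !exprS; field; by rewrite expf_neq0// gt_eqF.
    rewrite integral_cst// measure_dcube//.
    apply: (@le_trans _ _ ((3 / 2)%:E * (6 * side s j ^+ n)%:E)%E); last first.
      by rewrite -!EFinM lee_fin; lra.
    apply: (@le_trans _ _ ((3 / 2)%:E * \int[mu]_(x in dcube (side s j) d `\` Om)
        (expR (c * cabs (u x - z')))%:E)%E); last first.
      by apply: lee_wpmul2l; [rewrite lee_fin|exact: HOm].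
    rewrite -setDE -int_scale//; last exact: measurableD.
    apply: le_int => // x _; rewrite -?EFinM ?lee_fin ?mulr_ge0 ?expR_ge0//.
    rewrite -[X in _ <= X * _]lnK ?posrE; last by lra.
    rewrite -expRD ler_expR.
    have -> : ln (3 / 2) = c * 2 ^+ n.+2 by rewrite /c divfK// expf_neq0.
    rewrite -mulrDr ler_pM2l//.
    have -> : u x - z = (z' - z) + (u x - z') by rewrite [RHS]addrC addrA subrK.
    by apply: le_trans (cabsD _ _) _; rewrite lerD2r.
  rewrite setIT integral_cst//.
  apply: (@le_trans _ _ (9%:E * (2^-1 * s ^+ n)%:E)%E); first exact: lee_wpmul2l.
  by rewrite -EFinM lee_fin; lra.
rewrite (setD_setI _ bsub).
apply: le_trans (int_setU_le mu _ _ _ _) _ => //.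
- exact: measurableD.
- by apply: measurableI => //; exact: measurableC.
apply: le_trans (leeD good bd) _; rewrite -EFinD lee_fin; lra.
Qed.

(** Follows from [1 + x <= expR x] at [x = c * y / N], raised to the power [N]. *)
Lemma pow_le_exp (c y : R) (N : nat) : 0 < c -> 0 <= y -> (0 < N)%N ->
  y ^+ N <= (N%:R / c) ^+ N * expR (c * y).
Proof.
move=> c0 y0 N0; have N0' : 0 < N%:R :> R by rewrite ltr0n.
have -> : expR (c * y) = expR (c * y / N%:R) ^+ N.
  by rewrite -expRM_natr divfK ?gt_eqF.
rewrite -exprMn lerXn2r ?nnegrE ?mulr_ge0 ?invr_ge0 ?expR_ge0 ?(ltW c0)//.
apply: (@le_trans _ _ (N%:R / c * (c * y / N%:R))).
  have E (M : R) : 0 < M -> M / c * (c * y / M) = y.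
    by move=> M0; field; rewrite !gt_eqF.
  by rewrite E.
rewrite ler_pM2l ?divr_gt0//; apply: le_trans (expR_ge1Dx _).
by rewrite lerDr.
Qed.

(* The oscillation over a cube is measured with the average over that cube, but
   the integral is over the tripled cube. *)
Lemma john_nirenberg_moment (N : nat) : (0 < N)%N -> exists2 K : R, 0 <= K &
  forall u, osc_le 1 u -> forall s k, 0 < s ->
  (\int[mu]_(x in triple s k) (cabs (u x - cavg s k u) ^+ N)%:E <=
    (K * s ^+ n)%:E)%E.
Proof.
move=> N0; have [c c0 JN] := john_nirenberg.
pose K0 := (N%:R / c) ^+ N * 6.
have K00 : 0 <= K0 by rewrite mulr_ge0// exprn_ge0// divr_ge0// ltW.
exists (3 ^+ n * (2 ^+ N * (K0 + (2 * 2 * 3 ^+ n) ^+ N))) => [|u ou s k s0].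
  apply: mulr_ge0; [exact: exprn_ge0|apply: mulr_ge0; [exact: exprn_ge0|]].
  by apply: addr_ge0 => //; apply: exprn_ge0; apply: mulr_ge0 => //; exact: exprn_ge0.
have sn : 0 < s ^+ n by rewrite exprn_gt0.
have mu' := osc_le_cmeasurable ou.
have mcu z : measurable_fun setT (fun x => cabs (u x - z)).
  by apply: measurable_cabs; apply: cmeasurableB => //; exact: cmeasurable_cst.
have mpow z : measurable_fun setT (fun x => (cabs (u x - z) ^+ N)%:E).
  by apply/measurable_EFinP; exact: measurable_funX.
have p0 z x : (0 <= (cabs (u x - z) ^+ N)%:E)%E by rewrite lee_fin exprn_ge0// cabs_ge0.
set z := cavg s k u.
pose b := corner s k - const_mx s; pose Z := average (cube b (3 * s)) u.
have s3 : 0 < 3 * s by rewrite mulr_gt0.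
(* The averages over neighbouring cells are all compared with the average [Z] over the closed cube
   of side [3 * s] that contains them. *)
have near (d : 'rV[int]_n) : (forall i, adjacent (d ord0 i) (k ord0 i)) -> cabs (cavg s d u - Z) <= 2 * 3 ^+ n.
  move=> ad; rewrite -lee_fin; apply: le_trans (cabs_cavgB d Z ou s0) _.
  apply: (@le_trans _ _ ((2 / s ^+ n)%:E * (1 * (3 * s) ^+ n)%:E)%E).
    apply: lee_wpmul2l; first by rewrite lee_fin divr_ge0// ltW.
    have [_] := ou b _ s3; apply: le_trans; apply: le_int.
    - move=> x dx; apply: (triple_sub_cube (k := k) s0) => i.
      by rewrite (_ : idx s x = d)//; exact: ad.
    - by move=> x _; rewrite lee_fin cabs_ge0.
    - by move=> x _; rewrite lee_fin cabs_ge0.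
    - by [].
  rewrite -EFinM lee_fin mul1r exprMn; apply: eq_leW; field.
  by rewrite expf_neq0// gt_eqF.
have kk i : adjacent (k ord0 i) (k ord0 i) by rewrite /adjacent lerDl.
have mT : measurable (triple s k : set X) by exact: measurable_triple.
have D0 : 0 <= 2 ^+ N * (K0 + (2 * 2 * 3 ^+ n) ^+ N).
  by rewrite mulr_ge0 ?exprn_ge0// addr_ge0// exprn_ge0// mulr_ge0// exprn_ge0.
apply: (@le_trans _ _ ((2 ^+ N * (K0 + (2 * 2 * 3 ^+ n) ^+ N))%:E * mu (triple s k))%E); last first.
  apply: (@le_trans _ _ ((2 ^+ N * (K0 + (2 * 2 * 3 ^+ n) ^+ N))%:E * ((3 * s) ^+ n)%:E)%E).
    by apply: lee_wpmul2l; [rewrite lee_fin|exact: measure_triple_le].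
  rewrite -EFinM lee_fin; move: (2 ^+ N * (K0 + _)) => D.
  by rewrite exprMn mulrCA mulrA.
rewrite -integral_cst// triple_bigcup; apply: le_int_bigcup => //= [d _|d d' _ _ [x [<- <-//]]|d Pd].
  exact: measurable_dcube.
have mD : measurable (dcube s d : set X) by exact: measurable_dcube.
rewrite !setIT integral_cst// measure_dcube//.
have zz : cabs (cavg s d u - z) <= 2 * 2 * 3 ^+ n.
  have -> : cavg s d u - z = (cavg s d u - Z) - (z - Z) by rewrite opprB addrA subrK.
  apply: le_trans (cabsD _ _) _; rewrite cabsN.
  have := near d Pd; have := near k kk; rewrite -/z; lra.
have pw x : cabs (u x - z) ^+ N <= 2 ^+ N * (cabs (u x - cavg s d u) ^+ N + (2 * 2 * 3 ^+ n) ^+ N).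
  set a := cabs (u x - cavg s d u); set e := 2 * 2 * 3 ^+ n in zz *.
  have a0 : 0 <= a by exact: cabs_ge0.
  have e0 : 0 <= e by rewrite mulr_ge0// exprn_ge0.
  have h : cabs (u x - z) <= a + e.
    have -> : u x - z = (u x - cavg s d u) + (cavg s d u - z) by rewrite addrA subrK.
    by apply: le_trans (cabsD _ _) _; rewrite lerD2l.
  have cz := cabs_ge0 (u x - z).
  have aN := exprn_ge0 N a0; have eN := exprn_ge0 N e0.
  apply: (@le_trans _ _ ((2 * Num.max a e) ^+ N)).
    rewrite lerXn2r ?nnegrE ?mulr_ge0 ?le_max ?a0//; apply: le_trans h _.
    rewrite mulr_natl mulr2n lerD// le_max lexx ?orbT//.
  by rewrite exprMn ler_pM2l ?exprn_gt0//; rewrite /Num.max; case: ifP => _; [rewrite lerDr|rewrite lerDl].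
have cN0 : 0 <= (N%:R / c) ^+ N by rewrite exprn_ge0// divr_ge0// ltW.
have eN0 : 0 <= (2 * 2 * 3 ^+ n) ^+ N :> R by rewrite exprn_ge0// mulr_ge0// exprn_ge0.
have mexp : measurable_fun setT (fun x => (expR (c * cabs (u x - cavg s d u)))%:E).
  apply/measurable_EFinP; apply: measurableT_comp => //.
  by apply: measurable_funM.
have ee x : (0 <= (expR (c * cabs (u x - cavg s d u)))%:E)%E by rewrite lee_fin expR_ge0.
have mce : measurable_fun setT (fun x => ((N%:R / c) ^+ N)%:E * (expR (c * cabs (u x - cavg s d u)))%:E)%E.
  by apply: emeasurable_funM.
have cee x : (0 <= ((N%:R / c) ^+ N)%:E * (expR (c * cabs (u x - cavg s d u)))%:E)%E.
  by rewrite mule_ge0.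
have g0 x : (0 <= (2 ^+ N)%:E * ((((N%:R / c) ^+ N)%:E * (expR (c * cabs (u x - cavg s d u)))%:E) +
    (cst ((2 * 2 * 3 ^+ n) ^+ N)%:E x)))%E.
  by apply: mule_ge0; [rewrite lee_fin exprn_ge0|apply: adde_ge0].
apply: (@le_trans _ _ (\int[mu]_(x in dcube s d) ((2 ^+ N)%:E *
   ((((N%:R / c) ^+ N)%:E * (expR (c * cabs (u x - cavg s d u)))%:E) + (cst ((2 * 2 * 3 ^+ n) ^+ N)%:E x))))%E).
  apply: le_int => // x _.
  have : cabs (u x - z) ^+ N <= 2 ^+ N * ((N%:R / c) ^+ N *
      expR (c * cabs (u x - cavg s d u)) + (2 * 2 * 3 ^+ n) ^+ N).
    apply: le_trans (pw x) _.
    by rewrite ler_pM2l ?exprn_gt0// lerD2r pow_le_exp// cabs_ge0.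
  by rewrite -lee_fin EFinM EFinD EFinM.
rewrite int_scale ?exprn_ge0//; last 2 first.
- exact: emeasurable_funD.
- by move=> x; rewrite adde_ge0.
rewrite int_add// int_scale// integral_cst// measure_dcube//.
apply: (@le_trans _ _ ((2 ^+ N)%:E * ((K0 + (2 * 2 * 3 ^+ n) ^+ N) * s ^+ n)%:E)%E); last first.
  by rewrite -EFinM lee_fin mulrA.
apply: lee_wpmul2l; first by rewrite lee_fin exprn_ge0.
rewrite [X in (_ <= X%:E)%E]mulrDl [X in (_ <= X)%E]EFinD [X in (_ <= _ + X)%E]EFinM leeD2r//.
apply: (@le_trans _ _ (((N%:R / c) ^+ N)%:E * (6 * s ^+ n)%:E)%E); last first.
  by rewrite -EFinM lee_fin /K0 mulrA.
by apply: lee_wpmul2l; [rewrite lee_fin|exact: JN].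
Qed.

End john_nirenberg.

Section more_integral.
Context d (T : measurableType d) (R : realType) (mu : {measure set T -> \bar R}).

Lemma int_exhaust A (f : T -> \bar R) (G : (set T)^nat) (b : \bar R) :
  nondecreasing_seq G -> (forall k, measurable (G k)) -> A `<=` \bigcup_k G k ->
  measurable_fun setT f -> (forall x, 0 <= f x)%E ->
  (forall k, \int[mu]_(x in G k) f x <= b)%E ->
  (\int[mu]_(x in A) f x <= b)%E.
Proof.
move=> ndG mG AG mf f0 Gb.
apply: (@le_trans _ _ (\int[mu]_(x in \bigcup_k G k) f x)%E); first exact: le_int.
have := @ge0_nondecreasing_set_cvg_integral _ _ _ G f mu ndG mG
  (fun i => measurable_funS measurableT (@subsetT _ _) mf) (fun _ x _ => f0 x).
move=> /cvg_lim <-//; apply: lime_le; last exact: nearW.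
apply: ereal_nondecreasing_is_cvgn => i j ij; apply: le_int => //.
exact/subsetPset/ndG.
Qed.

Lemma ae_measure_le A B : measurable A -> measurable B ->
  {ae mu, forall x, A x -> B x} -> (mu A <= mu B)%E.
Proof.
move=> mA mB [N [mN N0 sN]].
apply: (@le_trans _ _ (mu (B `|` N))); last first.
  by apply: le_trans (measure_setU_le _ mB mN) _; rewrite -[leRHS]adde0 leeD2l// N0.
apply: measure_mono => //; first exact: measurableU.
move=> x Ax; have [|Bx] := pselect (B x); first by left.
by right; apply: sN => /= h; apply: Bx; exact: h.
Qed.

Lemma measurable_powRE (f : T -> R) t : measurable_fun setT f ->
  measurable_fun setT (fun x => (f x `^ t)%:E).
Proof.
by move=> mf; apply/measurable_EFinP; exact: (measurableT_comp (measurable_powR t)).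
Qed.

Lemma ae_le_int A (f g : T -> \bar R) : measurable A ->
  measurable_fun setT f -> measurable_fun setT g ->
  (forall x, 0 <= f x)%E -> (forall x, 0 <= g x)%E ->
  {ae mu, forall x, A x -> f x <= g x}%E ->
  (\int[mu]_(x in A) f x <= \int[mu]_(x in A) g x)%E.
Proof.
by move=> mA mf mg f0 g0 fg; apply: ae_ge0_le_integral => //; exact: measurable_funTS.
Qed.

Lemma ae_eq_int A (f g : T -> \bar R) : measurable A ->
  measurable_fun setT f -> measurable_fun setT g ->
  (forall x, 0 <= f x)%E -> (forall x, 0 <= g x)%E ->
  {ae mu, forall x, A x -> f x = g x}%E ->
  (\int[mu]_(x in A) f x = \int[mu]_(x in A) g x)%E.
Proof.
move=> mA mf mg f0 g0 fg; apply/eqP; rewrite eq_le; apply/andP; split;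
  apply: ae_le_int => //; apply: filterS fg => x h Ax; by rewrite h.
Qed.

End more_integral.

Lemma le_powR2r {R : realType} (t x y : R) : 0 <= t -> 0 <= x -> x <= y -> x `^ t <= y `^ t.
Proof.
by move=> t0 x0 xy; apply: ge0_ler_powR => //; rewrite nnegrE// (le_trans x0).
Qed.

Lemma le_poweR2r {R : realType} (t : R) (x y : \bar R) : 0 <= t -> (0 <= x)%E ->
  (x <= y)%E -> (x `^ t <= y `^ t)%E.
Proof.
move=> t0 x0 xy; apply: gt0_ler_poweR => //; rewrite in_itv/= leey andbT//.
exact: le_trans xy.
Qed.

Lemma powRVK {R : realType} (t x : R) : t != 0 -> 0 <= x -> (x `^ t) `^ t^-1 = x.
Proof. by move=> t0 x0; rewrite -powRrM mulfV// powRr1. Qed.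

Lemma powRKV {R : realType} (t x : R) : t != 0 -> 0 <= x -> (x `^ t^-1) `^ t = x.
Proof. by move=> t0 x0; rewrite -powRrM mulVf// powRr1. Qed.

(** The two bounds share the factor in [z], whose elimination compares [x] with [y]. It is applied
    with [x] and [y] the masses of a cube and of a subset, and [z] the dual mass of the cube. *)
Lemma powR_compare {R : realType} (a b x y z A th L t : R) : 0 < a -> 0 < th -> 0 < L ->
  0 < A -> 0 <= x -> 0 <= y -> 0 <= z ->
  (th * L) `^ t <= y `^ a * z `^ b -> x `^ a * z `^ b <= A * L `^ t ->
  x <= (A / th `^ t) `^ a^-1 * y.
Proof.
move=> a0 th0 L0 A0 x0 y0 z0 H1 H2.
have th1 : 0 < th `^ t by rewrite powR_gt0.
have L1 : 0 < L `^ t by rewrite powR_gt0.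
have Ath : 0 <= A / th `^ t by rewrite divr_ge0 ?ltW.
rewrite -(@powRVK _ a x)// ?gt_eqF// -[X in _ * X](@powRVK _ a)// ?gt_eqF//.
rewrite -powRM ?powR_ge0//; apply: le_powR2r; rewrite ?invr_ge0 ?powR_ge0 ?(ltW a0)//.
rewrite mulrAC ler_pdivlMr//.
suff : x `^ a * th `^ t * L `^ t <= A * y `^ a * L `^ t by rewrite ler_pM2r.
rewrite -mulrA -powRM ?(ltW th0) ?(ltW L0)//.
apply: le_trans (ler_wpM2l (powR_ge0 _ _) H1) _.
have := ler_wpM2l (powR_ge0 y a) H2.
have -> : y `^ a * (x `^ a * z `^ b) = x `^ a * (y `^ a * z `^ b) by ring.
by have -> : y `^ a * (A * L `^ t) = A * y `^ a * L `^ t by ring.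
Qed.

(** * Weights: dual pairs, the A-infinity property, reverse Hoelder *)

Section dual_pairs.
Context {R : realType} {n : nat}.
Local Notation X := 'rV[R]_n.
Local Notation mu := (leb R n).

(* With v = w^q, u = w^-p', a = 1/q, b = 1/p' this is the condition A_{p,q}; it is
   symmetric under exchange of (v, a) and (u, b). *)
Record dual_pair (a b A : R) (v u : X -> R) : Prop := DualPair {
  dp_a : 0 < a; dp_b : 0 < b;
  dp_mv : measurable_fun setT v; dp_mu : measurable_fun setT u;
  dp_v0 : forall x, 0 <= v x; dp_u0 : forall x, 0 <= u x;
  dp_ae : {ae mu, forall x, v x `^ a * u x `^ b = 1};
  dp_cube : forall c l, 0 < l ->
    ((\int[mu]_(x in cube c l) (v x)%:E) `^ a *
     (\int[mu]_(x in cube c l) (u x)%:E) `^ b <= (A * (l ^+ n) `^ (a + b))%:E)%E }.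

Lemma dual_pairC a b A v u : dual_pair a b A v u -> dual_pair b a A u v.
Proof.
move=> [a0 b0 mv mu' v0 u0 ae cu]; split => //.
  by apply: filterS ae => x; rewrite mulrC.
by move=> c l l0; rewrite muleC [b + a]addrC; exact: cu.
Qed.

Definition wt (v : X -> R) (E : set X) : R := fine (\int[mu]_(x in E) (v x)%:E)%E.

Variables (a b A : R) (v u : X -> R) (D : dual_pair a b A v u).

Let a0 := dp_a D.
Let b0 := dp_b D.
Let mv := dp_mv D.
Let mu' := dp_mu D.
Let v0 := dp_v0 D.
Let u0 := dp_u0 D.

(** Hoelder with exponents [a / (a + b)] and [b / (a + b)] applied to [v] and [u]: the integrand is
    1 almost everywhere. This is the converse of the defining bound, on arbitrary sets of finite
    measure and not only on cubes. *)
Lemma dp_holder E : measurable E -> (mu E < +oo)%E ->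
  (mu E `^ (a + b) <= (\int[mu]_(x in E) (v x)%:E) `^ a *
     (\int[mu]_(x in E) (u x)%:E) `^ b)%E.
Proof.
move=> mE Eoo.
have ab : 0 < a + b by rewrite addr_gt0.
have := hoelder_int mu mE mv mu' v0 u0 (divr_gt0 a0 ab) (divr_gt0 b0 ab).
rewrite -mulrDl mulfV ?gt_eqF// => /(_ erefl).
have -> : (\int[mu]_(x in E) (v x `^ (a / (a + b)) * u x `^ (b / (a + b)))%:E = mu E)%E.
  rewrite -integral_1//; apply: ae_eq_int => //.
  - apply/measurable_EFinP; apply: measurable_funM;
      by apply: (measurableT_comp (measurable_powR _)).
  - by move=> x; rewrite lee_fin mulr_ge0 ?powR_ge0.
  apply: filterS (dp_ae D) => x h _.
  by rewrite 2!powRrM -powRM ?powR_ge0// h powR1.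
have I0 (h : X -> R) : (forall x, 0 <= h x) -> (0 <= \int[mu]_(x in E) (h x)%:E)%E.
  by move=> h0; apply: integral_ge0 => x _; rewrite lee_fin.
move=> /(@le_poweR2r _ (a + b)) -/(_ (ltW ab) (measure_ge0 _ _)) /le_trans; apply.
by rewrite poweRM ?poweR_ge0// -!poweRrM !divfK// gt_eqF.
Qed.

Lemma dp_pos c l E : measurable E -> (0 < mu E)%E -> E `<=` cube c l -> 0 < l ->
  (0 < \int[mu]_(x in E) (v x)%:E)%E.
Proof.
move=> mE E0 Ec l0.
have Eoo : (mu E < +oo)%E.
  apply: (@le_lt_trans _ _ (mu (cube c l))).
    by apply: measure_mono => //; exact: measurable_cube.
  by rewrite measure_cube ?ltW// ltry.
rewrite lt_neqAle integral_ge0 ?andbT; last by move=> x _; rewrite lee_fin.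
apply/eqP => I0; have := dp_holder mE Eoo.
rewrite -I0 poweR0r ?gt_eqF// mul0e => h.
have := poweR_gt0 (a + b) E0; rewrite lt_neqAle => /andP[/eqP + _]; apply.
by apply/eqP; rewrite eq_le h poweR_ge0.
Qed.

End dual_pairs.

Section dual_pair_theory.
Context {R : realType} {n : nat}.
Local Notation X := 'rV[R]_n.
Local Notation mu := (leb R n).
Variables (a b A : R) (v u : X -> R) (D : dual_pair a b A v u).

Let a0 := dp_a D.
Let b0 := dp_b D.
Let mv := dp_mv D.
Let v0 := dp_v0 D.
Let D' := dual_pairC D.

Let vE0 x : (0 <= (v x)%:E)%E. Proof. by rewrite lee_fin. Qed.

(** An infinite mass of [v] on a cube would contradict the defining bound, the mass of [u] there
    being positive. *)
Lemma dp_fin c l E : measurable E -> E `<=` cube c l -> 0 < l ->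
  (\int[mu]_(x in E) (v x)%:E < +oo)%E.
Proof.
move=> mE Ec l0.
apply: (@le_lt_trans _ _ (\int[mu]_(x in cube c l) (v x)%:E)%E); first exact: le_int.
have mc := @measurable_cube R n c l.
have pc : (0 < mu (cube c l))%E by rewrite measure_cube ?ltW// lte_fin exprn_gt0.
rewrite ltNge leye_eq; apply/negP => /eqP voo.
have := dp_cube D c l0; rewrite voo poweRyr ?gt_eqF// gt0_mulye ?leNgt ?ltry//.
by apply: poweR_gt0; exact: (dp_pos D' mc pc (@subset_refl _ _) l0).
Qed.

Lemma wt_ge0 E : 0 <= wt v E.
Proof. by rewrite fine_ge0// integral_ge0. Qed.

Lemma wtE c l E : measurable E -> E `<=` cube c l -> 0 < l ->
  (\int[mu]_(x in E) (v x)%:E)%E = (wt v E)%:E.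
Proof.
move=> mE Ec l0; rewrite fineK// ge0_fin_numE ?integral_ge0//.
exact: dp_fin Ec l0.
Qed.

Lemma wt_gt0 c l : 0 < l -> 0 < wt v (cube c l).
Proof.
move=> l0; have mc := @measurable_cube R n c l.
rewrite -lte_fin -(wtE mc (@subset_refl _ _) l0).
apply: (dp_pos D mc _ (@subset_refl _ _) l0).
by rewrite measure_cube ?ltW// lte_fin exprn_gt0.
Qed.

Lemma wt_mono c l E F : measurable E -> measurable F -> E `<=` F -> F `<=` cube c l ->
  0 < l -> wt v E <= wt v F.
Proof.
move=> mE mF EF Fc l0; rewrite -lee_fin -(wtE mE (subset_trans EF Fc) l0) -(wtE mF Fc l0).
exact: le_int.
Qed.

End dual_pair_theory.

Section dual_pair_theory2.
Context {R : realType} {n : nat}.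
Local Notation X := 'rV[R]_n.
Local Notation mu := (leb R n).
Variables (a b A : R) (v u : X -> R) (D : dual_pair a b A v u).

Let a0 := dp_a D.
Let b0 := dp_b D.
Let mv := dp_mv D.
Let v0 := dp_v0 D.
Let D' := dual_pairC D.

Let vE0 x : (0 <= (v x)%:E)%E. Proof. by rewrite lee_fin. Qed.

Lemma wt_cube c l : 0 < l ->
  wt v (cube c l) `^ a * wt u (cube c l) `^ b <= A * (l ^+ n) `^ (a + b).
Proof.
move=> l0; have mc := @measurable_cube R n c l; have sc := @subset_refl _ (cube c l).
have := dp_cube D c l0.
by rewrite (wtE D mc sc l0) (wtE D' mc sc l0) !poweR_EFin -EFinM lee_fin.
Qed.

Lemma dp_A_gt0 : 0 < A.
Proof.
have := @wt_cube 0 1 ltr01; rewrite expr1n powR1 mulr1; apply: lt_le_trans.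
by rewrite mulr_gt0// powR_gt0//; [exact: (wt_gt0 D)|exact: (wt_gt0 D')].
Qed.

(** The A-infinity property: [dp_holder] on [E] bounds a product of masses from below, the defining
    bound on the cube bounds it from above, and comparing the two controls the cube by [E]. *)
Lemma wt_large (th : R) : 0 < th -> exists2 C : R, 1 < C & forall c l E, 0 < l ->
  measurable E -> E `<=` cube c l -> ((th * l ^+ n)%:E <= mu E)%E ->
  wt v (cube c l) <= C * wt v E.
Proof.
move=> th0; pose C0 := (A / th `^ (a + b)) `^ a^-1.
exists (1 + `|C0|) => [|c l E l0 mE Ec El].
  rewrite ltrDl normr_gt0 gt_eqF// powR_gt0// divr_gt0 ?powR_gt0//; exact: dp_A_gt0.
have ab : 0 < a + b by rewrite addr_gt0.
have mc := @measurable_cube R n c l; have sc := @subset_refl _ (cube c l).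
have ln0 : 0 < l ^+ n by rewrite exprn_gt0.
have Eoo : (mu E < +oo)%E.
  apply: (@le_lt_trans _ _ (mu (cube c l))); first exact: measure_mono.
  by rewrite measure_cube ?ltW// ltry.
have H1 : (th * l ^+ n) `^ (a + b) <= wt v E `^ a * wt u (cube c l) `^ b.
  rewrite -lee_fin; apply: (@le_trans _ _ (mu E `^ (a + b))%E).
    rewrite -poweR_EFin; apply: le_poweR2r => //; first exact: ltW.
    by rewrite lee_fin mulr_ge0// ltW.
  apply: le_trans (dp_holder D mE Eoo) _.
  rewrite (wtE D mE Ec l0) (wtE D' mE Ec l0) !poweR_EFin -EFinM lee_fin.
  apply: ler_wpM2l; first exact: powR_ge0.
  apply: le_powR2r; [exact: ltW|exact: (wt_ge0 D' _)|].
  exact: (wt_mono D' mE mc Ec sc l0).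
apply: le_trans (powR_compare a0 th0 ln0 dp_A_gt0 (wt_ge0 D _) (wt_ge0 D E)
  (wt_ge0 D' _) H1 (wt_cube c l0)) _.
rewrite ler_wpM2r//; first exact: (wt_ge0 D E).
by apply: le_trans (ler_norm _) _; rewrite lerDr.
Qed.

End dual_pair_theory2.

Section dual_pair_theory3.
Context {R : realType} {n : nat}.
Local Notation X := 'rV[R]_n.
Local Notation mu := (leb R n).
Variables (a b A : R) (v u : X -> R) (D : dual_pair a b A v u).

Let a0 := dp_a D.
Let b0 := dp_b D.
Let mv := dp_mv D.
Let v0 := dp_v0 D.
Let D' := dual_pairC D.

Let vE0 x : (0 <= (v x)%:E)%E. Proof. by rewrite lee_fin. Qed.

Lemma wt_dcube s k E : 0 < s -> measurable E -> E `<=` dcube s k ->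
  (\int[mu]_(x in E) (v x)%:E)%E = (wt v E)%:E.
Proof.
move=> s0 mE Es; apply: (wtE D mE _ s0).
exact: (subset_trans Es (@dcube_sub_cube _ _ _ _ s0)).
Qed.

Lemma wt_dcubeE s k : 0 < s -> wt v (dcube s k) = wt v (cube (corner s k) s).
Proof.
move=> s0; rewrite /wt int_cube_dcube//.
by apply/measurable_EFinP; exact: mv.
Qed.

Lemma wt_dcube_gt0 s k : 0 < s -> 0 < wt v (dcube s k).
Proof. by move=> s0; rewrite wt_dcubeE//; exact: (wt_gt0 D). Qed.

(** Stopping at twice the average of [v] selects at most half of the cube by volume, hence by
    [wt_large] at most the fraction [1 - c^-1] of its mass. Averages grow by at most [2 ^ (n + 1)]
    per generation, so for a small exponent [e] this growth is absorbed by the loss of mass. *)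
Lemma reverse_hoelder : exists2 e : R, 0 < e & exists2 C : R, 0 <= C & forall s k, 0 < s ->
  (\int[mu]_(x in dcube s k) (v x `^ (1 + e))%:E <=
    (C * (wt v (dcube s k) / s ^+ n) `^ e * wt v (dcube s k))%:E)%E.
Proof.
have h2 : 0 < 2^-1 :> R by rewrite invr_gt0.
have [c c1 Hc] := wt_large D h2.
have c0 : 0 < c by exact: lt_trans c1.
have ci1 : c^-1 < 1 by rewrite invf_lt1.
have ci0 : 0 < c^-1 by rewrite invr_gt0.
(* The exponent [e] will satisfy [G ^ e = r], so that one generation multiplies the bound by
   [r * (1 - c^-1) = 1 - c^-1 / 2], still below 1; then [C = 2 ^ e * (2 * c)] solves
   [2 ^ e + C (1 - c^-1 / 2) = C]. *)
pose r := (1 - c^-1 / 2) / (1 - c^-1).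
have r1 : 1 < r by rewrite /r ltr_pdivlMr; lra.
pose G : R := 2 ^+ n.+1.
have G1 : 1 < G by rewrite exprn_egt1// ltr1n.
pose e := ln r / ln G.
have lG : 0 < ln G by rewrite ln_gt0.
have e0 : 0 < e by rewrite divr_gt0// ln_gt0.
have Ge : G `^ e = r.
  rewrite /powR gt_eqF ?(lt_trans _ G1)// /e divfK ?gt_eqF// lnK// posrE.
  exact: lt_trans r1.
pose C := 2 `^ e * (2 * c).
have C0 : 0 <= C by rewrite mulr_ge0 ?powR_ge0// mulr_ge0// ltW.
exists e => //; exists C => //.
have mvE : measurable_fun setT (fun x => (v x)%:E) by apply/measurable_EFinP; exact: mv.
have mvp : measurable_fun setT (fun x => (v x `^ (1 + e))%:E) by apply: measurable_powRE; exact: mv.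
have vp0 x : (0 <= (v x `^ (1 + e))%:E)%E by rewrite lee_fin powR_ge0.
have vpE x : v x `^ (1 + e) = v x `^ e * v x.
  by rewrite powRD ?powRr1// 1?mulrC// gt_eqF// addr_gt0.
have we0 s k : 0 < s -> 0 <= wt v (dcube s k) / s ^+ n.
  by move=> s0; apply: divr_ge0; [exact: (wt_ge0 D)|rewrite exprn_ge0// ltW].
apply: (stopping_induction (P := fun s => 0 < s)
  (Phi := fun s k x => (v x `^ (1 + e))%:E)
  (beta := fun s k => (C * (wt v (dcube s k) / s ^+ n) `^ e * wt v (dcube s k))%:E)) => //.
- by move=> s' i; exact: side_gt0.
- move=> s' k' s'0; rewrite lee_fin; apply: mulr_ge0; last exact: (wt_ge0 D).
  by apply: mulr_ge0 => //; exact: powR_ge0.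
move=> s k s0; set V := wt v (dcube s k); set m := V / s ^+ n.
have V0 : 0 < V by exact: wt_dcube_gt0.
have sn : 0 < s ^+ n by rewrite exprn_gt0.
have m0 : 0 < m by rewrite divr_gt0.
have lam0 : 0 < 2 * m by rewrite mulr_gt0.
have mD : measurable (dcube s k : set X) by exact: measurable_dcube.
have VE : (\int[mu]_(x in dcube s k) (v x)%:E)%E = V%:E by exact: (wt_dcube (k := k) s0).
have osc : (\int[mu]_(x in dcube s k) (v x)%:E <= (2 * m * s ^+ n)%:E)%E.
  by rewrite VE lee_fin /m -mulrA divfK ?gt_eqF//; lra.
pose bad := cz_bad s k (fun x => (v x)%:E) (2 * m).
have bsub : bad_set s bad `<=` dcube s k by exact: cz_set_sub.
have mB : measurable (bad_set s bad) by exact: measurable_bad_set.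
have wB : (\int[mu]_(x in bad_set s bad) (v x)%:E)%E = (wt v (bad_set s bad))%:E.
  exact: (wt_dcube (k := k) s0).
have muB : (mu (bad_set s bad) <= (2^-1 * s ^+ n)%:E)%E.
  have h : ((2 * m)%:E * mu (bad_set s bad) <= V%:E)%E.
    apply: le_trans (cz_set_measure s0 k mvE vE0 _) _ => //.
    by rewrite -VE; apply: le_int.
  rewrite -(@lee_pmul2l _ (2 * m)%:E)// ?fin_numE// ?lte_fin//.
  apply: le_trans h _; rewrite -EFinM lee_fin /m.
  apply: eq_leW; field; by rewrite gt_eqF.
have mE : measurable (dcube s k `\` bad_set s bad) by exact: measurableD.
have sub : dcube s k `\` bad_set s bad `<=` dcube s k by move=> x [].
have wE : wt v (bad_set s bad) <= (1 - c^-1) * V.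
  have : wt v (cube (corner s k) s) <= c * wt v (dcube s k `\` bad_set s bad).
    apply: Hc => //.
      exact: (subset_trans sub (@dcube_sub_cube _ _ _ _ s0)).
    rewrite measure_setD//; last by rewrite measure_dcube// ltry.
    rewrite (setIidr bsub) measure_dcube// leeBrDr; last first.
      by rewrite ge0_fin_numE// (le_lt_trans muB)// ltry.
    apply: le_trans (leeD2l _ muB) _; rewrite -EFinD lee_fin; lra.
  rewrite -wt_dcubeE// -/V -ler_pdivrMl// => h.
  have : V = wt v (bad_set s bad) + wt v (dcube s k `\` bad_set s bad).
    apply: EFin_inj; rewrite -VE EFinD -wB -(wt_dcube s0 mE sub).
    rewrite -{1}(setDUK bsub) ge0_integral_setU//.
    - by apply: measurable_funTS.
    - by rewrite disj_set2E setDE setICA setICr setI0.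
  by move: h; rewrite mulrBl mul1r; lra.
exists bad; split => // Om mOm HOm.
have good : (\int[mu]_(x in dcube s k `\` bad_set s bad) (v x `^ (1 + e))%:E
    <= ((2 * m) `^ e * V)%:E)%E.
  rewrite EFinM -VE -int_scale ?powR_ge0//.
  apply: (@le_trans _ _ (\int[mu]_(x in dcube s k `\` bad_set s bad)
     (((2 * m) `^ e)%:E * (v x)%:E))%E); last first.
    by apply: le_int => // x _; rewrite mule_ge0// lee_fin powR_ge0.
  apply: ae_le_int => //.
  - exact: emeasurable_funM.
  - by move=> x; rewrite mule_ge0// lee_fin powR_ge0.
  have G0 : mu ((dcube s k `\` bad_set s bad) `&`
      [set x | ((2 * m)%:E < (v x)%:E)%E]) = 0%E by exact: cz_good_ae.
  exists ((dcube s k `\` bad_set s bad) `&` [set x | ((2 * m)%:E < (v x)%:E)%E]); split => //.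
    apply: measurableI => //; rewrite -[X in measurable X]setTI.
    exact: emeasurable_fun_o_infty.
  move=> x /= /not_implyP[Ex h]; split => //=; rewrite ltNge; apply/negP; rewrite lee_fin => h3.
  apply: h; rewrite -EFinM lee_fin vpE; apply: ler_wpM2r => //.
  by apply: le_powR2r => //; exact: ltW.
have bd : (\int[mu]_(x in bad_set s bad `&` ~` Om) (v x `^ (1 + e))%:E
    <= (C * (G * m) `^ e * wt v (bad_set s bad))%:E)%E.
  rewrite EFinM -wB -int_scale//; last by rewrite mulr_ge0 ?powR_ge0.
  rewrite -[X in (_ <= \int[mu]_(x in X) _)%E]setIT; apply: le_int_bad => //.
  + exact: measurableC.
  + exact: emeasurable_funM.
  + by move=> x; rewrite mule_ge0// lee_fin mulr_ge0 ?powR_ge0.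
  move=> j d fb; rewrite setIT.
  have sj := side_gt0 j s0; have mdj : measurable (dcube (side s j) d : set X) by exact: measurable_dcube.
  rewrite int_scale//; last by rewrite mulr_ge0 ?powR_ge0.
  rewrite -setDE; apply: le_trans (HOm _ _ fb) _.
  rewrite (wt_dcube sj mdj (@subset_refl _ _)) -EFinM lee_fin.
  apply: ler_wpM2r; first exact: (wt_ge0 D).
  apply: ler_wpM2l => //; apply: le_powR2r; [exact: ltW|exact: we0|].
  rewrite ler_pdivrMr ?exprn_gt0// -lee_fin -(wt_dcube sj mdj (@subset_refl _ _)).
  apply: (@le_trans _ _ (2 ^+ n * (2 * m) * side s j ^+ n)%:E).
    by apply: cz_first_le fb.
  by rewrite lee_fin /G exprS mulrA [2 ^+ n * 2]mulrC.
rewrite (setD_setI _ bsub).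
apply: le_trans (int_setU_le mu _ _ _ _) _ => //.
  by apply: measurableI => //; exact: measurableC.
apply: le_trans (leeD good bd) _; rewrite -EFinD lee_fin.
have me0 : 0 <= m `^ e by exact: powR_ge0.
have -> : (2 * m) `^ e = 2 `^ e * m `^ e by apply: powRM => //; exact: ltW.
have -> : (G * m) `^ e = r * m `^ e.
  by rewrite -Ge; apply: powRM; [rewrite ltW// (lt_trans _ G1)|exact: ltW].
have -> : C * (r * m `^ e) * wt v (bad_set s bad) = C * m `^ e * (r * wt v (bad_set s bad)) by ring.
have h3 : r * wt v (bad_set s bad) <= (1 - c^-1 / 2) * V.
  apply: le_trans (ler_wpM2l _ wE) _; first by rewrite ltW// (lt_trans _ r1).
  by rewrite mulrA /r divfK// gt_eqF// subr_gt0.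
apply: le_trans (lerD (lexx _) (ler_wpM2l (mulr_ge0 C0 me0) h3)) _.
apply: eq_leW; rewrite /C; field.
by rewrite gt_eqF.
Qed.
End dual_pair_theory3.

(** * Boxes and the growth of weights at infinity *)

Section balls.
Context {R : realType} {n : nat}.
Local Notation X := 'rV[R]_n.

Definition box (r : R) : set X := cube (const_mx (- r)) (2 * r).

Lemma boxE (r : R) x : 0 <= r -> box r x <-> `|x| <= r.
Proof.
move=> r0; rewrite (rV_norm_le x r0); split=> h i; have := h i; rewrite !mxE.
  by rewrite ler_norml => /andP[h1 h2]; apply/andP; split; lra.
by rewrite ler_norml => /andP[h1 h2]; apply/andP; split; lra.
Qed.

Lemma measurable_rV_norm : measurable_fun setT (fun x : X => `|x|).
Proof.
apply: (measurability _ (RGenOInfty.measurableE R)) => _ [_ [r ->] <-].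
rewrite setTI; have [r0|r0] := ltP r 0.
  rewrite (_ : _ @^-1` _ = setT)//; apply/seteqP; split => // x _ /=.
  by rewrite in_itv/= andbT; exact: lt_le_trans r0 (normr_ge0 _).
rewrite (_ : _ @^-1` _ = ~` box r).
  by apply: measurableC; exact: measurable_cube.
apply/seteqP; split => x /=; rewrite in_itv/= andbT.
  by move=> h /(boxE x r0); rewrite leNgt h.
by move=> h; rewrite ltNge; apply/negP => /(boxE x r0).
Qed.

Lemma box_sub (r r' : R) : 0 <= r -> r <= r' -> box r `<=` box r'.
Proof.
move=> r0 rr x /(boxE x r0) h; apply/(boxE x (le_trans r0 rr)).
exact: le_trans h rr.
Qed.

End balls.

Lemma powR_solve {R : realType} (a b A V U P : R) (n : nat) : 0 < a -> 0 < A -> 0 <= V ->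
  0 < U -> 0 < P -> V `^ a * U `^ b <= A * (P ^+ n) `^ (a + b) ->
  V <= A `^ a^-1 * P `^ ((a + b) * n%:R / a) * U `^ (- (b / a)).
Proof.
move=> a0 A0 V0 U0 P0; rewrite -ler_pdivlMr ?powR_gt0// => h.
have := @le_powR2r _ a^-1 _ _ _ (powR_ge0 _ _) h; rewrite invr_ge0 => /(_ (ltW a0)).
rewrite powRVK ?gt_eqF// => /le_trans; apply.
rewrite -powRN !powRM ?powR_ge0 ?mulr_ge0 ?powR_ge0 ?(ltW A0)//.
rewrite -!powRrM mulNr -powR_mulrn ?(ltW P0)// -powRrM.
by have -> : n%:R * ((a + b) / a) = (a + b) * n%:R / a by rewrite mulrA [n%:R * _]mulrC.
Qed.

Section growth.
Context {R : realType} {n : nat}.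
Local Notation X := 'rV[R]_n.
Local Notation mu := (leb R n).
Variables (a b A : R) (v u : X -> R) (D : dual_pair a b A v u).

Let a0 := dp_a D.
Let b0 := dp_b D.
Let mv := dp_mv D.
Let v0 := dp_v0 D.
Let D' := dual_pairC D.

(** Reverse doubling: for [n > 0] the shell between two consecutive boxes has at least half the
    volume of the larger one, so by [wt_large] for [u] it carries a fixed fraction of its mass. *)
Lemma wt_doubling : (0 < n)%N -> exists2 th : R, 0 < th < 1 &
  forall k, wt u (box 1) <= th ^+ k * wt u (box (2 ^+ k)).
Proof.
move=> n0.
have h2 : 0 < 2^-1 :> R by rewrite invr_gt0.
have [c c1 Hc] := wt_large D' h2.
have c0 : 0 < c by exact: lt_trans c1.
have ci1 : c^-1 < 1 by rewrite invf_lt1.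
have ci0 : 0 < c^-1 by rewrite invr_gt0.
exists (1 - c^-1); first by apply/andP; split; lra.
elim=> [|k ih]; first by rewrite !expr0 mul1r.
apply: le_trans ih _; rewrite exprSr -mulrA ler_pM2l ?exprn_gt0 ?subr_gt0//.
have p0 : 0 < 2 ^+ k :> R by rewrite exprn_gt0.
have p1 : 0 < 2 ^+ k.+1 :> R by rewrite exprn_gt0.
have l0 : 0 < 2 * 2 ^+ k.+1 :> R by rewrite mulr_gt0.
have mb r : measurable (box r : set X) by exact: measurable_cube.
have sb : box (2 ^+ k) `<=` (box (2 ^+ k.+1) : set X).
  by apply: box_sub; rewrite ?(ltW p0)// exprS; lra.
have mE : measurable (box (2 ^+ k.+1) `\` box (2 ^+ k) : set X) by exact: measurableD.
have sE : box (2 ^+ k.+1) `\` box (2 ^+ k) `<=` (box (2 ^+ k.+1) : set X) by move=> x [].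
have bk r : 0 < r -> mu (box r) = ((2 * r) ^+ n)%:E.
  by move=> r0; rewrite measure_cube// mulr_ge0// ltW.
have : wt u (box (2 ^+ k.+1)) <= c * wt u (box (2 ^+ k.+1) `\` box (2 ^+ k)).
  apply: Hc => //; rewrite measure_setD ?bk ?ltry// (setIidr sb) !bk// -EFinD lee_fin.
  have : (2 * 2 ^+ k) ^+ n <= 2^-1 * (2 * 2 ^+ k.+1) ^+ n :> R.
    rewrite [2 ^+ k.+1]exprS [2 * (2 * _)]mulrA exprMn [in leRHS]exprMn mulrA.
    rewrite ler_pM2r ?exprn_gt0// -[2 * 2]/(2 * 2) exprMn mulrA ler_peMl ?exprn_ge0//.
    have -> : 2 ^+ n = 2 * 2 ^+ n.-1 :> R by rewrite -exprS prednK.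
    by rewrite mulrA mulVf ?mul1r// exprn_ege1// ler1n.
  lra.
rewrite -ler_pdivrMl// => h.
have : wt u (box (2 ^+ k.+1)) = wt u (box (2 ^+ k)) + wt u (box (2 ^+ k.+1) `\` box (2 ^+ k)).
  apply: EFin_inj; rewrite EFinD -(wtE D' (mb _) (@subset_refl _ _) l0) -(wtE D' (mb _) sb l0) -(wtE D' mE sE l0).
  rewrite -{1}(setDUK sb) ge0_integral_setU//.
  - by apply/measurable_EFinP; apply: measurable_funTS; exact: (dp_mu D).
  - by move=> x _; rewrite lee_fin; exact: (dp_u0 D).
  - by rewrite disj_set2E setDE setICA setICr setI0.
by rewrite mulrBl mul1r; lra.
Qed.

(** On the box of radius [2 ^ k] the defining bound gives [v] a mass of at most a constant times
    [2 ^ k] to the power [(a + b) n / a], times a negative power of the mass of [u]. The first power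
    is exactly compensated by the decaying weight, and the mass of [u] grows geometrically by
    reverse doubling, so the shells sum. *)
Lemma wt_tail : (0 < n)%N ->
  (\int[mu]_x ((1 + `|x|) `^ (- ((a + b) * n%:R / a)) * v x)%:E < +oo)%E.
Proof.
move=> n0; set ga := (a + b) * n%:R / a.
have ga0 : 0 < ga by rewrite divr_gt0// mulr_gt0 ?ltr0n// addr_gt0.
have [th /andP[th0 th1] Hth] := wt_doubling n0.
have A0 := dp_A_gt0 D.
pose h x := ((1 + `|x|) `^ (- ga) * v x)%:E.
have mh : measurable_fun setT h.
  apply/measurable_EFinP; apply: measurable_funM => //.
  apply: (measurableT_comp (measurable_powR _)).
  by apply: measurable_funD => //; exact: measurable_rV_norm.
have h0 x : (0 <= h x)%E by rewrite lee_fin mulr_ge0 ?powR_ge0.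
have mb r : measurable (box r : set X) by exact: measurable_cube.
have hv x (r : R) : 0 < r -> r <= 1 + `|x| -> (h x <= (r `^ (- ga))%:E * (v x)%:E)%E.
  move=> r0 rx; rewrite -EFinM lee_fin ler_wpM2r// !powRN lef_pV2 ?posrE ?powR_gt0//.
  by apply: le_powR2r => //; exact: ltW.
have mvE : measurable_fun setT (fun x => (v x)%:E) by apply/measurable_EFinP; exact: mv.
have vE0 x : (0 <= (v x)%:E)%E by rewrite lee_fin.
pose U := wt u (box 1); have U0 : 0 < U by apply: (wt_gt0 D'); rewrite mulr_gt0.
(* The ratio of the geometric series over the shells. *)
pose eta := th `^ (b / a).
have eta1 : eta < 1.
  have e1 : (1 : R) `^ (b / a) = 1 by rewrite powR1.
  by rewrite /eta -[ltRHS]e1 gt0_ltr_powR ?nnegrE ?divr_gt0 ?(ltW th0).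
have eta0 : 0 < eta by rewrite powR_gt0.
pose C := A `^ a^-1 * 4 `^ ga * U `^ (- (b / a)).
have C0 : 0 <= C by rewrite !mulr_ge0 ?powR_ge0.
have shell k : (\int[mu]_(x in box (2 ^+ k.+1) `\` box (2 ^+ k)) h x <= (C * eta ^+ k)%:E)%E.
  have p0 : 0 < 2 ^+ k :> R by rewrite exprn_gt0.
  have p1 : 0 < 2 ^+ k.+1 :> R by rewrite exprn_gt0.
  have l0 : 0 < 2 * 2 ^+ k.+1 :> R by rewrite mulr_gt0.
  have pg0 : 0 <= (2 ^+ k : R) `^ (- ga) by exact: powR_ge0.
  apply: (@le_trans _ _ (\int[mu]_(x in box (2 ^+ k.+1)) (((2 ^+ k) `^ (- ga))%:E * (v x)%:E))%E).
    apply: le_int => //.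
    - by move=> x _; rewrite mule_ge0.
    - move=> x [_ Nx]; apply: hv => //; rewrite ltW// ltr_wpDl// ltNge; apply/negP => hx.
      by apply: Nx; apply/boxE => //; exact: ltW.
  rewrite int_scale// (wtE D (mb _) (@subset_refl _ _) l0) -EFinM lee_fin.
  set V := wt v _; set Uk := wt u (box (2 ^+ k.+1)).
  have V0 : 0 <= V by exact: (wt_ge0 D).
  have Uk0 : 0 < Uk by apply: (wt_gt0 D').
  have key : V <= A `^ a^-1 * (4 * 2 ^+ k) `^ ga * Uk `^ (- (b / a)).
    apply: powR_solve => //; have := wt_cube D (const_mx (- 2 ^+ k.+1)) l0.
    have -> : 2 * 2 ^+ k.+1 = 4 * 2 ^+ k :> R by rewrite exprS mulrA -natrM.
    have <- // : box (2 ^+ k.+1) = cube (const_mx (- 2 ^+ k.+1)) (4 * 2 ^+ k) :> set X.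
    by rewrite /box exprS mulrA -natrM.
  apply: le_trans (ler_wpM2l pg0 key) _.
  have key2 : Uk `^ (- (b / a)) <= U `^ (- (b / a)) * eta ^+ k.+1.
    have := Hth k.+1; rewrite -/U -/Uk => hU.
    rewrite !powRN -powR_mulrn ?(ltW eta0)// /eta powRAC powR_mulrn ?(ltW th0)//.
    rewrite ler_pdivlMl ?powR_gt0// -ler_pdivlMr ?invr_gt0 ?powR_gt0// invrK mulrC.
    rewrite -powRM ?exprn_ge0 ?(ltW th0) ?(ltW Uk0)//; apply: le_powR2r => //.
      by rewrite mulr_ge0 ?invr_ge0 ?ltW.
    exact: ltW.
  rewrite powRM ?(ltW p0)//.
  have -> : (2 ^+ k) `^ (- ga) * (A `^ a^-1 * (4 `^ ga * (2 ^+ k) `^ ga) * Uk `^ (- (b / a))) =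
    A `^ a^-1 * 4 `^ ga * Uk `^ (- (b / a)).
    by rewrite powRN; field; rewrite gt_eqF// powR_gt0.
  apply: le_trans (ler_wpM2l _ key2) _; first by rewrite mulr_ge0 ?powR_ge0.
  rewrite /C exprS.
  move: (A `^ _) (4 `^ ga) (U `^ _) (powR_ge0 A a^-1) (powR_ge0 4 ga) (powR_ge0 U (- (b / a))) => x y z x0 y0 z0.
  have : eta * (eta ^+ k * (x * (y * z))) <= 1 * (eta ^+ k * (x * (y * z))).
    by rewrite ler_wpM2r ?mulr_ge0 ?exprn_ge0 ?(ltW eta0)// ltW.
  have -> : x * y * (z * (eta * eta ^+ k)) = eta * (eta ^+ k * (x * (y * z))) by ring.
  by have -> : x * y * z * eta ^+ k = 1 * (eta ^+ k * (x * (y * z))) by ring.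
pose I0 := wt v (box 1).
have bound k : (\int[mu]_(x in box (2 ^+ k)) h x <= (I0 + C * ((1 - eta ^+ k) / (1 - eta)))%:E)%E.
  elim: k => [|k ih].
    have l20 : 0 < 2 * 1 :> R by rewrite mulr_gt0.
    rewrite !expr0 subrr mul0r mulr0 addr0 -(wtE D (mb _) (@subset_refl _ _) l20).
    apply: le_int => // x _; apply: le_trans (hv x 1 ltr01 _) _; first by rewrite lerDl.
    by rewrite powR1 mul1e.
  have sb : box (2 ^+ k) `<=` (box (2 ^+ k.+1) : set X).
    by apply: box_sub; rewrite ?exprn_ge0// exprS ler_peMl ?exprn_ge0// ler1n.
  rewrite -(setDUK sb); apply: le_trans (int_setU_le _ _ _ _ _) _ => //.
    exact: measurableD.
  apply: le_trans (leeD ih (shell k)) _; rewrite -EFinD lee_fin.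
  apply: eq_leW; rewrite exprS; field.
  by rewrite subr_eq0 gt_eqF.
apply: (@le_lt_trans _ _ (I0 + C * (1 / (1 - eta)))%:E); last exact: ltry.
apply: (int_exhaust (G := fun k => box (2 ^+ k))) => //.
- apply/nondecreasing_seqP => k; apply/subsetPset; apply: box_sub; rewrite ?exprn_ge0//.
  by rewrite exprS ler_peMl ?exprn_ge0// ler1n.
- move=> x _; have [k hk] : exists k : nat, `|x| <= 2 ^+ k.
    exists (Num.bound `|x|); apply: le_trans (_ : (Num.bound `|x|)%:R <= _).
      by apply/ltW/archi_boundP; exact: normr_ge0.
    by rewrite -natrX ler_nat ltnW// ltn_expl.
  by exists k => //; apply/boxE => //; exact: exprn_ge0.
move=> k; apply: le_trans (bound k) _; rewrite lee_fin lerD2l ler_wpM2l// ler_wpM2r ?invr_ge0 ?subr_ge0 ?(ltW eta1)//.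
by rewrite gerBl exprn_ge0// ltW.
Qed.

End growth.

(** * Dini moduli and dyadic kernel bounds *)

Section kernels.
Context {R : realType} {n : nat}.
Local Notation X := 'rV[R]_n.
Local Notation mu := (leb R n).
Implicit Types (x y z : X).

Lemma norm_le_enorm x : `|x| <= enorm x.
Proof.
apply/rV_norm_le => [|i]; first exact: sqrtr_ge0.
rewrite -sqrtr_sqr /enorm ler_wsqrtr// (bigD1 i)//= lerDl sumr_ge0// => j _.
exact: sqr_ge0.
Qed.

Lemma enorm_le_norm x : enorm x <= n%:R * `|x|.
Proof.
rewrite -[leRHS]ger0_norm ?mulr_ge0// -sqrtr_sqr /enorm ler_wsqrtr//.
apply: (@le_trans _ _ (\sum_(i < n) `|x| ^+ 2)).
  apply: ler_sum => i _; rewrite -(real_normK (num_real _)) lerXn2r ?nnegrE//.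
  exact: rV_coord_le.
rewrite sumr_const card_ord -[leLHS]mulr_natl exprMn ler_wpM2r ?sqr_ge0//.
case: (n) => [|k]; first by rewrite expr0n.
by rewrite expr2 ler_peMl ?ler1n.
Qed.

Lemma enorm_gt0 x y : x != y -> 0 < enorm (x - y).
Proof. by move=> xy; apply: lt_le_trans (norm_le_enorm _); rewrite normr_gt0 subr_eq0. Qed.

Section dini.
Variable rho : R -> R.
Hypothesis rho_dini : dini_modulus rho.

Let rho0 t : 0 <= t <= 1 -> 0 <= rho t. Proof. by case: rho_dini => [[_ +] _ _ _ _]; apply. Qed.

Let rho_le s t : 0 <= s -> s <= t -> t <= 1 -> rho s <= rho t.
Proof.
case: rho_dini => [_ _ + _ _] => h s0 st t1; apply: h => //; rewrite in_itv/=.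
  by rewrite s0 (le_trans st).
by rewrite t1 (le_trans s0).
Qed.

(** By monotonicity, the interval from [2 ^- (j + 1)] to [2 ^- j] contributes at least
    [rho (2 ^- (j + 1)) / 2] to the Dini integral. *)
Lemma dini_sum : exists2 S : R, 0 <= S & forall N, \sum_(j < N) rho (2^-1 ^+ j.+1) <= S.
Proof.
case: rho_dini => [[cont _] _ _ _ fin].
pose f (t : R) := (rho t / t)%:E.
have f0 t : `]0%R, 1%R]%classic t -> (0 <= f t)%E.
  rewrite /= in_itv/= => /andP[t0 t1]; rewrite lee_fin divr_ge0 ?(ltW t0)// rho0//.
  by rewrite ltW.
have mrho : measurable_fun (`]0%R, 1%R] : set (measurableTypeR R)) rho.
  apply: measurable_funS (subspace_continuous_measurable_fun _ cont) => //.
  by apply: subset_itv; rewrite ?bnd_simp.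
have mf : measurable_fun (`]0%R, 1%R] : set (measurableTypeR R)) f.
  apply/measurable_EFinP; apply: (eq_measurable_fun (fun t => rho t * t `^ (-1))).
    move=> t; rewrite inE/= in_itv/= => /andP[t0 _].
    by rewrite powR_inv1// ltW.
  apply: measurable_funM => //.
  by apply: measurable_funTS; exact: measurable_powR.
pose I := (\int[@lebesgue_measure R]_(t in `]0%R, 1%R]) f t)%E.
have p01 N : 0 <= (2^-1 : R) ^+ N <= 1.
  by rewrite exprn_ge0 ?invr_ge0//= exprn_ile1 ?invr_ge0// invf_le1// ler1n.
pose q N : R := 2^-1 ^+ N.
have key N : ((\sum_(j < N) rho (2^-1 ^+ j.+1) / 2)%:E +
    \int[@lebesgue_measure R]_(t in `]0%R, (q N)%R]) f t <= I)%E.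
  elim: N => [|N]; first by rewrite big_ord0 add0e /q expr0.
  apply: le_trans; rewrite big_ord_recr/= EFinD -addeA leeD2l//.
  have /andP[a0 a1] := p01 N; have /andP[b0 b1] := p01 N.+1.
  have ba : 2^-1 ^+ N.+1 <= 2^-1 ^+ N :> R by rewrite exprS ler_piMl// invf_le1// ler1n.
  have sub (c d : R) : 0 <= c -> d <= 1 -> `]c, d]%classic `<=` `]0%R, 1%R].
    by move=> c0 d1; apply: subset_itv; rewrite bnd_simp.
  rewrite (_ : `]0%R, (q N)%R]%classic = `]0%R, (q N.+1)%R] `|` `](q N.+1)%R, (q N)%R]); last first.
    by rewrite -itv_bndbnd_setU ?bnd_simp.
  rewrite ge0_integral_setU//=; last 3 first.
  - apply: measurable_funS mf => //.
    by rewrite subUset; split; exact: sub.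
  - move=> t [|]; [move=> h|move=> h]; apply: f0; by apply: (sub _ _ _ _ _ h).
  - apply/disj_set2P/seteqP; split => t //= []; rewrite !in_itv/= => /andP[_ h] /andP[h' _].
    by move: h'; rewrite ltNge h.
  rewrite addeC leeD2l//.
  apply: (@le_trans _ _ (\int[@lebesgue_measure R]_(t in `](q N.+1)%R, (q N)%R])
     (cst (rho (2^-1 ^+ N.+1) / 2^-1 ^+ N)%:E t))%E).
    rewrite integral_cst//= lebesgue_measure_itv/= lte_fin.
    have h : 2^-1 ^+ N.+1 < 2^-1 ^+ N :> R.
      have : 0 < 2^-1 ^+ N :> R by rewrite exprn_gt0 ?invr_gt0.
      by rewrite exprS; lra.
    rewrite h -EFinD -EFinM lee_fin /q exprS; apply: eq_leW.
    by field; rewrite expf_neq0.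
  apply: le_int => //.
  - by move=> t _; rewrite lee_fin divr_ge0// rho0// b0.
  - by move=> t h; apply: f0; apply: (sub _ _ _ _ _ h).
  move=> t; rewrite /= in_itv/= => /andP[t0 t1]; rewrite lee_fin.
  have tp : 0 < t by exact: le_lt_trans b0 t0.
  apply: ler_pM; rewrite ?invr_ge0 ?rho0 ?b0//.
    by apply: rho_le => //; [exact: ltW|exact: le_trans t1 a1].
  by rewrite lef_pV2// posrE (lt_le_trans tp).
have Ifin : (I < +oo)%E by [].
have I0 : (0 <= I)%E by apply: integral_ge0 => t /f0.
exists (2 * fine I) => [|N]; first by rewrite mulr_ge0// fine_ge0.
have Ifn : I \is a fin_num by rewrite ge0_fin_numE.
have := key N; rewrite -(fineK Ifn) => h.
have : ((\sum_(j < N) rho (2^-1 ^+ j.+1) / 2)%:E <= (fine I)%:E)%E.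
  apply: le_trans h; rewrite leeDl// integral_ge0// => t.
  rewrite /= in_itv/= => /andP[t0 t1]; apply: f0; rewrite /= in_itv/= t0/=.
  by apply: le_trans t1 _; case/andP: (p01 N).
by rewrite lee_fin -mulr_suml ler_pdivrMr// mulrC.
Qed.

(** The first [N] terms of the dyadic sum are all at least [rho (2 ^- N)], whence
    [rho (2 ^- N) <= S / N]. *)
Lemma dini_small (e : R) : 0 < e -> exists2 h : R, 0 < h <= 1 & forall t, 0 <= t <= h -> rho t <= e.
Proof.
move=> e0; have [S S0 HS] := dini_sum.
pose N := (Num.bound (S / e)).+1.
have SN : S < e * N%:R.
  rewrite mulrC -ltr_pdivrMr//; apply: lt_le_trans (archi_boundP _) _; first by rewrite divr_ge0// ltW.
  by rewrite ler_nat /N leqnSn.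
have h01 k : 0 < (2^-1 : R) ^+ k <= 1.
  by rewrite exprn_gt0 ?invr_gt0//= exprn_ile1 ?invr_ge0// invf_le1// ler1n.
exists (2^-1 ^+ N) => // t /andP[t0 tN].
have /andP[_ N1] := h01 N.
apply: le_trans (rho_le t0 tN N1) _.
have : \sum_(j < N) rho (2^-1 ^+ N) <= S.
  apply: le_trans (HS N); apply: ler_sum => j _.
  have /andP[h1 _] := h01 N; have /andP[_ h2] := h01 j.+1.
  apply: (rho_le (ltW h1) _ h2).
  by rewrite ler_wiXn2l ?invr_ge0// invf_le1// ler1n.
rewrite sumr_const card_ord -[leLHS]mulr_natr => h; rewrite leNgt; apply/negP => h2.
have : e * N%:R < rho (2^-1 ^+ N) * N%:R by rewrite ltr_pM2r// ltr0n.
lra.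
Qed.

End dini.

(* The gradient-type bound is dyadic: at distance 2^j l the kernel varies by
   om j times its size when one argument moves by at most l. *)
Record kernel_bounds (al Ck So : R) (om : nat -> R) (K : X -> X -> R) : Prop := KernelBounds {
  kb_Ck : 0 <= Ck; kb_om : forall j, 0 <= om j;
  kb_sum : forall N, \sum_(j < N) om j <= So;
  kb_size : forall x y, x != y -> `|K x y| <= Ck * `|x - y| `^ (al - n%:R);
  kb_mod : forall j l x x' y, 0 < l -> `|x - x'| <= l -> 2 ^+ j * l <= `|x - y| ->
    2 ^+ j * l <= `|x' - y| ->
    `|K x y - K x' y| + `|K y x - K y x'| <= om j * (2 ^+ j * l) `^ (al - n%:R);
  kb_small : forall d : R, 0 < d -> exists2 h : R, 0 < h & forall x x' y, x != y ->
    `|x - x'| <= h * `|x - y| -> `|K x y - K x' y| <= d * `|x - y| `^ (al - n%:R);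
  kb_meas : forall x, measurable_fun setT (K x) }.

Lemma powR_le_neg (x y t : R) : t <= 0 -> 0 < x -> x <= y -> y `^ t <= x `^ t.
Proof.
move=> t0 x0 xy; rewrite -[t]opprK !(powRN _ (- t)) lef_pV2 ?posrE ?powR_gt0//.
  by apply: le_powR2r => //; [rewrite oppr_ge0|exact: ltW].
exact: lt_le_trans xy.
Qed.

Lemma measurable_set1 x : measurable [set x].
Proof.
rewrite (_ : [set x] = cube x 0); first exact: measurable_cube.
apply/seteqP; split => y; first by move=> -> i; rewrite addr0 lexx.
by move=> h; apply/rowP => i; apply/le_anti; have := h i; rewrite addr0 andbC.
Qed.

(** The smoothness condition, stated with the Euclidean norm, passes to the maximum norm at the cost
    of a factor [n], absorbed by the shift [j0]. Measurability in the second variable also comes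
    from smoothness, the diagonal value being arbitrary. *)
Lemma kernel_boundsP al rho K : (0 < n)%N -> al <= n%:R -> dini_modulus rho ->
  size_condition al K -> regularity_condition rho al K ->
  exists Ck So om, kernel_bounds al Ck So om K.
Proof.
move=> n0 aln dini [c hc] reg.
have t0 : al - n%:R <= 0 by rewrite subr_le0.
have n1 : 1 <= n%:R :> R by rewrite ler1n.
have np : 0 < n%:R :> R by exact: lt_le_trans n1.
have inve x y : x != y -> (enorm (x - y) `^ (n%:R - al))^-1 <= `|x - y| `^ (al - n%:R).
  move=> xy; rewrite -powRN opprB; apply: powR_le_neg (norm_le_enorm _) => //.
  by rewrite normr_gt0 subr_eq0.
have rho0 t : 0 <= t <= 1 -> 0 <= rho t by case: dini => [[_ +] _ _ _ _]; apply.
have rho_le s t : 0 <= s -> s <= t -> t <= 1 -> rho s <= rho t.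
  case: dini => [_ _ + _ _] => h s0 st t1; apply: h => //; rewrite in_itv/=.
    by rewrite s0 (le_trans st).
  by rewrite t1 (le_trans s0).
have size x y : x != y -> `|K x y| <= `|c| * `|x - y| `^ (al - n%:R).
  move=> xy; apply: le_trans (hc _ _ xy) _.
  apply: le_trans (ler_norm _) _; rewrite normrM ler_wpM2l// ger0_norm ?inve//.
  by rewrite invr_ge0 powR_ge0.
have regular x x' y r : x != y -> 0 <= r -> r < 2^-1 -> n%:R * `|x - x'| <= r * `|x - y| ->
    `|K x y - K x' y| + `|K y x - K y x'| <= rho r * `|x - y| `^ (al - n%:R).
  move=> xy r0 r2 h; have e0 := enorm_gt0 xy.
  have h2 : enorm (x - x') <= r * enorm (x - y).
    apply: le_trans (enorm_le_norm _) _; apply: le_trans h _.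
    by rewrite ler_wpM2l// norm_le_enorm.
  have h3 : enorm (x - x') / enorm (x - y) <= r by rewrite ler_pdivrMr.
  have e1 : 0 <= enorm (x - x') / enorm (x - y) by rewrite divr_ge0 ?sqrtr_ge0.
  apply: le_trans (reg _ _ _ _) _.
    have : r * enorm (x - y) < 2^-1 * enorm (x - y) by rewrite ltr_pM2r.
    lra.
  apply: ler_pM; rewrite ?invr_ge0 ?powR_ge0 ?inve//.
    by apply: rho0; rewrite e1/=; lra.
  by apply: rho_le => //; lra.
have small (d : R) : 0 < d -> exists2 h : R, 0 < h & forall x x' y, x != y ->
    `|x - x'| <= h * `|x - y| -> `|K x y - K x' y| + `|K y x - K y x'| <= d * `|x - y| `^ (al - n%:R).
  move=> d0; have [h /andP[h0 h1] Hh] := dini_small dini d0.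
  have h4 : 0 < h / 4 by rewrite divr_gt0.
  exists (h / 4 / n%:R) => [|x x' y xy le]; first by rewrite divr_gt0.
  apply: le_trans (@regular x x' y (h / 4) xy _ _ _) _.
  - exact: ltW.
  - lra.
  - by move: le; rewrite mulrAC ler_pdivlMr// mulrC.
  by rewrite ler_wpM2r ?powR_ge0// Hh//; lra.
have [S S0 HS] := dini_sum dini.
have [j0 hj0] : exists j0, n%:R <= 2 ^+ j0 :> R.
  by exists n; rewrite -natrX ler_nat ltnW// ltn_expl.
(* At the first scales the points may be too close for the smoothness condition, and the four kernel
   values are bounded by their size; afterwards [n * l] is at most [2 ^- (j - j0)] times
   [2 ^ j * l], with a ratio below [1 / 2]. *)
pose om j := if (j <= j0.+1)%N then 4 * `|c| else rho (2^-1 ^+ (j - j0)).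
have h01 k : 0 <= (2^-1 : R) ^+ k <= 1.
  by rewrite exprn_ge0 ?invr_ge0//= exprn_ile1 ?invr_ge0// invf_le1// ler1n.
have om0 j : 0 <= om j by rewrite /om; case: ifP => _; [rewrite mulr_ge0|exact: rho0].
exists `|c|, (j0.+2%:R * (4 * `|c|) + S), om; split => //.
- move=> N; have : \sum_(j < j0.+2 + N) om j <= j0.+2%:R * (4 * `|c|) + S.
    rewrite big_split_ord/=; apply: lerD.
      rewrite mulr_natl -[j0.+2 in leRHS]card_ord -sumr_const; apply: ler_sum => j _.
      by rewrite /om -ltnS ltn_ord.
    apply: le_trans (HS N.+1); rewrite big_ord_recl/= ler_wpDl//; first exact: rho0.
    apply: ler_sum => j _; rewrite /om ifF.
      by rewrite (_ : (_ - _)%N = (bump 0 j).+1)// /bump; lia.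
    by apply/negbTE; rewrite -ltnNge; lia.
  apply: le_trans; rewrite addnC big_split_ord/= lerDl; exact: sumr_ge0.
- move=> j l x x' y l0 xx xy x'y.
  have p0 : 0 < 2 ^+ j * l by rewrite mulr_gt0// exprn_gt0.
  have nz z : 2 ^+ j * l <= `|z - y| -> z != y.
    by move=> h; rewrite -subr_eq0 -normr_gt0; exact: lt_le_trans h.
  have pw z : 2 ^+ j * l <= `|z - y| -> `|z - y| `^ (al - n%:R) <= (2 ^+ j * l) `^ (al - n%:R).
    by move=> h; exact: powR_le_neg.
  rewrite /om; case: leqP => hj.
    have sz z : 2 ^+ j * l <= `|z - y| -> `|K z y| + `|K y z| <= 2 * `|c| * (2 ^+ j * l) `^ (al - n%:R).
      move=> h; have h' := nz _ h; rewrite -mulrA mulr_natl mulr2n; apply: lerD.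
        by apply: le_trans (size _ _ h') _; rewrite ler_wpM2l// pw.
      by rewrite eq_sym in h'; apply: le_trans (size _ _ h') _; rewrite distrC ler_wpM2l// pw.
    have := sz _ xy; have := sz _ x'y; have := ler_normB (K x y) (K x' y).
    by have := ler_normB (K y x) (K y x'); lra.
  have /andP[h1 h2] := h01 (j - j0)%N.
  have := @regular x x' y (2^-1 ^+ (j - j0)) (nz _ xy) h1 _ _.
  have -> : 2^-1 ^+ (j - j0) < 2^-1 :> R.
    have [i ->] : exists i, (j - j0)%N = i.+2 by exists (j - j0).-2; clear -hj; lia.
    by rewrite !exprS; have /andP[h3 h4] := h01 i; lra.
  have -> : n%:R * `|x - x'| <= 2^-1 ^+ (j - j0) * `|x - y|.
    apply: le_trans (_ : 2 ^+ j0 * l <= _); first by apply: ler_pM.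
    apply: le_trans (_ : 2^-1 ^+ (j - j0) * (2 ^+ j * l) <= _); last by rewrite ler_wpM2l.
    rewrite mulrA -{2}(@subnK j0 j) ?exprD ?mulrA; last by clear -hj; lia.
    by rewrite -exprMn mulVf// expr1n mul1r.
  move=> /(_ erefl erefl) h; apply: le_trans h _.
  by rewrite ler_wpM2l ?pw// rho0.
- move=> d d0; have [h h0 H] := small d d0; exists h => // x x' y xy le.
  by apply: le_trans (H _ _ _ xy le); rewrite lerDl.
move=> y.
(* Off the diagonal [K y] is a pointwise limit of functions constant on small cells; its value at
   [y] is restored separately. *)
pose g z := K y z * \1_(~` [set y]) z.
have E1 z : \1_(~` [set y]) z = (z != y)%:R :> R.
  by rewrite indicE; have -> : (z \in ~` [set y]) = (z != y) by apply/idP/idP; rewrite inE/= => /eqP.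
have E2 z : \1_[set y] z = (z == y)%:R :> R.
  by rewrite indicE; have -> : (z \in [set y]) = (z == y) by apply/idP/idP; rewrite inE/= => /eqP.
have -> : K y = g \+ (fun z => K y y * \1_[set y] z).
  apply/funext => z /=; rewrite /g E1 E2.
  by have [->|_] := eqVneq z y; rewrite ?mulr0 ?mulr1 ?add0r ?addr0.
have my := @measurable_set1 y.
apply: measurable_funD; last by apply: measurable_funM => //; exact: measurable_indic.
pose s j : R := side 1 j; have s0 j : 0 < s j by exact: side_gt0.
apply: (@measurable_fun_cvg _ _ _ _ (fun j z => K y (corner (s j) (idx (s j) z)) * \1_(~` [set y]) z)) => //.
  move=> j; apply: measurable_funM; last by apply: measurable_indic; exact: measurableC.
  exact: (@measurable_dset_fun _ _ 1 j _ _ (fun k => K y (corner (s j) k))).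
move=> z _; rewrite /g; have [->|zy] := eqVneq z y.
  by under eq_fun do rewrite E1 eqxx mulr0; rewrite E1 eqxx mulr0; exact: cvg_cst.
apply: cvgMl; apply/cvgrPdist_le => e e0.
have zy0 : 0 < `|z - y| by rewrite normr_gt0 subr_eq0.
have pw0 : 0 < `|z - y| `^ (al - n%:R) by rewrite powR_gt0.
have [h h0 H] := small _ (divr_gt0 e0 pw0).
have hz : 0 < h * `|z - y| by rewrite mulr_gt0.
have [N hN] : exists N, 1 <= h * `|z - y| * 2 ^+ N.
  exists (Num.bound (h * `|z - y|)^-1); rewrite mulrC -ler_pdivrMr// mul1r.
  apply: le_trans (ltW (archi_boundP _)) _; first by rewrite invr_ge0 ltW.
  by rewrite -natrX ler_nat ltnW// ltn_expl.
exists N => // j /= Nj; have := H z (corner (s j) (idx (s j) z)) y zy.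
rewrite divfK ?gt_eqF// => H'.
apply: le_trans (H' _); first by rewrite lerDr.
apply: le_trans (ltW (dcube_dist (s0 j) (dcube_idx _ _) (dcube_corner _ (s0 j)))) _.
rewrite /s /side ler_pdivrMr ?exprn_gt0//; apply: le_trans hN _.
by rewrite ler_pM2l// ler_weXn2l// ler1n.
Qed.

End kernels.

Section weighted_estimate.
Context {R : realType} {n : nat}.
Local Notation X := 'rV[R]_n.
Local Notation C := R[i].
Local Notation mu := (leb R n).

(** * Functions with local moments of all orders *)

Section moments.
Implicit Types (g h : X -> R) (f b : X -> C).

Lemma measurable_box (r : R) : measurable (box r : set X).
Proof. exact: measurable_cube. Qed.

Lemma box_fin (r : R) : 0 <= r -> (mu (box r) < +oo)%E.
Proof. by move=> r0; apply: cube_fin; rewrite mulr_ge0. Qed.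

(** Finite moments of all orders on bounded sets: unlike boundedness, this is stable under
    multiplication by symbols of bounded mean oscillation. *)
Definition lmom h := [/\ measurable_fun setT h, forall x, 0 <= h x &
  forall N (r : R), 0 <= r -> (\int[mu]_(x in box r) (h x ^+ N.+1)%:E < +oo)%E].

Lemma lmom_le g h : lmom h -> measurable_fun setT g -> (forall x, 0 <= g x <= h x) -> lmom g.
Proof.
move=> [mh h0 hoo] mg gh; have g0 x : 0 <= g x by case/andP: (gh x).
split => // N r r0; apply: le_lt_trans (hoo N r r0); apply: le_int => // x _;
  rewrite lee_fin ?exprn_ge0// lerXn2r ?nnegrE//; by case/andP: (gh x).
Qed.

Lemma exprD_le (x y : R) N : 0 <= x -> 0 <= y -> (x + y) ^+ N <= 2 ^+ N * (x ^+ N + y ^+ N).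
Proof.
move=> x0 y0; apply: (@le_trans _ _ ((2 * Num.max x y) ^+ N)).
  rewrite lerXn2r ?nnegrE ?addr_ge0 ?mulr_ge0 ?le_max ?x0//.
  by rewrite mulr_natl mulr2n lerD// le_max lexx ?orbT.
rewrite exprMn ler_pM2l ?exprn_gt0//.
by rewrite /Num.max; case: ifP => _; [rewrite lerDr|rewrite lerDl]; exact: exprn_ge0.
Qed.

Lemma lmomD g h : lmom g -> lmom h -> lmom (fun x => g x + h x).
Proof.
move=> [mg g0 goo] [mh h0 hoo]; split => [|x|N r r0]; [exact: measurable_funD|exact: addr_ge0|].
have mX (k : X -> R) N' : measurable_fun setT k -> measurable_fun setT (fun x => (k x ^+ N')%:E).
  by move=> mk; apply/measurable_EFinP; exact: measurable_funX.
apply: (@le_lt_trans _ _ (\int[mu]_(x in box r) ((2 ^+ N.+1)%:E * ((g x ^+ N.+1)%:E + (h x ^+ N.+1)%:E)))%E).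
  apply: le_int => // x _; rewrite -?EFinD -?EFinM lee_fin ?mulr_ge0 ?addr_ge0 ?exprn_ge0 ?addr_ge0//.
  exact: exprD_le.
rewrite int_scale ?exprn_ge0//; last 3 first.
- exact: measurable_box.
- by apply: emeasurable_funD; exact: mX.
- by move=> x; rewrite -EFinD lee_fin addr_ge0 ?exprn_ge0.
rewrite int_add//; last 5 first.
- exact: measurable_box.
- exact: mX.
- exact: mX.
- by move=> x; rewrite lee_fin exprn_ge0.
- by move=> x; rewrite lee_fin exprn_ge0.
by apply: lte_mul_pinfty => //; apply: lte_add_pinfty; [exact: goo|exact: hoo].
Qed.

Lemma lmomM g h : lmom g -> lmom h -> lmom (fun x => g x * h x).
Proof.
move=> lg lh; have [mg g0 goo] := lg; have [mh h0 hoo] := lh.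
split => [|x|N r r0]; [exact: measurable_funM|exact: mulr_ge0|].
have [_ _ soo] := lmomD lg lh.
apply: le_lt_trans (soo (N + N.+1)%N r r0); apply: le_int => // x _;
  rewrite lee_fin ?exprn_ge0 ?addr_ge0 ?mulr_ge0//.
rewrite -addSn exprD exprMn; apply: ler_pM; rewrite ?exprn_ge0//;
  by rewrite lerXn2r ?nnegrE ?addr_ge0// ?lerDl ?lerDr.
Qed.

Lemma lmom_cst (c : R) : 0 <= c -> lmom (fun=> c).
Proof.
move=> c0; split => // N r r0; rewrite integral_cst; last exact: measurable_box.
by apply: lte_mul_pinfty; rewrite ?ltry ?lee_fin ?exprn_ge0 ?box_fin.
Qed.

Lemma lmom_bounded g (M : R) : measurable_fun setT g -> (forall x, 0 <= g x <= M) -> lmom g.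
Proof.
move=> mg gM; have M0 : 0 <= M by have /andP[h1 h2] := gM 0; exact: le_trans h2.
exact: lmom_le (lmom_cst M0) mg gM.
Qed.

Definition lmomc b := cmeasurable b /\ lmom (fun x => cabs (b x)).

Lemma lmomcB b z : lmomc b -> lmomc (fun x => b x - z).
Proof.
move=> [mb lb]; have mbz : cmeasurable (fun x => b x - z).
  by apply: cmeasurableB => //; exact: cmeasurable_cst.
split => //; apply: lmom_le (lmomD lb (lmom_cst (cabs_ge0 z))) (measurable_cabs mbz) _ => x.
by rewrite cabs_ge0/= -(cabsN z) cabsD.
Qed.

Lemma lmomc_cst z : lmomc (fun=> z).
Proof. by split; [exact: cmeasurable_cst|apply: lmom_cst; exact: cabs_ge0]. Qed.

Lemma lmomcM b f : lmomc b -> lmomc f -> lmomc (fun x => b x * f x).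
Proof.
move=> [mb lb] [mf lf]; split; first exact: cmeasurableM.
rewrite (_ : (fun _ => _) = fun x => cabs (b x) * cabs (f x)); first exact: lmomM.
by apply/funext => x; rewrite cabsM.
Qed.

Lemma lmomcD b f : lmomc b -> lmomc f -> lmomc (fun x => b x + f x).
Proof.
move=> [mb lb] [mf lf]; have mD := cmeasurableD mb mf; split => //.
by apply: lmom_le (lmomD lb lf) (measurable_cabs mD) _ => x; rewrite cabs_ge0 cabsD.
Qed.

Lemma lmomc_restr A f : measurable A -> lmomc f -> lmomc (crestr A f).
Proof.
move=> mA [mf lf]; have mr := cmeasurable_restr mA mf; split => //.
apply: lmom_le lf (measurable_cabs mr) _ => x; rewrite cabs_ge0/= cabs_restr.
by rewrite ler_piMl ?cabs_ge0// indicE lern1 leq_b1.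
Qed.

Definition bsupp f := exists2 r : R, 0 <= r & forall x, r < `|x| -> f x = 0.

(* The class of functions on which the operators are computed: it contains the
   bounded functions with bounded support and is stable under multiplication by
   functions of bounded mean oscillation. *)
Definition mclass f := lmomc f /\ bsupp f.

Lemma mclassMl b f : lmomc b -> mclass f -> mclass (fun x => b x * f x).
Proof.
move=> lb [lf [r r0 fr]]; split; first exact: lmomcM.
by exists r => // x xr; rewrite fr// mulr0.
Qed.

Lemma mclassZ z f : mclass f -> mclass (fun x => z * f x).
Proof. exact/mclassMl/lmomc_cst. Qed.

Lemma mclassD f f' : mclass f -> mclass f' -> mclass (fun x => f x + f' x).
Proof.
move=> [lf [r r0 fr]] [lf' [r' r0' fr']]; split; first exact: lmomcD.
exists (r + r') => [|x xr]; first exact: addr_ge0.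
by rewrite fr ?fr' ?addr0//; lra.
Qed.

Lemma mclass_restr A f : measurable A -> mclass f -> mclass (crestr A f).
Proof.
move=> mA [lf [r r0 fr]]; split; first exact: lmomc_restr.
by exists r => // x xr; rewrite /crestr fr//; case: ifP.
Qed.

Lemma mclass0 : mclass (fun=> 0).
Proof. by split; [exact: lmomc_cst|exists 0]. Qed.

Lemma mclass_meas f : mclass f -> cmeasurable f. Proof. by case=> [[]]. Qed.

Lemma mclass_int f N : mclass f -> (\int[mu]_x (cabs (f x) ^+ N.+1)%:E < +oo)%E.
Proof.
move=> [[mf [_ _ foo]] [r r0 fr]]; apply: le_lt_trans (foo N r r0).
rewrite [leRHS]integral_mkcond; apply: le_int => // x _.
- by rewrite lee_fin exprn_ge0// cabs_ge0.
- by rewrite erestrict_ge0// => y _; rewrite lee_fin exprn_ge0// cabs_ge0.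
rewrite patchE; case: ifPn => //; rewrite notin_setE => /(boxE x r0)/negP.
by rewrite -ltNge => /fr ->; rewrite cabs0 expr0n.
Qed.

Lemma mclass_cint f A : mclass f -> cint A f.
Proof.
move=> mf; split; first exact: mclass_meas.
apply: le_lt_trans (mclass_int 0 mf); apply: le_int => // x _;
  by rewrite lee_fin ?expr1 ?cabs_ge0.
Qed.

Lemma mclass_L2 f : mclass f -> in_L2 f.
Proof.
move=> mf; split; first exact: mclass_meas.
apply: poweR_lty; apply: le_lt_trans (mclass_int 1 mf); apply: le_int => // x _.
- by rewrite lee_fin mulr_ge0 ?powR_ge0.
- by rewrite lee_fin exprn_ge0 ?cabs_ge0.
- by rewrite powR1 mulr1 powR_mulrn ?cabs_ge0.
Qed.

Lemma mclass_sum I (r : seq I) (F : I -> X -> C) : (forall i, mclass (F i)) ->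
  mclass (fun x => \sum_(i <- r) F i x).
Proof.
move=> mF; elim: r => [|i r ih].
  by rewrite (_ : (fun _ => _) = fun=> 0); [exact: mclass0|apply/funext => x; rewrite big_nil].
rewrite (_ : (fun _ => _) = fun x => F i x + \sum_(j <- r) F j x); first exact: mclassD.
by apply/funext => x; rewrite big_cons.
Qed.

Lemma box_triple (s : R) : 0 < s -> forall r, 0 <= r < s -> (box r : set X) `<=` triple s 0.
Proof.
move=> s0 r /andP[r0 rs] x /(boxE x r0) h i.
have : `|x ord0 i| < s by apply: le_lt_trans (rV_coord_le _ _) (le_lt_trans h rs).
rewrite ltr_norml => /andP[h1 h2]; rewrite /adjacent !mxE.
have [h3|h3] := leP 0 (x ord0 i / s).
  by have -> : Num.floor (x ord0 i / s) = 0 by apply/floor_itvP; rewrite mulr0z h3/= add0r ltr_pdivrMr// mul1r.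
have -> // : Num.floor (x ord0 i / s) = -1.
apply/floor_itvP; rewrite mulrN1z addrC subrr h3 andbT.
by rewrite ler_pdivlMr// mulN1r ltW.
Qed.

Lemma cintegralZ A z f : measurable A -> cint A f ->
  cintegral A (fun x => z * f x) = z * cintegral A f.
Proof.
move=> mA cf; case: z => p q; rewrite /cintegral.
have h1 x : complex.Re ((p +i* q)%C * f x) = p * complex.Re (f x) - q * complex.Im (f x).
  by case: (f x).
have h2 x : complex.Im ((p +i* q)%C * f x) = p * complex.Im (f x) + q * complex.Re (f x).
  by case: (f x).
have iR := cint_Re mA cf; have iI := cint_Im mA cf.
have iz (k : X -> R) r : mu.-integrable A (EFin \o k) -> mu.-integrable A (EFin \o (fun x => r * k x)).
  by move=> ik; exact: (integrableZl mA r ik).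
congr Complex.
  under eq_Rintegral do rewrite h1.
  by rewrite RintegralB ?RintegralZl//; exact: iz.
under eq_Rintegral do rewrite h2.
by rewrite RintegralD ?RintegralZl//;exact: iz.
Qed.

Lemma osc_le_scale (M c : R) b : 0 <= c -> osc_le M b -> osc_le (c * M) (fun x => c%:C%C * b x).
Proof.
move=> c0 ob a l l0; have [cb ib] := ob a l l0; have mc := @measurable_cube R n a l.
have cC : cabs (c%:C%C : C) = c by rewrite cabs_real ger0_norm.
have mcb : cmeasurable (fun x => c%:C%C * b x) by apply: cmeasurableM; [exact: cmeasurable_cst|case: cb].
have cbE : (\int[mu]_(x in cube a l) (cabs (c%:C%C * b x))%:E = c%:E * \int[mu]_(x in cube a l) (cabs (b x))%:E)%E.
  rewrite -int_scale//; last 2 first.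
  - by apply: measurable_cabsE; case: cb.
  - by move=> x; rewrite lee_fin cabs_ge0.
  by apply: eq_integral => x _; rewrite cabsM cC.
split.
  split => //; rewrite cbE; apply: lte_mul_pinfty; by [rewrite lee_fin|case: cb].
have aE : average (cube a l) (fun x => c%:C%C * b x) = c%:C%C * average (cube a l) b.
  by rewrite /average mulrCA cintegralZ.
rewrite aE; under eq_integral do rewrite -mulrBr cabsM cC EFinM.
rewrite int_scale//; last 2 first.
- by apply: measurable_cabsE; apply: cmeasurableB; [case: cb|exact: cmeasurable_cst].
- by move=> x; rewrite lee_fin cabs_ge0.
by rewrite -mulrA EFinM; apply: lee_wpmul2l.
Qed.

Lemma osc_le_mono (M M' : R) b : M <= M' -> osc_le M b -> osc_le M' b.
Proof.
move=> MM ob a l l0; have [cb ib] := ob a l l0; split => //; apply: le_trans ib _.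
by rewrite lee_fin ler_wpM2r// exprn_ge0// ltW.
Qed.

(** After division by [1 + |M|] the John-Nirenberg moments apply on the tripled cube around the
    origin, which contains any given box once the side is large. *)
Lemma osc_le_lmomc M b : osc_le M b -> lmomc b.
Proof.
move=> ob0; have mb := osc_le_cmeasurable ob0; split => //.
pose c := (1 + `|M|)^-1; have M1 : 0 < 1 + `|M| by rewrite ltr_pwDl.
have c0 : 0 < c by rewrite invr_gt0.
have ob : osc_le 1 (fun x => c%:C%C * b x).
  apply: osc_le_mono (osc_le_scale (ltW c0) ob0).
  by rewrite mulrC ler_pdivrMr// mul1r; apply: le_trans (ler_norm _) _; rewrite lerDr.
set u := fun x => _ in ob; have mu' := osc_le_cmeasurable ob.
suff lu : lmom (fun x => cabs (u x)).
  have -> : (fun x => cabs (b x)) = fun x => c^-1 * cabs (u x).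
    by apply/funext => x; rewrite /u cabsM cabs_real gtr0_norm// mulKf// gt_eqF.
  by apply: lmomM => //; apply: lmom_cst; rewrite invr_ge0 ltW.
split => [|x|N r r0]; [exact: measurable_cabs|exact: cabs_ge0|].
have s0 : 0 < r + 1 by rewrite ltr_wpDl.
have [K K0 HK] := @john_nirenberg_moment R n N.+1 isT.
pose z := cavg (r + 1) 0 u.
have mz : cmeasurable (fun x => u x - z) by apply: cmeasurableB => //; exact: cmeasurable_cst.
have lz : (\int[mu]_(x in box r) (cabs (u x - z) ^+ N.+1)%:E < +oo)%E.
  apply: le_lt_trans (le_lt_trans (HK u ob (r + 1) 0 s0) (ltry _)).
  apply: le_int => [x|x _|x _|//]; rewrite ?lee_fin ?exprn_ge0 ?cabs_ge0//.
  by apply: (@box_triple _ s0 r); rewrite r0 ltrDl ltr01.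
have mX (f : X -> C) : cmeasurable f -> measurable_fun setT (fun x => (cabs (f x) ^+ N.+1)%:E).
  by move=> mf; apply/measurable_EFinP; apply: measurable_funX; exact: measurable_cabs.
apply: (@le_lt_trans _ _ (\int[mu]_(x in box r) ((2 ^+ N.+1)%:E * ((cabs (u x - z) ^+ N.+1)%:E + cst (cabs z ^+ N.+1)%:E x)))%E).
  apply: le_int => // x _; rewrite -?EFinD -?EFinM lee_fin ?mulr_ge0 ?addr_ge0 ?exprn_ge0 ?cabs_ge0//.
  apply: le_trans (exprD_le _ (cabs_ge0 _) (cabs_ge0 _)).
  by rewrite lerXn2r ?nnegrE ?addr_ge0 ?cabs_ge0// -{1}(subrK z (u x)) cabsD.
rewrite int_scale ?exprn_ge0//; last 3 first.
- exact: measurable_box.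
- by apply: emeasurable_funD => //; exact: mX.
- by move=> x; rewrite -EFinD lee_fin addr_ge0 ?exprn_ge0 ?cabs_ge0.
rewrite int_add//; last 4 first.
- exact: measurable_box.
- exact: mX.
- by move=> x; rewrite lee_fin exprn_ge0 ?cabs_ge0.
- by move=> x; rewrite lee_fin exprn_ge0 ?cabs_ge0.
apply: lte_mul_pinfty => //; apply: lte_add_pinfty => //; rewrite integral_cst; last exact: measurable_box.
by apply: lte_mul_pinfty; rewrite ?lee_fin ?exprn_ge0 ?cabs_ge0 ?box_fin ?ltry.
Qed.

End moments.

(** * Linear operators with a kernel and a local weak type bound *)

Section local_operators.
Implicit Types (f g : X -> C) (x y : X).

Definition vanishes_near f x := exists2 r : R, 0 < r & forall y, `|x - y| < r -> f y = 0.

(* What the rest of the proof uses of the operator; the weak type inequality is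
   the scale-invariant form of weak (1,1), resp. weak (1, n/(n-al)). *)
Record local_op (al B : R) (K : X -> X -> R) (T : (X -> C) -> X -> C) : Prop := LocalOp {
  lo_B : 0 <= B;
  lo_meas : forall f, mclass f -> cmeasurable (T f);
  lo_lin : forall z f g, mclass f -> mclass g ->
    {ae mu, forall x, T (fun y => z * f y + g y) x = z * T f x + T g x};
  lo_far : forall f, mclass f ->
    {ae mu, forall x, vanishes_near f x -> T f x = kernel_integral K f x};
  lo_weak : forall s k f t, 0 < s -> mclass f -> (forall x, ~ triple s k x -> f x = 0) ->
    0 < t -> (mu (dcube s k `&` [set x | (t%:E < (cabs (T f x))%:E)%E]) <=
      (B * s `^ al / t)%:E * \int[mu]_x (cabs (f x))%:E)%E }.

Section linearity.
Variable T : (X -> C) -> X -> C.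
Hypothesis lin : forall z f g, mclass f -> mclass g ->
    {ae mu, forall x, T (fun y => z * f y + g y) x = z * T f x + T g x}.

Lemma lin_add f g : mclass f -> mclass g ->
  {ae mu, forall x, T (fun y => f y + g y) x = T f x + T g x}.
Proof.
move=> mf mg; have := lin 1 mf mg; apply: filterS => x; rewrite mul1r => <-.
by congr (T _ x); apply/funext => y; rewrite mul1r.
Qed.

Lemma lin_zero : {ae mu, forall x, T (fun=> 0) x = 0}.
Proof.
have := lin (-1) mclass0 mclass0; apply: filterS => x.
by under [X in T X]eq_fun do rewrite mulr0 addr0; rewrite mulN1r addNr.
Qed.

Lemma lin_scale z f : mclass f -> {ae mu, forall x, T (fun y => z * f y) x = z * T f x}.
Proof.
move=> mf; have := lin z mf mclass0; apply: filterS2 lin_zero => x h0.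
by rewrite h0 addr0; under [X in T X]eq_fun do rewrite addr0.
Qed.

Lemma lin_sum I (r : seq I) (F : I -> X -> C) : (forall i, mclass (F i)) ->
  {ae mu, forall x, T (fun y => \sum_(i <- r) F i y) x = \sum_(i <- r) T (F i) x}.
Proof.
move=> mF; elim: r => [|i r ih].
  apply: filterS lin_zero => x h; rewrite big_nil -[RHS]h.
  by congr (T _ x); apply/funext => y; rewrite big_nil.
apply: filterS2 ih (lin_add (mF i) (mclass_sum r mF)) => x h1 h2.
rewrite big_cons -h1 -h2; congr (T _ x); apply/funext => y; by rewrite big_cons.
Qed.

End linearity.

Lemma cintegral_restr A f : measurable A -> cintegral setT (crestr A f) = cintegral A f.
Proof.
move=> mA; rewrite /cintegral; congr Complex; rewrite [RHS]Rintegral_mkcond;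
  apply: eq_Rintegral => x _; by rewrite patchE /crestr; case: ifP.
Qed.

Lemma kernel_cint al Ck So om K f x : kernel_bounds al Ck So om K -> al <= n%:R -> mclass f ->
  vanishes_near f x -> cint setT (fun y => (K x y)%:C%C * f y).
Proof.
move=> KB aln mf [r r0 fr].
have t0 : al - n%:R <= 0 by rewrite subr_le0.
have mKf : cmeasurable (fun y => (K x y)%:C%C * f y).
  apply: cmeasurableM (mclass_meas mf); apply: cmeasurable_real; exact: (kb_meas KB).
have := mclass_cint setT (mclassZ (Ck * r `^ (al - n%:R))%:C%C mf).
move=> /cint_le; apply => // y _; rewrite !cabsM !cabs_real.
have [xy|xy] := ltP `|x - y| r; first by rewrite fr// cabs0 !mulr0.
rewrite ler_wpM2r ?cabs_ge0// [leRHS]ger0_norm ?mulr_ge0 ?powR_ge0 ?(kb_Ck KB)//.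
apply: le_trans (kb_size KB _) _; last by rewrite ler_wpM2l ?(kb_Ck KB)// powR_le_neg.
by rewrite -subr_eq0 -normr_gt0 (lt_le_trans r0).
Qed.

Lemma real_int f A : cint A f -> (\int[mu]_(x in A) (cabs (f x))%:E)%E =
  (fine (\int[mu]_(x in A) (cabs (f x))%:E)%E)%:E.
Proof.
move=> [_ foo]; rewrite fineK// ge0_fin_numE// integral_ge0// => x _.
by rewrite lee_fin cabs_ge0.
Qed.

Lemma anc_dcube (t : R) d i x : 0 < t -> dcube t d x -> dcube (2 ^+ i * t) (iter i par d) x.
Proof. by move=> t0 dx; rewrite /dcube/= idx_iter_par// dx. Qed.

(* The mean zero condition replaces K x y by K x y - K x y' with y' a fixed
   point of the cube carrying f. *)
Lemma kernel_shell al Ck So om K f (t : R) d j x : kernel_bounds al Ck So om K -> al <= n%:R ->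
  mclass f -> 0 < t -> (forall x, ~ dcube t d x -> f x = 0) -> cintegral setT f = 0 ->
  ~ triple (2 ^+ j * t) (iter j par d) x ->
  ((cabs (kernel_integral K f x))%:E <=
    (2 * (om j * (2 ^+ j * t) `^ (al - n%:R)))%:E * \int[mu]_y (cabs (f y))%:E)%E.
Proof.
move=> KB aln mf t0 fd f0 xj.
have pj : 0 < 2 ^+ j * t by rewrite mulr_gt0// exprn_gt0.
have dist y : dcube t d y -> 2 ^+ j * t <= `|x - y|.
  by move=> dy; rewrite distrC; apply: ntriple_dist xj => //; exact: anc_dcube.
set z := corner t d.
have dz : dcube t d z by exact: dcube_corner.
have vn : vanishes_near f x.
  exists (2 ^+ j * t) => // y xy; apply: fd => /dist; by rewrite leNgt xy.
have cK := kernel_cint KB aln mf vn.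
have czf := mclass_cint setT (mclassZ (- (K x z))%:C%C mf).
have -> : kernel_integral K f x = cintegral setT (fun y => ((K x y)%:C%C * f y) + (- (K x z))%:C%C * f y).
  rewrite cintegralD// cintegralZ//; last exact: mclass_cint.
  by rewrite f0 mulr0 addr0.
apply: le_trans (cabs_cintegral_le measurableT (cintD measurableT cK czf)) _.
rewrite EFinM -muleA; apply: lee_wpmul2l => //.
rewrite -int_scale//; last 3 first.
- by apply: measurable_cabsE; exact: mclass_meas.
- by move=> y; rewrite lee_fin cabs_ge0.
- by rewrite mulr_ge0 ?powR_ge0 ?(kb_om KB).
apply: le_int => // y _; rewrite ?lee_fin ?mulr_ge0 ?powR_ge0 ?cabs_ge0 ?(kb_om KB)//.
rewrite -mulrDl cabsM -rmorphD cabs_real.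
case: (pselect (dcube t d y)) => [dy|/fd ->]; last by rewrite cabs0 !mulr0.
rewrite ler_wpM2r ?cabs_ge0//.
have := @kb_mod _ _ _ _ _ _ _ KB j t y z x t0 (ltW (dcube_dist t0 dy dz)).
rewrite -![`|_ - x|]distrC => /(_ (dist _ dy) (dist _ dz)).
by apply: le_trans; rewrite lerDr.
Qed.

End local_operators.

(** * Weak type (1,1) for Calderon-Zygmund operators *)

Section calderon_zygmund_weak.
Implicit Types (f g : X -> C) (x y : X).
Variables (Ck So A : R) (om : nat -> R) (K : X -> X -> R) (T : (X -> C) -> X -> C).
Hypothesis KB : kernel_bounds 0 Ck So om K.
Hypothesis Tmeas : forall f, mclass f -> cmeasurable (T f).
Hypothesis Tlin : forall z f g, mclass f -> mclass g ->
    {ae mu, forall x, T (fun y => z * f y + g y) x = z * T f x + T g x}.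
Hypothesis Tfar : forall f, mclass f ->
    {ae mu, forall x, vanishes_near f x -> T f x = kernel_integral K f x}.
Hypothesis A0 : 0 <= A.
Hypothesis TA : forall f, mclass f ->
  (\int[mu]_x (cabs (T f x) ^+ 2)%:E <= A%:E * \int[mu]_x (cabs (f x) ^+ 2)%:E)%E.

Let Ifin f : mclass f -> (\int[mu]_x (cabs (f x))%:E)%E = (fine (\int[mu]_x (cabs (f x))%:E)%E)%:E.
Proof. by move=> mf; exact: real_int (mclass_cint _ mf). Qed.

(** The shells between tripled ancestors of the cube are summed: on shell [j] the kernel varies by
    [om j] times [(2 ^ j t) ^ (- n)], while the volume is at most [6 ^ n (2 ^ j t) ^ n]. Nothing is
    claimed on the tripled cube itself, whose measure is estimated separately. *)
Lemma atom_far f (t : R) d i : mclass f -> 0 < t -> (forall x, ~ dcube t d x -> f x = 0) ->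
  cintegral setT f = 0 ->
  (\int[mu]_(x in triple (2 ^+ i * t) (iter i par d) `\` triple t d) (cabs (T f x))%:E <=
    (2 * 6 ^+ n * \sum_(j < i) om j)%:E * \int[mu]_y (cabs (f y))%:E)%E.
Proof.
move=> mf t0 fd f0; rewrite Ifin//; set I := fine _.
have I0 : 0 <= I by rewrite fine_ge0// integral_ge0// => x _; rewrite lee_fin cabs_ge0.
have pj j : 0 < 2 ^+ j * t by rewrite mulr_gt0// exprn_gt0.
have mTf : measurable_fun setT (fun x => (cabs (T f x))%:E) by apply: measurable_cabsE; exact: Tmeas.
have T0 x : (0 <= (cabs (T f x))%:E)%E by rewrite lee_fin cabs_ge0.
have mt j : measurable (triple (2 ^+ j * t) (iter j par d) : set X) by exact: measurable_triple.
have mt0 : measurable (triple t d : set X) by exact: measurable_triple.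
elim: i => [|i ih].
  by rewrite expr0 mul1r setDv integral_set0 -EFinM lee_fin !mulr_ge0 ?exprn_ge0// big_ord0.
apply: (@le_trans _ _ (\int[mu]_(x in (triple (2 ^+ i * t) (iter i par d) `\` triple t d) `|`
   (triple (2 ^+ i.+1 * t) (iter i.+1 par d) `\` triple (2 ^+ i * t) (iter i par d))) (cabs (T f x))%:E)%E).
  apply: le_int => // x [h1 h2].
  by have [h3|h3] := pselect (triple (2 ^+ i * t) (iter i par d) x); [left|right].
apply: le_trans (int_setU_le _ _ _ _ _) _ => //; try exact: measurableD.
have -> : ((2 * 6 ^+ n * \sum_(j < i.+1) om j)%:E * I%:E = (2 * 6 ^+ n * \sum_(j < i) om j)%:E * I%:E +
    (2 * 6 ^+ n * om i * I)%:E)%E.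
  by rewrite big_ord_recr/= -!EFinM -EFinD mulrDr mulrDl.
rewrite leeD//.
have c0 : 0 <= 2 * (om i * (2 ^+ i * t) `^ (0 - n%:R)) * I.
  by rewrite !mulr_ge0 ?powR_ge0 ?(kb_om KB).
have mD : measurable (triple (2 ^+ i.+1 * t) (iter i.+1 par d) `\` triple (2 ^+ i * t) (iter i par d) : set X).
  exact: measurableD.
apply: (@le_trans _ _ (\int[mu]_(x in triple (2 ^+ i.+1 * t) (iter i.+1 par d) `\` triple (2 ^+ i * t) (iter i par d))
   (cst (2 * (om i * (2 ^+ i * t) `^ (0 - n%:R)) * I)%:E x))%E).
  apply: ae_le_int => //.
  apply: filterS (Tfar mf) => x far [h1 h2].
  rewrite far; last first.
    exists (2 ^+ i * t) => // y xy; apply: fd => dy; move: xy; apply/negP; rewrite -leNgt distrC.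
    by apply: ntriple_dist h2 => //; exact: anc_dcube.
  rewrite EFinM -[X in (_ <= _ * X)%E]Ifin//; apply: kernel_shell KB _ mf t0 fd f0 h2.
  exact: ler0n.
rewrite integral_cst//.
apply: (@le_trans _ _ ((2 * (om i * (2 ^+ i * t) `^ (0 - n%:R)) * I)%:E * ((3 * (2 ^+ i.+1 * t)) ^+ n)%:E)%E).
  apply: lee_wpmul2l; first by rewrite lee_fin.
  apply: le_trans (measure_triple_le _ (pj i.+1)); apply: measure_mono => // x [].
rewrite -EFinM lee_fin sub0r powRN powR_mulrn ?(ltW (pj i))//.
have -> : (3 * (2 ^+ i.+1 * t)) ^+ n = 6 ^+ n * (2 ^+ i * t) ^+ n.
  by rewrite -exprMn exprS; congr (_ ^+ _); ring.
apply: eq_leW; field.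
by rewrite expf_neq0// gt_eqF.
Qed.

Section at_level.
Variables (s t : R) (k0 : 'rV[int]_n) (f : X -> C).
Hypotheses (s0 : 0 < s) (t0 : 0 < t) (mf : mclass f).
Hypothesis fs : forall x, ~ triple s k0 x -> f x = 0.
Let h x := (cabs (f x))%:E.
Hypothesis small : forall d, (\int[mu]_(x in dcube s d) h x <= (t * s ^+ n)%:E)%E.
Let bad j d := ((t * side s j ^+ n)%:E < \int[mu]_(x in dcube (side s j) d) h x)%E : Prop.
Let D (c : nat * 'rV[int]_n) : set X := dcube (side s c.1) c.2.

Let mh : measurable_fun setT h. Proof. by apply: measurable_cabsE; exact: mclass_meas. Qed.
Let h0 x : (0 <= h x)%E. Proof. by rewrite lee_fin cabs_ge0. Qed.
Let sj j : 0 < side s j. Proof. exact: side_gt0. Qed.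
Let mD c : measurable (D c). Proof. exact: measurable_dcube. Qed.
Let Dfin c : (mu (D c) < +oo)%E. Proof. by rewrite measure_dcube// ltry. Qed.
Let volD c : vol (D c) = side s c.1 ^+ n. Proof. by rewrite /vol measure_dcube. Qed.
Let volD0 c : 0 < vol (D c). Proof. by rewrite volD exprn_gt0. Qed.

Let first_le c : first_bad bad c -> (\int[mu]_(x in D c) h x <= (2 ^+ n * t * side s c.1 ^+ n)%:E)%E.
Proof.
case: c => -[|j] d [/= bd nb].
  by move: bd; rewrite /bad ltNge side0 small.
apply: (@le_trans _ _ (\int[mu]_(x in dcube (side s j) (par d)) h x)%E).
  apply: le_int => // x dx; have := anc_dcube 1 (sj j.+1) dx.
  by rewrite expr1; have -> : 2 * side s j.+1 = side s j by rewrite [in RHS](sideD s j 1) addn1 expr1.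
have := nb j (leqnn _); rewrite subSnn /bad => /negP; rewrite -leNgt => /le_trans; apply.
rewrite (_ : side s j = 2 * side s j.+1); last by rewrite (sideD s j 1) expr1 addn1.
by rewrite lee_fin exprMn mulrA [t * _]mulrC.
Qed.

Let badE := @bad_setE R n s s0 bad.
Let mB : measurable (bad_set s bad). Proof. exact: measurable_bad_set. Qed.

Let good : {ae mu, forall x, ~ bad_set s bad x -> (h x <= t%:E)%E}.
Proof.
pose N := ~` bad_set s bad `&` [set x | (t%:E < h x)%E].
have mN : measurable N.
  apply: measurableI; first exact: measurableC.
  by rewrite -[X in measurable X]setTI; exact: emeasurable_fun_o_infty.
exists N; split => //; last first.
  by move=> x /= /not_implyP[bx hx]; split => //=; rewrite ltNge; exact/negP.
have NE : N = (\bigcup_(d in [set: 'rV[int]_n]) dcube s d) `&` N.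
  by rewrite setIC setIidl// => x _; exists (idx s x).
apply/eqP; rewrite eq_le measure_ge0 andbT -integral_1//.
have z0 : (\int[mu]_(x in (\bigcup_(d in [set: 'rV[int]_n]) dcube s d) `&` N) cst 0 x = 0)%E by rewrite integral0.
rewrite -z0 {1}NE; apply: le_int_bigcup => //.
- by move=> d _; exact: measurable_dcube.
- by move=> d d' _ _ [x [<- <-]].
move=> d _; have md : measurable (dcube s d : set X) by exact: measurable_dcube.
rewrite integral_1 ?integral0; last exact: measurableI.
have G0 := cz_good_ae s0 d mh h0 t0.
rewrite (@measure_sub0 _ _ _ _ _ _ _ _ _ G0)//.
- exact: measurableI.
- apply: measurableI; first by apply: measurableD => //; exact: measurable_bad_set.
  by rewrite -[X in measurable X]setTI; exact: emeasurable_fun_o_infty.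
by move=> x [dx [bx hx]]; split => //; split => // -[j [_ hj]]; apply: bx; exists j.
Qed.

Let avg c := average (D c) f.

Let avg_le c : (cabs (avg c) * side s c.1 ^+ n <= 2 * fine (\int[mu]_(x in D c) h x)).
Proof.
have := cabs_averageB 0 (mD c) (mclass_cint _ mf) (Dfin c) (volD0 c).
rewrite subr0 (eq_integral h); last by move=> x _; rewrite subr0.
rewrite (real_int (mclass_cint _ mf)) -EFinM lee_fin volD mulrAC ler_pdivlMr//.
by rewrite exprn_gt0.
Qed.

Let atom c := crestr (D c) (fun x => f x - avg c).

Let atomE c : atom c = fun x => crestr (D c) f x + - avg c * crestr (D c) (fun=> 1) x.
Proof. by apply/funext => x; rewrite /atom /crestr; case: ifP; rewrite ?mulr1// mulr0 addr0. Qed.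

Let m1D c : mclass (crestr (D c) (fun=> 1)).
Proof.
split; first by apply: lmomc_restr => //; exact: lmomc_cst.
exists (side s c.1 * (1 + `|corner 1 c.2 : X|)) => [|x xr].
  by rewrite mulr_ge0 ?addr_ge0// ltW.
rewrite /crestr; case: ifP => // /set_mem xD; exfalso; move: xr; apply/negP; rewrite -leNgt.
apply/rV_norm_le => [|i]; first by rewrite mulr_ge0 ?addr_ge0// ltW.
have /(dcubeE _ _ (sj c.1))/(_ i) := xD => /andP[h1 h2].
have h3 := rV_coord_le (corner 1 c.2 : X) i; rewrite mxE mul1r in h3.
have /andP[h4 h5] : - `|corner 1 c.2 : X| <= (c.2 ord0 i)%:~R <= `|corner 1 c.2 : X|.
  by rewrite -ler_norml.
have p := sj c.1; rewrite ler_norml; apply/andP; split.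
  by apply: le_trans h1; rewrite -mulrN ler_pM2l//; lra.
by apply: le_trans (ltW h2) _; rewrite -{2}[side s c.1]mulr1 -mulrDr ler_pM2l//; lra.
Qed.

Let matom c : mclass (atom c).
Proof. by rewrite atomE; apply: mclassD; [exact: mclass_restr|exact: mclassZ]. Qed.

Let atom_supp c x : ~ D c x -> atom c x = 0.
Proof. by move=> dx; rewrite /atom /crestr memNset. Qed.

Let atom_mean c : cintegral setT (atom c) = 0.
Proof.
rewrite cintegral_restr//; have := averageB (avg c) (mD c) (mclass_cint _ mf) (Dfin c) (volD0 c).
rewrite subrr /average => /eqP; rewrite mulf_eq0 => /orP[|/eqP//].
by move=> /eqP/(congr1 (@complex.Re R))/= /eqP; rewrite invr_eq0 gt_eqF.
Qed.

Let atom_int c : (\int[mu]_x (cabs (atom c x))%:E <= 3%:E * \int[mu]_(x in D c) h x)%E.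
Proof.
have hD := real_int (mclass_cint (D c) mf).
apply: (@le_trans _ _ (\int[mu]_(x in D c) (h x + (cst (cabs (avg c))%:E x)))%E).
  rewrite [leRHS]integral_mkcond; apply: le_int => // x _.
  - by rewrite lee_fin cabs_ge0.
  - by rewrite erestrict_ge0// => y _; rewrite adde_ge0// lee_fin cabs_ge0.
  rewrite patchE /atom /crestr; case: ifP => _; last by rewrite cabs0.
  by rewrite -EFinD lee_fin -(cabsN (avg c)) cabsD.
rewrite int_add//; last by move=> x; rewrite lee_fin cabs_ge0.
rewrite integral_cst// measure_dcube// hD -EFinM -EFinD -EFinM lee_fin.
have := avg_le c; lra.
Qed.

(** Linearity of [T] is available only for finite sums, so only the stopping cubes with code below
    [N] are subtracted; the others are dealt with by letting [N] grow. *)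
Let cs N := [seq c <- pmap (@pickle_inv _) (iota 0 N) | `[< first_bad bad c >] ].

Let cs_uniq N : uniq (cs N).
Proof. by rewrite filter_uniq// (pmap_uniq (@pickle_invK _))// iota_uniq. Qed.

Let mem_cs N c : c \in cs N <-> first_bad bad c /\ (pickle c < N)%N.
Proof.
rewrite mem_filter mem_pmap; split.
  move=> /andP[/asboolP fb Sc].
  have [ i ] : exists2 i, i \in iota 0 N & Some c = pickle_inv i by exact/mapP.
  rewrite mem_iota add0n => /andP[_ iN] /esym e.
  by split => //; have := @pickle_invK (nat * 'rV[int]_n)%type i; rewrite /ocancel/oapp e => ->.
move=> [fb cN]; apply/andP; split; first exact/asboolP.
by apply/mapP; exists (pickle c); rewrite ?mem_iota// pickleK_inv.
Qed.

Let U N := \bigcup_(c in [set c | c \in cs N]) D c.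

Let mU N : measurable (U N). Proof. exact: measurable_cbigcup. Qed.

Let UB N : U N `<=` bad_set s bad.
Proof. by move=> x [c /= /mem_cs[fb _] cx]; rewrite badE; exists c. Qed.

Let gN N x := f x - \sum_(c <- cs N) atom c x.

Let sum_atom N c x : c \in cs N -> D c x -> \sum_(c <- cs N) atom c x = f x - avg c.
Proof.
move=> cN cx; rewrite (bigD1_seq c)//= big1_seq ?addr0.
  by rewrite /atom /crestr mem_set.
move=> c' /andP[cc' c'N]; apply: atom_supp => c'x; move/negP: cc'; apply; apply/eqP.
have /mem_cs[f1 _] := cN; have /mem_cs[f2 _] := c'N.
by apply: (first_bad_disj s0 f2 f1); exists x.
Qed.

Let gN_out N x : ~ U N x -> gN N x = f x.
Proof.
move=> Ux; rewrite /gN big1_seq ?subr0// => c /= cN; apply: atom_supp => cx.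
by apply: Ux; exists c.
Qed.

Let mgN N : mclass (gN N).
Proof.
rewrite (_ : gN N = fun x => f x + -1 * \sum_(c <- cs N) atom c x).
  by apply: mclassD => //; apply: mclassZ; exact: mclass_sum.
by apply/funext => x; rewrite mulN1r.
Qed.

Let sumD (r : seq (nat * 'rV[int]_n)) : uniq r -> {in r, forall c, first_bad bad c} ->
  (\sum_(c <- r) \int[mu]_(x in D c) h x <= \int[mu]_x h x)%E.
Proof.
move=> ur rb; rewrite -ge0_integral_bigsetU//.
- by apply: le_int.
- move=> c c' cr c'r [x [cx c'x]]; apply: (first_bad_disj s0 (rb _ cr) (rb _ c'r)).
  by exists x.
- exact: measurable_funTS.
Qed.

Let I := (\int[mu]_x h x)%E.

(** On the subtracted cubes [gN] is an average of [f], and off the bad set it is [f], so there it is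
    bounded by [2 ^ (n + 1) t]; on stopping cubes not yet subtracted it is still [f] and leaves the
    error term. The factor 4 counts [f] once and the atoms three times. *)
Let gN_sq N : (\int[mu]_x (cabs (gN N x) ^+ 2)%:E <=
  (2 ^+ n.+1 * t)%:E * (4%:E * I) + \int[mu]_(x in bad_set s bad `\` U N) (cabs (f x) ^+ 2)%:E)%E.
Proof.
have mg := mclass_meas (mgN N).
have mR : measurable (bad_set s bad `\` U N) by exact: measurableD.
pose rest x := ((cabs (f x) ^+ 2)%:E * (\1_(bad_set s bad `\` U N) x)%:E)%E.
have mrest : measurable_fun setT rest.
  apply: emeasurable_funM; apply/measurable_EFinP; last exact: measurable_indic.
  by apply: measurable_funX; apply: measurable_cabs; exact: mclass_meas.
have rest0 x : (0 <= rest x)%E by rewrite mule_ge0 ?lee_fin ?exprn_ge0 ?cabs_ge0.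
have M0 : 0 <= 2 ^+ n.+1 * t by rewrite mulr_ge0 ?exprn_ge0// ltW.
have M1 : t <= 2 ^+ n.+1 * t by rewrite ler_peMl ?(ltW t0)// exprn_ege1// ler1n.
have mgE : measurable_fun setT (fun x => ((2 ^+ n.+1 * t)%:E * (cabs (gN N x))%:E)%E).
  by apply: emeasurable_funM => //; exact: measurable_cabsE.
apply: (@le_trans _ _ (\int[mu]_x ((2 ^+ n.+1 * t)%:E * (cabs (gN N x))%:E + rest x))%E).
  apply: ae_le_int => //.
  - by apply/measurable_EFinP; apply: measurable_funX; exact: measurable_cabs.
  - exact: emeasurable_funD.
  - by move=> x; rewrite lee_fin exprn_ge0 ?cabs_ge0.
  - by move=> x; rewrite adde_ge0// mule_ge0 ?lee_fin ?cabs_ge0.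
  apply: filterS good => x gx _.
  have bnd : cabs (gN N x) <= 2 ^+ n.+1 * t ->
    ((cabs (gN N x) ^+ 2)%:E <= (2 ^+ n.+1 * t)%:E * (cabs (gN N x))%:E + rest x)%E.
    move=> le; apply: (@le_trans _ _ ((2 ^+ n.+1 * t)%:E * (cabs (gN N x))%:E)%E); last by rewrite leeDl.
    by rewrite -EFinM lee_fin expr2 ler_wpM2r ?cabs_ge0.
  have [[c /= cN cx]|Ux] := pselect (U N x).
    apply: bnd; rewrite /gN (sum_atom cN cx) opprB addrC subrK.
    have /mem_cs[fb _] := cN; have := avg_le c; have := first_le fb.
    rewrite (real_int (mclass_cint (D c) mf)) lee_fin => h1 h2.
    have p : 0 < side s c.1 ^+ n by rewrite exprn_gt0.
    by rewrite -(ler_pM2r p) exprS; lra.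
  have [bx|bx] := pselect (bad_set s bad x).
    rewrite gN_out// /rest indicE mem_set// mule1 leeDr// mule_ge0 ?lee_fin ?cabs_ge0//.
  by apply: bnd; rewrite gN_out//; apply: le_trans M1; have := gx bx; rewrite lee_fin.
rewrite int_add//; last by move=> x; rewrite mule_ge0 ?lee_fin ?cabs_ge0.
rewrite int_scale//; [|exact: measurable_cabsE|by move=> x; rewrite lee_fin cabs_ge0].
apply: leeD; last first.
  apply: eq_leW; rewrite /rest [RHS]integral_mkcond.
  apply: eq_integral => x _; rewrite patchE indicE; case: ifP => _; by rewrite ?mule1 ?mule0.
apply: lee_wpmul2l; first by rewrite lee_fin.
apply: (@le_trans _ _ (\int[mu]_x (h x + \sum_(c <- cs N) (cabs (atom c x))%:E))%E).
  apply: le_int => // [x _|x _|x _]; first by rewrite lee_fin cabs_ge0.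
    by rewrite adde_ge0// sume_ge0// => c _; rewrite lee_fin cabs_ge0.
  rewrite sumEFin -EFinD lee_fin; apply: le_trans (cabsD _ _) _; rewrite cabsN lerD2l.
  exact: cabs_sum.
have matomE c : measurable_fun setT (fun x => (cabs (atom c x))%:E).
  by apply: measurable_cabsE; exact: mclass_meas.
rewrite int_add//; last 2 first.
- exact: emeasurable_sum.
- by move=> x; rewrite sume_ge0// => c _; rewrite lee_fin cabs_ge0.
rewrite ge0_integral_sum//; last by move=> c x _; rewrite lee_fin cabs_ge0.
have -> : (4%:E * I = I + 3%:E * I)%E.
  by rewrite /I (Ifin mf) -!EFinM -EFinD; congr (_%:E); lra.
rewrite leeD2l//; apply: (@le_trans _ _ (\sum_(c <- cs N) 3%:E * \int[mu]_(x in D c) h x)%E).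
  by apply: lee_sum => c _; exact: atom_int.
rewrite -ge0_sume_distrr; last by move=> c _; rewrite integral_ge0.
by apply: lee_wpmul2l => //; apply: sumD => // c /mem_cs[].
Qed.

(** A stopping cube meets the tripled cube of [k0], outside which [f] vanishes, so its ancestor of
    side [s] is a neighbour of [k0]; hence the shells of [atom_far] up to scale [s] reach all of the
    cube [k0]. *)
Let cover c : first_bad bad c -> dcube s k0 `<=` triple (2 ^+ c.1 * side s c.1) (iter c.1 par c.2).
Proof.
move=> [bd _] x dx.
have [y [Dy ty]] : exists y, D c y /\ triple s k0 y.
  apply/not_existsP => H; move: bd; rewrite /bad.
  rewrite (eq_integral (cst 0%E)) ?integral0 ?lte_fin ?ltNge ?mulr_ge0 ?exprn_ge0 ?(ltW t0) ?(ltW (sj _))//.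
  move=> y /set_mem Dy; rewrite /h fs ?cabs0// => ty; exact: (H y).
have e : 2 ^+ c.1 * side s c.1 = s by rewrite -[X in _ * side s X]add0n -sideD side0.
move=> i; have := ty i; rewrite e /adjacent andbC => h'.
have <- : idx s y = iter c.1 par c.2 by rewrite -{1}e idx_iter_par// Dy.
by rewrite dx.
Qed.

Let trip (c : nat * 'rV[int]_n) : set X := triple (side s c.1) c.2.
Let V := \bigcup_(c in first_bad bad) trip c.
Let mtrip c : measurable (trip c). Proof. exact: measurable_triple. Qed.
Let mV : measurable V. Proof. exact: measurable_cbigcup. Qed.

Let V_le : (mu V <= (3 ^+ n / t)%:E * I)%E.
Proof.
have c0 : 0 <= 3 ^+ n / t by rewrite divr_ge0 ?exprn_ge0// ltW.
apply: (@le_trans _ _ (\int[mu]_(x in \bigcup_(c in first_bad bad) D c) ((3 ^+ n / t)%:E * h x))%E).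
  apply: le_measure_bigcup => //.
  - exact: first_bad_disj.
  - exact: emeasurable_funM.
  - by move=> x; rewrite mule_ge0.
  move=> c [bd _]; rewrite int_scale//.
  apply: le_trans (measure_triple_le _ (sj _)) _.
  apply: (@le_trans _ _ ((3 ^+ n / t)%:E * (t * side s c.1 ^+ n)%:E)%E).
    by rewrite -EFinM lee_fin exprMn mulrA divfK// gt_eqF.
  by apply: lee_wpmul2l; rewrite ?lee_fin// ltW.
rewrite int_scale//; last exact: measurable_cbigcup.
by apply: lee_wpmul2l; rewrite ?lee_fin//; apply: le_int.
Qed.

(** The sets [U N] exhaust the bad set and [f] is square integrable. *)
Let rest_small (e : R) : 0 < e -> exists N,
  (\int[mu]_(x in bad_set s bad `\` U N) (cabs (f x) ^+ 2)%:E <= e%:E)%E.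
Proof.
move=> e0; apply/not_existsP => H.
pose q x := (cabs (f x) ^+ 2)%:E.
have mq : measurable_fun setT q.
  by apply/measurable_EFinP; apply: measurable_funX; apply: measurable_cabs; exact: mclass_meas.
have q0 x : (0 <= q x)%E by rewrite lee_fin exprn_ge0 ?cabs_ge0.
pose a := fine (\int[mu]_(x in bad_set s bad) q x).
have aE : (\int[mu]_(x in bad_set s bad) q x)%E = a%:E.
  rewrite fineK// ge0_fin_numE ?integral_ge0//.
  by apply: (le_lt_trans _ (mclass_int 1 mf)); apply: le_int => // x _; exact: q0.
suff : (\int[mu]_(x in bad_set s bad) q x <= (a - e)%:E)%E by rewrite aE lee_fin; lra.
apply: (int_exhaust (G := U)) => //.
- apply/nondecreasing_seqP => k; apply/subsetPset => x [c /= /mem_cs[fb ck] cx].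
  by exists c => //=; apply/mem_cs; split => //; exact: ltnW.
- move=> x; rewrite badE => -[c fb cx]; exists (pickle c).+1 => //; exists c => //=.
  by apply/mem_cs.
move=> N; have /negP := H N; rewrite -ltNge => hN.
have sp : (\int[mu]_(x in bad_set s bad) q x = \int[mu]_(x in U N) q x +
    \int[mu]_(x in bad_set s bad `\` U N) q x)%E.
  rewrite -{1}(setDUK (@UB N)) ge0_integral_setU//.
  - exact: measurableD.
  - exact: measurable_funTS.
  - by rewrite disj_set2E setDE setICA setICr setI0.
have qU : (\int[mu]_(x in U N) q x <= a%:E)%E.
  by rewrite -aE; apply: le_int => //; exact: UB.
rewrite leNgt; apply/negP => h1; have : (a%:E < a%:E)%E; last by rewrite ltxx.
rewrite -{2}aE sp (_ : a%:E = (a - e)%:E + e%:E)%E; last by rewrite -EFinD subrK.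
exact: lteD.
Qed.

(** Outside the tripled stopping cubes [V], a value above [t] forces the good part or the sum over
    the atoms to exceed [t / 2]. The good part is handled in L^2, which gives
    [(4 / t ^ 2) * A * (2 ^ (n + 1) * t) * 4], and the atoms in L^1, which gives
    [(2 / t) * (2 * 6 ^ n * So) * 3]. *)
Lemma cz_level : (mu (dcube s k0 `&` [set x | (t%:E < (cabs (T f x))%:E)%E]) <=
  ((3 ^+ n + 16 * 2 ^+ n.+1 * A + 12 * 6 ^+ n * So) / t)%:E * I)%E.
Proof.
have So0 : 0 <= So by have := kb_sum KB 0; rewrite big_ord0.
have mS (u : X -> \bar R) (r : \bar R) : measurable_fun setT u -> measurable [set x | (r < u x)%E].
  by move=> mu'; rewrite -[X in measurable X]setTI; exact: emeasurable_fun_o_infty.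
have mTE g : mclass g -> measurable_fun setT (fun x => (cabs (T g x))%:E).
  by move=> mg; apply: measurable_cabsE; exact: Tmeas.
have T0 g x : (0 <= (cabs (T g x))%:E)%E by rewrite lee_fin cabs_ge0.
have mQ : measurable (dcube s k0 : set X) by exact: measurable_dcube.
have t20 : 0 < t / 2 by rewrite divr_gt0.
pose bT N x := (\sum_(c <- cs N) (cabs (T (atom c) x))%:E)%E.
have mbT N : measurable_fun setT (bT N) by apply: emeasurable_sum => c; exact: mTE.
have bT0 N x : (0 <= bT N x)%E by apply: sume_ge0.
have step N : (mu (dcube s k0 `&` [set x | (t%:E < (cabs (T f x))%:E)%E]) <=
    ((3 ^+ n + 16 * 2 ^+ n.+1 * A + 12 * 6 ^+ n * So) / t)%:E * I + (4 * A / t ^+ 2)%:E *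
    \int[mu]_(x in bad_set s bad `\` U N) (cabs (f x) ^+ 2)%:E)%E.
  pose G := [set x | (((t / 2) ^+ 2)%:E < (cabs (T (gN N) x) ^+ 2)%:E)%E].
  pose F := (dcube s k0 `\` V) `&` [set x | ((t / 2)%:E < bT N x)%E].
  have mG2 : measurable_fun setT (fun x => (cabs (T (gN N) x) ^+ 2)%:E).
    by apply/measurable_EFinP; apply: measurable_funX; apply: measurable_cabs; exact: Tmeas.
  have mG : measurable G by exact: mS.
  have mF : measurable F by apply: measurableI; [exact: measurableD|exact: mS].
  apply: (@le_trans _ _ (mu (V `|` (G `|` F)))).
    apply: ae_measure_le.
    - by apply: measurableI => //; apply: mS; exact: mTE.
    - by apply: measurableU => //; exact: measurableU.
    have Tg := lin_add Tlin (mgN N) (mclass_sum (cs N) matom).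
    apply: filterS2 Tg (lin_sum Tlin (cs N) matom) => x.
    rewrite (_ : (fun y => gN N y + \sum_(i <- cs N) atom i y) = f); last first.
      by apply/funext => y; rewrite /gN subrK.
    move=> h1 h2 [Qx /=]; rewrite lte_fin => tx.
    have [Vx|Vx] := pselect (V x); first by left.
    right; have [Fx|Fx] := pselect (F x); [by right|left].
    have {Fx} : (bT N x <= (t / 2)%:E)%E by rewrite leNgt; apply/negP => h3; apply: Fx.
    rewrite /bT sumEFin lee_fin => h3; rewrite /G/= lte_fin ltrXn2r ?nnegrE ?cabs_ge0 ?(ltW t20)//.
    move: tx; rewrite h1 h2 => /lt_le_trans -/(_ _ (cabsD _ _)).
    have := cabs_sum (cs N) (fun c => T (atom c) x); lra.
  apply: (@le_trans _ _ (mu V + (mu G + mu F))%E).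
    apply: (@le_trans _ _ (mu V + mu (G `|` F))%E).
      by apply: measure_setU_le => //; exact: measurableU.
    by rewrite leeD2l//; apply: measure_setU_le.
  have GE : (mu G <= (16 * 2 ^+ n.+1 * A / t)%:E * I + (4 * A / t ^+ 2)%:E *
      \int[mu]_(x in bad_set s bad `\` U N) (cabs (f x) ^+ 2)%:E)%E.
    have t2 : 0 < (t / 2) ^+ 2 by rewrite exprn_gt0.
    have g20 x : (0 <= (cabs (T (gN N) x) ^+ 2)%:E)%E by rewrite lee_fin exprn_ge0 ?cabs_ge0.
    have := @cheby _ _ _ mu setT _ ((t / 2) ^+ 2) measurableT mG2 g20 (ltW t2).
    rewrite setTI -/G -lee_pdivlMl//.
    have r0 : (0 <= \int[mu]_(x in bad_set s bad `\` U N) (cabs (f x) ^+ 2)%:E)%E.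
      by apply: integral_ge0 => x _; rewrite lee_fin exprn_ge0 ?cabs_ge0.
    have i0 : (0 <= I)%E by apply: integral_ge0.
    move=> /le_trans; apply; apply: (@le_trans _ _ ((((t / 2) ^+ 2)^-1)%:E * (A%:E * ((2 ^+ n.+1 * t)%:E * (4%:E * I) +
       \int[mu]_(x in bad_set s bad `\` U N) (cabs (f x) ^+ 2)%:E)))%E).
      apply: lee_wpmul2l; first by rewrite lee_fin invr_ge0 ltW.
      by apply: le_trans (TA (mgN N)) _; apply: lee_wpmul2l; rewrite ?lee_fin.
    have p0 : 0 <= 2 ^+ n.+1 * t by rewrite mulr_ge0 ?exprn_ge0// ltW.
    have p1 : (0 <= (2 ^+ n.+1 * t)%:E * (4%:E * I))%E by apply: mule_ge0; rewrite ?lee_fin// mule_ge0.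
    rewrite muleA -EFinM ge0_muleDr//.
    rewrite !muleA -!EFinM; apply: leeD.
      apply: eq_leW; congr (_%:E * _)%E.
      by field; rewrite gt_eqF.
    apply: eq_leW; congr (_%:E * _)%E.
    by field; rewrite gt_eqF.
  have FE : (mu F <= (12 * 6 ^+ n * So / t)%:E * I)%E.
    have := @cheby _ _ _ mu (dcube s k0 `\` V) _ (t / 2) (measurableD mQ mV) (mbT N) (bT0 N) (ltW t20).
    rewrite -/F -lee_pdivlMl// => /le_trans; apply.
    rewrite ge0_integral_sum//; last 2 first.
    - exact: measurableD.
    - by move=> c; apply: measurable_funTS; exact: mTE.
    apply: (@le_trans _ _ (((t / 2)^-1)%:E * (\sum_(c <- cs N) (6 * 6 ^+ n * So)%:E * \int[mu]_(x in D c) h x))%E).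
      apply: lee_wpmul2l; first by rewrite lee_fin invr_ge0 ltW.
      rewrite big_seq [leRHS]big_seq; apply: lee_sum => c /mem_cs[fb _].
      apply: (@le_trans _ _ (\int[mu]_(x in triple (2 ^+ c.1 * side s c.1) (iter c.1 par c.2) `\` trip c) (cabs (T (atom c) x))%:E)%E).
        apply: le_int => // x [Qx Vx]; split; first exact: cover fb _ Qx.
        by move=> tx; apply: Vx; exists c.
      apply: le_trans (atom_far _ (matom c) (sj _) (@atom_supp c) (atom_mean c)) _.
      apply: (@le_trans _ _ ((2 * 6 ^+ n * So)%:E * (3%:E * \int[mu]_(x in D c) h x))%E); last first.
        rewrite muleA -EFinM; apply: eq_leW; congr (_%:E * _)%E; ring.
      apply: lee_pmul => //.
      + by rewrite lee_fin !mulr_ge0 ?exprn_ge0// sumr_ge0// => j _; exact: (kb_om KB).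
      + by apply: integral_ge0 => x _; rewrite lee_fin cabs_ge0.
      + by rewrite lee_fin ler_pM2l ?mulr_gt0 ?exprn_gt0//; exact: (kb_sum KB).
    rewrite -ge0_sume_distrr; last by move=> c _; rewrite integral_ge0.
    rewrite muleA -EFinM.
    apply: (@le_trans _ _ (((t / 2)^-1 * (6 * 6 ^+ n * So))%:E * I)%E).
      apply: lee_wpmul2l; first by rewrite lee_fin !mulr_ge0 ?exprn_ge0// invr_ge0 ltW.
      by apply: sumD => // c /mem_cs[].
    apply: eq_leW; congr (_%:E * _)%E; field.
    by rewrite gt_eqF.
  apply: le_trans (leeD V_le (leeD GE FE)) _.
  rewrite /I (Ifin mf) -!EFinM !addeA -!EFinD [leRHS]addeC addeAC [X in (_ <= X)%E]addeC.
  rewrite -EFinD leeD2r// lee_fin; apply: eq_leW; field.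
  by rewrite gt_eqF.
apply/lee_addgt0Pr => e e0.
have d0 : 0 < 4 * A / t ^+ 2 + 1 by rewrite ltr_wpDl// divr_ge0 ?exprn_ge0 ?mulr_ge0// ltW.
have [N hN] := rest_small (divr_gt0 e0 d0).
apply: le_trans (step N) _; rewrite leeD2l//.
apply: (@le_trans _ _ ((4 * A / t ^+ 2)%:E * (e / (4 * A / t ^+ 2 + 1))%:E)%E).
  by apply: lee_wpmul2l; rewrite ?lee_fin// divr_ge0 ?exprn_ge0 ?mulr_ge0// ltW.
rewrite -EFinM lee_fin mulrCA ler_piMr ?(ltW e0)// ler_pdivrMr// mul1r; lra.
Qed.

End at_level.

Lemma cz_local_op : local_op 0 (3 ^+ n + 16 * 2 ^+ n.+1 * A + 12 * 6 ^+ n * So) K T.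
Proof.
have So0 : 0 <= So by have := kb_sum KB 0; rewrite big_ord0.
have B0 : 0 <= 3 ^+ n + 16 * 2 ^+ n.+1 * A + 12 * 6 ^+ n * So.
  by rewrite !addr_ge0// !mulr_ge0// exprn_ge0.
split => // s k f t s0 mf fs t0; rewrite powRr0 mulr1.
(* If some cell of side [s] has average above [t], the right-hand side already exceeds the measure
   of the cube. *)
case: (pselect (forall d, (\int[mu]_(x in dcube s d) (cabs (f x))%:E <= (t * s ^+ n)%:E)%E)) => [small|].
  exact: cz_level.
move=> /existsNP[d /negP]; rewrite -ltNge => big.
apply: (@le_trans _ _ (mu (dcube s k))).
  apply: measure_mono; [|exact: measurable_dcube|by move=> x []].
  apply: measurableI; first exact: measurable_dcube.
  rewrite -[X in measurable X]setTI; apply: emeasurable_fun_o_infty => //.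
  by apply: measurable_cabsE; exact: Tmeas.
rewrite measure_dcube//; apply: (@le_trans _ _ ((1 / t)%:E * (t * s ^+ n)%:E)%E).
  by rewrite -EFinM lee_fin mulrA divfK// ?mul1r// gt_eqF.
apply: lee_pmul => //.
- by rewrite lee_fin divr_ge0// ltW.
- by rewrite lee_fin mulr_ge0 ?exprn_ge0// ltW.
- rewrite lee_fin ler_pM2r ?invr_gt0//.
  have : 1 <= 3 ^+ n :> R by rewrite exprn_ege1// ler1n.
  have : 0 <= 16 * 2 ^+ n.+1 * A by rewrite !mulr_ge0// exprn_ge0.
  have : 0 <= 12 * 6 ^+ n * So by rewrite !mulr_ge0// exprn_ge0.
  lra.
- apply: le_trans (ltW big) _; apply: le_int => // x _; by rewrite lee_fin cabs_ge0.
Qed.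

End calderon_zygmund_weak.

(** * Fractional integral operators *)

Section fractional.
Implicit Types (f g : X -> C) (x y : X).

Lemma measurable_norm_sub x : measurable_fun setT (fun y : X => `|x - y|).
Proof.
apply: (measurableT_comp measurable_rV_norm); apply: measurable_fun_rV => i.
apply: (eq_measurable_fun (fun t : X => x ord0 i - t ord0 i)); first by move=> t _; rewrite !mxE.
by apply: measurable_funB => //; exact: measurable_coord.
Qed.

Lemma measure_set1 x : (0 < n)%N -> mu [set x] = 0%E.
Proof.
move=> n0; have -> : [set x] = cube x 0.
  apply/seteqP; split => y; first by move=> -> i; rewrite addr0 lexx.
  by move=> h; apply/rowP => i; apply/le_anti; have := h i; rewrite addr0 andbC.
by rewrite measure_cube// expr0n; case: n n0.
Qed.

Lemma cintZ A z f : measurable A -> cint A f -> cint A (fun x => z * f x).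
Proof.
move=> mA [mf foo]; split; first by apply: cmeasurableM => //; exact: cmeasurable_cst.
under eq_integral do rewrite cabsM EFinM.
rewrite int_scale ?cabs_ge0//; [|exact: measurable_cabsE|by move=> x; rewrite lee_fin cabs_ge0].
by apply: lte_mul_pinfty; rewrite ?lee_fin ?cabs_ge0.
Qed.

Lemma side_small (s r : R) : 0 < s -> 0 < r -> exists N, forall j, (N <= j)%N -> side s j <= r.
Proof.
move=> s0 r0; exists (Num.bound (s / r)) => j Nj.
rewrite /side ler_pdivrMr ?exprn_gt0// mulrC -ler_pdivrMr//.
apply: le_trans (ltW (archi_boundP _)) _; first by rewrite divr_ge0// ltW.
by rewrite -natrX ler_nat (leq_trans Nj)// ltnW// ltn_expl.
Qed.

Variable al : R.
Hypotheses (al0 : 0 < al) (aln : al < n%:R).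

Let n0 : (0 < n)%N.
Proof. by rewrite -(ltr0n R); exact: lt_trans aln. Qed.

Let pot x y := `|x - y| `^ (al - n%:R).

Let q : R := 2 `^ (- al).
Let q0 : 0 < q. Proof. exact: powR_gt0. Qed.
Let q1 : q < 1.
Proof.
rewrite /q powRN invf_lt1 ?powR_gt0// -[ltLHS](powRr0 2) /powR gt_eqF// ltr_expR mul0r.
by rewrite mulr_gt0// ln_gt0// ltr1n.
Qed.

(** The sum of the geometric series of ratio [2 ^ (- al)] over the shells around a point, times the
    loss [2 ^ (n - al)] from using the inner radius of a shell. *)
Let Cr := 2 `^ (n%:R - al) / (1 - q).
Let Cr0 : 0 <= Cr. Proof. by rewrite divr_ge0 ?powR_ge0// subr_ge0 ltW. Qed.

Let CrS0 s : 0 <= Cr * s `^ al. Proof. exact: mulr_ge0 Cr0 (powR_ge0 _ _). Qed.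

Let mpot x : measurable_fun setT (fun y => (pot x y)%:E).
Proof. by apply: measurable_powRE; exact: measurable_norm_sub. Qed.

(** By convention 0 to a nonzero power is 0, so the potential ignores the diagonal point, which is
    negligible anyway. *)
Let potxx x : pot x x = 0.
Proof. by rewrite /pot subrr normr0 powR0// subr_eq0 lt_eqF. Qed.

Lemma potential_le (s : R) (h : X -> \bar R) x : 0 < s -> measurable_fun setT h ->
  (forall y, 0 <= h y)%E ->
  (\int[mu]_(y in triple s (idx s x)) ((pot x y)%:E * h y) <= (Cr * s `^ al)%:E * maxf s h x)%E.
Proof.
move=> s0 mh h0; set M := maxf s h x.
have M0 : (0 <= M)%E by exact: maxf_ge0.
have sj j : 0 < side s j by exact: side_gt0.
pose tr j : set X := triple (side s j) (idx (side s j) x).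
have mtr j : measurable (tr j) by exact: measurable_triple.
have ml : measurable_fun setT (fun y => ((pot x y)%:E * h y)%E) by exact: emeasurable_funM.
have l0 y : (0 <= (pot x y)%:E * h y)%E by rewrite mule_ge0// lee_fin powR_ge0.
have trS j : tr j.+1 `<=` tr j.
  have e : side s j = 2 * side s j.+1 by rewrite (sideD s j 1) expr1 addn1.
  by move=> y; rewrite /tr e idx_par//; exact: triple_par.
have tr0 j : tr j `<=` tr 0.
  by elim: j => // j ih; exact: subset_trans (trS j) ih.
have key N : (\int[mu]_(y in tr 0%N `\` tr N) ((pot x y)%:E * h y) <=
    (2 `^ (n%:R - al) * s `^ al * ((1 - q ^+ N) / (1 - q)))%:E * M)%E.
  elim: N => [|N ih].
    by rewrite setDv integral_set0 expr0 subrr mul0r mulr0 mul0e.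
  apply: (@le_trans _ _ (\int[mu]_(y in (tr 0%N `\` tr N) `|` (tr N `\` tr N.+1)) ((pot x y)%:E * h y))%E).
    apply: le_int => // y [h1 h2].
    by have [h3|h3] := pselect (tr N y); [right|left].
  apply: le_trans (int_setU_le _ _ _ _ _) _ => //; try exact: measurableD.
  have -> : ((2 `^ (n%:R - al) * s `^ al * ((1 - q ^+ N.+1) / (1 - q)))%:E * M =
     (2 `^ (n%:R - al) * s `^ al * ((1 - q ^+ N) / (1 - q)))%:E * M +
     (2 `^ (n%:R - al) * s `^ al * q ^+ N)%:E * M)%E.
    rewrite -ge0_muleDl ?lee_fin ?mulr_ge0 ?powR_ge0 ?exprn_ge0 ?invr_ge0 ?subr_ge0 ?exprn_ile1 ?(ltW q0) ?(ltW q1)//.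
    congr (_ * _)%E; rewrite -EFinD; congr EFin; rewrite exprS; field.
    by rewrite subr_eq0 gt_eqF.
  rewrite leeD//.
  apply: (@le_trans _ _ (\int[mu]_(y in tr N) ((side s N.+1 `^ (al - n%:R))%:E * h y))%E).
    apply: le_int => // [y _|y [h1 h2]]; first by rewrite mule_ge0// lee_fin powR_ge0.
    apply: lee_wpmul2r => //; rewrite lee_fin; apply: powR_le_neg => //.
      by rewrite subr_le0 ltW.
    exact: ntriple_dist (dcube_idx _ _) h2.
  rewrite int_scale ?powR_ge0//.
  have -> : (\int[mu]_(y in tr N) h y = (side s N ^+ n)%:E * avg3 (side s N) h (idx (side s N) x))%E.
    by rewrite /avg3 muleA -EFinM mulfV ?mul1e// gt_eqF// exprn_gt0.
  rewrite muleA -EFinM.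
  have e2 : side s N.+1 `^ (al - n%:R) * side s N ^+ n = 2 `^ (n%:R - al) * s `^ al * q ^+ N.
    have -> : side s N.+1 = side s N / 2 by rewrite /side exprSr invfM mulrA.
    rewrite powRM ?(ltW (sj N)) ?invr_ge0// -powR_inv1// -powRrM -powR_mulrn ?(ltW (sj N))//.
    rewrite mulN1r opprB mulrAC -powRD; last by rewrite (gt_eqF (sj N)) implybT.
    rewrite subrK mulrC -mulrA; congr (_ * _); rewrite /side powRM ?(ltW s0) ?invr_ge0 ?exprn_ge0//.
    congr (_ * _); rewrite -[q ^+ N]powR_mulrn ?(ltW q0)// /q -powRrM.
    rewrite -exprVn -powR_mulrn ?invr_ge0// -powR_inv1// -!powRrM; congr powR; ring.
  by rewrite e2; apply: lee_wpmul2l; [rewrite lee_fin !mulr_ge0 ?powR_ge0 ?exprn_ge0 ?(ltW q0)|exact: avg3_le_maxf].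
have mx := @measurable_set1 R n x.
have trE : triple s (idx s x) = tr 0%N by rewrite /tr side0.
rewrite trE; apply: (@le_trans _ _ (\int[mu]_(y in (tr 0%N `\ x) `|` [set x]) ((pot x y)%:E * h y))%E).
  apply: le_int => // y ty; have [->|yx] := eqVneq y x; first by right.
  by left; split => //= /eqP; rewrite (negbTE yx).
apply: le_trans (int_setU_le _ _ _ _ _) _ => //; first exact: measurableD.
rewrite [X in (_ + X)%E](eq_integral (cst 0%E)) ?integral0 ?adde0; last first.
  by move=> y; rewrite inE/= => ->; rewrite potxx mul0e.
apply: (int_exhaust (G := fun N => tr 0%N `\` tr N)) => //.
- apply/nondecreasing_seqP => j; apply/subsetPset => y [h1 h2]; split => // /trS; exact: h2.
- by move=> N; exact: measurableD.
- move=> y [ty /= yx]; have d0 : 0 < `|x - y|.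
    by rewrite normr_gt0 subr_eq0; apply/eqP => e; apply: yx.
  have d2 : 0 < `|x - y| / 2 by rewrite divr_gt0.
  have [N hN] := side_small s0 d2; exists N => //; split => // /(triple_dist (sj _) (dcube_idx _ _)).
  by have := hN N (leqnn _); lra.
move=> N; apply: le_trans (key N) _; apply: lee_wpmul2r => //.
rewrite lee_fin (_ : Cr * s `^ al = 2 `^ (n%:R - al) * s `^ al * (1 - q)^-1); last by rewrite /Cr mulrAC.
rewrite ler_wpM2l ?mulr_ge0 ?powR_ge0// ler_piMl ?invr_ge0 ?subr_ge0 ?(ltW q1)//.
by rewrite gerBl exprn_ge0// ltW.
Qed.

Variables (Ck So : R) (om : nat -> R) (K : X -> X -> R).
Hypothesis KB : kernel_bounds al Ck So om K.

Let habs f y := (cabs (f y))%:E.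
(** Almost every point belongs to this set, and there the kernel integral converges absolutely;
    extension by 0 elsewhere will give a measurable version of the operator. *)
Definition frac_dom f : set X := [set x | (maxf 1 (habs f) x < +oo)%E].
Definition frac_op f : X -> C := crestr (frac_dom f) (kernel_integral K f).

Let mhabs f : mclass f -> measurable_fun setT (habs f).
Proof. by move=> mf; apply: measurable_cabsE; exact: mclass_meas. Qed.

Let habs0 f y : (0 <= habs f y)%E. Proof. by rewrite lee_fin cabs_ge0. Qed.

Lemma measurable_frac_dom f : measurable (frac_dom f).
Proof.
rewrite /frac_dom -[X in measurable X]setTI; apply: emeasurable_fun_infty_o => //.
exact: measurable_maxf.
Qed.

Lemma frac_dom_ae f : mclass f -> {ae mu, forall x, frac_dom f x}.
Proof.
move=> mf; exists (~` frac_dom f); split => //; first by apply: measurableC; exact: measurable_frac_dom.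
apply/eqP; rewrite eq_le measure_ge0 andbT; apply/lee_addgt0Pr => e e0; rewrite add0e.
set I := fine (\int[mu]_x habs f x)%E.
have IE : (\int[mu]_x habs f x)%E = I%:E by exact: real_int (mclass_cint _ mf).
have I0 : 0 <= I by rewrite fine_ge0// integral_ge0.
pose t := 9 ^+ n * (I + 1) / e.
have t0 : 0 < t by rewrite divr_gt0// mulr_gt0 ?exprn_gt0// ltr_wpDl.
have := maxf_weak ltr01 (mhabs mf) (@habs0 f) t0.
rewrite IE -EFinM => h; apply: le_trans (le_trans _ h) _.
  apply: measure_mono; [by apply: measurableC; exact: measurable_frac_dom| |].
    rewrite -[X in measurable X]setTI; apply: emeasurable_fun_o_infty => //.
    exact: measurable_maxf.
  by move=> x /= /negP; rewrite -leNgt leye_eq => /eqP ->; exact: ltry.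
rewrite lee_fin (_ : 9 ^+ n / t * I = e * (I / (I + 1))).
  by rewrite ler_piMr ?(ltW e0)// ler_pdivrMr ?ltr_wpDl// mul1r lerDl.
by rewrite /t; field; rewrite expf_neq0// !gt_eqF// ltr_wpDl.
Qed.

Let KpotE x y : x != y -> `|K x y| <= Ck * pot x y. Proof. exact: (kb_size KB). Qed.

Let ae_neq x : {ae mu, forall y : X, x != y}.
Proof.
exists [set x]; split; [exact: measurable_set1|exact: measure_set1|].
by move=> y /= /negP; rewrite negbK => /eqP.
Qed.

Let mK f x : mclass f -> cmeasurable (fun y => (K x y)%:C%C * f y).
Proof.
move=> mf; apply: cmeasurableM (mclass_meas mf); apply: cmeasurable_real; exact: (kb_meas KB).
Qed.

Let pot_int f (s : R) x : 0 < s -> mclass f ->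
  (\int[mu]_y ((pot x y)%:E * habs f y) <= (Cr * s `^ al)%:E * maxf s (habs f) x +
    (s `^ (al - n%:R))%:E * \int[mu]_(y in ~` triple s (idx s x)) habs f y)%E.
Proof.
move=> s0 mf; have mt : measurable (triple s (idx s x) : set X) by exact: measurable_triple.
have mp : measurable_fun setT (fun y => (pot x y)%:E * habs f y)%E.
  by apply: emeasurable_funM => //; exact: mhabs.
rewrite -(setUv (triple s (idx s x))); apply: le_trans (int_setU_le _ _ _ _ _) _ => //.
- exact: measurableC.
- by move=> y; rewrite mule_ge0// lee_fin powR_ge0.
apply: leeD; first by apply: potential_le => //; exact: mhabs.
rewrite -(int_scale _ (measurableC mt) (mhabs mf) (@habs0 f) (powR_ge0 _ _)).
have p0 (r : R) y : 0 <= r -> (0 <= r%:E * habs f y)%E by move=> r0; rewrite mule_ge0.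
apply: le_int => // [y _|y _|y ty]; try exact/p0/powR_ge0.
apply: lee_wpmul2r => //; rewrite lee_fin; apply: powR_le_neg => //.
  by rewrite subr_le0 ltW.
exact: ntriple_dist (dcube_idx _ _) ty.
Qed.

Let Kint f x : mclass f -> (\int[mu]_y (cabs ((K x y)%:C%C * f y))%:E <=
  Ck%:E * \int[mu]_y ((pot x y)%:E * habs f y))%E.
Proof.
move=> mf; have mp : measurable_fun setT (fun y => (pot x y)%:E * habs f y)%E.
  by apply: emeasurable_funM => //; exact: mhabs.
rewrite -int_scale ?(kb_Ck KB)//; last by move=> y; rewrite mule_ge0// lee_fin powR_ge0.
apply: ae_le_int => //.
- by apply: measurable_cabsE; exact: mK.
- exact: emeasurable_funM.
- by move=> y; rewrite lee_fin cabs_ge0.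
- by move=> y; apply: mule_ge0; [rewrite lee_fin (kb_Ck KB)|rewrite mule_ge0// lee_fin powR_ge0].
apply: filterS (ae_neq x) => y xy _; rewrite cabsM cabs_real -!EFinM lee_fin mulrA.
by rewrite ler_wpM2r ?cabs_ge0// KpotE.
Qed.

Lemma frac_dom_cint f x : mclass f -> frac_dom f x -> cint setT (fun y => (K x y)%:C%C * f y).
Proof.
move=> mf dx; split; first exact: mK.
apply: le_lt_trans (Kint x mf) _; apply: lte_mul_pinfty; rewrite ?lee_fin ?(kb_Ck KB)//.
apply: le_lt_trans (pot_int x ltr01 mf) _; apply: lte_add_pinfty.
  by apply: lte_mul_pinfty; rewrite ?lee_fin ?CrS0.
apply: lte_mul_pinfty; rewrite ?lee_fin ?powR_ge0//.
apply: le_lt_trans (mclass_int 0 mf); apply: le_int => // y _; by rewrite ?lee_fin ?expr1 ?cabs_ge0.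
Qed.

Lemma frac_lin z f g : mclass f -> mclass g ->
    {ae mu, forall x, frac_op (fun y => z * f y + g y) x = z * frac_op f x + frac_op g x}.
Proof.
move=> mf mg; have mfg := mclassD (mclassZ z mf) mg.
apply: filterS3 (frac_dom_ae mf) (frac_dom_ae mg) (frac_dom_ae mfg) => x df dg dfg.
rewrite /frac_op /crestr; have -> := mem_set dfg; have -> := mem_set df; have -> := mem_set dg.
have cf := frac_dom_cint mf df; have cg := frac_dom_cint mg dg.
rewrite /kernel_integral -cintegralZ// -cintegralD//.
  by congr cintegral; apply/funext => y; ring.
exact: cintZ.
Qed.

Let part (b : bool) (z : C) : R := if b then complex.Re z else complex.Im z.

Let frac_cvg (b : bool) f x : mclass f -> frac_dom f x ->
  part b (kernel_integral K (crestr (~` triple (side (1 : R) j) (idx (side (1 : R) j) x)) f)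
    (corner (side (1 : R) j) (idx (side (1 : R) j) x))) @[j --> \oo] --> part b (kernel_integral K f x).
Proof.
move=> mf dx; have sj j : 0 < side (1 : R) j by exact: side_gt0.
pose c j := corner (side (1 : R) j) (idx (side (1 : R) j) x).
pose fj j := crestr (~` triple (side (1 : R) j) (idx (side (1 : R) j) x)) f.
have mtr j : measurable (~` triple (side (1 : R) j) (idx (side (1 : R) j) x) : set X) by apply: measurableC; exact: measurable_triple.
have mfj j : mclass (fj j) by exact: mclass_restr.
have xc j : `|x - c j| < side (1 : R) j by apply: dcube_dist => //; exact: dcube_corner.
pose F j y := (part b ((K (c j) y)%:C%C * fj j y))%:E.
pose F0 y := (part b ((K x y)%:C%C * f y))%:E.
have mpart (g : X -> C) : cmeasurable g -> measurable_fun setT (fun y => (part b (g y))%:E).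
  by move=> [h1 h2]; apply/measurable_EFinP; rewrite /part; case: (b).
have part_le z : `|part b z| <= cabs z by rewrite /part; case: (b); [exact: Re_le_cabs|exact: Im_le_cabs].
have partM (r : R) z : part b (r%:C%C * z) = r * part b z.
  by rewrite /part; case: z => u v; case: (b) => /=; rewrite mul0r ?subr0 ?addr0.
have part0 : part b 0 = 0 by rewrite /part; case: (b).
pose G y := ((Ck * 2 `^ (n%:R - al))%:E * ((pot x y)%:E * habs f y))%E.
have mG : measurable_fun setT G.
  by apply: emeasurable_funM => //; apply: emeasurable_funM => //; exact: mhabs.
have p2 : 0 <= Ck * 2 `^ (n%:R - al) by rewrite mulr_ge0 ?powR_ge0 ?(kb_Ck KB).
have p3 y : (0 <= (pot x y)%:E * habs f y)%E by rewrite mule_ge0// lee_fin powR_ge0.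
have G0 y : (0 <= G y)%E by apply: mule_ge0 => //; rewrite lee_fin.
have iG : mu.-integrable setT G.
  apply/integrableP; split => //; under eq_integral do rewrite gee0_abs//.
  rewrite int_scale//; last by apply: emeasurable_funM => //; exact: mhabs.
  apply: lte_mul_pinfty; rewrite ?lee_fin//.
  apply: le_lt_trans (pot_int x ltr01 mf) _; apply: lte_add_pinfty.
    by apply: lte_mul_pinfty; rewrite ?lee_fin ?CrS0.
  apply: lte_mul_pinfty; rewrite ?lee_fin ?powR_ge0//.
  apply: le_lt_trans (mclass_int 0 mf); apply: le_int => // y _; by rewrite ?lee_fin ?expr1 ?cabs_ge0.
have dom : {ae mu, forall y, forall j, setT y -> (`|F j y| <= G y)%E}.
  apply/aeW => y j _; rewrite /F abse_EFin.
  have [ty|ty] := pselect (triple (side (1 : R) j) (idx (side (1 : R) j) x) y).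
    by rewrite /fj /crestr memNset ?mulr0 ?part0 ?normr0//; exact.
  have d1 : side (1 : R) j <= `|x - y| by exact: ntriple_dist (dcube_idx _ _) ty.
  have d2 : side (1 : R) j <= `|c j - y| by apply: ntriple_dist ty => //; exact: dcube_corner.
  have d3 : `|x - y| / 2 <= `|c j - y|.
    have := ler_normD (x - c j) (c j - y); rewrite subrKA; have := xc j; lra.
  have nz z : side (1 : R) j <= `|z - y| -> z != y.
    by move=> h; rewrite -subr_eq0 -normr_gt0; exact: lt_le_trans h.
  rewrite partM normrM /G -!EFinM lee_fin mulrA; apply: ler_pM => //; last first.
    by apply: le_trans (part_le _) _; rewrite /fj /crestr; case: ifP; rewrite ?cabs0 ?cabs_ge0.
  apply: le_trans (KpotE (nz _ d2)) _; rewrite -mulrA ler_wpM2l ?(kb_Ck KB)//.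
  apply: le_trans (powR_le_neg _ _ d3) _; first by rewrite subr_le0 ltW.
    by rewrite divr_gt0// (lt_le_trans (sj j)).
  rewrite powRM ?invr_ge0// -powR_inv1// -powRrM mulN1r opprB mulrC; exact: lexx.
have conv : {ae mu, forall y, setT y -> F j y @[j --> \oo] --> F0 y}.
  apply: filterS (ae_neq x) => y xy _; apply: cvg_EFin; first exact: nearW.
  have d0 : 0 < `|x - y| by rewrite normr_gt0 subr_eq0.
  have p0 : 0 < pot x y by rewrite /pot powR_gt0.
  apply/cvgrPdist_le => e e0.
  have f1 : 0 < cabs (f y) + 1 by rewrite ltr_wpDl ?cabs_ge0.
  have [h h0 H] := kb_small KB (divr_gt0 e0 (mulr_gt0 p0 f1)).
  have d02 : 0 < `|x - y| / 2 by rewrite divr_gt0.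
  have [N1 HN1] := side_small ltr01 d02.
  have [N2 HN2] := side_small ltr01 (mulr_gt0 h0 d0).
  exists (N1 + N2)%N => // j /= Nj.
  have j1 := HN1 j (leq_trans (leq_addr _ _) Nj); have j2 := HN2 j (leq_trans (leq_addl _ _) Nj).
  have ty : ~ triple (side (1 : R) j) (idx (side (1 : R) j) x) y.
    by move=> /(triple_dist (sj j) (dcube_idx _ _)); lra.
  rewrite /fj /crestr mem_set// !partM -mulrBl normrM.
  have := H x (c j) y xy (ltW (lt_le_trans (xc j) j2)) => K1.
  apply: le_trans (ler_pM (normr_ge0 _) (normr_ge0 _) K1 (part_le _)) _.
  rewrite -/(pot x y) (_ : _ * pot x y * _ = e * (cabs (f y) / (cabs (f y) + 1))).
    by rewrite ler_piMr ?(ltW e0)// ler_pdivrMr// mul1r lerDl.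
  by field; rewrite !gt_eqF.
have mF j : measurable_fun setT (F j) by apply: mpart; apply: mK.
have mF0 : measurable_fun setT F0 by apply: mpart; exact: mK.
have [iF0 _ lim] := dominated_convergence measurableT mF mF0 conv iG dom.
have E : (\int[mu]_y F0 y)%E = (fine (\int[mu]_y F0 y)%E)%:E.
  by rewrite fineK//; exact: integrable_fin_num.
move: lim; rewrite E => /fine_cvg; rewrite /= /F0 /F.
by rewrite /part; case: (b).
Qed.

Lemma frac_meas f : mclass f -> cmeasurable (frac_op f).
Proof.
move=> mf; have H b : measurable_fun setT (fun x => part b (frac_op f x)).
  have -> : (fun x => part b (frac_op f x)) = (fun x => part b (kernel_integral K f x)) \_ (frac_dom f).
    by apply/funext => x; rewrite patchE /frac_op /crestr; case: ifP => //; rewrite /part; case: b.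
  apply/(measurable_restrictT _ (measurable_frac_dom f)).
  apply: (measurable_fun_cvg (h := fun j x => part b (kernel_integral K
    (crestr (~` triple (side 1 j) (idx (side 1 j) x)) f) (corner (side 1 j) (idx (side 1 j) x))))); last first.
    by move=> x dx; exact: frac_cvg.
  move=> j; apply: measurable_funTS.
  exact: (@measurable_dset_fun _ _ 1 j _ _ (fun k => part b (kernel_integral K
    (crestr (~` triple (side 1 j) k) f) (corner (side 1 j) k)))).
by split; [exact: (H true)|exact: (H false)].
Qed.

Lemma frac_far f : mclass f ->
  {ae mu, forall x, vanishes_near f x -> frac_op f x = kernel_integral K f x}.
Proof.
by move=> mf; apply: filterS (frac_dom_ae mf) => x dx _; rewrite /frac_op /crestr mem_set.
Qed.

(** As [f] vanishes outside the tripled cube, the operator is pointwise at most [2 Ck Cr s ^ al]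
    times the maximal function, and [maxf_weak] applies. The summand 1 makes the constant
    positive. *)
Lemma frac_weak s k f t : 0 < s -> mclass f -> (forall x, ~ triple s k x -> f x = 0) ->
    0 < t -> (mu (dcube s k `&` [set x | (t%:E < (cabs (frac_op f x))%:E)%E]) <=
      (9 ^+ n * (2 * Ck * Cr + 1) * s `^ al / t)%:E * \int[mu]_x (cabs (f x))%:E)%E.
Proof.
move=> s0 mf fs t0; pose B := (2 * Ck * Cr + 1) * s `^ al.
have B1 : 0 <= 2 * Ck * Cr by apply: mulr_ge0 Cr0; rewrite mulr_ge0// (kb_Ck KB).
have B0 : 0 < B by rewrite mulr_gt0 ?powR_gt0// ltr_wpDl.
have mo : measurable_fun setT (fun x => (cabs (frac_op f x))%:E) by apply: measurable_cabsE; exact: frac_meas.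
apply: (@le_trans _ _ (mu [set x | ((t / B)%:E < maxf s (habs f) x)%E])).
  apply: measure_mono.
  - apply: measurableI; first exact: measurable_dcube.
    by rewrite -[X in measurable X]setTI; exact: emeasurable_fun_o_infty.
  - rewrite -[X in measurable X]setTI; apply: emeasurable_fun_o_infty => //.
    exact: measurable_maxf.
  move=> x [xk /= tx]; set M := maxf s (habs f) x.
  have M0 : (0 <= M)%E by apply: maxf_ge0.
  have dx : frac_dom f x.
    apply: contrapT => dx; move: tx; rewrite /frac_op /crestr memNset// cabs0 lte_fin ltNge.
    by rewrite (ltW t0).
  have : (t%:E < (2 * Ck * Cr * s `^ al)%:E * M)%E.
    apply: lt_le_trans tx _; rewrite /frac_op /crestr mem_set//.
    apply: le_trans (cabs_cintegral_le measurableT (frac_dom_cint mf dx)) _.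
    have -> : 2 * Ck * Cr * s `^ al = 2 * (Ck * (Cr * s `^ al)) by rewrite !mulrA.
    rewrite EFinM -muleA; apply: lee_wpmul2l => //; apply: le_trans (Kint x mf) _.
    rewrite EFinM -muleA; apply: lee_wpmul2l; first by rewrite lee_fin (kb_Ck KB).
    apply: le_trans (pot_int x s0 mf) _; rewrite [X in (_ + _ * X)%E](eq_integral (cst 0%E)).
      by rewrite integral0 mule0 adde0.
    by move=> y /set_mem; rewrite xk => ty; rewrite /habs fs// cabs0.
  move: M M0 => [r||] //; last by rewrite ltry.
  rewrite lee_fin -EFinM !lte_fin => r0 h; rewrite ltr_pdivrMr//; apply: lt_le_trans h _.
  rewrite mulrC ler_wpM2l// /B ler_wpM2r ?powR_ge0//; lra.
apply: le_trans (maxf_weak s0 (mhabs mf) (@habs0 f) (divr_gt0 t0 B0)) _.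
apply: lee_wpmul2r; first exact: integral_ge0.
by rewrite lee_fin invf_div /B !mulrA.
Qed.

Lemma frac_local_op : local_op al (9 ^+ n * (2 * Ck * Cr + 1)) K frac_op.
Proof.
split; [|exact: frac_meas|exact: frac_lin|exact: frac_far|exact: frac_weak].
rewrite mulr_ge0 ?exprn_ge0// addr_ge0//; apply: mulr_ge0 Cr0; by rewrite mulr_ge0// (kb_Ck KB).
Qed.

End fractional.

Section rho_type.

Lemma vanishes_near_closure (f : X -> C) x : vanishes_near f x -> ~ closure [set y | f y != 0] x.
Proof.
move=> [r r0 fr] /(_ (ball x r) (nbhsx_ballx _ _ r0))[y [/= /eqP fy]].
by rewrite -ball_normE/= => /fr.
Qed.

Lemma L2_sqr (A : R) (f g : X -> C) : 0 <= A -> (L2norm g <= A%:E * L2norm f)%E ->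
  (\int[mu]_x (cabs (g x) ^+ 2)%:E <= (A ^+ 2)%:E * \int[mu]_x (cabs (f x) ^+ 2)%:E)%E.
Proof.
have E (h : X -> C) : (L2norm h = (\int[mu]_x (cabs (h x) ^+ 2)%:E) `^ 2^-1)%E.
  rewrite /L2norm /wnorm; congr (_ `^ _)%E; apply: eq_integral => x _.
  by rewrite powR1 mulr1 powR_mulrn ?cabs_ge0.
have I0 (h : X -> C) : (0 <= \int[mu]_x (cabs (h x) ^+ 2)%:E)%E.
  by apply: integral_ge0 => x _; rewrite lee_fin exprn_ge0 ?cabs_ge0.
move=> A0; rewrite !E => /(@le_poweR2r _ 2 _ _) -/(_ (ler0n _ _) (poweR_ge0 _ _)).
rewrite poweRM ?poweR_ge0 ?lee_fin// -!poweRrM mulVf// !poweRe1//.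
by rewrite poweR_EFin powR_mulrn.
Qed.

(** For positive [al] the operator is prescribed only where its integral converges, hence the
    measurable version [T'], which agrees with [T] almost everywhere; for [al = 0] it is [T]
    itself. *)
Lemma rho_type_local_op (rho : R -> R) (al : R) K T : 0 <= al -> al < n%:R ->
  dini_modulus rho -> rho_type_operator rho al K T ->
  exists Ck So om B T', [/\ kernel_bounds al Ck So om K, local_op al B K T' &
    forall f, mclass f -> {ae mu, forall x, T' f x = T f x}].
Proof.
move=> al0 aln dini; have n0 : (0 < n)%N by rewrite -(ltr0n R); exact: le_lt_trans aln.
rewrite /rho_type_operator; case: eqVneq => [alE|al1].
  rewrite {al al0 aln}alE => -[sz reg [TL2 Tlin [A TA]] Tfar].
  have [Ck [So [om KB]]] := kernel_boundsP n0 (ler0n _ _) dini sz reg.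
  exists Ck, So, om; have A0 : 0 <= `|A| ^+ 2 by exact: sqr_ge0.
  exists (3 ^+ n + 16 * 2 ^+ n.+1 * `|A| ^+ 2 + 12 * 6 ^+ n * So), T; split => //; last first.
    by move=> f _; apply/aeW.
  apply: cz_local_op KB _ _ _ A0 _.
  - by move=> f /mclass_L2/TL2[].
  - by move=> z f g mf mg; apply: Tlin; exact: mclass_L2.
  - move=> f mf; apply: filterS (Tfar f (mclass_L2 mf)) => x h /vanishes_near_closure; exact: h.
  - move=> f mf; apply: L2_sqr => //; apply: le_trans (TA _ (mclass_L2 mf)) _.
    by apply: lee_wpmul2r; [exact: poweR_ge0|rewrite lee_fin ler_norm].
move=> [sz reg Tf]; have al2 : 0 < al by rewrite lt_neqAle eq_sym al1.
have [Ck [So [om KB]]] := kernel_boundsP n0 (ltW aln) dini sz reg.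
exists Ck, So, om; eexists; exists (frac_op K); split; [exact: KB|exact: (frac_local_op al2 aln KB)|].
move=> f mf; apply: filterS (frac_dom_ae mf) => x dx.
have cK := frac_dom_cint al2 aln KB mf dx.
rewrite Tf; [by rewrite /frac_op /crestr mem_set|exact: mclass_meas|].
by split; [exact: cint_Re cK|exact: cint_Im cK].
Qed.

End rho_type.

(** * Iterated commutators with several symbols *)

Section commutators.
Implicit Types (f g b : X -> C) (bs : seq (X -> C)) (x y : X) (lr : (X -> C) * (X -> C)).

(** The symbols form a list, the head being outermost, so that they can be replaced one at a
    time. *)
Definition comms (T : (X -> C) -> X -> C) bs := foldr commutator T bs.

(* The pairs (l, r) for which l T(r f) occurs in the expansion of the commutator;
   the signs are put in r. *)
Fixpoint splits bs : seq ((X -> C) * (X -> C)) :=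
  if bs is b :: bs' then
    [seq (fun x => b x * lr.1 x, lr.2) | lr <- splits bs'] ++
    [seq (lr.1, fun x => - b x * lr.2 x) | lr <- splits bs']
  else [:: (fun=> 1, fun=> 1)].

Lemma size_splits bs : size (splits bs) = (2 ^ size bs)%N.
Proof. by elim: bs => // b bs ih; rewrite /= size_cat !size_map ih addnn -mul2n expnS. Qed.

Lemma ae_seq (I : eqType) (s : seq I) (P : I -> X -> Prop) :
  (forall i, i \in s -> {ae mu, forall x, P i x}) ->
  {ae mu, forall x, forall i, i \in s -> P i x}.
Proof.
elim: s => [_|i s ih H]; first exact/aeW.
apply: filterS2 (H i (mem_head _ _)) (ih (fun j js => H j (mem_behead _))) => //.
  by move=> x h1 h2 j; rewrite inE => /predU1P[->|/h2].
Qed.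

Definition lmomcs bs := forall b, b \in bs -> lmomc b.

Lemma lmomcs_cons b bs : lmomcs (b :: bs) -> lmomc b /\ lmomcs bs.
Proof. by move=> h; split => [|c cb]; apply: h; rewrite inE ?eqxx ?cb ?orbT. Qed.

Lemma splits_lmomc bs lr : lmomcs bs -> lr \in splits bs -> lmomc lr.1 /\ lmomc lr.2.
Proof.
elim: bs lr => [|b bs ih] lr; first by rewrite inE => _ /eqP -> /=; split; exact: lmomc_cst.
move=> /lmomcs_cons[lb lbs]; rewrite mem_cat => /orP[] /mapP[[l r] /(ih _ lbs)[hl hr] ->] /=.
  by split => //; exact: lmomcM.
split => //; apply: lmomcM => //; rewrite (_ : (fun _ => _) = fun x => -1 * b x).
  by apply: lmomcM => //; exact: lmomc_cst.
by apply/funext => x; rewrite mulN1r.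
Qed.

Section expansion.
Variable T : (X -> C) -> X -> C.
Hypothesis Tlin : forall z f g, mclass f -> mclass g ->
    {ae mu, forall x, T (fun y => z * f y + g y) x = z * T f x + T g x}.

Lemma comms_lin bs z f g : lmomcs bs -> mclass f -> mclass g ->
  {ae mu, forall x, comms T bs (fun y => z * f y + g y) x = z * comms T bs f x + comms T bs g x}.
Proof.
elim: bs f g => [|b bs ih] f g; first by move=> _; exact: Tlin.
move=> /lmomcs_cons[lb lbs] mf mg.
apply: filterS2 (ih _ _ lbs mf mg) (ih _ _ lbs (mclassMl lb mf) (mclassMl lb mg)) => x h1 h2.
rewrite /= /commutator h1 (_ : (fun y => b y * (z * f y + g y)) = fun y => z * (b y * f y) + b y * g y).
  by rewrite h2; ring.
by apply/funext => y; ring.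
Qed.

(** A commutator does not see constants added to its symbols; as [T] is linear only almost
    everywhere, so is this identity. The constant [z b] will be the average of the symbol over a
    cube. *)
Lemma comms_shift bs (z : (X -> C) -> C) f : lmomcs bs -> mclass f ->
  {ae mu, forall x, comms T [seq (fun x => b x - z b) | b <- bs] f x = comms T bs f x}.
Proof.
elim: bs f => [|b bs ih] f; first by move=> _ _; exact/aeW.
move=> /lmomcs_cons[lb lbs] mf; have mbf := mclassMl lb mf.
have mbzf := mclassMl (lmomcB (z b) lb) mf.
apply: filterS3 (ih _ lbs mf) (ih _ lbs mbzf) (comms_lin (- z b) lbs mf mbf) => x h1 h2 h3.
rewrite /= /commutator [X in _ * X - _]h1 [X in _ - X]h2.
rewrite (_ : (fun y => (b y - z b) * f y) = fun y => - z b * f y + b y * f y).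
  by rewrite h3; ring.
by apply/funext => y; ring.
Qed.

Lemma comms_expand bs f : lmomcs bs -> mclass f ->
  {ae mu, forall x, comms T bs f x = \sum_(lr <- splits bs) lr.1 x * T (fun y => lr.2 y * f y) x}.
Proof.
elim: bs f => [|b bs ih] f.
  move=> _ _; apply/aeW => x; rewrite /= big_seq1 mul1r.
  by congr (T _ x); apply/funext => y; rewrite mul1r.
move=> /lmomcs_cons[lb lbs] mf; have mbf := mclassMl lb mf.
have neg : {ae mu, forall x, forall lr, lr \in splits bs ->
    T (fun y => - b y * lr.2 y * f y) x = - T (fun y => lr.2 y * (b y * f y)) x}.
  apply: ae_seq => lr /(splits_lmomc lbs)[_ hr].
  apply: filterS (lin_scale Tlin (-1) (mclassMl hr mbf)) => x; rewrite mulN1r => <-.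
  by congr (T _ x); apply/funext => y; ring.
apply: filterS3 (ih _ lbs mf) (ih _ lbs mbf) neg => x h1 h2 h3.
rewrite /= /commutator h1 h2 big_cat !big_map/= mulr_sumr -sumrN; congr (_ + _).
  by apply: eq_bigr => lr _; rewrite mulrA.
by rewrite big_seq [RHS]big_seq; apply: eq_bigr => lr /h3 ->; rewrite mulrN.
Qed.

Lemma comms_meas bs f : (forall f, mclass f -> cmeasurable (T f)) -> lmomcs bs -> mclass f ->
  cmeasurable (comms T bs f).
Proof.
move=> mT; elim: bs f => [|b bs ih] f; first by move=> _; exact: mT.
move=> /lmomcs_cons[lb lbs] mf; apply: cmeasurableB.
  by apply: cmeasurableM; [case: lb|exact: ih].
by apply: ih => //; exact: mclassMl.
Qed.

End expansion.

(* Dominates every product of the functions b - z b. *)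
Definition Wprod bs (z : (X -> C) -> C) x : R := \prod_(b <- bs) (1 + cabs (b x - z b)).

Lemma Wprod_ge1 bs z x : 1 <= Wprod bs z x.
Proof.
rewrite /Wprod; elim: bs => [|b bs ih]; first by rewrite big_nil.
by rewrite big_cons mulr_ege1// lerDl cabs_ge0.
Qed.

Lemma splits_le bs z lr x : lr \in splits [seq (fun x => b x - z b) | b <- bs] ->
  cabs (lr.1 x) <= Wprod bs z x /\ cabs (lr.2 x) <= Wprod bs z x.
Proof.
have c1 : cabs (1 : C) = 1 by rewrite /= expr0n/= addr0 expr1n sqrtr1.
elim: bs lr => [|b bs ih] lr.
  by rewrite inE => /eqP ->/=; rewrite /Wprod big_nil -[X in X <= _]/(cabs (1 : C)) c1.
rewrite mem_cat => /orP[] /mapP[[l r] /ih[/= hl hr] ->] /=; rewrite /Wprod big_cons -/(Wprod bs z x);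
  have w1 := Wprod_ge1 bs z x; have b0 := cabs_ge0 (b x - z b);
  split; rewrite ?cabsM ?cabsN.
- by apply: ler_pM; rewrite ?cabs_ge0// lerDr.
- by apply: le_trans hr _; rewrite ler_peMl ?lerDl//; lra.
- by apply: le_trans hl _; rewrite ler_peMl ?lerDl//; lra.
- by apply: ler_pM; rewrite ?cabs_ge0// lerDr.
Qed.

Lemma lmom_Wprod bs z : lmomcs bs -> lmom (Wprod bs z).
Proof.
elim: bs => [_|b bs ih /lmomcs_cons[lb lbs]].
  by rewrite (_ : Wprod _ _ = fun=> 1); [exact: lmom_cst|apply/funext => x; rewrite /Wprod big_nil].
rewrite (_ : Wprod _ _ = fun x => (1 + cabs (b x - z b)) * Wprod bs z x); last first.
  by apply/funext => x; rewrite /Wprod big_cons.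
apply: lmomM (ih lbs); apply: lmomD; first exact: lmom_cst.
by have [] := lmomcB (z b) lb.
Qed.

(** The product is at most a power of its largest factor; [M] is that factor, or 1 for the empty
    list, and any power of it is 1 or a term of the sum. *)
Lemma prod_le_sum (I : Type) (s : seq I) (F : I -> R) : (forall i, 1 <= F i) ->
  \prod_(i <- s) F i <= 1 + \sum_(i <- s) F i ^+ size s.
Proof.
move=> F1; have F0 i : 0 <= F i by apply: le_trans (F1 i).
have [M [M1 hM Ms]] : exists M, [/\ 1 <= M, \prod_(i <- s) F i <= M ^+ size s &
    forall N, M ^+ N <= 1 + \sum_(i <- s) F i ^+ N].
  elim: s => [|i s [M [M1 hM Ms]]].
    by exists 1; split=> [||N]; rewrite ?big_nil ?expr1n ?addr0.
  have p0 : 0 <= \prod_(a <- s) F a by rewrite prodr_ge0.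
  have [FM|FM] := leP (F i) M.
    exists M; split=> [||N]; rewrite ?big_cons ?exprS//; first by apply: ler_pM.
    by apply: le_trans (Ms N) _; rewrite lerD2l lerDr exprn_ge0.
  exists (F i); split=> [||N]; rewrite ?big_cons ?exprS//.
    apply: ler_pM => //; apply: le_trans hM _.
    by rewrite lerXn2r ?nnegrE// ?(ltW FM)//; lra.
  have : 0 <= \sum_(a <- s) F a ^+ N by rewrite sumr_ge0// => a _; rewrite exprn_ge0.
  by lra.
exact: le_trans hM (Ms _).
Qed.

Lemma Wprod_moment (m N : nat) : (0 < N)%N -> exists2 Kw : R, 0 <= Kw &
  forall bs, size bs = m -> (forall b, b \in bs -> osc_le 1 b) -> forall s k, 0 < s ->
  (\int[mu]_(x in triple s k) (Wprod bs (cavg s k) x ^+ N)%:E <= (Kw * s ^+ n)%:E)%E.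
Proof.
move=> N0; have mN0 : (0 < N * m + 1)%N by rewrite addn1.
have [K K0 HK] := @john_nirenberg_moment R n _ mN0.
(* The exponent [N * m] produced by [prod_le_sum] is raised by 1 so as to be positive also for
   [m = 0]; the factors are at least 1, so this only increases the bound. *)
pose E := (N * m + 1)%N.
have p3 : 0 <= 3 ^+ n :> R by exact: exprn_ge0.
pose D := 2 ^+ E * (3 ^+ n + K); have D0 : 0 <= D by rewrite mulr_ge0 ?exprn_ge0 ?addr_ge0.
exists (3 ^+ n + m%:R * D); first by rewrite addr_ge0// mulr_ge0.
move=> bs sm ob s k s0; have sn : 0 < s ^+ n by rewrite exprn_gt0.
have mt : measurable (triple s k : set X) by exact: measurable_triple.
pose y b x := 1 + cabs (b x - cavg s k b).
have y1 b x : 1 <= y b x by rewrite lerDl cabs_ge0.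
have lb b : b \in bs -> lmom (y b).
  move=> /ob/osc_le_lmomc lb; apply: lmomD; first exact: lmom_cst.
  by have [] := lmomcB (cavg s k b) lb.
have m1 b : b \in bs -> (\int[mu]_(x in triple s k) (y b x ^+ E)%:E <= (D * s ^+ n)%:E)%E.
  move=> bb; have ob' := ob _ bb.
  have mb : measurable_fun setT (fun x => (cabs (b x - cavg s k b) ^+ E)%:E).
    apply/measurable_EFinP; apply: measurable_funX; apply: measurable_cabs.
    by apply: cmeasurableB; [exact: osc_le_cmeasurable ob'|exact: cmeasurable_cst].
  apply: (@le_trans _ _ (\int[mu]_(x in triple s k) ((2 ^+ E)%:E * (cst 1%:E x + (cabs (b x - cavg s k b) ^+ E)%:E)))%E).
    apply: le_int => // x _; rewrite -?EFinD -?EFinM lee_fin ?mulr_ge0 ?exprn_ge0 ?addr_ge0 ?exprn_ge0 ?cabs_ge0//.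
    by apply: le_trans (exprD_le _ ler01 (cabs_ge0 _)) _; rewrite expr1n.
  rewrite int_scale ?exprn_ge0//; last 2 first.
  - exact: emeasurable_funD.
  - by move=> x; rewrite -EFinD lee_fin addr_ge0// exprn_ge0 ?cabs_ge0.
  rewrite int_add//; last by move=> x; rewrite lee_fin exprn_ge0 ?cabs_ge0.
  rewrite -mulrA [X in (_ <= X)%E]EFinM; apply: lee_wpmul2l; first by rewrite lee_fin exprn_ge0.
  rewrite mulrDl EFinD; apply: leeD; last exact: HK.
  by rewrite integral_cst// mul1e -exprMn; exact: measure_triple_le.
have yE0 b x : 0 <= y b x ^+ E by rewrite exprn_ge0// (le_trans _ (y1 b x)).
have main x : Wprod bs (cavg s k) x ^+ N <= 1 + \sum_(b <- bs) y b x ^+ E.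
  rewrite /Wprod -prodrXl; apply: le_trans (prod_le_sum bs (F := fun b => y b x ^+ N) _) _.
    by move=> b; exact: exprn_ege1.
  rewrite lerD2l sm; apply: ler_sum => b _; rewrite -exprM.
  by rewrite ler_weXn2l// /E addn1.
have sum_le bs' : {subset bs' <= bs} ->
    measurable_fun setT (fun x => (1 + \sum_(b <- bs') y b x ^+ E)%:E) /\
    (\int[mu]_(x in triple s k) (1 + \sum_(b <- bs') y b x ^+ E)%:E <=
      ((3 ^+ n + (size bs')%:R * D) * s ^+ n)%:E)%E.
  elim: bs' => [_|b bs' ih sub].
    under eq_fun do rewrite big_nil addr0; split; first exact: measurable_cst.
    by rewrite integral_cst// mul1e mul0r addr0 -exprMn measure_triple_le.
  have bb : b \in bs by apply: sub; rewrite mem_head.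
  have [mS IS] := ih (fun c cb => sub c (mem_behead (s := b :: bs') cb)).
  have mb : measurable_fun setT (fun x => (y b x ^+ E)%:E).
    by apply/measurable_EFinP; apply: measurable_funX; case: (lb _ bb).
  have eS x : ((1 + \sum_(c <- b :: bs') y c x ^+ E)%:E = (y b x ^+ E)%:E + (1 + \sum_(c <- bs') y c x ^+ E)%:E)%E.
    by rewrite big_cons -EFinD addrCA.
  have S0 x : (0 <= (1 + \sum_(c <- bs') y c x ^+ E)%:E)%E.
    by rewrite lee_fin addr_ge0// sumr_ge0.
  split; first by under eq_fun do rewrite eS; exact: emeasurable_funD.
  under eq_integral do rewrite eS.
  rewrite int_add//; last by move=> x; rewrite lee_fin.
  apply: le_trans (leeD (m1 _ bb) IS) _; rewrite -EFinD lee_fin /= -natr1.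
  by apply: eq_leW; ring.
have [_] := sum_le bs (fun _ => id); rewrite sm; apply: le_trans.
apply: le_int => // x _; rewrite lee_fin ?exprn_ge0 ?addr_ge0 ?sumr_ge0//.
by rewrite (le_trans _ (Wprod_ge1 _ _ _)).
Qed.

End commutators.

(** * Pointwise control off stopping cubes *)

Section sparse.
Implicit Types (f g b : X -> C) (bs : seq (X -> C)) (x y : X) (lr : (X -> C) * (X -> C)).
Variables (al Ck So B : R) (om : nat -> R) (K : X -> X -> R) (T : (X -> C) -> X -> C).
Hypotheses (al0 : 0 <= al) (aln : al <= n%:R) (KB : kernel_bounds al Ck So om K) (LO : local_op al B K T).

Let So0 : 0 <= So. Proof. by have := kb_sum KB 0; rewrite big_ord0. Qed.
Let B0 : 0 <= B. Proof. exact: (lo_B LO). Qed.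

(** On the shell of scale [2 ^ j t] the kernel difference, of size [om j], meets an average of [g]
    over a tripled ancestor, at most [D]; what remains is [(2 ^ j t) ^ al <= s ^ al], and the moduli
    sum to at most [So]. *)
Lemma far_diff g (t s D : R) d i x x' : 0 < t -> 0 <= D -> mclass g -> 2 ^+ i * t = s ->
  (forall y, triple t d y -> g y = 0) -> (forall y, ~ triple s (iter i par d) y -> g y = 0) ->
  (forall j, (j < i)%N ->
    \int[mu]_(y in triple (2 ^+ j.+1 * t) (iter j.+1 par d)) (cabs (g y))%:E <=
      (D * (2 ^+ j.+1 * t) ^+ n)%:E)%E ->
  dcube t d x -> dcube t d x' ->
  cabs (kernel_integral K g x - kernel_integral K g x') <= 2 * 2 ^+ n * So * D * s `^ al.
Proof.
move=> t0 D0 mg sE gin gout HD dx dx'.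
have pj j : 0 < 2 ^+ j * t by rewrite mulr_gt0// exprn_gt0.
have vn z : dcube t d z -> vanishes_near g z.
  move=> dz; exists t => // y zy; apply: gin; apply: contrapT => ty.
  by have := ntriple_dist t0 dz ty; rewrite leNgt zy.
have c1 := kernel_cint KB aln mg (vn _ dx); have c2 := kernel_cint KB aln mg (vn _ dx').
have c2' := cintN c2.
have -> : kernel_integral K g x - kernel_integral K g x' =
    cintegral setT (fun y => (K x y)%:C%C * g y + - ((K x' y)%:C%C * g y)).
  by rewrite cintegralD// cintegralN.
rewrite -lee_fin; apply: le_trans (cabs_cintegral_le measurableT (cintD measurableT c1 c2')) _.
pose F j y := ((om j * (2 ^+ j * t) `^ (al - n%:R))%:E *
  (\1_(triple (2 ^+ j.+1 * t) (iter j.+1 par d)) y * cabs (g y))%:E)%E.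
have c0 j : 0 <= om j * (2 ^+ j * t) `^ (al - n%:R) by rewrite mulr_ge0 ?powR_ge0 ?(kb_om KB).
have mtr j : measurable (triple (2 ^+ j.+1 * t) (iter j.+1 par d) : set X) by exact: measurable_triple.
have mh j : measurable_fun setT (fun y => (\1_(triple (2 ^+ j.+1 * t) (iter j.+1 par d)) y * cabs (g y))%:E).
  apply/measurable_EFinP; apply: measurable_funM; first exact: measurable_indic.
  by apply: measurable_cabs; exact: mclass_meas.
have h0 j y : (0 <= (\1_(triple (2 ^+ j.+1 * t) (iter j.+1 par d)) y * cabs (g y))%:E)%E.
  by rewrite lee_fin mulr_ge0 ?cabs_ge0.
have mF j : measurable_fun setT (F j) by exact: emeasurable_funM.
have F0 j y : (0 <= F j y)%E by rewrite mule_ge0// lee_fin.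
have pw y : ((cabs ((K x y)%:C%C * g y + - ((K x' y)%:C%C * g y)))%:E <= \sum_(j < i) F j y)%E.
  have [gy|gy] := eqVneq (g y) 0.
    by rewrite gy !mulr0 subrr cabs0 sume_ge0.
  have ex : exists j, (j < i)%N /\ triple (2 ^+ j.+1 * t) (iter j.+1 par d) y /\
      ~ triple (2 ^+ j * t) (iter j par d) y.
    have ti : triple (2 ^+ i * t) (iter i par d) y.
      by rewrite sE; apply: contrapT => /gout /eqP; rewrite (negbTE gy).
    have t0' : ~ triple (2 ^+ 0 * t) (iter 0 par d) y.
      by rewrite expr0 mul1r => /gin /eqP; rewrite (negbTE gy).
    elim: (i) ti => [/t0'//|j ih tj].
    have [h|h] := pselect (triple (2 ^+ j * t) (iter j par d) y); last by exists j.
    by have [l [lj hl]] := ih h; exists l; split => //; exact: ltnW.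
  have [j [ji [tj ntj]]] := ex.
  rewrite (bigD1 (Ordinal ji))//=; apply: (@le_trans _ _ (F j y)); last by rewrite leeDl// sume_ge0.
  rewrite /F indicE mem_set// mul1r -EFinM lee_fin -mulrBl -rmorphB cabsM cabs_real.
  rewrite ler_wpM2r ?cabs_ge0//.
  have dist z : dcube t d z -> 2 ^+ j * t <= `|z - y|.
    by move=> dz; apply: ntriple_dist ntj => //; exact: anc_dcube.
  have := @kb_mod _ _ _ _ _ _ _ KB j t x x' y t0 (ltW (dcube_dist t0 dx dx')) (dist _ dx) (dist _ dx').
  by apply: le_trans; rewrite lerDl.
apply: (@le_trans _ _ (2%:E * \int[mu]_y (\sum_(j < i) F j y))%E).
  by apply: lee_wpmul2l => //; apply: le_int => // y _; rewrite ?lee_fin ?cabs_ge0// sume_ge0.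
rewrite ge0_integral_sum//.
apply: (@le_trans _ _ (2%:E * \sum_(j < i) (2 ^+ n * om j * D * s `^ al)%:E)%E).
  apply: lee_wpmul2l => //; apply: lee_sum => j _.
  rewrite int_scale//.
  have -> : (\int[mu]_y (\1_(triple (2 ^+ j.+1 * t) (iter j.+1 par d)) y * cabs (g y))%:E =
     \int[mu]_(y in triple (2 ^+ j.+1 * t) (iter j.+1 par d)) (cabs (g y))%:E)%E.
    rewrite [RHS]integral_mkcond; apply: eq_integral => y _.
    by rewrite patchE indicE; case: ifP => _; rewrite ?mul1r ?mul0r.
  apply: le_trans (lee_wpmul2l _ (HD j (ltn_ord j))) _; first by rewrite lee_fin.
  rewrite -EFinM lee_fin.
  have -> : om j * (2 ^+ j * t) `^ (al - n%:R) * (D * (2 ^+ j.+1 * t) ^+ n) =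
      2 ^+ n * om j * D * (2 ^+ j * t) `^ al.
    rewrite exprS -[2 * 2 ^+ j * t]mulrA exprMn -[(2 ^+ j * t) ^+ n]powR_mulrn ?(ltW (pj j))//.
    have -> : (2 ^+ j * t) `^ al = (2 ^+ j * t) `^ (al - n%:R) * (2 ^+ j * t) `^ n%:R.
      by rewrite -powRD ?subrK// (gt_eqF (pj j)) implybT.
    by ring.
  rewrite ler_wpM2l ?mulr_ge0 ?exprn_ge0 ?(kb_om KB)//; apply: le_powR2r => //; first exact: ltW.
  by rewrite -sE ler_pM2r// ler_weXn2l ?ler1n// ltnW.
rewrite sumEFin -EFinM lee_fin.
have -> : \sum_(j < i) 2 ^+ n * om j * D * s `^ al = 2 ^+ n * D * s `^ al * \sum_(j < i) om j.
  by rewrite mulr_sumr; apply: eq_bigr => j _; ring.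
have -> : 2 * 2 ^+ n * So * D * s `^ al = 2 * (2 ^+ n * D * s `^ al * So) by ring.
by rewrite ler_pM2l// ler_wpM2l ?(kb_sum KB)// !mulr_ge0 ?exprn_ge0 ?powR_ge0.
Qed.

(** The weak type bound at a threshold proportional to the average of [f]. When [J = 0] the
    threshold is 0, and the set where [T f] does not vanish is exhausted by positive thresholds. *)
Lemma weak_level s k f (A J : R) : 0 < s -> 0 < A -> mclass f -> (forall x, ~ triple s k x -> f x = 0) ->
  (\int[mu]_x (cabs (f x))%:E <= J%:E)%E ->
  (mu (dcube s k `&` [set x | ((A * s `^ al * (J / s ^+ n))%:E < (cabs (T f x))%:E)%E]) <=
    (B / A * s ^+ n)%:E)%E.
Proof.
move=> s0 A0 mf fs fJ; have sn : 0 < s ^+ n by rewrite exprn_gt0.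
have sa : 0 < s `^ al by rewrite powR_gt0.
have J0 : 0 <= J by rewrite -lee_fin; apply: le_trans fJ; apply: integral_ge0 => x _; rewrite lee_fin cabs_ge0.
have mT : measurable_fun setT (fun x => (cabs (T f x))%:E) by apply: measurable_cabsE; exact: (lo_meas LO).
have mS (r : \bar R) : measurable [set x | (r < (cabs (T f x))%:E)%E].
  by rewrite -[X in measurable X]setTI; exact: emeasurable_fun_o_infty.
have mD : measurable (dcube s k : set X) by exact: measurable_dcube.
have [JE|J1] := eqVneq J 0; last first.
  have Jp : 0 < J by rewrite lt_neqAle eq_sym J1.
  have t0 : 0 < A * s `^ al * (J / s ^+ n) by rewrite !mulr_gt0 ?invr_gt0.
  apply: le_trans (lo_weak LO s0 mf fs t0) _.
  apply: (@le_trans _ _ ((B * s `^ al / (A * s `^ al * (J / s ^+ n)))%:E * J%:E)%E).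
    by apply: lee_wpmul2l => //; rewrite lee_fin divr_ge0 ?mulr_ge0 ?(ltW sa) ?invr_ge0 ?(ltW sn) ?(ltW A0).
  rewrite -EFinM lee_fin; apply: eq_leW; field.
  by rewrite !gt_eqF.
rewrite JE mul0r mulr0 in fJ *.
have f0 : (\int[mu]_x (cabs (f x))%:E = 0)%E.
  by apply/eqP; rewrite eq_le fJ integral_ge0// => x _; rewrite lee_fin cabs_ge0.
apply: (@le_trans _ _ 0%E); last by rewrite lee_fin mulr_ge0 ?divr_ge0 ?(ltW sn) ?(ltW A0).
rewrite -integral_1; last exact: measurableI.
apply: (int_exhaust (G := fun N => dcube s k `&` [set x | ((N.+1%:R^-1)%:E < (cabs (T f x))%:E)%E])) => //.
- apply/nondecreasing_seqP => N; apply/subsetPset => x [dx /= h]; split => //=.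
  by apply: le_lt_trans h; rewrite lee_fin lef_pV2 ?posrE// ler_nat.
- by move=> N; exact: measurableI.
- move=> x [dx /=]; rewrite lte_fin => h; exists (Num.bound (cabs (T f x))^-1) => //; split => //=.
  rewrite lte_fin invf_plt ?posrE//; apply: lt_trans (archi_boundP _) _; first by rewrite invr_ge0 ltW.
  by rewrite ltr_nat.
move=> N; rewrite integral_1; last exact: measurableI.
by apply: le_trans (lo_weak LO s0 mf fs _) _; rewrite ?invr_gt0// f0 mule0.
Qed.

Lemma cabsRM (r : R) (z : C) : 0 <= r -> cabs (r%:C%C * z) = r * cabs z.
Proof. by move=> r0; rewrite cabsM cabs_real ger0_norm. Qed.

(* Calderon-Zygmund stopping on the set E where the functions T(r f) or the
   maximal function are large: a stopping cube is at least three quarters outside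
   E, so it contains a point at which everything is controlled. *)
Lemma sparse_step (m : nat) : exists2 C0 : R, 0 < C0 & forall bs, size bs = m -> lmomcs bs ->
  forall f s k, 0 < s -> mclass f -> exists bad,
  let z := cavg s k in let W := Wprod bs z in
  let F := crestr (triple s k) f in
  let lam := s `^ al * (fine (\int[mu]_(x in triple s k) (W x * cabs (f x))%:E)%E / s ^+ n) in
  [/\ bad_set s bad `<=` dcube s k, (mu (bad_set s bad) <= (2^-1 * s ^+ n)%:E)%E,
   {ae mu, forall x, (dcube s k `\` bad_set s bad) x ->
      cabs (comms T bs F x) <= C0 * lam * W x} &
   forall i d, first_bad bad (i, d) -> {ae mu, forall x, dcube (side s i) d x ->
      cabs (comms T bs F x) <= cabs (comms T bs (crestr (triple (side s i) d) f) x) +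
        C0 * lam * W x}].
Proof.
pose M : R := (2 ^ m)%:R; have M1 : 1 <= M by rewrite ler1n expn_gt0.
have M0 : 0 < M by exact: lt_le_trans M1.
(* With [M = 2 ^ m] terms in the expansion, this [A] makes the set [E] of large values fill at most
   [2 ^- (n + 3)] of the cube. Stopping on [E] at density [2 ^- (n + 2)] then selects at most half
   of the cube, and in each stopping cube [E] has density at most [1 / 4]. *)
pose A : R := 2 ^+ n.+3 * (M * B + 9 ^+ n).
have A0 : 0 < A by rewrite mulr_gt0 ?exprn_gt0// ltr_wpDl ?exprn_gt0// mulr_ge0// ltW.
(* Chosen so that the local piece [T (rFP lr)] is large on at most a quarter of a stopping cube. *)
pose A' := 4 * M * B + 1; have A'0 : 0 < A' by rewrite ltr_wpDl// !mulr_ge0// ltW.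
pose C1 := A + A' * A + 2 * 2 ^+ n * So * A.
have C1A : A <= C1.
  have p1 : 0 <= A' * A by rewrite mulr_ge0// ltW.
  have p2 : 0 <= 2 * 2 ^+ n * So * A.
  apply: mulr_ge0 (ltW A0); apply: mulr_ge0 So0; apply: mulr_ge0 => //; exact: exprn_ge0.
  by rewrite /C1; lra.
exists (M * C1); first by rewrite mulr_gt0// (lt_le_trans A0).
move=> bs sm lbs f s k s0 mf; pose z := cavg s k; pose W := Wprod bs z.
pose Q : set X := triple s k; have mQ : measurable Q by exact: measurable_triple.
pose F := crestr Q f; have mF : mclass F by exact: mclass_restr.
pose bz := [seq (fun x => b x - z b) | b <- bs].
have lbz : lmomcs bz by move=> _ /mapP[b /lbs lb ->]; exact: lmomcB.
have W1 x : 1 <= W x by exact: Wprod_ge1.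
have W0 x : 0 <= W x by exact: le_trans (W1 x).
have lW : lmom W by exact: lmom_Wprod.
have sn : 0 < s ^+ n by rewrite exprn_gt0.
have sa : 0 < s `^ al by rewrite powR_gt0.
pose phi x := (W x)%:C%C * F x.
have mphi : mclass phi.
  apply: mclassMl => //; split; first by apply: cmeasurable_real; case: lW.
  by under eq_fun do rewrite cabs_real ger0_norm//.
have phiE x : cabs (phi x) = W x * cabs (F x) by rewrite cabsRM.
have phi_out x : ~ Q x -> phi x = 0 by move=> Qx; rewrite /phi /F /crestr memNset ?mulr0.
pose J := fine (\int[mu]_(x in Q) (W x * cabs (f x))%:E)%E.
have JE : (\int[mu]_x (cabs (phi x))%:E = J%:E)%E.
  have -> : J = fine (\int[mu]_x (cabs (phi x))%:E)%E.
    rewrite /J integral_mkcond; congr fine; apply: eq_integral => x _.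
    by rewrite patchE phiE /F /crestr; case: ifP => _//; rewrite cabs0 mulr0.
  exact: real_int (mclass_cint _ mphi).
have J0 : 0 <= J by rewrite fine_ge0// integral_ge0// => x _; rewrite lee_fin mulr_ge0 ?cabs_ge0.
pose lam := s `^ al * (J / s ^+ n).
have lam0 : 0 <= lam by rewrite mulr_ge0 ?divr_ge0 ?(ltW sa) ?(ltW sn).
have hphi x : (0 <= (cabs (phi x))%:E)%E by rewrite lee_fin cabs_ge0.
have mhphi : measurable_fun setT (fun x => (cabs (phi x))%:E) by apply: measurable_cabsE; exact: mclass_meas.
have mG (G : X -> C) : cmeasurable G -> forall r : \bar R, measurable [set x | (r < (cabs (G x))%:E)%E].
  by move=> mG r; rewrite -[X in measurable X]setTI; apply: emeasurable_fun_o_infty => //; exact: measurable_cabsE.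
have mD j d : measurable (dcube (side s j) d : set X) by apply: measurable_dcube; exact: side_gt0.
have mDk : measurable (dcube s k : set X) by exact: measurable_dcube.
have spl lr : lr \in splits bz -> [/\ lmomc lr.2, forall x, cabs (lr.1 x) <= W x & forall x, cabs (lr.2 x) <= W x].
  move=> lin; split; first by have [] := splits_lmomc lbz lin.
    by move=> x; have [] := splits_le x lin.
  by move=> x; have [] := splits_le x lin.
pose rF lr x := lr.2 x * F x.
pose El lr := dcube s k `&` [set x | ((A * s `^ al * (J / s ^+ n))%:E < (cabs (T (rF lr) x))%:E)%E].
pose E0 := dcube s k `&` [set x | ((A * (J / s ^+ n))%:E < maxf s (fun x => (cabs (phi x))%:E) x)%E].
have mrF lr : lr \in splits bz -> mclass (rF lr) by move=> /spl[lr2 _ _]; exact: mclassMl.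
have rF_le lr x : lr \in splits bz -> cabs (rF lr x) <= cabs (phi x).
  by move=> /spl[_ _ lr2]; rewrite phiE cabsM ler_wpM2r ?cabs_ge0.
have rF_out lr x : ~ Q x -> rF lr x = 0 by move=> Qx; rewrite /rF /F /crestr memNset ?mulr0.
have El_le lr : lr \in splits bz -> measurable (El lr) /\ (mu (El lr) <= (B / A * s ^+ n)%:E)%E.
  move=> lin; split; first by apply: measurableI => //; apply: mG; apply: (lo_meas LO); exact: mrF.
  apply: weak_level (mrF _ lin) (rF_out lr) _ => //.
  by rewrite -JE; apply: le_int => // x _; rewrite lee_fin ?cabs_ge0// rF_le.
have mE0 : measurable E0.
  apply: measurableI => //; rewrite -[X in measurable X]setTI.
  by apply: emeasurable_fun_o_infty => //; exact: measurable_maxf.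
have E0_le : (mu E0 <= (9 ^+ n / A * s ^+ n)%:E)%E.
  have [J1|J1] := eqVneq J 0.
    have -> : E0 = set0.
      rewrite -subset0 => x [_ /=]; rewrite J1 mul0r mulr0 => /lt_maxfP[j]; apply/negP; rewrite -leNgt.
      have I0 : (\int[mu]_(y in triple (side s j) (idx (side s j) x)) (cabs (phi y))%:E = 0)%E.
        apply/eqP; rewrite eq_le integral_ge0// andbT.
        have : (J%:E <= 0)%E by rewrite J1.
        by rewrite -JE; apply: le_trans; apply: le_int.
      by rewrite /avg3 I0 mule0.
    by rewrite measure0 lee_fin mulr_ge0 ?divr_ge0 ?exprn_ge0 ?(ltW A0) ?(ltW s0).
  have Jp : 0 < J by rewrite lt_neqAle eq_sym J1.
  have t0 : 0 < A * (J / s ^+ n) by apply: mulr_gt0 => //; exact: divr_gt0.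
  apply: le_trans (le_trans _ (maxf_weak s0 mhphi hphi t0)) _.
    apply: measure_mono => //; last by move=> x [].
    by rewrite -[X in measurable X]setTI; apply: emeasurable_fun_o_infty => //; exact: measurable_maxf.
  rewrite JE -EFinM lee_fin; apply: eq_leW; field.
  by rewrite !gt_eqF.
pose E := E0 `|` [set x | exists2 lr, lr \in splits bz & El lr x].
have [mE E_le] : measurable E /\ (mu E <= (2^-1 ^+ n.+3 * s ^+ n)%:E)%E.
  have : forall ls : seq ((X -> C) * (X -> C)), {subset ls <= splits bz} ->
      measurable (E0 `|` [set x | exists2 lr, lr \in ls & El lr x]) /\
      (mu (E0 `|` [set x | exists2 lr, lr \in ls & El lr x]) <=
        (((size ls)%:R * (B / A) + 9 ^+ n / A) * s ^+ n)%:E)%E.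
    elim=> [_|lr ls ih sub].
      rewrite (_ : _ `|` _ = E0) ?mul0r ?add0r//.
      by apply/seteqP; split => [x [//|[? ]]|x]; [rewrite in_nil|left].
    have [m1 l1] := El_le lr (sub _ (mem_head _ _)).
    have [m2 l2] := ih (fun c cl => sub c (mem_behead (s := lr :: ls) cl)).
    have -> : E0 `|` [set x | exists2 c, c \in lr :: ls & El c x] =
        El lr `|` (E0 `|` [set x | exists2 c, c \in ls & El c x]).
      apply/seteqP; split => x.
        case=> [h|[c]]; first by right; left.
        by rewrite inE => /predU1P[->|cl] h; [left|right; right; exists c].
      case=> [h|[h|[c cl h]]]; [|by left|]; right; [exists lr => //|exists c => //];
        by rewrite ?mem_head// inE cl orbT.
    split; first exact: measurableU.
    apply: le_trans (measure_setU_le _ m1 m2) _; apply: le_trans (leeD l1 l2) _.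
    rewrite -EFinD lee_fin /= -[(size ls).+1%:R]natr1; apply: eq_leW; ring.
  move=> /(_ (splits bz) (fun _ => id)); rewrite size_splits size_map sm -/M => -[? h]; split => //.
  apply: le_trans h _; rewrite lee_fin ler_pM2r//; apply: eq_leW.
  have MB : M * B + 9 ^+ n != 0 by rewrite gt_eqF// ltr_wpDl ?exprn_gt0// mulr_ge0// ltW.
  rewrite /A exprVn; field; by rewrite MB expf_neq0.
pose I1 x : \bar R := (\1_E x)%:E.
have mI1 : measurable_fun setT I1 by apply/measurable_EFinP; exact: measurable_indic.
have I10 x : (0 <= I1 x)%E by rewrite lee_fin.
have I1E D : measurable D -> (\int[mu]_(x in D) I1 x = mu (D `&` E))%E.
  by move=> mD'; rewrite integral_indic// setIC.
pose th : R := 2^-1 ^+ n.+2; have th0 : 0 < th by rewrite exprn_gt0 ?invr_gt0.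
have thlt1 : th < 1.
  by rewrite /th exprVn invf_lt1 ?exprn_gt0// exprn_egt1// ltr1n.
have fle : (\int[mu]_(x in dcube s k) I1 x <= (th * s ^+ n)%:E)%E.
  rewrite I1E//; apply: (@le_trans _ _ (mu E)); first by apply: measure_mono => //; exact: measurableI.
  apply: le_trans E_le _; rewrite lee_fin ler_pM2r// /th exprS.
  have := th0; rewrite /th; lra.
pose bad := cz_bad s k I1 th.
have bsub : bad_set s bad `<=` dcube s k by exact: cz_set_sub.
have mB : measurable (bad_set s bad) by exact: measurable_bad_set.
exists bad; rewrite -/z -/W -/Q -/F -/J -/lam; split => //.
- have h : (th%:E * mu (bad_set s bad) <= \int[mu]_(x in bad_set s bad) I1 x)%E by exact: cz_set_measure.
  have : (th%:E * mu (bad_set s bad) <= th%:E * (2^-1 * s ^+ n)%:E)%E.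
    apply: le_trans h _; rewrite I1E//; apply: (@le_trans _ _ (mu E)).
      by apply: measure_mono => //; exact: measurableI.
    apply: le_trans E_le _; rewrite -EFinM lee_fin mulrA ler_pM2r// /th exprS; lra.
  by rewrite lee_pmul2l// ?fin_numE// lte_fin.
- have G0 : mu ((dcube s k `\` bad_set s bad) `&` [set x | (th%:E < I1 x)%E]) = 0%E by exact: cz_good_ae.
  have offE : {ae mu, forall x, (dcube s k `\` bad_set s bad) x -> ~ E x}.
    exists ((dcube s k `\` bad_set s bad) `&` [set x | (th%:E < I1 x)%E]); split => //.
      apply: measurableI; first exact: measurableD.
      by rewrite -[X in measurable X]setTI; exact: emeasurable_fun_o_infty.
    move=> x /= /not_implyP[hx /contrapT Ex]; split => //=.
    by rewrite /I1 indicE mem_set.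
  apply: filterS3 (comms_shift (lo_lin LO) z lbs mF) (comms_expand (lo_lin LO) lbz mF) offE => x h1 h2 h3 Qx.
  rewrite -h1 h2; apply: le_trans (cabs_sum _ _) _.
  have step lr : lr \in splits bz -> cabs (lr.1 x * T (rF lr) x) <= W x * (A * lam).
    move=> lin; rewrite cabsM; have [_ l1 _] := spl _ lin.
    apply: ler_pM => //; rewrite ?cabs_ge0//; rewrite leNgt; apply/negP => h.
    apply: (h3 Qx); right; exists lr => //; split; first by case: Qx.
    by rewrite /= lte_fin -mulrA.
  rewrite big_seq; apply: le_trans (ler_sum _ (fun lr lin => step lr lin)) _.
  rewrite -big_seq big_const_seq count_predT iter_addr_0 size_splits size_map sm.
  apply: (@le_trans _ _ (M * A * lam * W x)).
    by rewrite -mulr_natl -/M; apply: eq_leW; ring.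
  rewrite -[X in _ <= X]/(M * C1 * lam * W x).
  by rewrite ler_wpM2r// ler_wpM2r// ler_pM2l.
move=> i d fb; set t := side s i.
have t0 : 0 < t by exact: side_gt0.
have tn : 0 < t ^+ n by rewrite exprn_gt0.
have ts : 2 ^+ i * t = s by rewrite -[X in _ * side s X]add0n -sideD side0.
have ta : t `^ al <= s `^ al.
  apply: le_powR2r => //; first exact: ltW.
  by rewrite -ts ler_peMl ?(ltW t0)// exprn_ege1// ler1n.
have dk : iter i par d = k by case: fb => [[]].
set P3 : set X := triple t d; have mP3 : measurable P3 by exact: measurable_triple.
have P3Q : P3 `<=` Q by have := @triple_iter_par R n i t d t0; rewrite ts dk.
pose P : set X := dcube t d; have mP : measurable P by exact: measurable_dcube.
pose FP := crestr P3 f; have mFP : mclass FP by exact: mclass_restr.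
pose Fo := crestr (Q `\` P3) f.
have mFo : mclass Fo by apply: mclass_restr => //; exact: measurableD.
have FE x : F x = FP x + Fo x.
  rewrite /F /FP /Fo /crestr; have [p3|p3] := pselect (P3 x).
    by rewrite (mem_set p3) (mem_set (P3Q _ p3)) memNset ?addr0// => -[].
  rewrite (memNset p3) add0r; have [qx|qx] := pselect (Q x); first by rewrite !mem_set.
  by rewrite !memNset// => -[].
pose rFP lr x := lr.2 x * FP x; pose rFo lr x := lr.2 x * Fo x.
pose D := A * (J / s ^+ n); have D0 : 0 <= D by rewrite mulr_ge0 ?divr_ge0 ?(ltW A0) ?(ltW sn).
pose JP := fine (\int[mu]_(x in P3) (cabs (phi x))%:E)%E.
have JPE : (\int[mu]_(x in P3) (cabs (phi x))%:E = JP%:E)%E by exact: real_int (mclass_cint _ mphi).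
(* The far piece is first bounded at a point [x'] outside both exceptional sets, where it is a
   difference of two controlled values, and then transported to the other points of the stopping
   cube by [far_diff]. *)
have claim lr : lr \in splits bz ->
    {ae mu, forall x, P x -> cabs (T (rFo lr) x) <= C1 * lam}.
  move=> lin; have [lr2 _ l2W] := spl _ lin.
  have mrP : mclass (rFP lr) by exact: mclassMl.
  have mro : mclass (rFo lr) by exact: mclassMl.
  have gin y : P3 y -> rFo lr y = 0.
    by move=> p3; rewrite /rFo /Fo /crestr memNset ?mulr0// => -[].
  have gout y : ~ Q y -> rFo lr y = 0.
    by move=> qy; rewrite /rFo /Fo /crestr memNset ?mulr0// => -[].
  have go_le y : cabs (rFo lr y) <= cabs (phi y).
    rewrite phiE /rFo cabsM; apply: ler_pM; rewrite ?cabs_ge0//.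
    rewrite /Fo /F /crestr; case: ifPn => [/set_mem[qy _]|_]; first by rewrite mem_set.
    by rewrite cabs0 cabs_ge0.
  have vn x : P x -> vanishes_near (rFo lr) x.
    move=> dx; exists t => // y xy; apply: gin; apply: contrapT => ty.
    by have := ntriple_dist t0 dx ty; rewrite leNgt xy.
  pose G := P `&` [set x | ((A' * t `^ al * (JP / t ^+ n))%:E < (cabs (T (rFP lr) x))%:E)%E].
  have mGG : measurable G by apply: measurableI => //; apply: mG; exact: (lo_meas LO).
  have G_le : (mu G <= (4^-1 * t ^+ n)%:E)%E.
    apply: (@le_trans _ _ (B / A' * t ^+ n)%:E).
      apply: weak_level mrP _ _ => //.
        by move=> y p3; rewrite /rFP /FP /crestr memNset ?mulr0.
      rewrite -JPE [leRHS]integral_mkcond; apply: le_int => // y _.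
      - by rewrite lee_fin cabs_ge0.
      - exact: erestrict_ge0.
      rewrite patchE /rFP /FP /crestr; case: ifPn => [/set_mem p3|_]; last by rewrite mulr0 cabs0.
      rewrite lee_fin cabsM phiE; apply: ler_pM; rewrite ?cabs_ge0//.
      by rewrite /F /crestr mem_set//; exact: P3Q.
    rewrite lee_fin ler_pM2r// ler_pdivrMr//; have : B <= M * B by rewrite ler_peMl.
    by rewrite /A'; lra.
  have PE_le : (mu (P `&` E) <= (4^-1 * t ^+ n)%:E)%E.
    rewrite -I1E//; apply: (@le_trans _ _ (2 ^+ n * th * t ^+ n)%:E); first by apply: cz_first_le fb.
    rewrite lee_fin ler_pM2r//; apply: eq_leW.
    by rewrite /th exprVn !exprS; field; rewrite expf_neq0.
  have far := lo_far LO mro.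
  have sumT : {ae mu, forall x, T (rF lr) x = T (rFP lr) x + T (rFo lr) x}.
    apply: filterS (lin_add (lo_lin LO) mrP mro) => x <-.
    by congr (T _ x); apply/funext => y; rewrite /rF /rFP /rFo FE mulrDr.
  have [x' [Px' Ex' Gx' farx' sumx']] : exists x', [/\ P x', ~ E x', ~ G x',
      T (rFo lr) x' = kernel_integral K (rFo lr) x' &
      T (rF lr) x' = T (rFP lr) x' + T (rFo lr) x'].
    apply: contrapT => H.
    have : (mu P <= mu ((P `&` E) `|` G))%E.
      apply: ae_measure_le => //; first by apply: measurableU => //; exact: measurableI.
      apply: filterS2 far sumT => x h1 h2 Px; have [Ex|Ex] := pselect (E x); first by left.
      right; apply: contrapT => Gx; apply: H; exists x; split => //; exact/h1/vn.
    apply/negP; rewrite -ltNge; apply: (@le_lt_trans _ _ ((4^-1 * t ^+ n)%:E + (4^-1 * t ^+ n)%:E)%E).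
      apply: le_trans (leeD PE_le G_le); apply: measure_setU_le => //; exact: measurableI.
    by rewrite measure_dcube// -EFinD lte_fin; lra.
  have max_le : (maxf s (fun x => (cabs (phi x))%:E) x' <= D%:E)%E.
    rewrite leNgt; apply/negP => h; apply: Ex'; left; split => //=.
    by apply: (sub_dcube_iter s0 dk).
  have avg_le l : (l <= i)%N -> (\int[mu]_(y in triple (2 ^+ l * t) (iter l par d)) (cabs (phi y))%:E <=
      (D * (2 ^+ l * t) ^+ n)%:E)%E.
    move=> li; have := le_trans (avg3_le_maxf s (fun x => (cabs (phi x))%:E) (i - l)%N x') max_le.
    have -> : idx (side s (i - l)) x' = iter l par d.
      by rewrite (idx_side _ l _ s0) subnK// Px'.
    have -> : side s (i - l)%N = 2 ^+ l * t by rewrite (sideD s _ l) subnK.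
    have pl : 0 < (2 ^+ l * t) ^+ n by rewrite exprn_gt0// mulr_gt0// exprn_gt0.
    by rewrite /avg3 (mulrC D) lee_pdivrMl.
  have JP_le : JP / t ^+ n <= D.
    rewrite ler_pdivrMr// -lee_fin -JPE; have := avg_le 0%N (leq0n _).
    by rewrite expr0 mul1r.
  have K' : cabs (kernel_integral K (rFo lr) x') <= (A + A' * A) * lam.
    rewrite -farx'; have -> : T (rFo lr) x' = T (rF lr) x' + - T (rFP lr) x' by rewrite sumx'; ring.
    apply: le_trans (cabsD _ _) _; rewrite cabsN mulrDl; apply: lerD.
      rewrite leNgt; apply/negP => h; apply: Ex'; right; exists lr => //; split.
        by apply: (sub_dcube_iter s0 dk).
      by rewrite /= lte_fin -mulrA.
    apply: le_trans (_ : A' * t `^ al * (JP / t ^+ n) <= _).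
      by rewrite leNgt; apply/negP => h; apply: Gx'; split => //=; rewrite lte_fin.
    rewrite -mulrA -mulrA ler_pM2l// /lam [A * _]mulrCA; apply: ler_pM => //; first exact: powR_ge0.
    by rewrite divr_ge0 ?fine_ge0 ?integral_ge0 ?(ltW tn).
  apply: filterS far => x farx Px; rewrite farx; last exact: vn.
  have -> : kernel_integral K (rFo lr) x = kernel_integral K (rFo lr) x' +
      (kernel_integral K (rFo lr) x - kernel_integral K (rFo lr) x') by ring.
  apply: le_trans (cabsD _ _) _; rewrite /C1 mulrDl lerD//.
  apply: le_trans (@far_diff _ t s D d i _ _ t0 D0 mro ts gin _ _ Px Px') _.
  - by rewrite dk; exact: gout.
  - move=> j ji; apply: le_trans (avg_le j.+1 ji); apply: le_int => // y _; rewrite lee_fin ?cabs_ge0//.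
  by apply: eq_leW; rewrite /D /lam; ring.
have sumU : {ae mu, forall x, comms T bs F x = comms T bs FP x + comms T bs Fo x}.
  apply: filterS (comms_lin (lo_lin LO) 1 lbs mFP mFo) => x; rewrite mul1r => <-.
  by congr (comms T bs _ x); apply/funext => y; rewrite FE mul1r.
have ex : {ae mu, forall x, comms T bs Fo x = \sum_(lr <- splits bz) lr.1 x * T (rFo lr) x}.
  by apply: filterS2 (comms_shift (lo_lin LO) z lbs mFo) (comms_expand (lo_lin LO) lbz mFo) => x <- ->.
apply: filterS3 sumU ex (ae_seq claim) => x h1 h2 h3 Px.
rewrite h1; apply: le_trans (cabsD _ _) _; rewrite lerD2l h2; apply: le_trans (cabs_sum _ _) _.
have step lr : lr \in splits bz -> cabs (lr.1 x * T (rFo lr) x) <= W x * (C1 * lam).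
  move=> lin; rewrite cabsM; have [_ l1 _] := spl _ lin.
  by apply: ler_pM => //; rewrite ?cabs_ge0//; exact: h3.
rewrite big_seq; apply: le_trans (ler_sum _ (fun lr lin => step lr lin)) _.
rewrite -big_seq big_const_seq count_predT iter_addr_0 size_splits size_map sm.
rewrite -[X in _ <= X]/(M * C1 * lam * W x).
by rewrite -mulr_natl -/M; apply: eq_leW; ring.
Qed.

End sparse.

(** * Integration of the pointwise control *)

Section sparse_domination.
Implicit Types (f g b : X -> C) (bs : seq (X -> C)) (x y : X).
Variables (al Ck So B : R) (om : nat -> R) (K : X -> X -> R) (T : (X -> C) -> X -> C).
Hypotheses (al0 : 0 <= al) (aln : al <= n%:R) (KB : kernel_bounds al Ck So om K) (LO : local_op al B K T).

Definition sparse_avg bs f s k : R :=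
  s `^ al * (fine (\int[mu]_(x in triple s k) (Wprod bs (cavg s k) x * cabs (f x))%:E)%E / s ^+ n).

(** The contribution of each cube of the recursion is charged to the part of it off its stopping
    cubes, which has at least half its volume and on which [H] dominates the normalised
    contribution. These parts are disjoint over all generations, so the charges add up to a single
    integral of [H]. *)
Lemma sparse_domination (m : nat) : exists2 C0 : R, 0 < C0 & forall bs, size bs = m -> lmomcs bs ->
  forall f (h : X -> R) (H : X -> \bar R) s, 0 < s -> mclass f ->
  measurable_fun setT h -> (forall x, 0 <= h x) ->
  measurable_fun setT H -> (forall x, 0 <= H x)%E ->
  (forall i k x, dcube (side s i) k x ->
    (sparse_avg bs f (side s i) k / side s i ^+ n)%:E *
      \int[mu]_(x in dcube (side s i) k) (Wprod bs (cavg (side s i) k) x * h x)%:E <= H x)%E ->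
  forall k, (\int[mu]_(x in dcube s k) (cabs (comms T bs (crestr (triple s k) f) x) * h x)%:E <=
    C0%:E * \int[mu]_(x in dcube s k) H x)%E.
Proof.
have [C0 C00 step] := @sparse_step _ _ _ _ _ _ _ al0 aln KB LO m.
exists (2 * C0); first by rewrite mulr_gt0.
move=> bs sm lbs f h H s0 s00 mf mh h0 mH H0 HH k0.
pose P s := exists i, s = side s0 i.
have Ps s : P s -> 0 < s by move=> [i ->]; exact: side_gt0.
(* The case distinction makes [Phi] measurable for every [s], as the induction requires, also when
   [s] is not a side length. *)
pose Phi s k x := (if 0 < s then cabs (comms T bs (crestr (triple s k) f) x) * h x else 0)%:E.
have -> : (\int[mu]_(x in dcube s0 k0) (cabs (comms T bs (crestr (triple s0 k0) f) x) * h x)%:E =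
    \int[mu]_(x in dcube s0 k0) Phi s0 k0 x)%E by apply: eq_integral => x _; rewrite /Phi s00.
have mcm s k : 0 < s -> measurable_fun setT (fun x => cabs (comms T bs (crestr (triple s k) f) x)).
  move=> sp; apply: measurable_cabs; apply: comms_meas (lo_meas LO) lbs _.
  by apply: mclass_restr => //; exact: measurable_triple.
have mPhi s k : measurable_fun setT (Phi s k).
  rewrite /Phi; case E : (0 < s); last exact: measurable_cst.
  by apply/measurable_EFinP; apply: measurable_funM => //; exact: mcm.
have Phi0 s k x : (0 <= Phi s k x)%E.
  by rewrite /Phi; case: ifP => _; rewrite lee_fin// mulr_ge0 ?cabs_ge0.
have mC c : 0 <= c -> measurable_fun setT (fun x => c%:E * H x)%E by move=> _; exact: measurable_funeM.
have C02 : 0 <= 2 * C0 by rewrite mulr_ge0// ltW.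
apply: (@stopping_induction _ _ P Phi (fun s k => (2 * C0)%:E * \int[mu]_(x in dcube s k) H x)%E) => //.
- by move=> _ i [j ->]; exists (j + i)%N; rewrite side_side.
- by move=> s k _; rewrite mule_ge0 ?lee_fin// integral_ge0.
- move=> s k Pss; have sp := Ps _ Pss; have [i si] := Pss.
  have [bad] := step bs sm lbs f s k sp mf; rewrite /=; move=> [bsub badm good badP].
  exists bad; split => // Om mOm IH.
  set W := Wprod bs (cavg s k); set lam := s `^ al * _ in good badP.
  have lam0 : 0 <= lam.
    rewrite mulr_ge0 ?powR_ge0// divr_ge0 ?exprn_ge0 ?(ltW sp)// fine_ge0// integral_ge0// => x _.
    by rewrite lee_fin mulr_ge0 ?cabs_ge0// (le_trans _ (Wprod_ge1 _ _ _)).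
  have W0 x : 0 <= W x by exact: le_trans (Wprod_ge1 _ _ _).
  have mW : measurable_fun setT W by have [] := lmom_Wprod (cavg s k) lbs.
  pose g x := (C0 * lam * (W x * h x))%:E.
  have mg : measurable_fun setT g by apply/measurable_EFinP; apply: measurable_funM => //; exact: measurable_funM.
  have Cl0 : 0 <= C0 * lam by exact: mulr_ge0 (ltW C00) lam0.
  have g0 x : (0 <= g x)%E by rewrite lee_fin; apply: mulr_ge0 => //; exact: mulr_ge0.
  have mB : measurable (bad_set s bad) by exact: measurable_bad_set.
  have mQ : measurable (dcube s k : set X) by exact: measurable_dcube.
  have Q1 : (\int[mu]_(x in dcube s k `\` bad_set s bad) Phi s k x <=
      \int[mu]_(x in dcube s k `\` bad_set s bad) g x)%E.
    apply: ae_le_int => //; first exact: measurableD.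
    apply: filterS good => x h1 Qx; rewrite /Phi sp /g lee_fin mulrA ler_wpM2r//.
    exact: h1.
  have Q2 : (\int[mu]_(x in bad_set s bad `&` ~` Om) Phi s k x <=
      \int[mu]_(x in bad_set s bad `&` setT) ((2 * C0)%:E * H x + g x))%E.
    apply: le_int_bad => //; first exact: measurableC.
    - by apply: emeasurable_funD => //; exact: mC.
    - by move=> x; rewrite adde_ge0// mule_ge0// lee_fin.
    move=> j d fb; rewrite setIT; set t := side s j; set D : set X := dcube t d.
    have tp : 0 < t by exact: side_gt0.
    have mD : measurable D by exact: measurable_dcube.
    apply: (@le_trans _ _ (\int[mu]_(x in D `&` ~` Om) (Phi t d x + g x))%E).
      apply: ae_le_int => //; first by apply: measurableI => //; exact: measurableC.
      - exact: emeasurable_funD.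
      - by move=> x; rewrite adde_ge0.
      apply: filterS (badP j d fb) => x h1 [Dx _]; rewrite /Phi sp tp /g -EFinD lee_fin.
      by have := ler_wpM2r (h0 x) (h1 Dx); rewrite mulrDl -[_ * W x * h x]mulrA.
    rewrite int_add//; last by apply: measurableI => //; exact: measurableC.
    rewrite int_add//; [|exact: mC|by move=> x; rewrite mule_ge0// lee_fin].
    rewrite int_scale//; apply: leeD; first exact: IH.
    by apply: le_int => // x [].
  (* The charge: the factor 2 pays for removing the stopping cubes from the domain. *)
  have Q3 : (\int[mu]_(x in dcube s k) g x <= \int[mu]_(x in dcube s k `\` bad_set s bad) ((2 * C0)%:E * H x))%E.
    pose c := ((lam / s ^+ n)%:E * \int[mu]_(x in dcube s k) (W x * h x)%:E)%E.
    have c0 : (0 <= c)%E.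
      by rewrite mule_ge0 ?integral_ge0// ?lee_fin ?divr_ge0 ?exprn_ge0 ?(ltW sp)// => x _; rewrite lee_fin mulr_ge0.
    have sn : 0 < s ^+ n by rewrite exprn_gt0.
    have -> : (\int[mu]_(x in dcube s k) g x = C0%:E * (c * (s ^+ n)%:E))%E.
      under eq_integral do rewrite /g EFinM.
      rewrite int_scale//; [|by apply/measurable_EFinP; exact: measurable_funM|by move=> x; rewrite lee_fin mulr_ge0].
      by rewrite /c [X in _ = (_ * X)%E]muleAC -EFinM divfK ?gt_eqF// EFinM muleA.
    have half : ((s ^+ n)%:E <= 2%:E * mu (dcube s k `\` bad_set s bad))%E.
      rewrite measure_setD// measure_dcube// ?ltry//.
      have : (mu (dcube s k `&` bad_set s bad) <= (2^-1 * s ^+ n)%:E)%E.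
        by apply: le_trans badm; apply: measure_mono => //; exact: measurableI.
      have : (0 <= mu (dcube s k `&` bad_set s bad))%E by exact: measure_ge0.
      by case: (mu _) => [r| |]// _; rewrite -EFinB -EFinM !lee_fin; lra.
    apply: (@le_trans _ _ (\int[mu]_(x in dcube s k `\` bad_set s bad) ((2 * C0)%:E * c))%E); last first.
      apply: le_int => // [x _|x _|x [Qx _]]; first by rewrite mule_ge0// lee_fin.
        by rewrite mule_ge0// lee_fin.
      by apply: lee_wpmul2l; rewrite ?lee_fin//; rewrite /c /lam /W si; apply: HH; rewrite -si.
    rewrite integral_cst//=; last exact: measurableD.
    rewrite mulrC EFinM -!(muleA C0%:E); apply: lee_wpmul2l; first by rewrite lee_fin ltW.
    by rewrite (muleC 2%:E) -(muleA c); apply: lee_wpmul2l.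
  have Qsplit (F : X -> \bar R) : measurable_fun setT F -> (forall x, 0 <= F x)%E ->
      (\int[mu]_(x in dcube s k `\` bad_set s bad) F x + \int[mu]_(x in bad_set s bad) F x =
       \int[mu]_(x in dcube s k) F x)%E.
    move=> mF F0; rewrite -ge0_integral_setU//; last 3 first.
    - exact: measurableD.
    - exact: measurable_funS (@subsetT _ _) mF.
    - by apply/disj_setPS => x [[_ +]].
    by congr integral; apply/seteqP; split => [x [[]//|/bsub//]|x Qx];
      have [|] := pselect (bad_set s bad x); [right|left].
  rewrite setIT int_add// in Q2; [|exact: mC|by move=> x; rewrite mule_ge0// lee_fin].
  apply: (@le_trans _ _ (\int[mu]_(x in dcube s k `\` bad_set s bad) Phi s k x +
      \int[mu]_(x in bad_set s bad `&` ~` Om) Phi s k x)%E).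
    have mBO : measurable (bad_set s bad `&` ~` Om) by apply: measurableI => //; exact: measurableC.
    apply: (@le_trans _ _ (\int[mu]_(x in (dcube s k `\` bad_set s bad) `|` (bad_set s bad `&` ~` Om)) Phi s k x)%E);
      last by apply: int_setU_le => //; exact: measurableD.
    apply: le_int => // x [Qx Ox]; have [Bx|Bx] := pselect (bad_set s bad x); last by left.
    by right; split => // Omx; apply: Ox.
  apply: le_trans (leeD Q1 Q2) _; rewrite addeCA [X in (_ + X <= _)%E]Qsplit//.
  rewrite -int_scale// -(Qsplit (fun x => (2 * C0)%:E * H x)%E); last 2 first.
  - exact: mC.
  - by move=> x; rewrite mule_ge0// lee_fin.
  by rewrite addeC leeD2r.
by exists 0%N; rewrite side0.
Qed.
End sparse_domination.

Lemma powR_peel_le (K V w s e : R) : 0 <= K -> 0 <= w -> w <= V -> 0 < s -> 0 <= e ->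
  K * (w / s) `^ e * w <= K * (V / s) `^ (1 + e) * s.
Proof.
move=> K0 w0 wV s0 e0; have V0 : 0 <= V / s by rewrite divr_ge0 ?(ltW s0)// (le_trans w0).
have e1 : 1 + e != 0 by rewrite gt_eqF// ltr_wpDr.
rewrite powRD ?(negbTE e1)// powRr1// -!mulrA ler_wpM2l//.
have -> : V * (s^-1 * ((V / s) `^ e * s)) = (V / s) `^ e * V by field; rewrite gt_eqF.
apply: (ler_pM (powR_ge0 _ _) w0 _ wV); apply: (le_powR2r e0); first by rewrite divr_ge0 ?(ltW s0)//.
by rewrite ler_pM2r ?invr_gt0.
Qed.

(** * Weighted averages and the local weighted estimate *)

Section weighted_averages.
Implicit Types (f g b : X -> C) (bs : seq (X -> C)) (x y : X).
Variables (a b A : R) (v u : X -> R) (D : dual_pair a b A v u).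
Let mv := dp_mv D.
Let v0 := dp_v0 D.

Definition wt3 (v : X -> R) s k : R := wt v (cube (corner s k - const_mx s) (3 * s)).

Lemma reverse_hoelder_triple : exists2 e : R, 0 < e & exists2 C : R, 0 <= C &
  forall s k, 0 < s -> (\int[mu]_(x in triple s k) (v x `^ (1 + e))%:E <=
    (C * (wt3 v s k / s ^+ n) `^ (1 + e) * s ^+ n)%:E)%E.
Proof.
have [e e0 [K K0 HK]] := reverse_hoelder D; exists e => //.
exists (3 ^+ n * K) => [|s k s0]; first by rewrite mulr_ge0 ?exprn_ge0.
have sn : 0 < s ^+ n by rewrite exprn_gt0.
set V := wt3 v s k; have V0 : 0 <= V by exact: wt_ge0 D _.
set c := K * (V / s ^+ n) `^ (1 + e).
have c0 : 0 <= c by rewrite mulr_ge0 ?powR_ge0.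
have mvp : measurable_fun setT (fun x => (v x `^ (1 + e))%:E) by exact: measurable_powRE.
have : (avg3 s (fun x => (v x `^ (1 + e))%:E) k <= (3 ^+ n * c)%:E)%E.
  have vp x : (0 <= (v x `^ (1 + e))%:E)%E by rewrite lee_fin powR_ge0.
  have c30 : 0 <= 3 ^+ n * c by apply: mulr_ge0 => //; exact: exprn_ge0.
  rewrite leNgt; apply/negP => /(lt_avg3_neighbor s0 mvp vp c30)[d [adj]]; apply/negP.
  rewrite -leNgt (mulrAC _ c) mulfV ?mul1r ?expf_neq0//.
  have dt : dcube s d `<=` cube (corner s k - const_mx s) (3 * s).
    by move=> x dx; apply: (triple_sub_cube s0) => i; rewrite dx.
  have dV : wt v (dcube s d) <= V.
    apply: (wt_mono D _ _ dt (@subset_refl _ _)) => //; [exact: measurable_dcube|exact: measurable_cube|by rewrite mulr_gt0].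
  have d0 := wt_ge0 D (dcube s d).
  by apply: le_trans (HK s d s0) _; rewrite lee_fin; exact: powR_peel_le K0 d0 dV sn (ltW e0).
rewrite /avg3 lee_pdivrMl// => /le_trans; apply; rewrite -EFinM lee_fin /c.
by apply: eq_leW; ring.
Qed.

(** Hoelder with three factors. The reverse Hoelder inequality lowers the exponent spent on [v] from
    [a] to [a' = a / (1 + e)]; the room [a - a'] pays for moments of the product of oscillations,
    with exponent [r = 1 / N < a - a'], and [tau = 1 - a' - r] is left for [F]. The strict
    inequality [tau > 1 - a] is what later makes the maximal function bounded. *)
Lemma Wprod_weighted (m : nat) : a < 1 -> exists2 tau : R, 1 - a < tau < 1 & exists2 C : R, 0 <= C &
  forall bs, size bs = m -> (forall b, b \in bs -> osc_le 1 b) -> forall s k (F : X -> R), 0 < s ->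
  measurable_fun setT F -> (forall x, 0 <= F x) ->
  (\int[mu]_(x in triple s k) (Wprod bs (cavg s k) x * (F x * v x `^ a))%:E <=
    (C * (wt3 v s k / s ^+ n) `^ a * s ^+ n)%:E * avg3 s (fun x => (F x `^ tau^-1)%:E) k `^ tau)%E.
Proof.
move=> a1; have a0 := dp_a D.
have [e e0 [Cr Cr0 HC]] := reverse_hoelder_triple.
pose a' := a / (1 + e).
have e1 : 0 < 1 + e by rewrite addr_gt0.
have a'0 : 0 < a' by rewrite divr_gt0.
have ea' : (1 + e) * a' = a by rewrite /a' mulrCA mulfV ?gt_eqF// mulr1.
have aa : 0 < a - a' by rewrite subr_gt0 /a' ltr_pdivrMr// mulrDr mulr1 ltrDl mulr_gt0.
pose N := (Num.bound (a - a')^-1).+1; pose r : R := N%:R^-1.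
have N0 : 0 < N%:R :> R by rewrite ltr0n.
have r0 : 0 < r by rewrite invr_gt0.
have ra : r < a - a'.
  rewrite invf_plt//; apply: lt_trans (archi_boundP _) _; first by rewrite invr_ge0 ltW.
  by rewrite ltr_nat.
pose tau := 1 - a' - r; exists tau; first by rewrite /tau; lra.
have tau0 : 0 < tau by rewrite /tau; lra.
have [Kw Kw0 HW] := @Wprod_moment m N isT.
exists (Kw `^ r * Cr `^ a'); first by rewrite mulr_ge0 ?powR_ge0.
move=> bs sm ob s k F s0 mF F0; have sn : 0 < s ^+ n by rewrite exprn_gt0.
set W := Wprod bs (cavg s k); set V := wt3 v s k / s ^+ n.
have V0 : 0 <= V by rewrite divr_ge0 ?(ltW sn)//; exact: wt_ge0 D _.
have lbs : lmomcs bs by move=> c /ob; exact: osc_le_lmomc.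
have W0 x : 0 <= W x by exact: le_trans (Wprod_ge1 _ _ _).
have mW : measurable_fun setT W by have [] := lmom_Wprod (cavg s k) lbs.
have mt : measurable (triple s k : set X) by exact: measurable_triple.
have mp t (g : X -> R) : measurable_fun setT g -> measurable_fun setT (fun x => g x `^ t).
  by move=> mg; exact: (measurableT_comp (measurable_powR t)).
under eq_integral => x _.
  have -> : Wprod bs (cavg s k) x * (F x * v x `^ a) =
      (W x ^+ N) `^ r * (F x `^ tau^-1) `^ tau * (v x `^ (1 + e)) `^ a'.
    rewrite -powR_mulrn// /r -powRrM mulfV ?gt_eqF// powRr1// powRKV ?gt_eqF// -powRrM.
    by rewrite ea' mulrA.
  over.
have sum1 : r + tau + a' = 1 by rewrite /tau; ring.
have H3 := @hoelder3_int _ _ _ mu _ (fun x => W x ^+ N) _ _ r tau a' mt (measurable_funX N mW)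
  (mp tau^-1 _ mF) (mp (1 + e) _ mv) (fun x => exprn_ge0 N (W0 x)) (fun x => powR_ge0 _ _)
  (fun x => powR_ge0 _ _) r0 tau0 a'0 sum1.
apply: (le_trans H3).
have FE : (\int[mu]_(x in triple s k) (F x `^ tau^-1)%:E = (s ^+ n)%:E * avg3 s (fun x => (F x `^ tau^-1)%:E) k)%E.
  by rewrite /avg3 muleA -EFinM mulfV ?gt_eqF// mul1e.
have av0 : (0 <= avg3 s (fun x => (F x `^ tau^-1)%:E) k)%E by apply: avg3_ge0 => // x; rewrite lee_fin powR_ge0.
have W1 : ((\int[mu]_(x in triple s k) (W x ^+ N)%:E) `^ r <= (Kw `^ r * (s ^+ n) `^ r)%:E)%E.
  rewrite -powRM ?(ltW sn)// -poweR_EFin; apply: le_poweR2r (HW bs sm ob s k s0); first exact: ltW.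
  by apply: integral_ge0 => x _; rewrite lee_fin exprn_ge0.
have v1 : ((\int[mu]_(x in triple s k) (v x `^ (1 + e))%:E) `^ a' <= (Cr `^ a' * V `^ a * (s ^+ n) `^ a')%:E)%E.
  have -> : V `^ a = (V `^ (1 + e)) `^ a' by rewrite -powRrM ea'.
  rewrite -!powRM ?mulr_ge0 ?powR_ge0 ?(ltW sn)// -poweR_EFin; apply: le_poweR2r (HC s k s0); first exact: ltW.
  by apply: integral_ge0 => x _; rewrite lee_fin powR_ge0.
rewrite FE poweRM ?lee_fin ?(ltW sn)// poweR_EFin.
have -> : ((Kw `^ r * Cr `^ a' * V `^ a * s ^+ n)%:E * avg3 s (fun x => (F x `^ tau^-1)%:E) k `^ tau =
   (Kw `^ r * (s ^+ n) `^ r)%:E * (((s ^+ n) `^ tau)%:E * avg3 s (fun x => (F x `^ tau^-1)%:E) k `^ tau) *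
   (Cr `^ a' * V `^ a * (s ^+ n) `^ a')%:E)%E.
  have {1}-> : s ^+ n = (s ^+ n) `^ r * (s ^+ n) `^ tau * (s ^+ n) `^ a'.
    by rewrite -!powRD ?(gt_eqF sn) ?implybT// sum1 powRr1 ?(ltW sn).
  move: (avg3 s _ k `^ tau)%E => Z; rewrite [X in _ = (X * _)%E]muleA -[X in _ = (X * _ * _)%E]EFinM [RHS]muleAC -EFinM; congr (_%:E * _)%E.
  by move: (Kw `^ r) (Cr `^ a') (V `^ a) ((s ^+ n) `^ _) ((s ^+ n) `^ _) ((s ^+ n) `^ _) => *; ring.
apply: lee_pmul => //; first by rewrite mule_ge0 ?poweR_ge0// mule_ge0 ?poweR_ge0// lee_fin powR_ge0.
- exact: poweR_ge0.
- by apply: lee_wpmul2r => //; rewrite mule_ge0 ?poweR_ge0// lee_fin powR_ge0.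
Qed.

End weighted_averages.

Lemma hoelder_ereal d (T : measurableType d) (mu : {measure set T -> \bar R})
    (A : set T) (f g : T -> \bar R) (a b : R) : measurable A ->
  measurable_fun setT f -> measurable_fun setT g ->
  (forall x, 0 <= f x)%E -> (forall x, 0 <= g x)%E ->
  (\int[mu]_(x in A) f x < +oo)%E -> (\int[mu]_(x in A) g x < +oo)%E ->
  0 < a -> 0 < b -> a + b = 1 ->
  (\int[mu]_(x in A) (f x `^ a * g x `^ b) <=
   (\int[mu]_(x in A) f x) `^ a * (\int[mu]_(x in A) g x) `^ b)%E.
Proof.
move=> mA mf mg f0 g0 foo goo a0 b0 ab.
have fin h : measurable_fun setT h -> (forall x, 0 <= h x)%E -> (\int[mu]_(x in A) h x < +oo)%E ->
    {ae mu, forall x, A x -> (h x = (fine (h x))%:E)%E}.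
  move=> mh h0 hoo; have : mu.-integrable A h.
    apply/integrableP; split; first exact: measurable_funS (@subsetT _ _) mh.
    by under eq_integral do rewrite gee0_abs//.
  by move/(integrable_ae mA); apply: filterS => x h1 /h1 h2; rewrite fineK.
have mfin h : measurable_fun setT h -> measurable_fun setT (fine \o h : T -> R).
  by move=> mh; apply: measurableT_comp => //.
have mpe (h : T -> \bar R) c : measurable_fun setT h -> measurable_fun setT (fun x => h x `^ c)%E.
  by move=> mh; exact: (measurableT_comp (measurable_poweR c)).
have ff := fin f mf f0 foo; have gg := fin g mg g0 goo.
have H := @hoelder_int _ _ _ mu A (fine \o f) (fine \o g) a b mA (mfin f mf) (mfin g mg)
  (fun x => fine_ge0 (f0 x)) (fun x => fine_ge0 (g0 x)) a0 b0 ab.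
rewrite (ae_eq_int (g := fun x => (((fine \o f) x) `^ a * ((fine \o g) x) `^ b)%:E) (mu := mu) mA); last first.
- by apply: filterS2 ff gg => x h1 h2 Ax; rewrite (h1 Ax) (h2 Ax) !poweR_EFin -EFinM.
- by move=> x; rewrite lee_fin mulr_ge0 ?powR_ge0.
- by move=> x; rewrite mule_ge0 ?poweR_ge0.
- apply/measurable_EFinP; apply: measurable_funM; apply: (measurableT_comp (measurable_powR _)); exact: mfin.
- by apply: emeasurable_funM; exact: mpe.
apply: (le_trans H); apply: eq_leW.
have E h : measurable_fun setT h -> (forall x, 0 <= h x)%E ->
    {ae mu, forall x, A x -> (h x = (fine (h x))%:E)%E} ->
    (\int[mu]_(x in A) ((fine \o h) x)%:E = \int[mu]_(x in A) h x)%E.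
  move=> mh h0 hf; apply: ae_eq_int => //.
  - by apply/measurable_EFinP; exact: mfin.
  - by move=> x; rewrite lee_fin fine_ge0.
  - by apply: filterS hf => x h1 /h1 <-.
by rewrite !E.
Qed.

(** Hedberg's trick: [y] is split as [y ^ (1 - th) * y ^ th], and the decay bound, used on the first
    factor only, absorbs the power of the scale. *)
Lemma powR_interpolate (al th K t y c : R) : 0 < t -> 0 <= y -> 0 <= K ->
  0 <= th <= 1 -> al = c * (1 - th) -> y <= K * t `^ (- c) ->
  t `^ al * y <= K `^ (1 - th) * y `^ th.
Proof.
move=> t0; rewrite le_eqVlt => /predU1P[<-|y0] K0 /andP[th0 th1] -> yK.
  by rewrite mulr0 mulr_ge0 ?powR_ge0.
have h : y `^ (1 - th) <= K `^ (1 - th) * (t `^ (- c)) `^ (1 - th).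
  by rewrite -powRM ?powR_ge0//; apply: le_powR2r => //; [rewrite subr_ge0|exact: ltW].
have {1}-> : y = y `^ (1 - th) * y `^ th.
  by rewrite -powRD ?(gt_eqF y0) ?implybT// subrK powRr1// ltW.
rewrite mulrA ler_wpM2r ?powR_ge0// mulrC; apply: (@le_trans _ _ (K `^ (1 - th) * (t `^ (- c)) `^ (1 - th) * t `^ (c * (1 - th)))).
  by rewrite ler_wpM2r ?powR_ge0.
rewrite -mulrA -powRrM -powRD ?(gt_eqF t0) ?implybT// mulNr addNr powRr0 mulr1//.
Qed.

Lemma jensen_constant (tau P Nf s : R) :
  0 < s -> 0 < tau -> 0 < P -> 0 <= Nf ->
  ((s ^+ n)^-1 * (Nf `^ tau^-1 * ((3 * s) ^+ n) `^ (1 - (tau * P)^-1))) `^ tau =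
  3 `^ (n%:R * (tau - P^-1)) * Nf * s `^ (- (n%:R / P)).
Proof.
move=> s0 t0 P0 N0; have s1 := ltW s0.
have e1 : (1 - (tau * P)^-1) * tau = tau - P^-1 by field; rewrite !gt_eqF.
have p0 := @powR_ge0 R.
rewrite exprMn -!powR_mulrn// -powRN.
rewrite powRM ?p0// ?mulr_ge0 ?p0// powRM ?p0// powRKV ?gt_eqF// -[X in _ * (_ * X)]powRrM e1.
rewrite powRM ?p0// -!powRrM.
have -> : - (n%:R / P) = - n%:R * tau + n%:R * (tau - P^-1) by field; rewrite gt_eqF.
rewrite powRD ?(gt_eqF s0) ?implybT//; move: (3 `^ _) (s `^ _) (s `^ _) => x y z; ring.
Qed.

Section local_weighted.
Implicit Types (f g b : X -> C) (bs : seq (X -> C)) (x y : X).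
Variables (al Ck So B : R) (om : nat -> R) (K : X -> X -> R) (T : (X -> C) -> X -> C).
Hypotheses (al0 : 0 <= al) (aln : al <= n%:R) (KB : kernel_bounds al Ck So om K) (LO : local_op al B K T).
Variables (a b A : R) (v u : X -> R) (D : dual_pair a b A v u).
Hypotheses (n0 : (0 < n)%N) (a1 : a < 1) (b1 : b < 1) (alE : al = n%:R * (1 - a - b)).
Let D' := dual_pairC D.

Lemma wt3_le s k : 0 < s ->
  (wt3 u s k / s ^+ n) `^ b * (wt3 v s k / s ^+ n) `^ a <= A * 3 `^ (n%:R * (a + b)).
Proof.
move=> s0; have sn : 0 < s ^+ n by rewrite exprn_gt0.
have V0 : 0 <= wt3 v s k := wt_ge0 D _; have U0 : 0 <= wt3 u s k := wt_ge0 D' _.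
rewrite !powRM ?invr_ge0 ?(ltW sn)// mulrACA -powRD ?invr_eq0 ?(gt_eqF sn) ?implybT//.
have s3 : 0 < 3 * s by rewrite mulr_gt0.
have := wt_cube D (corner s k - const_mx s) s3; rewrite -/(wt3 v s k) -/(wt3 u s k) mulrC => h.
apply: le_trans (ler_wpM2r (powR_ge0 _ _) h) _.
rewrite exprMn powRM ?exprn_ge0 ?(ltW s0)// -powR_mulrn// -powRrM -mulrA -mulrA ler_wpM2l ?(ltW (dp_A_gt0 D))//.
rewrite -[leRHS]mulr1 ler_wpM2l ?powR_ge0// addrC -powRM ?invr_ge0 ?(ltW sn)//.
by rewrite mulfV ?gt_eqF// powR1.
Qed.

(** Jensen's inequality from exponent [1 / tau] to [P], possible because [tau * P > 1]; the
    resulting power of [s] is the one required by [powR_interpolate]. *)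
Lemma avg3_jensen (F : X -> R) (tau P Nf s : R) k : 0 < s -> measurable_fun setT F ->
  (forall x, 0 <= F x) -> 0 < tau -> 1 < tau * P -> 0 <= Nf ->
  (\int[mu]_x (F x `^ P)%:E <= (Nf `^ P)%:E)%E ->
  (avg3 s (fun x => (F x `^ tau^-1)%:E) k `^ tau <=
    (3 `^ (n%:R * (tau - P^-1)) * Nf * s `^ (- (n%:R / P)))%:E)%E.
Proof.
move=> s0 mF F0 t0 tP N0 FN; have sn : 0 < s ^+ n by rewrite exprn_gt0.
have P0 : 0 < P by rewrite -(pmulr_rgt0 _ t0) (lt_trans _ tP).
have mt : measurable (triple s k : set X) by exact: measurable_triple.
have mp t : measurable_fun setT (fun x => F x `^ t) by exact: (measurableT_comp (measurable_powR t)).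
have J := jensen_int mu mt (mp tau^-1) (fun x => powR_ge0 _ _) tP.
have Ie : (\int[mu]_(x in triple s k) (F x `^ tau^-1 `^ (tau * P))%:E <= (Nf `^ P)%:E)%E.
  apply: le_trans FN; apply: le_int => // x _; rewrite ?lee_fin ?powR_ge0//.
  by rewrite -powRrM mulKf ?gt_eqF.
have tPi : 0 < (tau * P)^-1 < 1 by have tP0 := lt_trans ltr01 tP; rewrite invr_gt0 invf_lt1// tP0.
have I1 : (\int[mu]_(x in triple s k) (F x `^ tau^-1)%:E <=
    (Nf `^ tau^-1 * ((3 * s) ^+ n) `^ (1 - (tau * P)^-1))%:E)%E.
  apply: (le_trans J); rewrite EFinM; apply: lee_pmul; rewrite ?poweR_ge0//.
    apply: le_trans (le_poweR2r _ _ Ie) _; first by case/andP: tPi => /ltW.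
      by apply: integral_ge0 => x _; rewrite lee_fin powR_ge0.
    by rewrite poweR_EFin -powRrM invfM mulrCA mulfV ?gt_eqF// mulr1.
  rewrite -poweR_EFin; apply: le_poweR2r (measure_ge0 _ _) (measure_triple_le _ s0).
  by case/andP: tPi => _ /ltW; rewrite subr_ge0.
have a0 : (0 <= avg3 s (fun x => (F x `^ tau^-1)%:E) k)%E by apply: avg3_ge0 => // x; rewrite lee_fin powR_ge0.
have I2 : (avg3 s (fun x => (F x `^ tau^-1)%:E) k <=
    ((s ^+ n)^-1 * (Nf `^ tau^-1 * ((3 * s) ^+ n) `^ (1 - (tau * P)^-1)))%:E)%E.
  by rewrite EFinM; apply: lee_wpmul2l => //; rewrite lee_fin invr_ge0 ltW.
apply: le_trans (le_poweR2r (ltW t0) a0 I2) _.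
by rewrite poweR_EFin lee_fin jensen_constant.
Qed.

(** The estimate in dual form, tested against [g]. The exponent [(1 - b)^-1] is [p] and [(1 - a)^-1]
    is the conjugate of [q]. Averages turn into maximal functions of [F ^ (1 / t1)] and
    [g ^ (1 / t2)], bounded at the exponents [t1 * P > 1] and [t2 * Q > 1], and Hoelder with
    exponents [a] and [1 - a] recombines them. *)
Lemma local_weighted (m : nat) : exists2 C1 : R, 0 <= C1 & forall bs, size bs = m ->
  (forall c, c \in bs -> osc_le 1 c) -> forall f (g : X -> R) s k (Nf Ng : R),
  0 < s -> mclass f -> measurable_fun setT g -> (forall x, 0 <= g x) -> 0 <= Nf -> 0 <= Ng ->
  (\int[mu]_x ((cabs (f x) * v x `^ a) `^ (1 - b)^-1)%:E <= (Nf `^ (1 - b)^-1)%:E)%E ->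
  (\int[mu]_x (g x `^ (1 - a)^-1)%:E <= (Ng `^ (1 - a)^-1)%:E)%E ->
  (\int[mu]_(x in dcube s k)
     (cabs (comms T bs (crestr (triple s k) f) x) * (g x * v x `^ a))%:E <= (C1 * Nf * Ng)%:E)%E.
Proof.
have a0 := dp_a D; have b0 := dp_b D.
have [C0 C00 sparse] := @sparse_domination _ _ _ _ _ _ _ al0 aln KB LO m.
have [t1 /andP[t1b t11] [Cu Cu0 Hu]] := Wprod_weighted D' m b1.
have [t2 /andP[t2a t21] [Cv Cv0 Hv]] := Wprod_weighted D m a1.
(* Here [th] is [p / q]: of the average of [f], the share [1 - th] is spent on the norm [Nf] and the
   power of the scale, the share [th] goes to the maximal function. *)
pose P := (1 - b)^-1; pose Q := (1 - a)^-1; pose th := P * a.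
have b1' : 0 < 1 - b by rewrite subr_gt0.
have a1' : 0 < 1 - a by rewrite subr_gt0.
have P0 : 0 < P by rewrite invr_gt0.
have Q0 : 0 < Q by rewrite invr_gt0.
have t10 : 0 < t1 by exact: lt_trans t1b.
have t20 : 0 < t2 by exact: lt_trans t2a.
have t1n : t1 != 0 by rewrite gt_eqF.
have t2n : t2 != 0 by rewrite gt_eqF.
have eqP1 (h : X -> R) t : t != 0 -> forall c,
    (fun x => ((h x `^ t^-1) `^ (t * c))%:E) = (fun x => (h x `^ c)%:E).
  by move=> tn c; apply/funext => x; rewrite -powRrM mulKf.
have tP : 1 < t1 * P by rewrite /P ltr_pdivlMr// mul1r.
have tQ : 1 < t2 * Q by rewrite /Q ltr_pdivlMr// mul1r.
have nn : 0 <= n%:R * (1 - a - b) by rewrite -alE.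
have th0 : 0 <= th <= 1.
  move: nn; rewrite pmulr_rge0 ?ltr0n// => nn.
  by rewrite /th mulr_ge0 ?(ltW P0) ?(ltW a0)// /P mulrC ler_pdivrMr// mul1r; lra.
have alE' : al = n%:R / P * (1 - th) by rewrite alE /th /P invrK; field; rewrite gt_eqF.
have [M1c M1c0 HM1] := @maxf_strong R n _ tP.
have [M2c M2c0 HM2] := @maxf_strong R n _ tQ.
pose K0 := 3 `^ (n%:R * (t1 - P^-1)) : R.
pose A3 := A * 3 `^ (n%:R * (a + b)).
have A30 : 0 <= A3 by rewrite mulr_ge0 ?powR_ge0// ltW// (dp_A_gt0 D).
have K00 : 0 <= K0 by exact: powR_ge0.
pose E := Cu * Cv * A3 * K0 `^ (1 - th).
have E0 : 0 <= E by rewrite /E mulr_ge0 ?powR_ge0//; apply: mulr_ge0 => //; exact: mulr_ge0.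
exists (C0 * (E * (M1c `^ a * M2c `^ (1 - a)))).
  by rewrite mulr_ge0 ?(ltW C00)//; apply: mulr_ge0 => //; rewrite mulr_ge0 ?powR_ge0.
move=> bs sm ob f g s k Nf Ng s0 mf mg g0 Nf0 Ng0 HNf HNg.
have lbs : lmomcs bs by move=> c /ob; exact: osc_le_lmomc.
have mv := dp_mv D; have v0 := dp_v0 D; have mu' := dp_mu D; have u0 := dp_u0 D.
have mp (h : X -> R) t : measurable_fun setT h -> measurable_fun setT (fun x => h x `^ t).
  by move=> mh; exact: (measurableT_comp (measurable_powR t)).
have mcf : measurable_fun setT (fun x => cabs (f x)) by apply: measurable_cabs; exact: mclass_meas.
pose F x := cabs (f x) * v x `^ a.
have mF : measurable_fun setT F by apply: measurable_funM => //; exact: mp.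
have F0 x : 0 <= F x by rewrite mulr_ge0 ?cabs_ge0 ?powR_ge0.
pose G1 := maxf s (fun x => (F x `^ t1^-1)%:E); pose G2 := maxf s (fun x => (g x `^ t2^-1)%:E).
have p0 (h : X -> R) t x : (0 <= (h x `^ t)%:E)%E by rewrite lee_fin powR_ge0.
have mG1 : measurable_fun setT G1 by exact: measurable_maxf.
have mG2 : measurable_fun setT G2 by exact: measurable_maxf.
have G10 x : (0 <= G1 x)%E by exact: maxf_ge0.
have G20 x : (0 <= G2 x)%E by exact: maxf_ge0.
pose H x := ((E * Nf `^ (1 - th))%:E * (G1 x `^ (t1 * th) * G2 x `^ t2))%E.
have mpe (h : X -> \bar R) c : measurable_fun setT h -> measurable_fun setT (fun x => h x `^ c)%E.
  by move=> mh; exact: (measurableT_comp (measurable_poweR c)).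
have mGG : measurable_fun setT (fun x => G1 x `^ (t1 * th) * G2 x `^ t2)%E.
  by apply: emeasurable_funM; exact: mpe.
have mH : measurable_fun setT H by exact: measurable_funeM.
have GG0 x : (0 <= G1 x `^ (t1 * th) * G2 x `^ t2)%E by rewrite mule_ge0 ?poweR_ge0.
have EN0 : 0 <= E * Nf `^ (1 - th) by apply: mulr_ge0 => //; exact: powR_ge0.
have H0 x : (0 <= H x)%E by apply: mule_ge0.
apply: (@le_trans _ _ (C0%:E * \int[mu]_(x in dcube s k) H x)%E).
  apply: (sparse bs sm lbs f (fun x => g x * v x `^ a) H s) => //.
  - by apply: measurable_funM => //; exact: mp.
  - by move=> x; rewrite mulr_ge0 ?powR_ge0.
  move=> i d x dx; set t := side s i; have t0 : 0 < t by exact: side_gt0.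
  have tn : 0 < t ^+ n by rewrite exprn_gt0.
  have mtr : measurable (triple t d : set X) by exact: measurable_triple.
  set W := Wprod bs (cavg t d).
  have W0 y : 0 <= W y by exact: le_trans (Wprod_ge1 _ _ _).
  have mW : measurable_fun setT W by have [] := lmom_Wprod (cavg t d) lbs.
  pose Y := (avg3 t (fun y => (g y `^ t2^-1)%:E) d `^ t2)%E.
  pose y := fine (avg3 t (fun y => (F y `^ t1^-1)%:E) d).
  pose Ub := (wt3 u t d / t ^+ n) `^ b; pose Va := (wt3 v t d / t ^+ n) `^ a.
  have av0 : (0 <= avg3 t (fun y => (F y `^ t1^-1)%:E) d)%E by apply: avg3_ge0.
  have jen := @avg3_jensen F t1 P Nf t d t0 mF F0 t10 tP Nf0 HNf.
  have yE : (avg3 t (fun y => (F y `^ t1^-1)%:E) d = y%:E)%E.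
    move: av0 jen; rewrite /y; case: (avg3 _ _ _) => [r| |]// _.
    by rewrite poweRyr ?gt_eqF.
  have y0 : 0 <= y by exact: fine_ge0.
  rewrite yE poweR_EFin lee_fin in jen.
  have I1 : (\int[mu]_(z in triple t d) (W z * cabs (f z))%:E <= (Cu * Ub * t ^+ n * y `^ t1)%:E)%E.
    rewrite (ae_eq_int (mu := mu) (g := fun z => (W z * (F z * u z `^ b))%:E) mtr); last first.
    - apply: filterS (dp_ae D) => z vu _; congr _%:E.
      by rewrite /F -mulrA vu mulr1.
    - by move=> z; rewrite lee_fin mulr_ge0// mulr_ge0// powR_ge0.
    - by move=> z; rewrite lee_fin mulr_ge0// cabs_ge0.
    - by apply/measurable_EFinP; apply: measurable_funM => //; apply: measurable_funM => //; exact: mp.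
    - by apply/measurable_EFinP; exact: measurable_funM.
    by apply: le_trans (Hu bs sm ob t d F t0 mF F0) _; rewrite yE poweR_EFin -EFinM.
  have I2 : (\int[mu]_(z in dcube t d) (W z * (g z * v z `^ a))%:E <= (Cv * Va * t ^+ n)%:E * Y)%E.
    apply: le_trans (Hv bs sm ob t d g t0 mg g0); apply: le_int.
    - exact: dcube_triple.
    - by move=> z _; rewrite lee_fin mulr_ge0// mulr_ge0// powR_ge0.
    - by move=> z _; rewrite lee_fin mulr_ge0// mulr_ge0// powR_ge0.
    - by [].
  have Ub0 : 0 <= Ub by exact: powR_ge0.
  have Va0 : 0 <= Va by exact: powR_ge0.
  have S1 : sparse_avg al bs f t d <= Cu * Ub * (K0 * Nf) `^ (1 - th) * (y `^ t1) `^ th.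
    have fI : fine (\int[mu]_(z in triple t d) (W z * cabs (f z))%:E)%E <= Cu * Ub * t ^+ n * y `^ t1.
      have : (0 <= \int[mu]_(z in triple t d) (W z * cabs (f z))%:E)%E.
        by apply: integral_ge0 => z _; rewrite lee_fin mulr_ge0// cabs_ge0.
      by move: I1; case: (integral _ _ _).
    apply: (@le_trans _ _ (t `^ al * (Cu * Ub * y `^ t1))).
      by apply: (ler_wpM2l (powR_ge0 _ _)); rewrite ler_pdivrMr// mulrAC.
    rewrite mulrCA -[X in _ <= X]mulrA; apply: (ler_wpM2l (mulr_ge0 Cu0 Ub0)).
    exact: powR_interpolate t0 (powR_ge0 _ _) (mulr_ge0 K00 Nf0) th0 alE' jen.
  have yG : ((y `^ (t1 * th))%:E <= G1 x `^ (t1 * th))%E.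
    rewrite -poweR_EFin -yE; apply: le_poweR2r => //; first by apply: mulr_ge0 (ltW t10) _; case/andP: th0.
    by rewrite -[d in avg3 _ _ d]dx; exact: avg3_le_maxf.
  have YG : (Y <= G2 x `^ t2)%E.
    apply: le_poweR2r (ltW t20) _ _; first by apply: avg3_ge0.
    by rewrite -[d in avg3 _ _ d]dx; exact: avg3_le_maxf.
  have Y0 : (0 <= Y)%E by exact: poweR_ge0.
  have S0 : 0 <= sparse_avg al bs f t d.
    by rewrite /sparse_avg mulr_ge0 ?powR_ge0// divr_ge0 ?(ltW tn)// fine_ge0// integral_ge0// => z _;
      rewrite lee_fin mulr_ge0 ?cabs_ge0//; exact: W0.
  apply: (@le_trans _ _ ((sparse_avg al bs f t d / t ^+ n)%:E * ((Cv * Va * t ^+ n)%:E * Y))%E).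
    by apply: lee_wpmul2l I2; rewrite lee_fin divr_ge0 ?(ltW tn).
  have -> : ((sparse_avg al bs f t d / t ^+ n)%:E * ((Cv * Va * t ^+ n)%:E * Y) =
      (sparse_avg al bs f t d * (Cv * Va))%:E * Y)%E.
    by rewrite muleA -EFinM mulrACA -!mulrA mulVf ?gt_eqF// mulr1.
  apply: (@le_trans _ _ ((E * Nf `^ (1 - th))%:E * ((y `^ (t1 * th))%:E * Y))%E); last first.
    by apply: lee_wpmul2l; [rewrite lee_fin|apply: lee_pmul; rewrite ?lee_fin ?powR_ge0].
  rewrite [leRHS]muleA -EFinM; apply: (lee_wpmul2r Y0); rewrite lee_fin.
  apply: le_trans (ler_wpM2r (mulr_ge0 Cv0 Va0) S1) _.
  have UV : Ub * Va <= A3 by exact: wt3_le.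
  rewrite -powRrM powRM// /E; have e1 := powR_ge0 K0 (1 - th); have e2 := powR_ge0 Nf (1 - th).
  have e3 := powR_ge0 y (t1 * th).
  move: (K0 `^ _) (Nf `^ _) (y `^ _) e1 e2 e3 => c1 c2 c3 e1 e2 e3.
  have -> : Cu * Ub * (c1 * c2) * c3 * (Cv * Va) = (Cu * Cv * c1 * c2 * c3) * (Ub * Va) by ring.
  have -> : Cu * Cv * A3 * c1 * c2 * c3 = (Cu * Cv * c1 * c2 * c3) * A3 by ring.
  by apply: ler_wpM2l => //; do 4 apply: mulr_ge0 => //.
rewrite -!(mulrA C0) EFinM; apply: lee_wpmul2l; first by rewrite lee_fin ltW.
have mQ : measurable (dcube s k : set X) by exact: measurable_dcube.
have Qoo : (mu (dcube s k) < +oo)%E by rewrite measure_dcube// ltry.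
have J1 : (\int[mu]_(x in dcube s k) (G1 x `^ (t1 * P)) <= (M1c * Nf `^ P)%:E)%E.
  have HM := HM1 s _ _ s0 mQ Qoo (mp _ t1^-1 mF) (fun x => powR_ge0 _ _).
  rewrite (eqP1 F t1 t1n P) in HM; apply: (le_trans HM); rewrite EFinM.
  by apply: (lee_wpmul2l _ HNf); rewrite lee_fin.
have J2 : (\int[mu]_(x in dcube s k) (G2 x `^ (t2 * Q)) <= (M2c * Ng `^ Q)%:E)%E.
  have HM := HM2 s _ _ s0 mQ Qoo (mp _ t2^-1 mg) (fun x => powR_ge0 _ _).
  rewrite (eqP1 g t2 t2n Q) in HM; apply: (le_trans HM); rewrite EFinM.
  by apply: (lee_wpmul2l _ HNg); rewrite lee_fin.
rewrite /H int_scale//.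
have -> : E * (M1c `^ a * M2c `^ (1 - a)) * Nf * Ng = E * Nf `^ (1 - th) *
    ((M1c * Nf `^ P) `^ a * (M2c * Ng `^ Q) `^ (1 - a)).
  rewrite !powRM ?powR_ge0// -!powRrM -/th /Q mulVf ?gt_eqF// powRr1//.
  have {1}-> : Nf = Nf `^ (1 - th) * Nf `^ th.
    by rewrite -powRD ?subrK ?powRr1// oner_eq0.
  by move: (M1c `^ a) (M2c `^ _) (Nf `^ _) (Nf `^ _) => c1 c2 c3 c4; ring.
rewrite [leRHS]EFinM; apply: lee_wpmul2l; first by rewrite lee_fin.
under eq_integral => x _.
  have -> : (G1 x `^ (t1 * th) * G2 x `^ t2 = (G1 x `^ (t1 * P)) `^ a * (G2 x `^ (t2 * Q)) `^ (1 - a))%E.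
    by rewrite -!poweRrM -!mulrA mulVf ?gt_eqF// mulr1.
  over.
apply: le_trans (hoelder_ereal (mu := mu) mQ (mpe _ _ mG1) (mpe _ _ mG2) _ _ _ _ a0 a1' _) _.
- by move=> x; exact: poweR_ge0.
- by move=> x; exact: poweR_ge0.
- exact: le_lt_trans J1 (ltry _).
- exact: le_lt_trans J2 (ltry _).
- by ring.
rewrite [leRHS]EFinM -(poweR_EFin (M1c * Nf `^ P) a) -(poweR_EFin (M2c * Ng `^ Q) (1 - a)); apply: lee_pmul; [exact: poweR_ge0|exact: poweR_ge0| |].
  by apply: (le_poweR2r (ltW a0) _ J1); apply: integral_ge0 => x _; exact: poweR_ge0.
by apply: (le_poweR2r (ltW a1') _ J2); apply: integral_ge0 => x _; exact: poweR_ge0.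
Qed.

End local_weighted.

Lemma powR_absorb (i c a : R) : 0 <= i -> 0 <= c -> 0 < a ->
  i <= c * i `^ (1 - a) -> i <= c `^ a^-1.
Proof.
rewrite le_eqVlt => /predU1P[<- *|i0 c0 a0]; first exact: powR_ge0.
have {1}-> : i = i `^ a * i `^ (1 - a).
  by rewrite -powRD ?(gt_eqF i0) ?implybT// subrKC powRr1// ltW.
rewrite ler_pM2r ?powR_gt0// => hi.
rewrite -[X in X <= _](powRVK (t := a)) ?gt_eqF ?(ltW i0)//.
by apply: le_powR2r; rewrite ?invr_ge0 ?(ltW a0) ?powR_ge0.
Qed.

Lemma mulr_powRB1 (h t : R) : 0 <= h -> t != 0 -> h * h `^ (t - 1) = h `^ t.
Proof.
rewrite le_eqVlt => /predU1P[<- t0|h0 t0]; first by rewrite mul0r powR0.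
by rewrite -[X in X * _]powRr1 ?ltW// -powRD ?(gt_eqF h0) ?implybT// subrKC.
Qed.

Lemma int_eq_sub d (T : measurableType d) (mu : {measure set T -> \bar R})
    (E Q : set T) (F G : T -> \bar R) : E `<=` Q -> (forall x, E x -> F x = G x) ->
  (forall x, ~ E x -> F x = 0%E) -> (\int[mu]_(x in Q) F x = \int[mu]_(x in E) G x)%E.
Proof.
move=> EQ FG F0; rewrite integral_mkcond [RHS]integral_mkcond; apply: eq_integral => x _.
rewrite !patchE; have [Ex|Ex] := pselect (E x).
  by rewrite (mem_set Ex) (mem_set (EQ _ Ex)) FG.
by rewrite (memNset Ex) F0//; case: ifP.
Qed.

(** * Global weighted bound for commutators *)

Section weighted_bound.
Implicit Types (f g b : X -> C) (bs : seq (X -> C)) (x y : X).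

Lemma comms_scale (T : (X -> C) -> X -> C) bs (z : (X -> C) -> C) f :
  (forall z f g, mclass f -> mclass g ->
    {ae mu, forall x, T (fun y => z * f y + g y) x = z * T f x + T g x}) ->
  lmomcs bs -> mclass f ->
  {ae mu, forall x, comms T [seq (fun x => z b * b x) | b <- bs] f x =
    (\prod_(b <- bs) z b) * comms T bs f x}.
Proof.
move=> Tlin; elim: bs f => [|b bs ih] f.
  by move=> _ _; apply/aeW => x; rewrite big_nil mul1r.
move=> /lmomcs_cons[lb lbs] mf; have mbf := mclassMl lb mf.
have mzbf : mclass (fun y => z b * (b y * f y)) by exact: mclassZ.
have mzbf' : mclass (fun y => z b * b y * f y).
  by rewrite (_ : (fun _ => _) = fun y => z b * (b y * f y)) //; apply/funext => y; rewrite mulrA.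
apply: filterS3 (ih _ lbs mf) (ih _ lbs mzbf') (lin_scale (fun w f g => comms_lin Tlin w lbs) (z b) mbf) => x h1 h2 h3.
rewrite /= /commutator [X in _ * X - _]h1 [X in _ - X]h2 big_cons.
rewrite (_ : (fun y => z b * b y * f y) = fun y => z b * (b y * f y)).
  by rewrite h3; ring.
by apply/funext => y; rewrite mulrA.
Qed.

(** Each multiplication by a symbol either acts on a function that vanishes outside [E] or is
    evaluated at a point of [E]. *)
Lemma comms_local (T : (X -> C) -> X -> C) (E : set X) bs (c : (X -> C) -> X -> C) f x :
  (forall b, b \in bs -> forall y, E y -> c b y = b y) ->
  (forall y, ~ E y -> f y = 0) -> E x -> comms T (map c bs) f x = comms T bs f x.
Proof.
elim: bs f => // b bs ih f cb f0 Ex; have cb' a : a \in bs -> forall y, E y -> c a y = a y.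
  by move=> ab; apply: cb; rewrite inE ab orbT.
rewrite /= /commutator ih// (cb b (mem_head _ _))//; congr (_ - _).
have -> : (fun y => c b y * f y) = (fun y => b y * f y).
  apply/funext => y; have [Ey|Ey] := pselect (E y); first by rewrite (cb b (mem_head _ _)).
  by rewrite f0 ?mulr0.
by apply: ih => // y Ey; rewrite f0 ?mulr0.
Qed.

Lemma box_triple_near (r s : R) d y : 0 <= r < s -> dcube s d y -> `|y| <= r ->
  (box r : set X) `<=` triple s d.
Proof.
move=> /andP[r0 rs] dy yr x /(boxE _ r0) xr i; have s0 : 0 < s by exact: le_lt_trans rs.
have fl (w : X) : `|w| <= r -> -1 <= Num.floor (w ord0 i / s) <= 0.
  move=> wr; have := le_lt_trans (le_trans (rV_coord_le w i) wr) rs.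
  rewrite ltr_norml => /andP[h1 h2].
  have f1 := floor_le_tmp (w ord0 i / s); have f2 := floorD1_gt (w ord0 i / s).
  have q1 : -1 < w ord0 i / s by rewrite ltr_pdivlMr// mulN1r.
  have q2 : w ord0 i / s < 1 by rewrite ltr_pdivrMr// mul1r.
  apply/andP; split.
    by rewrite floor_ge_int ltW.
  by rewrite -ltzD1 add0r floor_lt_int.
have := fl x xr; have := fl y yr; rewrite /adjacent -dy /idx !mxE.
move: (Num.floor _) (Num.floor _) => p q; lia.
Qed.

Variables (al Ck So B : R) (om : nat -> R) (K : X -> X -> R) (T : (X -> C) -> X -> C).
Hypotheses (al0 : 0 <= al) (aln : al <= n%:R) (KB : kernel_bounds al Ck So om K) (LO : local_op al B K T).
Variables (a b A : R) (v u : X -> R) (D : dual_pair a b A v u).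
Hypotheses (n0 : (0 < n)%N) (a1 : a < 1) (b1 : b < 1) (alE : al = n%:R * (1 - a - b)).

(** With [v ^ a = w] this is the [P]-th power of the norm of L^P(w^P), restricted to [E]. *)
Definition wint (P : R) (E : set X) f : \bar R := (\int[mu]_(x in E) ((cabs (f x) * v x `^ a) `^ P)%:E)%E.

Lemma measurable_wint (P : R) f : cmeasurable f ->
  measurable_fun setT (fun x => ((cabs (f x) * v x `^ a) `^ P)%:E).
Proof.
move=> mf; apply: measurable_powRE; apply: measurable_funM; first exact: measurable_cabs.
by apply: (measurableT_comp (measurable_powR a)); exact: dp_mv D.
Qed.

(** The test function is [h ^ (1 / a - 1)], the extremal one for duality, cut off where [h] exceeds
    [N] so that the integral [I] is finite and can be absorbed by [powR_absorb]. *)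
Lemma wint_local_osc1 (m : nat) : exists2 C1 : R, 0 <= C1 & forall bs, size bs = m ->
  (forall c, c \in bs -> osc_le 1 c) -> forall f s k (Nf : R),
  0 < s -> mclass f -> 0 <= Nf -> (wint (1 - b)^-1 setT f <= (Nf `^ (1 - b)^-1)%:E)%E ->
  (wint a^-1 (dcube s k) (comms T bs (crestr (triple s k) f)) <= ((C1 * Nf) `^ a^-1)%:E)%E.
Proof.
have [C1 C10 H] := local_weighted al0 aln KB LO D n0 a1 b1 alE m.
exists C1 => // bs sm ob f s k Nf s0 mf Nf0 HNf.
have a0 := dp_a D; have a1' : 0 < 1 - a by rewrite subr_gt0.
have lbs : lmomcs bs by move=> c /ob; exact: osc_le_lmomc.
have mt : measurable (triple s k : set X) by exact: measurable_triple.
have mQ : measurable (dcube s k : set X) by exact: measurable_dcube.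
pose U := comms T bs (crestr (triple s k) f); pose h x := cabs (U x) * v x `^ a.
have mU : cmeasurable U by apply: comms_meas (lo_meas LO) lbs _; exact: mclass_restr.
have mh : measurable_fun setT h.
  apply: measurable_funM; first exact: measurable_cabs.
  by apply: (measurableT_comp (measurable_powR a)); exact: dp_mv D.
have h0 x : 0 <= h x by rewrite mulr_ge0 ?cabs_ge0 ?powR_ge0.
pose G (N : nat) := dcube s k `&` [set x | h x <= N%:R].
have mG N : measurable (G N).
  by apply: measurableI => //; rewrite -[X in measurable X]setTI; apply: measurable_fun_le => //; exact: measurable_cst.
have mhp t : measurable_fun setT (fun x => h x `^ t) by exact: (measurableT_comp (measurable_powR t)).
rewrite /wint; apply: (@int_exhaust _ _ _ mu _ _ G).
- move=> i j ij; apply/subsetPset => x [Qx hi]; split => //=; apply: le_trans hi _.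
  by rewrite ler_nat.
- exact: mG.
- move=> x Qx; exists (Num.bound (h x)) => //; split => //=; apply: ltW; exact: archi_boundP.
- exact: measurable_wint.
- by move=> x; rewrite lee_fin powR_ge0.
move=> N; set I := (\int[mu]_(x in G N) _)%E.
have Ioo : (I < +oo)%E.
  apply: (@le_lt_trans _ _ (\int[mu]_(x in dcube s k) (N%:R `^ a^-1)%:E)%E).
    apply: (@le_trans _ _ (\int[mu]_(x in G N) (N%:R `^ a^-1)%:E)%E); last first.
      by apply: le_int => // x [].
    apply: le_int => // x; rewrite ?lee_fin ?powR_ge0// => -[_ hN].
    by apply: le_powR2r; rewrite ?invr_ge0 ?(ltW a0)//; exact: h0.
  by rewrite integral_cst// measure_dcube// -EFinM ltry.
have I0 : (0 <= I)%E by apply: integral_ge0 => x _; rewrite lee_fin powR_ge0.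
have IE : I = (fine I)%:E by rewrite fineK// ge0_fin_numE.
pose i := fine I; have i0 : 0 <= i by exact: fine_ge0.
pose g x := \1_(G N) x * h x `^ (a^-1 - 1).
have aa : a^-1 - 1 = a^-1 * (1 - a) by field; rewrite gt_eqF.
have an0 : a^-1 != 0 by rewrite invr_eq0 gt_eqF.
have gG x : G N x -> g x = h x `^ (a^-1 - 1) by move=> xG; rewrite /g indicE mem_set// mul1r.
have gN x : ~ G N x -> g x = 0 by move=> xG; rewrite /g indicE memNset// mul0r.
have gE : (\int[mu]_x (g x `^ (1 - a)^-1)%:E = I)%E.
  apply: int_eq_sub; first exact: subsetT.
    by move=> x /gG ->; rewrite -powRrM aa -mulrA mulfV ?gt_eqF// mulr1.
  by move=> x /gN ->; rewrite powR0// invr_eq0 gt_eqF.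
have := H bs sm ob f g s k Nf (i `^ (1 - a)) s0 mf _ _ Nf0 (powR_ge0 _ _) HNf.
have -> : (\int[mu]_(x in dcube s k) (cabs (comms T bs (crestr (triple s k) f) x) * (g x * v x `^ a))%:E)%E = I.
  apply: int_eq_sub; [by move=> x []| |by move=> x /gN ->; rewrite mul0r mulr0].
  move=> x /gG ->; congr _%:E; rewrite mulrCA mulrC -/(U x) -/(h x).
  by apply: mulr_powRB1 => //; exact: an0.
move=> /(_ _ _ _)/=; rewrite IE -/i gE IE -/i => HH.
have : i <= C1 * Nf * i `^ (1 - a).
  rewrite -lee_fin; apply: HH.
  - by apply: measurable_funM => //; exact: measurable_indic.
  - by move=> x; rewrite mulr_ge0 ?powR_ge0.
  - by rewrite lee_fin powRVK ?gt_eqF.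
by move=> hi; rewrite lee_fin; exact: (powR_absorb i0 (mulr_ge0 C10 Nf0) a0 hi).
Qed.

(** By multilinearity each symbol may be divided by its bound [M c]. *)
Lemma wint_local (m : nat) : exists2 C1 : R, 0 <= C1 & forall bs (M : (X -> C) -> R), size bs = m ->
  (forall c, c \in bs -> 0 < M c /\ osc_le (M c) c) -> forall f s k (Nf : R),
  0 < s -> mclass f -> 0 <= Nf -> (wint (1 - b)^-1 setT f <= (Nf `^ (1 - b)^-1)%:E)%E ->
  (wint a^-1 (dcube s k) (comms T bs (crestr (triple s k) f)) <=
    ((C1 * (\prod_(c <- bs) M c) * Nf) `^ a^-1)%:E)%E.
Proof.
have [C1 C10 H] := wint_local_osc1 m; exists C1 => // bs M sm ob f s k Nf s0 mf Nf0 HN.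
have a0 := dp_a D; have mt : measurable (triple s k : set X) by exact: measurable_triple.
pose z c : C := ((M c)^-1)%:C%C; pose F := crestr (triple s k) f.
have mF : mclass F by exact: mclass_restr.
have lbs : lmomcs bs by move=> c /ob[_]; exact: osc_le_lmomc.
pose zs := [seq (fun x => z c * c x) | c <- bs].
have ozs c : c \in zs -> osc_le 1 c.
  move=> /mapP[c' /ob[M0 oc] ->]; rewrite -(mulVf (lt0r_neq0 M0)).
  by apply: osc_le_scale => //; rewrite invr_ge0 ltW.
have := H zs _ ozs f s k Nf s0 mf Nf0 HN; rewrite size_map => /(_ sm).
pose PM := \prod_(c <- bs) M c.
have PM0 : 0 < PM.
  rewrite /PM; elim: (bs) ob => [|c cs ih] ob; first by rewrite big_nil.
  rewrite big_cons mulr_gt0//; first by have [] := ob c (mem_head _ _).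
  by apply: ih => e ce; apply: ob; rewrite inE ce orbT.
have PE : \prod_(c <- bs) z c = (PM^-1)%:C%C.
  rewrite /PM /z; elim: (bs) => [|c cs ih]; first by rewrite !big_nil invr1.
  by rewrite !big_cons ih invfM rmorphM.
have mU : cmeasurable (comms T bs F) by exact: comms_meas (lo_meas LO) lbs mF.
have mQ : measurable (dcube s k : set X) by exact: measurable_dcube.
have -> : wint a^-1 (dcube s k) (comms T zs F) = ((PM^-1 `^ a^-1)%:E * wint a^-1 (dcube s k) (comms T bs F))%E.
  rewrite /wint -int_scale ?powR_ge0//; [|exact: measurable_wint|by move=> x; rewrite lee_fin powR_ge0].
  apply: ae_eq_int => //.
  - apply: measurable_wint; apply: comms_meas (lo_meas LO) _ mF.
    by move=> c /ozs; exact: osc_le_lmomc.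
  - by apply: measurable_funeM; exact: measurable_wint.
  - by move=> x; rewrite lee_fin powR_ge0.
  - by move=> x; rewrite mule_ge0 ?lee_fin ?powR_ge0.
  apply: filterS (comms_scale z (lo_lin LO) lbs mF) => x -> _.
  rewrite PE cabsM cabs_real ger0_norm ?invr_ge0 ?(ltW PM0)// -mulrA powRM ?invr_ge0 ?(ltW PM0)//.
  by rewrite mulr_ge0 ?cabs_ge0 ?powR_ge0.
move=> h; have -> : ((C1 * PM * Nf) `^ a^-1)%:E = ((PM `^ a^-1)%:E * ((C1 * Nf) `^ a^-1)%:E)%E.
  by rewrite -EFinM -powRM ?(ltW PM0) ?mulr_ge0//; congr (_ `^ _)%:E; ring.
rewrite -[leLHS]mul1e (_ : 1%:E = (PM `^ a^-1)%:E * (PM^-1 `^ a^-1)%:E)%E; last first.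
  by rewrite -EFinM -powRM ?invr_ge0 ?(ltW PM0)// mulfV ?gt_eqF// powR1.
by rewrite -muleA; apply: lee_wpmul2l => //; rewrite lee_fin powR_ge0.
Qed.

(** Given the box over which the commutator is integrated, the side [s] is taken so large that the
    tripled cube of every cell meeting this box contains the support of [f]; there the local bound
    applies to [f] itself. The few cells that meet the box cost a factor [3 ^ n], obtained from
    [lt_avg3_neighbor]. *)
Lemma weighted_bound (m : nat) : exists2 C1 : R, 0 <= C1 & forall bs (M : (X -> C) -> R), size bs = m ->
  (forall c, c \in bs -> 0 < M c /\ osc_le (M c) c) -> forall f (Nf : R),
  mclass f -> 0 <= Nf -> (wint (1 - b)^-1 setT f <= (Nf `^ (1 - b)^-1)%:E)%E ->
  (wint a^-1 setT (comms T bs f) <= ((C1 * (\prod_(c <- bs) M c) * Nf) `^ a^-1)%:E)%E.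
Proof.
have [C1 C10 H] := wint_local m; have a0 := dp_a D.
have an0 : a != 0 by rewrite gt_eqF.
pose k3 : R := (3 ^+ n) `^ a; have k30 : 0 <= k3 by exact: powR_ge0.
exists (k3 * C1); first exact: mulr_ge0.
move=> bs M sm ob f Nf mf Nf0 HN; have [_ [r r0 fr]] := mf.
have lbs : lmomcs bs by move=> c /ob[_]; exact: osc_le_lmomc.
have mU : cmeasurable (comms T bs f) by exact: comms_meas (lo_meas LO) lbs mf.
set PM := \prod_(c <- bs) M c.
have PM0 : 0 <= PM.
  rewrite /PM; elim: (bs) ob => [|c cs ih] ob; first by rewrite big_nil.
  rewrite big_cons mulr_ge0//; first by have [/ltW] := ob c (mem_head _ _).
  by apply: ih => e ce; apply: ob; rewrite inE ce orbT.
pose phi x := ((cabs (comms T bs f x) * v x `^ a) `^ a^-1)%:E.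
have mphi : measurable_fun setT phi by exact: measurable_wint.
have phi0 x : (0 <= phi x)%E by rewrite lee_fin powR_ge0.
have mbox j : measurable (box j%:R : set X) by exact: measurable_box.
pose c := (C1 * PM * Nf) `^ a^-1; have c0 : 0 <= c by exact: powR_ge0.
have -> : ((k3 * C1 * PM * Nf) `^ a^-1)%:E = (3 ^+ n * c)%:E.
  rewrite /c -!mulrA powRM//; last by rewrite !mulr_ge0.
  by rewrite /k3 powRVK// exprn_ge0.
apply: (@int_exhaust _ _ _ mu _ _ (fun j => box j%:R)) => //.
- by move=> i j ij; apply/subsetPset; apply: box_sub; rewrite ?ler_nat.
- move=> x _; exists (Num.bound `|x|) => //; apply/boxE => //.
  by apply: ltW; exact: archi_boundP.
move=> j; pose s : R := j%:R + r + 1.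
have s0 : 0 < s by rewrite ltr_wpDl ?addr_ge0.
have rs : 0 <= r < s by rewrite r0/= /s -addrA addrCA ltrDl ltr_wpDl.
have js : 0 <= (j%:R : R) < s by rewrite ler0n/= /s -addrA ltrDl ltr_wpDl.
pose rj := Num.max (j%:R : R) r.
have rjs : 0 <= rj < s by rewrite le_max ler0n/= gt_max; case/andP: rs => _ ->; case/andP: js => _ ->.
pose psi x : \bar R := ((\1_(box j%:R) x)%:E * phi x)%E.
have mpsi : measurable_fun setT psi.
  by apply: emeasurable_funM => //; apply/measurable_EFinP; exact: measurable_indic.
have psi0 x : (0 <= psi x)%E by rewrite mule_ge0// lee_fin.
have psiE (E : set X) : (box j%:R : set X) `<=` E -> (\int[mu]_(x in E) psi x = \int[mu]_(x in box j%:R) phi x)%E.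
  move=> bE; apply: int_eq_sub => // x bx; rewrite /psi indicE.
    by rewrite mem_set// mul1e.
  by rewrite memNset// mul0e.
rewrite -[X in (X <= _)%E](psiE (triple s 0)); last exact: box_triple.
have sn : 0 < s ^+ n by rewrite exprn_gt0.
have -> : (\int[mu]_(x in triple s 0) psi x = (s ^+ n)%:E * avg3 s psi 0)%E.
  by rewrite /avg3 muleA -EFinM mulfV ?gt_eqF// mul1e.
suff : (avg3 s psi 0 <= (3 ^+ n * c / s ^+ n)%:E)%E.
  move=> h; apply: le_trans (lee_wpmul2l _ h) _; first by rewrite lee_fin ltW.
  by rewrite -EFinM mulrC divfK ?gt_eqF.
have c30 : 0 <= 3 ^+ n * c / s ^+ n by rewrite divr_ge0 ?(ltW sn)// mulr_ge0 ?exprn_ge0.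
rewrite leNgt; apply/negP => /(lt_avg3_neighbor s0 mpsi psi0 c30)[d [_]]; apply/negP; rewrite -leNgt.
have -> : 3 ^+ n * c / s ^+ n / 3 ^+ n * s ^+ n = c by field; rewrite !gt_eqF ?exprn_gt0.
have mQ : measurable (dcube s d : set X) by exact: measurable_dcube.
have [[y [dy yj]]|none] := pselect (exists y, dcube s d y /\ box j%:R y); last first.
  rewrite integral0_eq ?lee_fin// => y dy; rewrite /psi indicE memNset ?mul0e// => yj.
  by apply: none; exists y.
have yr : `|y| <= rj by rewrite le_max (boxE _ _).1.
have near := @box_triple_near rj s d y rjs dy yr.
have fE : crestr (triple s d) f = f.
  apply/funext => x; rewrite /crestr; case: ifPn => // /negP xt; rewrite fr//.
  rewrite ltNge; apply/negP => xr; apply: xt; apply/mem_set/near/boxE; first by case/andP: rjs.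
  by rewrite le_max xr orbT.
apply: le_trans (H bs M sm ob f s d Nf s0 mf Nf0 HN); rewrite fE /wint.
apply: le_int => // x _; first by rewrite lee_fin powR_ge0.
rewrite /psi indicE; case: (x \in _); first by rewrite mul1e.
by rewrite mul0e lee_fin powR_ge0.
Qed.

End weighted_bound.

(** * Small oscillation, far kernels and change of symbols *)

Section compactness_tools.
Implicit Types (f g b : X -> C) (bs : seq (X -> C)) (x y : X).

Lemma osc_le_close g z (e : R) : cmeasurable g -> (forall x, cabs (g x - z) <= e) -> osc_le (3 * e) g.
Proof.
move=> mg ge c l l0; have mQ := @measurable_cube R n c l; have ln : 0 < l ^+ n by rewrite exprn_gt0.
have Qoo : (mu (cube c l) < +oo)%E by exact/cube_fin/ltW.
have e0 : 0 <= e by exact: le_trans (cabs_ge0 _) (ge c).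
have mgz : measurable_fun setT (fun x => (cabs (g x - z))%:E).
  by apply: measurable_cabsE; apply: cmeasurableB => //; exact: cmeasurable_cst.
have ci : cint (cube c l) g.
  apply: cint_le (cint_cst (cabs z + e)%:C%C mQ Qoo) mg _ => x _.
  rewrite cabs_real ger0_norm ?addr_ge0 ?cabs_ge0// -[g x](subrK z) addrC.
  by apply: le_trans (cabsD _ _) _; rewrite lerD2l.
split => //; have Ie : (\int[mu]_(x in cube c l) (cabs (g x - z))%:E <= (e * l ^+ n)%:E)%E.
  apply: (@le_trans _ _ (\int[mu]_(x in cube c l) e%:E)%E).
    by apply: le_int => // x _; rewrite lee_fin ?cabs_ge0.
  by rewrite integral_cst//= measure_cube ?(ltW l0).
have vE : vol (cube c l) = l ^+ n by rewrite vol_cube// ltW.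
have av : cabs (average (cube c l) g - z) <= 2 * e.
  rewrite -lee_fin; apply: le_trans (cabs_averageB z mQ ci Qoo _) _; rewrite vE//.
  apply: le_trans (lee_wpmul2l _ Ie) _; first by rewrite lee_fin divr_ge0 ?ltW.
  by rewrite -EFinM lee_fin; apply: eq_leW; field; rewrite gt_eqF.
apply: (@le_trans _ _ (\int[mu]_(x in cube c l) (3 * e)%:E)%E); last first.
  by rewrite integral_cst//= measure_cube ?(ltW l0).
apply: le_int => // x _; rewrite lee_fin ?cabs_ge0 ?mulr_ge0//.
have -> : g x - average (cube c l) g = (g x - z) + - (average (cube c l) g - z) by ring.
by apply: le_trans (cabsD _ _) _; rewrite cabsN; have := ge x; lra.
Qed.

(** Tonelli on the set of pairs of points in adjacent cells. It is symmetric, so a given [y] is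
    counted only for [x] in its own tripled cube, of volume at most [(3 s) ^ n]. *)
Lemma int_avg3 (s : R) (F : X -> \bar R) : 0 < s -> measurable_fun setT F -> (forall x, 0 <= F x)%E ->
  (\int[mu]_x avg3 s F (idx s x) <= (3 ^+ n)%:E * \int[mu]_x F x)%E.
Proof.
move=> s0 mF F0; have sn : 0 < s ^+ n by rewrite exprn_gt0.
pose E : set (X * X) := \bigcup_(k in [set: 'rV[int]_n]) (dcube s k `*` triple s k).
have mE : measurable E.
  apply: measurable_cbigcup => k _; apply: measurableX; [exact: measurable_dcube|exact: measurable_triple].
have EP x y : E (x, y) <-> triple s (idx s x) y.
  by split => [[k _ [/= <-]]|h] //; exists (idx s x).
have Esym x y : E (x, y) <-> triple s (idx s y) x.
  by rewrite EP; split => h i; have := h i; rewrite /adjacent andbC.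
pose G (z : X * X) := ((\1_E z)%:E * F z.2)%E.
have mG : measurable_fun setT G.
  apply: emeasurable_funM; first by apply/measurable_EFinP; exact: measurable_indic.
  exact: (measurableT_comp mF measurable_snd).
have G0 z : (0 <= G z)%E by rewrite mule_ge0// lee_fin.
have e1 x : (\int[mu]_(y in triple s (idx s x)) F y = \int[mu]_y G (x, y))%E.
  apply/esym; apply: int_eq_sub => // y; rewrite /G indicE => h.
    by rewrite mem_set ?mul1e//; exact/EP.
  by rewrite memNset ?mul0e// => /EP.
have e2 y : (\int[mu]_x G (x, y) <= ((3 * s) ^+ n)%:E * F y)%E.
  rewrite /G/= ge0_integralZr//; last first.
    apply/measurable_EFinP; apply: measurableT_comp; first exact: measurable_indic.
    exact: measurable_pair2.
  apply: lee_wpmul2r => //; apply: le_trans (measure_triple_le (idx s y) s0).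
  rewrite -integral_1; last exact: measurable_triple.
  apply: (@le_trans _ _ (\int[mu]_(x in triple s (idx s y)) (cst 1%:E x))%E) => //.
  apply: eq_leW; apply: int_eq_sub => // x h; rewrite indicE.
    by rewrite mem_set//; exact/Esym.
  by rewrite memNset// => /Esym.
rewrite /avg3; under eq_integral do rewrite e1.
have mGy : measurable_fun setT (fun x => (\int[mu]_y G (x, y))%E).
  exact: (@measurable_fun_fubini_tonelli_F _ _ _ _ _ (lebesgue_rV n)).
rewrite int_scale//; last 2 first.
- by move=> x; apply: integral_ge0.
- by rewrite invr_ge0 ltW.
have -> : (\int[mu]_x \int[mu]_y G (x, y) = \int[mu]_y \int[mu]_x G (x, y))%E.
  exact: (@fubini_tonelli _ _ _ _ _ (lebesgue_rV n) (lebesgue_rV n)).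
apply: (@le_trans _ _ (((s ^+ n)^-1)%:E * (((3 * s) ^+ n)%:E * \int[mu]_y F y))%E).
  apply: lee_wpmul2l; first by rewrite lee_fin invr_ge0 ltW.
  have s30 : 0 <= (3 * s) ^+ n by rewrite exprn_ge0// mulr_ge0// ltW.
  rewrite -int_scale//; apply: le_int => // y _; first by apply: integral_ge0.
  by rewrite mule_ge0.
by rewrite muleA -EFinM exprMn mulrCA mulVf ?gt_eqF// mulr1.
Qed.

Variables (al Ck So B : R) (om : nat -> R) (K : X -> X -> R) (T : (X -> C) -> X -> C).
Hypotheses (al0 : 0 <= al) (aln : al <= n%:R) (KB : kernel_bounds al Ck So om K) (LO : local_op al B K T).

Lemma vanishes_nearM b f x : vanishes_near f x -> vanishes_near (fun y => b y * f y) x.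
Proof. by move=> [r r0 fr]; exists r => // y /fr ->; rewrite mulr0. Qed.

Lemma comms_far bs f : lmomcs bs -> mclass f -> {ae mu, forall x, vanishes_near f x ->
  comms T bs f x = kernel_integral K (fun y => (\prod_(b <- bs) (b x - b y)) * f y) x}.
Proof.
elim: bs f => [|b bs ih] f.
  move=> _ mf; apply: filterS (lo_far LO mf) => x h vf; rewrite /= (h vf).
  by congr (kernel_integral K _ x); apply/funext => y; rewrite big_nil mul1r.
move=> /lmomcs_cons[lb lbs] mf.
have lp x : lmomc (fun y => \prod_(c <- bs) (c x - c y)).
  elim: (bs) lbs => [_|c cs ihc /lmomcs_cons[lc lcs]].
    by rewrite (_ : (fun _ => _) = fun=> 1); [exact: lmomc_cst|apply/funext => y; rewrite big_nil].
  rewrite (_ : (fun _ => _) = fun y => (c x + -1 * c y) * \prod_(d <- cs) (d x - d y)); last first.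
    by apply/funext => y; rewrite big_cons mulN1r.
  apply: lmomcM (ihc lcs); apply: lmomcD; first exact: lmomc_cst.
  by apply: lmomcM => //; exact: lmomc_cst.
apply: filterS2 (ih _ lbs mf) (ih _ lbs (mclassMl lb mf)) => x h1 h2 vf.
have mg := mclassMl (lp x) mf.
have mbg : mclass (fun y => - (\prod_(c <- bs) (c x - c y) * (b y * f y))).
  rewrite (_ : (fun _ => _) = fun y => -1 * (\prod_(c <- bs) (c x - c y) * (b y * f y))).
    by apply: mclassZ; apply: mclassMl => //; exact: mclassMl.
  by apply/funext => y; rewrite mulN1r.
have vbg : vanishes_near (fun y => - (\prod_(c <- bs) (c x - c y) * (b y * f y))) x.
  by have [r r0 fr] := vf; exists r => // y /fr ->; rewrite !mulr0 oppr0.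
have k1 := kernel_cint KB aln mg (vanishes_nearM _ vf).
have k2 := kernel_cint KB aln mbg vbg.
have k1b := kernel_cint KB aln (mclassZ (b x) mg) (vanishes_nearM (fun=> b x) (vanishes_nearM _ vf)).
rewrite /= /commutator h1// h2//; last exact: vanishes_nearM.
rewrite /kernel_integral -cintegralZ// -[X in _ - X]opprK opprK -cintegralN//; last first.
  have := cintN k2; congr (cint _ _); apply/funext => y; by rewrite mulrN opprK.
rewrite -cintegralD//; first last.
- by have := k2; congr (cint _ _); apply/funext => y; rewrite mulrN.
- by have := k1b; congr (cint _ _); apply/funext => y; rewrite mulrCA.
by congr cintegral; apply/funext => y; rewrite big_cons; ring.
Qed.

Lemma comms_subst bs1 bs2 b g f : lmomcs bs1 -> lmomcs bs2 -> lmomc b -> lmomc g -> mclass f ->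
  {ae mu, forall x, comms T (bs1 ++ b :: bs2) f x =
    comms T (bs1 ++ g :: bs2) f x + comms T (bs1 ++ (fun x => b x - g x) :: bs2) f x}.
Proof.
move=> + l2 lb lg; elim: bs1 f => [|c bs1 ih] f.
  move=> _ mf; have mbg : mclass (fun y => (b y - g y) * f y).
    apply: mclassMl mf; rewrite (_ : (fun _ => _) = fun y => b y + -1 * g y); last by apply/funext => y; rewrite mulN1r.
    by apply: lmomcD => //; apply: lmomcM => //; exact: lmomc_cst.
  apply: filterS (lin_add (fun w f g => comms_lin (lo_lin LO) w l2) (mclassMl lg mf) mbg) => x.
  rewrite (_ : (fun y => g y * f y + (b y - g y) * f y) = fun y => b y * f y).
    by rewrite /= /commutator => ->; ring.
  by apply/funext => y; ring.
move=> /lmomcs_cons[lc l1] mf.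
apply: filterS2 (ih _ l1 mf) (ih _ l1 (mclassMl lc mf)) => x h1 h2.
by rewrite /= /commutator h1 h2; ring.
Qed.

End compactness_tools.

Lemma exprB_le (z w : R[i]) (M : R) m : 1 <= M -> cabs z <= M -> cabs w <= M ->
  cabs (z ^+ m - w ^+ m) <= m%:R * M ^+ m * cabs (z - w).
Proof.
move=> M1 zM wM; have M0 : 0 <= M by exact: le_trans M1.
have cX : cabs (w ^+ m) <= M ^+ m.
  elim: m => [|m ih]; first by rewrite !expr0 /= expr0n/= addr0 expr1n sqrtr1.
  by rewrite !exprS cabsM; apply: ler_pM; rewrite ?cabs_ge0.
elim: m cX => [|m ih] cX; first by rewrite !expr0 subrr cabs0 !mul0r.
have cXm : cabs (w ^+ m) <= M ^+ m.
  elim: (m) => [|k ihk]; first by rewrite !expr0 /= expr0n/= addr0 expr1n sqrtr1.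
  by rewrite !exprS cabsM; apply: ler_pM; rewrite ?cabs_ge0.
have -> : z ^+ m.+1 - w ^+ m.+1 = z * (z ^+ m - w ^+ m) + (z - w) * w ^+ m by rewrite !exprS; ring.
apply: le_trans (cabsD _ _) _; rewrite !cabsM.
have h1 : cabs z * cabs (z ^+ m - w ^+ m) <= M * (m%:R * M ^+ m * cabs (z - w)).
  by apply: ler_pM; rewrite ?cabs_ge0//; exact: ih.
have h2 : cabs (z - w) * cabs (w ^+ m) <= cabs (z - w) * (M * M ^+ m).
  rewrite ler_wpM2l ?cabs_ge0//; apply: le_trans cXm _.
  by rewrite ler_peMl ?exprn_ge0.
by apply: le_trans (lerD h1 h2) _; rewrite exprS -natr1; apply: eq_leW; ring.
Qed.

Lemma powR_add_le (t x y : R) : 0 <= t -> 0 <= x -> 0 <= y ->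
  (x + y) `^ t <= 2 `^ t * (x `^ t + y `^ t).
Proof.
move=> t0; wlog xy : x y / x <= y.
  by move=> H x0 y0; have [/H|/ltW /H] := leP x y; [apply|rewrite addrC [x `^ _ + _]addrC; apply].
move=> x0 y0; apply: (@le_trans _ _ ((2 * y) `^ t)); first by apply: le_powR2r; rewrite ?addr_ge0//; lra.
by rewrite powRM// ler_wpM2l ?powR_ge0// lerDr powR_ge0.
Qed.

Section compactness.
Implicit Types (f g b : X -> C) (bs : seq (X -> C)) (x y : X).

Lemma int_tail (F : X -> \bar R) (G : (set X)^nat) (e : R) : measurable_fun setT F ->
  (forall x, 0 <= F x)%E -> (\int[mu]_x F x < +oo)%E -> nondecreasing_seq G ->
  (forall j, measurable (G j)) -> [set: X] `<=` \bigcup_j G j -> 0 < e ->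
  exists j : nat, (\int[mu]_(x in ~` G j) F x <= e%:E)%E.
Proof.
move=> mF F0 Foo ndG mG GT e0; apply/not_existsP => H.
have IE : (\int[mu]_x F x)%E = (fine (\int[mu]_x F x))%:E by rewrite fineK// ge0_fin_numE ?integral_ge0.
set I := fine _ in IE.
suff : (\int[mu]_x F x <= (I - e)%:E)%E by rewrite IE lee_fin; lra.
apply: (int_exhaust (G := G)) => // j; have /negP := H j; rewrite -ltNge => hj.
have : (\int[mu]_(x in G j) F x + \int[mu]_(x in ~` G j) F x = I%:E)%E.
  rewrite -IE -ge0_integral_setU ?setUv//; first exact: measurableC.
  by apply/disj_setPS => x [].
have i1 : (0 <= \int[mu]_(x in G j) F x)%E by apply: integral_ge0.
move: i1 hj; case: (\int[mu]_(x in G j) F x)%E => [r| |]//;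
  case: (\int[mu]_(x in ~` G j) F x)%E => [r'| |]// _.
by rewrite lte_fin -EFinD => hr [<-]; rewrite lee_fin; lra.
Qed.

Lemma box_nd : nondecreasing_seq (fun j : nat => box j%:R : set X).
Proof. by move=> i j ij; apply/subsetPset; apply: box_sub; rewrite ?ler_nat. Qed.

Lemma box_cover : [set: X] `<=` \bigcup_(j in setT) box j%:R.
Proof.
move=> x _; exists (Num.bound `|x|) => //; apply/boxE => //.
by apply: ltW; exact: archi_boundP.
Qed.

Definition phi (e : R) x : R := (1 + `|x|) `^ e.

Lemma phi_ge0 e x : 0 <= phi e x. Proof. exact: powR_ge0. Qed.

Lemma measurable_phi e : measurable_fun setT (phi e : X -> R).
Proof.
apply: (measurableT_comp (measurable_powR e)); apply: measurable_funD => //.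
exact: measurable_rV_norm.
Qed.

Lemma norm_shift (r s : R) x y : 0 <= r -> 0 < s -> `|x| <= r -> s <= `|x - y| ->
  1 + `|y| <= ((1 + r) / s + 1) * `|x - y|.
Proof.
move=> r0 s0 xr sxy; have yx : `|y| <= `|x| + `|x - y|.
  by rewrite -[y in X in X <= _](subKr x); exact: ler_normB.
have : (1 + r) <= (1 + r) / s * `|x - y| by rewrite mulrAC ler_pdivlMr// ler_wpM2l// addr_ge0.
lra.
Qed.

Lemma powR_shift (e L p z : R) : e <= 0 -> 0 < L -> 0 < p -> p <= L * z -> z `^ e <= L^-1 `^ e * p `^ e.
Proof.
move=> e0 L0 p0 pz; rewrite -powRM ?invr_ge0 ?(ltW L0) ?(ltW p0)//.
by apply: powR_le_neg => //; [rewrite mulr_gt0 ?invr_gt0|rewrite mulrC ler_pdivrMr// mulrC].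
Qed.

Variables (al Ck So B : R) (om : nat -> R) (K : X -> X -> R) (T : (X -> C) -> X -> C).
Hypotheses (al0 : 0 <= al) (aln : al <= n%:R) (KB : kernel_bounds al Ck So om K) (LO : local_op al B K T).

(** All that is kept of a test function: measurability, a bound, a bounded support and uniform
    continuity. *)
Definition unif_supp (G r0 : R) g := [/\ cmeasurable g, forall x, r0 < `|x| -> g x = 0,
  forall x, cabs (g x) <= G & forall e : R, 0 < e -> exists2 d : R, 0 < d &
    forall x y, `|x - y| <= d -> cabs (g x - g y) <= e].

Section far_part.
Variables (G r0 : R) (g : X -> C) (m : nat) (s : R).
Hypotheses (ug : unif_supp G r0 g) (G1 : 1 <= G) (r00 : 0 <= r0) (m0 : (0 < m)%N) (s0 : 0 < s).
Let e := al - n%:R.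
Let e0 : e <= 0. Proof. by rewrite subr_le0. Qed.
Let Ck0 : 0 <= Ck. Proof. exact: kb_Ck KB. Qed.

Definition far_kernel x y : C := (g x - g y) ^+ m * (K x y)%:C%C.

Let gB x y : cabs (g x - g y) <= 2 * G.
Proof. by have [_ _ gG _] := ug; apply: le_trans (cabsD _ _) _; rewrite cabsN mulr2n mulrDl mul1r lerD. Qed.

Let gBX x y : cabs ((g x - g y) ^+ m) <= (2 * G) ^+ m.
Proof.
elim: m => [|k ih]; first by rewrite !expr0 /= expr0n/= addr0 expr1n sqrtr1.
by rewrite !exprS cabsM; apply: ler_pM; rewrite ?cabs_ge0.
Qed.

(** One of the points lies within [r0] of the origin, otherwise the positive power of [g x - g y]
    vanishes; hence [(1 + |x|) (1 + |y|) <= L |x - y|], and the kernel is dominated by a tensor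
    product. One factor will lie in the target space, the other in the dual of the source. *)
Lemma far_kernel_le : exists2 C3 : R, 0 <= C3 & forall x y, s <= `|x - y| ->
  cabs (far_kernel x y) <= C3 * phi e x * phi e y.
Proof.
pose L := (1 + r0) * ((1 + r0) / s + 1).
have q0 : 0 <= (1 + r0) / s by rewrite divr_ge0 ?addr_ge0// ltW.
have L0 : 0 < L by apply: mulr_gt0; [rewrite ltr_wpDr|rewrite ltr_wpDl].
exists ((2 * G) ^+ m * Ck * L^-1 `^ e).
  by rewrite !mulr_ge0 ?powR_ge0// exprn_ge0// mulr_ge0// (le_trans _ G1).
move=> x y sxy; have [_ gr _ _] := ug.
have xy0 : 0 < `|x - y| by exact: lt_le_trans sxy.
have nxy : x != y by rewrite -subr_eq0 -normr_gt0.
have hL : `|x| <= r0 \/ `|y| <= r0 -> (1 + `|x|) * (1 + `|y|) <= L * `|x - y|.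
  case=> h; rewrite /L -mulrA; last rewrite mulrC; apply: ler_pM; rewrite ?addr_ge0// ?lerD2l//.
    exact: norm_shift.
  by rewrite distrC; apply: norm_shift => //; rewrite distrC.
have [h|] := pselect (`|x| <= r0 \/ `|y| <= r0); last first.
  move=> /not_orP[/negP h1 /negP h2]; rewrite /far_kernel !gr ?ltNge// subrr expr0n gtn_eqF// mul0r cabs0.
  by rewrite !mulr_ge0 ?powR_ge0 ?phi_ge0// exprn_ge0// mulr_ge0// (le_trans _ G1).
rewrite /far_kernel cabsM cabs_real -!mulrA; apply: ler_pM; rewrite ?cabs_ge0 ?normr_ge0//.
apply: le_trans (kb_size KB nxy) _; rewrite ler_wpM2l// /phi -powRM ?addr_ge0//.
by apply: powR_shift => //; exact: hL.
Qed.

Lemma far_kernel_diff (r eta : R) : 0 <= r -> 0 < eta -> exists2 h : R, 0 < h & forall x x' y,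
  `|x| <= r -> s <= `|x - y| -> s <= `|x' - y| -> `|x - x'| <= h ->
  cabs (far_kernel x y - far_kernel x' y) <= eta * phi e y.
Proof.
move=> rp eta0; have [_ _ _ uc] := ug.
pose L := (1 + r) / s + 1; have L0 : 0 < L by rewrite ltr_wpDl ?divr_ge0 ?addr_ge0 ?(ltW s0).
pose c := L^-1 `^ e; have c0 : 0 < c by rewrite powR_gt0// invr_gt0.
pose M := (2 * G) ^+ m; have M0 : 0 <= M by rewrite exprn_ge0// mulr_ge0// (le_trans _ G1).
have p1 : 0 < m%:R * M * Ck * c + 1 by rewrite ltr_wpDl// !mulr_ge0// ltW.
have p2 : 0 < M * c + 1 by rewrite ltr_wpDl// mulr_ge0// ltW.
have [d1 d10 hd1] := uc (eta / 2 / (m%:R * M * Ck * c + 1)) (divr_gt0 (divr_gt0 eta0 (ltr0Sn _ 1)) p1).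
have [h2 h20 hh2] := kb_small KB (divr_gt0 (divr_gt0 eta0 (ltr0Sn _ 1)) p2).
exists (Num.min d1 (h2 * s)); first by rewrite lt_min d10 mulr_gt0.
move=> x x' y xr sx sx'; rewrite le_min => /andP[xd xh].
have xy0 : 0 < `|x - y| by exact: lt_le_trans sx.
have nxy : x != y by rewrite -subr_eq0 -normr_gt0.
have pz : `|x - y| `^ e <= c * phi e y.
  by apply: powR_shift => //; exact: norm_shift.
have f0 := phi_ge0 e y.
have -> : far_kernel x y - far_kernel x' y = ((g x - g y) ^+ m - (g x' - g y) ^+ m) * (K x y)%:C%C +
    (g x' - g y) ^+ m * (K x y - K x' y)%:C%C by rewrite /far_kernel rmorphB; ring.
apply: le_trans (cabsD _ _) _; rewrite !cabsM !cabs_real.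
have t1 : cabs ((g x - g y) ^+ m - (g x' - g y) ^+ m) * `|K x y| <= eta / 2 * phi e y.
  have G2 : 1 <= 2 * G by rewrite (le_trans G1)// ler_peMl ?ler1n// (le_trans _ G1).
  have hx := exprB_le m G2 (gB x y) (gB x' y).
  have E : g x - g y - (g x' - g y) = g x - g x' by ring.
  rewrite E in hx.
  apply: (@le_trans _ _ (m%:R * M * (eta / 2 / (m%:R * M * Ck * c + 1)) * (Ck * (c * phi e y)))).
    apply: ler_pM; rewrite ?cabs_ge0 ?normr_ge0//.
      by apply: le_trans hx _; rewrite ler_wpM2l ?mulr_ge0//; exact: hd1.
    by apply: le_trans (kb_size KB nxy) _; rewrite ler_wpM2l.
  have -> : m%:R * M * (eta / 2 / (m%:R * M * Ck * c + 1)) * (Ck * (c * phi e y)) =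
      (eta / 2 * phi e y) * ((m%:R * M * Ck * c) / (m%:R * M * Ck * c + 1)) by ring.
  rewrite ler_piMr ?mulr_ge0 ?(ltW eta0)// ler_pdivrMr// mul1r; lra.
have t2 : cabs ((g x' - g y) ^+ m) * `|K x y - K x' y| <= eta / 2 * phi e y.
  apply: (@le_trans _ _ (M * (eta / 2 / (M * c + 1) * (c * phi e y)))).
    apply: ler_pM; rewrite ?cabs_ge0 ?normr_ge0//.
    apply: le_trans (hh2 _ _ _ nxy _) _.
      by apply: le_trans xh _; rewrite ler_wpM2l// ltW.
    by rewrite ler_wpM2l// divr_ge0 ?(ltW p2)// divr_ge0// ltW.
  have -> : M * (eta / 2 / (M * c + 1) * (c * phi e y)) = (eta / 2 * phi e y) * ((M * c) / (M * c + 1)) by ring.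
  rewrite ler_piMr ?mulr_ge0 ?(ltW eta0)// ler_pdivrMr// mul1r; lra.
by apply: le_trans (lerD t1 t2) _; lra.
Qed.

End far_part.

End compactness.

End weighted_estimate.

Section cells.
Context {R : realType} {n : nat}.
Local Notation X := 'rV[R]_n.

Lemma finite_cells (t r : R) : 0 < t -> 0 <= r -> exists L : seq 'rV[int]_n,
  (forall x : X, `|x| <= r -> idx t x \in L) /\
  (forall x : X, idx t x \in L -> `|x| <= r + 2 * t).
Proof.
move=> t0 r0; pose M := Num.bound (r / t).
have rM : r / t < M%:R by apply: archi_boundP; rewrite divr_ge0// ltW.
pose k (f : {ffun 'I_n -> 'I_(2 * M).+1}) : 'rV[int]_n := \row_i ((f i)%:Z - M%:Z).
exists [seq d <- codom k | `|corner t d : X| <= r + t]; split => x.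
  move=> xr; rewrite mem_filter; apply/andP; split.
    have := ltW (dcube_dist t0 (dcube_idx t x) (dcube_corner (idx t x) t0)).
    move=> h; rewrite -[corner t (idx t x)](subKr x).
    by apply: le_trans (ler_normB _ _) _; exact: lerD.
  have fl i : - (M%:Z) <= Num.floor (x ord0 i / t) <= M%:Z.
    have : `|x ord0 i / t| < M%:R.
      rewrite normrM [`|t^-1|]gtr0_norm ?invr_gt0//; apply: le_lt_trans rM.
      by rewrite ler_pM2r ?invr_gt0//; exact: le_trans (rV_coord_le x i) xr.
    rewrite ltr_norml => /andP[h1 h2]; apply/andP; split.
      by rewrite floor_ge_int mulrNz ltW.
    by rewrite -ltzD1 floor_lt_int rmorphD/= (lt_trans h2)// ltrDl.
  apply/codomP; exists [ffun i => inord `|(Num.floor (x ord0 i / t) + M%:Z)%R|%N].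
  apply/rowP => i; rewrite !mxE ffunE inordK; have := fl i; move: (Num.floor _) => z; lia.
rewrite mem_filter => /andP[h _].
have := ltW (dcube_dist t0 (dcube_idx t x) (dcube_corner (idx t x) t0)).
have : `|x| <= `|x - corner t (idx t x)| + `|corner t (idx t x) : X|.
  by rewrite -[X in `|X| <= _](subrK (corner t (idx t x)) x); exact: ler_normD.
lra.
Qed.

End cells.

(** The three errors of the approximation by step functions, near the diagonal, on a bounded region
    and at infinity, each take at most a third of [eps]. *)
Lemma budget_le {R : realType} (eps q p V c : R) : 0 < eps -> 0 < q -> 0 < p -> 0 <= V -> 0 <= c ->
  q * (eps / 3 / (q * p) * p + q * (eps / 3 / (q * q * (V + 1)) * V +
    c * (eps / 3 / (q * q * (c + 1))))) <= eps.
Proof.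
move=> eps0 q0 p0 V0 c0; have V1 : 0 < V + 1 by rewrite ltr_wpDl.
have c1 : 0 < c + 1 by rewrite ltr_wpDl.
rewrite [leLHS](_ : _ = eps / 3 * (1 + V / (V + 1) + c / (c + 1))); last by field; rewrite !gt_eqF.
have h1 : V / (V + 1) <= 1 by rewrite ler_pdivrMr//; lra.
have h2 : c / (c + 1) <= 1 by rewrite ler_pdivrMr//; lra.
by rewrite -[leRHS](divfK (_ : 3 != 0))// ler_pM2l ?divr_gt0//; lra.
Qed.

Section compactness_of_commutators.
Context {R : realType} {n : nat}.
Local Notation X := 'rV[R]_n.
Local Notation C := R[i].
Local Notation mu := (leb R n).

(** * Approximation of commutators by step functions *)

Section finite_rank.
Implicit Types (f g b : X -> C) (bs : seq (X -> C)) (x y : X).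
Variables (al Ck So B : R) (om : nat -> R) (K : X -> X -> R) (T : (X -> C) -> X -> C).
Hypotheses (al0 : 0 <= al) (aln : al <= n%:R) (KB : kernel_bounds al Ck So om K) (LO : local_op al B K T).
Variables (a b A : R) (v u : X -> R) (D : dual_pair a b A v u).
Hypotheses (n0 : (0 < n)%N) (a1 : a < 1) (b1 : b < 1) (alE : al = n%:R * (1 - a - b)).
Let D' := dual_pairC D.
Let e := al - n%:R.
Local Notation phi := (phi (R := R) (n := n) e).

Let phiE x : phi x = (1 + `|x|) `^ e. Proof. by []. Qed.

(** The exponent [al - n = - n (a + b)], divided by [a], is exactly the one of [wt_tail]. *)
Lemma phi_tail_a : (\int[mu]_x ((phi x * v x `^ a) `^ a^-1)%:E < +oo)%E.
Proof.
have := wt_tail D n0; congr (_ < _)%E; apply: eq_integral => x _; congr _%:E.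
have a0 := dp_a D; rewrite powRM ?powR_ge0// powRVK ?gt_eqF//; last exact: dp_v0 D _.
rewrite phiE -powRrM; congr (_ `^ _ * _).
by rewrite /e alE; field; rewrite gt_eqF.
Qed.

(** Hoelder for the factors [|f| v ^ a] and [phi u ^ b], whose product is [phi |f|] almost
    everywhere; the second is controlled by [wt_tail] for the dual pair. *)
Lemma phi_int : exists2 Psi : R, 0 <= Psi & forall f, cmeasurable f ->
  (wint a v (1 - b)^-1 setT f <= 1%:E)%E -> (\int[mu]_y (phi y * cabs (f y))%:E <= Psi%:E)%E.
Proof.
have b0 := dp_b D; have b1' : 0 < 1 - b by rewrite subr_gt0.
have mv := dp_mv D; have mu' := dp_mu D; have v0 := dp_v0 D; have u0 := dp_u0 D.
have mp (h : X -> R) t : measurable_fun setT h -> measurable_fun setT (fun x => h x `^ t).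
  by move=> mh; exact: (measurableT_comp (measurable_powR t)).
have mphi : measurable_fun setT phi by exact: measurable_phi.
pose U y := (phi y * u y `^ b) `^ b^-1.
have mU : measurable_fun setT U by apply: (mp _ _ _); apply: measurable_funM => //; exact: mp.
have U0 y : 0 <= U y by exact: powR_ge0.
have Uoo : (\int[mu]_y (U y)%:E < +oo)%E.
  have := wt_tail D' n0; congr (_ < _)%E; apply: eq_integral => x _; congr _%:E.
  rewrite /U powRM ?powR_ge0// powRVK ?gt_eqF// phiE -powRrM; congr (_ `^ _ * _).
  by rewrite /e alE; field; rewrite gt_eqF.
have UE y : U y `^ b = phi y * u y `^ b.
  by apply: powRKV; [exact: lt0r_neq0|exact: mulr_ge0 (phi_ge0 _ _) (powR_ge0 _ _)].
clearbody U.
have I0 : (0 <= \int[mu]_y (U y)%:E)%E by apply: integral_ge0 => y _; rewrite lee_fin.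
pose I := fine (\int[mu]_y (U y)%:E)%E.
have IE : (\int[mu]_y (U y)%:E)%E = I%:E by rewrite fineK// ge0_fin_numE.
exists (I `^ b) => [|f mf Hf]; first exact: powR_ge0.
pose F y := (cabs (f y) * v y `^ a) `^ (1 - b)^-1.
have mF : measurable_fun setT F.
  by apply: (mp _ _ _); apply: measurable_funM; [exact: measurable_cabs|exact: mp].
have F0 y : 0 <= F y by exact: powR_ge0.
have FE y : F y `^ (1 - b) = cabs (f y) * v y `^ a.
  by apply: powRKV; [exact: lt0r_neq0|exact: mulr_ge0 (cabs_ge0 _) (powR_ge0 _ _)].
have HF : (\int[mu]_y (F y)%:E <= 1)%E by [].
clearbody F.
rewrite (ae_eq_int (mu := mu) (g := fun y => (F y `^ (1 - b) * U y `^ b)%:E))//; last first.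
- apply: filterS (dp_ae D) => y vu _; congr _%:E.
  rewrite FE UE; transitivity (v y `^ a * u y `^ b * (phi y * cabs (f y))); first by rewrite vu mul1r.
  by move: (v y `^ a) (u y `^ b) (phi y) => c1 c2 c3; ring.
- by move=> y; rewrite lee_fin mulr_ge0 ?powR_ge0.
- by move=> y; rewrite lee_fin mulr_ge0 ?powR_ge0 ?cabs_ge0.
- by apply/measurable_EFinP; apply: measurable_funM; exact: mp.
- by apply/measurable_EFinP; apply: measurable_funM => //; exact: measurable_cabs.
have := @hoelder_int _ _ _ mu setT F U (1 - b) b measurableT mF mU F0 U0 b1' b0 (subrK _ _).
move=> /le_trans; apply; rewrite IE poweR_EFin -[leRHS]mul1e; apply: lee_wpmul2r.
  by rewrite lee_fin powR_ge0.
rewrite (_ : 1%E = (1%:E `^ (1 - b))%E); last by rewrite poweR_EFin powR1.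
by apply: (le_poweR2r (ltW b1') _ HF); apply: integral_ge0 => y _; rewrite lee_fin.
Qed.

Section cell.
Variables (G r0 : R) (g : X -> C) (m : nat).
Hypotheses (ug : unif_supp G r0 g) (G1 : 1 <= G) (r00 : 0 <= r0) (m0 : (0 < m)%N).

(** The kernel is cut sharply, cell by cell, instead of by a smooth cutoff: for [x] in the cell [k],
    what is integrated lies outside the tripled cell. *)
Definition far_part s k f x : C :=
  cintegral setT (fun y => far_kernel K g m x y * crestr (~` triple s k) f y).

Lemma unif_supp_lmomc : lmomc g.
Proof.
have [mg _ gG _] := ug; split => //; apply: (@lmom_bounded _ _ _ G); first exact: measurable_cabs.
by move=> x; rewrite cabs_ge0 gG.
Qed.

Lemma cmeasurable_far_kernel x : cmeasurable (far_kernel K g m x).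
Proof.
have [mg _ _ _] := ug; apply: cmeasurableM; last by apply: cmeasurable_real; exact: (kb_meas KB).
elim: (m) => [|k ih]; first by under eq_fun do rewrite expr0; exact: cmeasurable_cst.
under eq_fun do rewrite exprS; apply: cmeasurableM => //; exact: cmeasurableB.
Qed.

Lemma near_far s k f : 0 < s -> mclass f -> {ae mu, forall x, dcube s k x ->
  comms T (nseq m g) f x = comms T (nseq m g) (crestr (triple s k) f) x + far_part s k f x}.
Proof.
move=> s0 mf; have lbs : lmomcs (nseq m g) by move=> c /nseqP[-> _]; exact: unif_supp_lmomc.
have mt : measurable (triple s k : set X) by exact: measurable_triple.
have mf1 := mclass_restr mt mf; have mf2 := mclass_restr (measurableC mt) mf.
apply: filterS2 (lin_add (fun w f g => comms_lin (lo_lin LO) w lbs) mf1 mf2) (comms_far aln KB LO lbs mf2) => x h1 h2 kx.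
have fE : (fun y => crestr (triple s k) f y + crestr (~` triple s k) f y) = f.
  apply/funext => y; rewrite /crestr in_setC; case: ifP => /= _; by rewrite ?addr0 ?add0r.
rewrite fE in h1; rewrite h1 h2.
  rewrite /kernel_integral /far_part; congr (_ + cintegral _ _); apply/funext => y.
  by rewrite /far_kernel big_nseq iter_mulr_1 mulrA [_%:C%C * _]mulrC.
exists s => // y xy; rewrite /crestr memNset// => ty; move: xy.
by rewrite ltNge (ntriple_dist s0 kx).
Qed.

(** Only [phi_int] is used of [f], so the bounds are uniform on the unit ball. The constant [C4]
    comes before [r] and [eta], which can therefore be chosen in terms of it. *)
Lemma far_bounds s : 0 < s -> exists2 C4 : R, 0 <= C4 &
  forall (r eta : R), 0 <= r -> 0 < eta -> exists2 h : R, 0 < h & forall f, mclass f ->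
  (wint a v (1 - b)^-1 setT f <= 1%:E)%E ->
  (forall k x, dcube s k x -> cabs (far_part s k f x) <= C4 * phi x) /\
  (forall k x x', dcube s k x -> dcube s k x' -> `|x| <= r -> `|x - x'| <= h ->
    cabs (far_part s k f x - far_part s k f x') <= eta).
Proof.
move=> s0; have [Psi Psi0 HPsi] := phi_int.
have [C3 C30 far_le] := far_kernel_le aln KB ug G1 r00 m0 s0.
exists (2 * C3 * Psi); first by rewrite !mulr_ge0.
move=> r eta rp eta0.
have P1 : 0 < 2 * Psi + 1 by rewrite ltr_wpDl// mulr_ge0.
have [h h0 Hh] := far_kernel_diff aln KB m ug G1 s0 rp (divr_gt0 eta0 P1).
exists h => // f mf Hf.
have If := HPsi f (mclass_meas mf) Hf.
have mphi : measurable_fun setT phi by exact: measurable_phi.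
have mcf : measurable_fun setT (fun y => cabs (f y)) by apply: measurable_cabs; exact: mclass_meas.
pose Z k := crestr (~` triple s k) f.
have mZ k : cmeasurable (Z k).
  by apply: cmeasurable_restr; [apply: measurableC; exact: measurable_triple|exact: mclass_meas].
have Z_le k y : cabs (Z k y) <= cabs (f y).
  by rewrite /Z cabs_restr ler_piMl ?cabs_ge0// indicE; case: (_ \in _).
have Zout k x y : dcube s k x -> Z k y != 0 -> s <= `|x - y|.
  move=> kx; rewrite /Z /crestr; case: ifPn => [/set_mem ty _|_]; last by rewrite eqxx.
  exact: ntriple_dist ty.
have bound (H : X -> C) (c : R) k : 0 <= c -> cmeasurable H ->
    (forall y, Z k y != 0 -> cabs (H y) <= c * phi y) ->
    cint setT (fun y => H y * Z k y) /\ cabs (cintegral setT (fun y => H y * Z k y)) <= 2 * c * Psi.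
  move=> c0 mH HH.
  have I1 : (\int[mu]_y (cabs (H y * Z k y))%:E <= (c * Psi)%:E)%E.
    apply: (@le_trans _ _ (\int[mu]_y (c%:E * (phi y * cabs (f y))%:E))%E).
      apply: le_int => // y _; rewrite -?EFinM ?lee_fin ?cabs_ge0 ?mulr_ge0 ?cabs_ge0 ?phi_ge0//.
      rewrite cabsM; have [->|z0] := eqVneq (Z k y) 0.
        by rewrite cabs0 mulr0 !mulr_ge0 ?cabs_ge0 ?phi_ge0.
      by rewrite mulrA; apply: ler_pM; rewrite ?cabs_ge0//; exact: HH.
    rewrite int_scale//.
    - by rewrite EFinM; apply: lee_wpmul2l; rewrite ?lee_fin.
    - by apply/measurable_EFinP; exact: measurable_funM.
    - by move=> y; rewrite lee_fin mulr_ge0 ?cabs_ge0 ?phi_ge0.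
  have ci : cint setT (fun y => H y * Z k y).
    by split; [exact: cmeasurableM|apply: (le_lt_trans I1); exact: ltry].
  split => //; rewrite -lee_fin; apply: le_trans (cabs_cintegral_le measurableT ci) _.
  by rewrite -mulrA EFinM; apply: lee_wpmul2l; rewrite ?lee_fin.
have ci k x : dcube s k x -> cint setT (fun y => far_kernel K g m x y * Z k y) /\
    cabs (far_part s k f x) <= 2 * (C3 * phi x) * Psi.
  move=> kx; apply: bound (cmeasurable_far_kernel x) _; first by rewrite mulr_ge0 ?phi_ge0.
  by move=> y /(Zout _ _ _ kx); exact: far_le.
split => [k x /ci[_]|k x x' kx kx' xr xx].
  by rewrite (_ : 2 * (C3 * phi x) * Psi = 2 * C3 * Psi * phi x)//; ring.
have [c1 _] := ci k x kx; have [c2 _] := ci k x' kx'.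
have -> : far_part s k f x - far_part s k f x' =
    cintegral setT (fun y => (far_kernel K g m x y - far_kernel K g m x' y) * Z k y).
  rewrite /far_part -cintegralN// -cintegralD//; last exact: cintN.
  by congr cintegral; apply/funext => y; rewrite mulrBl.
have e0 : 0 <= eta / (2 * Psi + 1) by rewrite divr_ge0 ?ltW.
have [_ h2] := bound (fun y => far_kernel K g m x y - far_kernel K g m x' y) _ k e0
  (cmeasurableB (cmeasurable_far_kernel x) (cmeasurable_far_kernel x')) (fun y zy =>
   Hh x x' y xr (Zout _ _ _ kx zy) (Zout _ _ _ kx' zy) xx).
apply: le_trans h2 _; 
have -> : 2 * (eta / (2 * Psi + 1)) * Psi = eta * (2 * Psi / (2 * Psi + 1)) by ring.
rewrite ler_piMr ?(ltW eta0)// ler_pdivrMr// mul1r; lra.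
Qed.

Definition stepf (t : R) (L : seq 'rV[int]_n) (c : 'rV[int]_n -> C) x : C :=
  if idx t x \in L then c (idx t x) else 0.

Lemma cmeasurable_stepf t L c : 0 < t -> cmeasurable (stepf t L c).
Proof.
move=> t0; pose h (r : C -> R) k := r (if k \in L then c k else 0).
have mh (r : C -> R) : measurable_fun setT (fun x : X => r (stepf t L c x)).
  by have := @measurable_dset_fun R n t 0 _ _ (h r) t0; rewrite side0.
by split; exact: mh.
Qed.

(** On a cell of side [s] the near part is a commutator whose symbol varies little on the tripled
    cell. The far part is bounded by [C4 phi] and varies little within cells on bounded sets, so
    inside a box it is close to its values at the corners of cells of side [t], and outside it is
    small in norm. Only the coefficients [c] depend on [f]. *)
Lemma finite_rank_approx (eps : R) : 0 < eps -> exists t L Mc, 0 < t /\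
  forall f, mclass f -> (wint a v (1 - b)^-1 setT f <= 1%:E)%E ->
  exists c, (forall k, cabs (c k) <= Mc) /\
  (wint a v a^-1 setT (fun x => comms T (nseq m g) f x - stepf t L c x)%R <= eps%:E)%E.
Proof.
move=> eps0; have a0 := dp_a D; have mv := dp_mv D; have v0 := dp_v0 D.
have [C1 C10 Hloc] := wint_local al0 aln KB LO D n0 a1 b1 alE m.
pose q := a^-1; have q0 : 0 < q by rewrite invr_gt0.
pose q2 : R := 2 `^ q; have q20 : 0 < q2 by rewrite powR_gt0.
pose p3 : R := 3 ^+ n; have p30 : 0 < p3 by rewrite exprn_gt0.
pose ka := eps / 3 / (q2 * p3).
have ka0 : 0 < ka by rewrite divr_gt0 ?mulr_gt0// divr_gt0.
(* The bound [1 / 3] gives [(3 * ee) ^ m <= 3 * ee] for positive [m]; the other one makes the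
   constant of the near part at most [ka]. *)
pose ee := Num.min (3^-1) (ka `^ a / (3 * (C1 + 1))).
have C11 : 0 < C1 + 1 by rewrite ltr_wpDl.
have ee0 : 0 < ee by rewrite lt_min invr_gt0 ltr0n divr_gt0 ?powR_gt0// mulr_gt0.
have [mg gr gG uc] := ug; have [d d0 hd] := uc ee ee0.
(* Points of a cell and of its tripled cell are at distance less than [2 * s = d]. *)
pose s := d / 2; have s0 : 0 < s by rewrite divr_gt0.
have [C4 C40 Hfar] := far_bounds s0.
have nearC : (C1 * (3 * ee) ^+ m) `^ q <= ka.
  rewrite -[leRHS](powRVK (t := a)) ?gt_eqF ?(ltW ka0)//; apply: le_powR2r (ltW q0) _ _.
    by rewrite mulr_ge0 ?exprn_ge0// mulr_ge0// ltW.
  apply: (@le_trans _ _ (C1 * (3 * ee))).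
    apply: ler_wpM2l => //; rewrite -[leRHS]expr1; apply: ler_wiXn2l => //; first by rewrite mulr_ge0// ltW.
    by rewrite mulrC -ler_pdivlMr// mul1r ge_min lexx.
  have : ee <= ka `^ a / (3 * (C1 + 1)) by rewrite ge_min lexx orbT.
  rewrite ler_pdivlMr ?mulr_gt0// => h; apply: le_trans h.
  have -> : ee * (3 * (C1 + 1)) = C1 * (3 * ee) + 3 * ee by ring.
  by rewrite lerDl mulr_ge0// ltW.
have phi_a := phi_tail_a.
pose tail x := ((phi x * v x `^ a) `^ q)%:E.
have mtail : measurable_fun setT tail.
  apply: measurable_powRE; apply: measurable_funM; first exact: measurable_phi.
  exact: (measurableT_comp (measurable_powR a)).
pose tau := eps / 3 / (q2 * q2 * (C4 `^ q + 1)).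
have tau0 : 0 < tau by rewrite divr_gt0 ?mulr_gt0 ?divr_gt0// ltr_wpDl// powR_ge0.
have [j Hj] := int_tail mtail (fun x => powR_ge0 _ _) phi_a (@box_nd R n) (fun j => measurable_box j%:R) (@box_cover R n) tau0.
pose r2 := j%:R + 2 * s; have r20 : 0 <= r2 by rewrite addr_ge0// mulr_ge0// ltW.
pose V2 := wt v (box r2); have V20 : 0 <= V2 by exact: wt_ge0 D _.
pose eta := (eps / 3 / (q2 * q2 * (V2 + 1))) `^ a.
have eta0 : 0 < eta by rewrite powR_gt0// divr_gt0 ?mulr_gt0 ?divr_gt0// ltr_wpDl.
have [h h0 Hf] := Hfar r2 eta r20 eta0.
(* Halving [s] makes the cells of side [t] refine those of side [s], so the corner used for the step
   function lies in the same [s]-cell as [x]. *)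
have [N HN] := side_small s0 h0; pose t := side s N.
have t0 : 0 < t by exact: side_gt0.
have ts : t <= s by rewrite /t /side ler_pdivrMr ?exprn_gt0// ler_peMr ?(ltW s0)// exprn_ege1// ler1n.
have [L [Lin Lout]] := @finite_cells R n t j%:R t0 (ler0n R j).
exists t, L, C4; split => // f mf nf; have [F1 F2] := Hf f mf nf.
pose sk (k : 'rV[int]_n) : 'rV[int]_n := iter N par k.
have skE x : idx s x = sk (idx t x) by rewrite (idx_sub s0 N).
pose c (k : 'rV[int]_n) : C := far_part s (sk k) f (corner t k).
exists c; split => [k|].
  have kc : dcube s (sk k) (corner t k : X).
    by rewrite /dcube/= skE (dcube_corner k t0).
  apply: le_trans (F1 _ _ kc) _; rewrite ler_piMr//.
  rewrite phiE -[leRHS](powRr0 (1 + `|corner t k : X|)); apply: ler_powR; last by rewrite /e subr_le0.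
  by rewrite lerDl.
pose U x := comms T (nseq m g) f x - stepf t L c x.
have lbs : lmomcs (nseq m g) by move=> c' /nseqP[-> _]; exact: unif_supp_lmomc.
have mU : cmeasurable U.
  by apply: cmeasurableB; [exact: comms_meas (lo_meas LO) lbs mf|exact: cmeasurable_stepf].
pose del x := eta * \1_(box r2) x + C4 * phi x * \1_(~` box j%:R) x.
have del0 x : 0 <= del x by rewrite addr_ge0 ?mulr_ge0 ?phi_ge0// ltW.
have far_del x : cabs (far_part s (idx s x) f x - stepf t L c x) <= del x.
  rewrite /stepf; case: ifPn => xL.
    have xr : `|x| <= r2 by apply: le_trans (Lout x xL) _; rewrite lerD2l ler_pM2l.
    rewrite /del indicE mem_set ?mulr1; last exact/boxE.
    apply: (@le_trans _ _ eta); last by rewrite lerDl !mulr_ge0 ?phi_ge0.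
    rewrite /c -skE; apply: F2 => //; first by rewrite /dcube/= skE (dcube_corner _ t0) -skE.
    by apply: le_trans (HN N (leqnn _)); apply: ltW; apply: dcube_dist t0 (dcube_idx t x) (dcube_corner _ t0).
  rewrite subr0 /del [in X in _ + X]indicE mem_set ?mulr1; last by move=> /(boxE _ (ler0n R j)) /Lin; exact/negP.
  by apply: le_trans (F1 (idx s x) x (dcube_idx s x)) _; rewrite lerDr mulr_ge0// ltW.
pose P := (1 - b)^-1; pose Fp y := ((cabs (f y) * v y `^ a) `^ P)%:E.
have mFp : measurable_fun setT Fp by apply: (measurable_wint D); exact: mclass_meas.
have Fp0 y : (0 <= Fp y)%E by rewrite lee_fin powR_ge0.
pose dl x := ((del x * v x `^ a) `^ q)%:E.
have mdel : measurable_fun setT del.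
  have mi (E : set X) : measurable E -> measurable_fun setT (\1_E : X -> R) by move=> mE; exact: measurable_indic.
  have mb (r : R) : measurable (box r : set X) by exact: measurable_box.
  apply: measurable_funD; apply: measurable_funM; [exact: measurable_cst|exact: mi| |].
    by apply: measurable_funM; [exact: measurable_cst|exact: measurable_phi].
  by apply: mi; exact: measurableC.
have mdl : measurable_fun setT dl.
  apply: measurable_powRE; apply: measurable_funM => //.
  exact: (measurableT_comp (measurable_powR a)).
have dl0 x : (0 <= dl x)%E by rewrite lee_fin powR_ge0.
(* The integrals over tripled cells enter through a function constant on cells, so that their sum
   over all cells is one integral, bounded by [int_avg3]. *)
pose av x := avg3 s Fp (idx s x).
have mav : measurable_fun setT av.
  by have := @measurable_dset_fun R n s 0 _ _ (avg3 s Fp) s0; rewrite side0.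
have av0 x : (0 <= av x)%E by exact: avg3_ge0.
pose H x := (q2%:E * (ka%:E * av x + dl x))%E.
have mH1 : measurable_fun setT (fun x => ka%:E * av x + dl x)%E.
  by apply: emeasurable_funD => //; exact: measurable_funeM.
have H10 x : (0 <= ka%:E * av x + dl x)%E by rewrite adde_ge0// mule_ge0// lee_fin ltW.
have HE (E : set X) : measurable E -> (\int[mu]_(x in E) H x =
    q2%:E * (ka%:E * \int[mu]_(x in E) av x + \int[mu]_(x in E) dl x))%E.
  move=> mE; rewrite /H int_scale ?(ltW q20)// int_add//; [|exact: measurable_funeM|].
    by rewrite int_scale// ltW.
  by move=> x; rewrite mule_ge0// lee_fin ltW.
have Ifp : (\int[mu]_x Fp x <= 1)%E by [].
have cube k : (\int[mu]_(x in dcube s k) ((cabs (U x) * v x `^ a) `^ q)%:E <= \int[mu]_(x in dcube s k) H x)%E.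
  have mQ : measurable (dcube s k : set X) by exact: measurable_dcube.
  have mt : measurable (triple s k : set X) by exact: measurable_triple.
  have mfk := mclass_restr mt mf.
  pose V := comms T (nseq m g) (crestr (triple s k) f).
  have mV : cmeasurable V by exact: comms_meas (lo_meas LO) lbs mfk.
  have mVp := measurable_wint D q mV.
  have Vp0 x : (0 <= ((cabs (V x) * v x `^ a) `^ q)%:E)%E by rewrite lee_fin powR_ge0.
  apply: (@le_trans _ _ (\int[mu]_(x in dcube s k) (q2%:E * (((cabs (V x) * v x `^ a) `^ q)%:E + dl x)))%E).
    apply: ae_le_int => //; first exact: (measurable_wint D q mU).
    - by apply: measurable_funeM; exact: emeasurable_funD.
    - by move=> x; rewrite lee_fin powR_ge0.
    - by move=> x; apply: mule_ge0; [rewrite lee_fin ltW|exact: adde_ge0].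
    apply: filterS (near_far k s0 mf) => x h1 kx; rewrite -EFinD -EFinM lee_fin.
    have p1 : 0 <= cabs (V x) * v x `^ a by rewrite mulr_ge0 ?cabs_ge0 ?powR_ge0.
    have p2 : 0 <= del x * v x `^ a by rewrite mulr_ge0 ?powR_ge0.
    apply: le_trans (powR_add_le (ltW q0) p1 p2); apply: le_powR2r (ltW q0) _ _.
      by rewrite mulr_ge0 ?cabs_ge0 ?powR_ge0.
    rewrite -mulrDl; apply: ler_wpM2r; first exact: powR_ge0.
    rewrite /U (h1 kx) -addrA; apply: le_trans (cabsD _ _) _; rewrite lerD2l -{1}kx; exact: far_del.
  rewrite HE// int_scale ?(ltW q20)//; last 2 first.
  - exact: emeasurable_funD.
  - by move=> x; rewrite adde_ge0.
  apply: lee_wpmul2l; first by rewrite lee_fin ltW.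
  rewrite int_add//; apply: leeD => //.
  pose I := fine (\int[mu]_(x in triple s k) Fp x)%E.
  have I0' : (0 <= \int[mu]_(x in triple s k) Fp x)%E by apply: integral_ge0.
  have I1' : (\int[mu]_(x in triple s k) Fp x <= 1)%E by apply: le_trans Ifp; apply: le_int.
  have IE : (\int[mu]_(x in triple s k) Fp x = I%:E)%E.
    by rewrite /I; move: I0' I1'; case: (integral _ _ _).
  have I0 : 0 <= I by exact: fine_ge0.
  have I1 : I <= 1 by rewrite -lee_fin -IE.
  have -> : (\int[mu]_(x in dcube s k) av x = I%:E)%E.
    rewrite -IE (eq_integral (cst (avg3 s Fp k))); last by move=> x /set_mem kx; rewrite /av kx.
    rewrite integral_cst// measure_dcube// /avg3 muleAC -EFinM mulVf ?mul1e//.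
    by rewrite gt_eqF// exprn_gt0.
  (* Freezing the symbol outside the tripled cell does not change the commutator on the cell, by
     [comms_local], and makes its oscillation at most [3 * ee] on all cubes. *)
  pose z := g (corner s k); pose g' y := if y \in triple s k then g y else z.
  have og : osc_le (3 * ee) g'.
    apply: (osc_le_close (z := z)).
      rewrite (_ : g' = fun y => crestr (triple s k) g y + crestr (~` triple s k) (fun=> z) y).
        by apply: cmeasurableD; apply: cmeasurable_restr => //; exact: measurableC.
      apply/funext => y; rewrite /g' /crestr in_setC; case: ifP => _ /=; by rewrite ?addr0 ?add0r.
    move=> y; rewrite /g'; case: ifPn => [/set_mem yt|_]; last by rewrite subrr cabs0 ltW.
    apply: hd; rewrite distrC; apply: le_trans (ltW (triple_dist s0 (dcube_corner k s0) yt)) _.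
    by rewrite /s mulrC divfK.
  have -> : (\int[mu]_(x in dcube s k) ((cabs (V x) * v x `^ a) `^ q)%:E =
      wint a v a^-1 (dcube s k) (comms T (nseq m g') (crestr (triple s k) (crestr (triple s k) f))))%E.
    apply: eq_integral => x /set_mem kx; congr ((cabs _ * _) `^ _)%:E.
    have -> : crestr (triple s k) (crestr (triple s k) f) = crestr (triple s k) f.
      by apply/funext => y; rewrite /crestr; case E : (y \in triple s k).
    rewrite -(map_nseq m (fun=> g') g); apply/esym; apply: (@comms_local _ _ _ (triple s k)).
    - by move=> b0 /nseqP[-> _] y ty; rewrite /g' mem_set.
    - by move=> y ty; rewrite /crestr memNset.
    - exact: dcube_triple.
  have Nf : (wint a v P setT (crestr (triple s k) f) <= ((I `^ (1 - b)) `^ P)%:E)%E.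
    rewrite powRVK ?lt0r_neq0 ?subr_gt0// -IE; apply: eq_leW.
    apply: int_eq_sub => // y ty; rewrite /crestr; first by rewrite mem_set.
    by rewrite memNset// cabs0 mul0r powR0// invr_eq0 gt_eqF// subr_gt0.
  have := Hloc (nseq m g') (fun=> 3 * ee) (size_nseq _ _) _ _ s k _ s0 mfk (powR_ge0 _ _) Nf.
  move=> /(_ _)/le_trans; apply; first by move=> c' /nseqP[-> _]; rewrite mulr_gt0.
  rewrite -EFinM lee_fin big_nseq iter_mulr_1 powRM ?powR_ge0//; last first.
    by rewrite mulr_ge0 ?exprn_ge0// mulr_ge0// ltW.
  apply: ler_pM; rewrite ?powR_ge0// -powRrM.
  (* Since [(1 - b) / a = q / p >= 1] and [I <= 1], the power of [I] is at most [I], which can be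
     summed over cells. *)
  have [->|Ine] := eqVneq I 0; first by rewrite powR0// mulf_neq0 ?invr_eq0 ?gt_eqF ?subr_gt0.
  have Ip : 0 < I by rewrite lt_neqAle eq_sym Ine.
  rewrite -[leRHS]powRr1//; apply: ger_powR; first by rewrite Ip.
  have := al0; rewrite alE pmulr_rge0 ?ltr0n// => h3.
  by rewrite ler_pdivlMr// mul1r; lra.
have total : (\int[mu]_x ((cabs (U x) * v x `^ a) `^ q)%:E <= \int[mu]_x H x)%E.
  have UT : \bigcup_(k in [set: 'rV[int]_n]) dcube s k = [set: X].
    by apply/seteqP; split => // x _; exists (idx s x).
  have := @le_int_bigcup _ _ _ mu _ setT (dcube s) setT setT
    (fun x => ((cabs (U x) * v x `^ a) `^ q)%:E) H.
  rewrite UT setIT; apply => //.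
  - by move=> k _; exact: measurable_dcube.
  - by move=> k k' _ _ [x [<- <-]].
  - exact: (measurable_wint D q mU).
  - exact: measurable_funeM.
  - by move=> x; rewrite lee_fin powR_ge0.
  - by move=> x; rewrite mule_ge0// lee_fin ltW.
  - by move=> k _; rewrite !setIT; exact: cube.
apply: (le_trans total); rewrite HE//.
have dlI : (\int[mu]_x dl x <= (q2 * (eta `^ q * V2 + C4 `^ q * tau))%:E)%E.
  have mbj : measurable (~` box j%:R : set X) by apply: measurableC; exact: measurable_box.
  have mbr : measurable (box r2 : set X) by exact: measurable_box.
  have m1 : measurable_fun setT (fun x => ((\1_(box r2) x * v x)%:E : \bar R)).
    by apply/measurable_EFinP; apply: measurable_funM => //; exact: measurable_indic.
  have m2 : measurable_fun setT (fun x => ((\1_(~` box j%:R) x)%:E * tail x)%E).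
    by apply: emeasurable_funM => //; apply/measurable_EFinP; exact: measurable_indic.
  have t0' x : (0 <= tail x)%E by rewrite lee_fin powR_ge0.
  have z1 x : (0 <= (\1_(box r2) x * v x)%:E :> \bar R)%E by rewrite lee_fin mulr_ge0.
  have z2 x : (0 <= (\1_(~` box j%:R) x)%:E * tail x)%E by rewrite mule_ge0// lee_fin.
  have cq := powR_ge0 C4 q; have eq := powR_ge0 eta q.
  apply: (@le_trans _ _ (\int[mu]_x (q2%:E * ((eta `^ q)%:E * (\1_(box r2) x * v x)%:E +
      (C4 `^ q)%:E * ((\1_(~` box j%:R) x)%:E * tail x))))%E).
    apply: le_int => // x _; first by apply: mule_ge0; [rewrite lee_fin ltW|apply: adde_ge0; apply: mule_ge0].
    change (((del x * v x `^ a) `^ q)%:E <= (q2 * (eta `^ q * (\1_(box r2) x * v x) +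
      C4 `^ q * (\1_(~` box j%:R) x * (phi x * v x `^ a) `^ q)))%R%:E)%E.
    rewrite lee_fin /del mulrDl.
    apply: le_trans (powR_add_le (ltW q0) _ _) _; rewrite ?mulr_ge0 ?phi_ge0 ?powR_ge0 ?(ltW eta0)//.
    apply: (ler_wpM2l (ltW q20)); apply: lerD.
      rewrite -mulrA powRM ?mulr_ge0 ?powR_ge0 ?(ltW eta0)//; apply: ler_wpM2l => //.
      rewrite indicE; case: (x \in _); first by rewrite !mul1r powRVK ?gt_eqF.
      by rewrite !mul0r powR0// gt_eqF.
    rewrite -!mulrA powRM ?mulr_ge0 ?phi_ge0 ?powR_ge0//; apply: ler_wpM2l => //.
    rewrite mulrCA indicE; case: (x \in _); first by rewrite !mul1r.
    by rewrite !mul0r powR0// gt_eqF.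
  rewrite int_scale ?(ltW q20)//; last 2 first.
  - by apply: emeasurable_funD; exact: measurable_funeM.
  - by move=> x; apply: adde_ge0; apply: mule_ge0.
  rewrite [leRHS]EFinM; apply: lee_wpmul2l; first by rewrite lee_fin ltW.
  rewrite int_add//; [|exact: measurable_funeM|exact: measurable_funeM|by move=> x; rewrite mule_ge0|by move=> x; rewrite mule_ge0].
  rewrite !int_scale// EFinD; apply: leeD; rewrite EFinM; apply: lee_wpmul2l; rewrite ?lee_fin//.
    have r2p : 0 < r2 by rewrite ltr_wpDl ?mulr_gt0.
    rewrite /V2 -(wtE D (c := const_mx (- r2)) (l := 2 * r2))// ?mulr_gt0//.
    apply: eq_leW; apply: int_eq_sub => // x xb; rewrite indicE.
      by rewrite mem_set ?mul1r.
    by rewrite memNset ?mul0r.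
  apply: le_trans Hj; apply: eq_leW; apply: int_eq_sub => // x xb; rewrite indicE.
    by rewrite mem_set ?mul1e.
  by rewrite memNset ?mul0e.
have avI : (\int[mu]_x av x <= p3%:E)%E.
  apply: le_trans (int_avg3 s0 mFp Fp0) _; rewrite -[leRHS]mule1.
  by apply: lee_wpmul2l => //; rewrite lee_fin ltW.
apply: (@le_trans _ _ (q2%:E * (ka%:E * p3%:E + (q2 * (eta `^ q * V2 + C4 `^ q * tau))%:E))%E).
  apply: lee_wpmul2l; first by rewrite lee_fin ltW.
  by apply: leeD dlI; apply: lee_wpmul2l avI; rewrite lee_fin ltW.
rewrite -(EFinM ka p3) -EFinD -(EFinM q2) lee_fin.
have -> : eta `^ q = eps / 3 / (q2 * q2 * (V2 + 1)).
  apply: powRVK; [by rewrite gt_eqF|apply: divr_ge0; first by rewrite divr_ge0// ltW].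
  by apply: mulr_ge0; [apply: mulr_ge0; exact: ltW|exact: addr_ge0].
by rewrite /ka /tau; apply: budget_le => //; exact: powR_ge0.
Qed.

End cell.

End finite_rank.

(** * Passage to symbols in CMO *)

Section cmo_symbols.
Implicit Types (f g b : X -> C) (bs : seq (X -> C)) (x y : X).

Lemma osc_le_bmo (M : R) f : (forall c l, 0 < l -> cint (cube c l) f) -> (bmo_norm f <= M%:E)%E ->
  osc_le M f.
Proof.
move=> cf fM c l l0; split; first exact: cf.
have ln : 0 < l ^+ n by rewrite exprn_gt0.
have : (((vol (cube c l))^-1)%:E * \int[mu]_(x in cube c l) (cabs (f x - average (cube c l) f))%:E <= M%:E)%E.
  by apply: le_trans fM; apply: ereal_sup_ubound; exists (cube c l) => //; exists c, l.
by rewrite vol_cube ?(ltW l0)// lee_pdivrMl// -EFinM mulrC.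
Qed.

Lemma osc_leB (M M' : R) f g : osc_le M f -> osc_le M' g -> osc_le (M + M') (fun x => f x - g x).
Proof.
move=> of_ og c l l0; have [cf If] := of_ c l l0; have [cg Ig] := og c l l0.
have mQ := @measurable_cube R n c l.
have cd : cint (cube c l) (fun x => f x - g x) by apply: cintD => //; exact: cintN.
split => //; have aE : average (cube c l) (fun x => f x - g x) = average (cube c l) f - average (cube c l) g.
  rewrite /average -mulrBr; congr (_ * _).
  by rewrite (cintegralD mQ cf (cintN cg)) cintegralN.
have mo h z : cint (cube c l) h -> measurable_fun setT (fun x => (cabs (h x - z))%:E).
  by move=> [mh _]; apply: measurable_cabsE; apply: cmeasurableB => //; exact: cmeasurable_cst.
rewrite mulrDl EFinD; apply: le_trans (leeD If Ig).
rewrite -int_add//; [|exact: mo|exact: mo|by move=> x; rewrite lee_fin cabs_ge0|by move=> x; rewrite lee_fin cabs_ge0].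
apply: le_int => // x _; rewrite -?EFinD lee_fin ?addr_ge0 ?cabs_ge0// aE.
have -> : f x - g x - (average (cube c l) f - average (cube c l) g) =
  (f x - average (cube c l) f) + - (g x - average (cube c l) g) by ring.
by apply: le_trans (cabsD _ _) _; rewrite cabsN.
Qed.

Variables (al Ck So B : R) (om : nat -> R) (K : X -> X -> R) (T : (X -> C) -> X -> C).
Hypotheses (al0 : 0 <= al) (aln : al <= n%:R) (KB : kernel_bounds al Ck So om K) (LO : local_op al B K T).
Variables (a b A : R) (v u : X -> R) (D : dual_pair a b A v u).
Hypotheses (n0 : (0 < n)%N) (a1 : a < 1) (b1 : b < 1) (alE : al = n%:R * (1 - a - b)).

Lemma wintD (P : R) f g : 0 <= P -> cmeasurable f -> cmeasurable g ->
  (wint a v P setT (fun x => f x + g x)%R <= (2 `^ P)%:E * (wint a v P setT f + wint a v P setT g))%E.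
Proof.
move=> P0 mf mg; have mF := measurable_wint D P mf; have mG := measurable_wint D P mg.
have p h x : (0 <= ((cabs (h x) * v x `^ a) `^ P)%:E)%E by rewrite lee_fin powR_ge0.
rewrite /wint -int_add// -int_scale ?powR_ge0//; [|exact: emeasurable_funD|by move=> x; rewrite adde_ge0].
apply: le_int => //; [by move=> x _; rewrite lee_fin powR_ge0| |move=> x _].
  by move=> x _; apply: mule_ge0; [rewrite lee_fin powR_ge0|exact: adde_ge0].
rewrite -EFinD -EFinM lee_fin.
have q h : 0 <= cabs (h x) * v x `^ a by rewrite mulr_ge0 ?cabs_ge0 ?powR_ge0.
apply: le_trans (powR_add_le P0 (q f) (q g)); apply: (le_powR2r P0); first exact: (q (fun x => f x + g x)).
by rewrite -mulrDl ler_wpM2r ?powR_ge0//; exact: cabsD.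
Qed.

Lemma wint_ae (P : R) f g : cmeasurable f -> cmeasurable g -> {ae mu, forall x, f x = g x} ->
  wint a v P setT f = wint a v P setT g.
Proof.
move=> mf mg fg; apply: ae_eq_int => //; [exact: (measurable_wint D)|exact: (measurable_wint D)| | |].
- by move=> x; rewrite lee_fin powR_ge0.
- by move=> x; rewrite lee_fin powR_ge0.
by apply: filterS fg => x -> _.
Qed.

Lemma wint0 (P : R) : P != 0 -> wint a v P setT (fun=> 0) = 0%E.
Proof. by move=> P0; apply: integral0_eq => x _; rewrite cabs0 mul0r powR0. Qed.

Lemma comms_nseq_cat i g bs f : comms T (nseq i g ++ g :: bs) f = comms T (nseq i.+1 g ++ bs) f.
Proof. by rewrite -cat_rcons; congr (comms T (_ ++ _) f); elim: i => //= i ->. Qed.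

(** The symbols are replaced one at a time; each difference is a commutator with one symbol [be - g]
    of oscillation at most [de], the others being at most [M1]. As [wint] is a power of a norm,
    every use of [wintD] costs the factor [q2]. *)
Lemma cmo_finite_rank (m : nat) (be : X -> C) (M eps : R) : (0 < m)%N -> 0 < eps -> osc_le M be ->
  (forall d : R, 0 < d -> exists G r0 g, [/\ 1 <= G, 0 <= r0, unif_supp G r0 g &
    osc_le d (fun x => be x - g x)]) ->
  exists t L Mc, 0 < t /\
  forall f, mclass f -> (wint a v (1 - b)^-1 setT f <= 1%:E)%E ->
  exists c, (forall k, cabs (c k) <= Mc) /\
  (wint a v a^-1 setT (fun x => comms T (nseq m be) f x - stepf t L c x)%R <= eps%:E)%E.
Proof.
move=> m0 eps0 ob app; have a0 := dp_a D.
pose q := a^-1; have q0 : 0 < q by rewrite invr_gt0.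
pose q2 : R := 2 `^ q; have q20 : 0 < q2 by rewrite powR_gt0.
have q21 : 1 <= q2 by rewrite /q2 -[X in X <= _](powRr0 (2 : R)); apply: ler_powR; rewrite ?ler1n// ltW.
have [C1 C10 HW] := weighted_bound al0 aln KB LO D n0 a1 b1 alE m.
pose M1 := `|M| + 1; have M11 : 1 <= M1 by rewrite lerDr.
have M10 : 0 < M1 by exact: lt_le_trans M11.
pose ka := eps / (2 * q2) / (m%:R * q2 ^+ m).
have mq : 0 < m%:R * q2 ^+ m by rewrite mulr_gt0 ?ltr0n ?exprn_gt0.
have ka0 : 0 < ka by rewrite !divr_gt0// mulr_gt0.
have CM : 0 < C1 * M1 ^+ m + 1 by rewrite ltr_wpDl// mulr_ge0// exprn_ge0// ltW.
(* The bound [de <= 1] keeps the oscillation of [g] at most [M1]. *)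
pose de := Num.min 1 (ka `^ a / (C1 * M1 ^+ m + 1)).
have de0 : 0 < de by rewrite lt_min ltr01 divr_gt0// powR_gt0.
have [G [r0 [g [G1 r00 ug od]]]] := app de de0.
have ob1 : osc_le M1 be by apply: osc_le_mono ob; rewrite /M1 (le_trans (ler_norm _))// lerDl.
have og : osc_le M1 g.
  rewrite (_ : g = fun x => be x - (be x - g x)); last by apply/funext => x; ring.
  apply: osc_le_mono (osc_leB ob od); rewrite /M1; apply: lerD; first exact: ler_norm.
  by rewrite ge_min lexx.
have lb := osc_le_lmomc ob1; have lg := osc_le_lmomc og.
have e20 : 0 < eps / (2 * q2) by rewrite divr_gt0 ?mulr_gt0.
have [t [L [Mc [t0 HF]]]] := finite_rank_approx al0 aln KB LO D n0 a1 b1 alE ug G1 r00 m0 e20.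
exists t, L, Mc; split => // f mf nf; have [c [cM cI]] := HF f mf nf; exists c; split => //.
have lln i j : lmomcs (nseq i g ++ nseq j be).
  by move=> h; rewrite mem_cat => /orP[] /nseqP[-> _].
have mcm i j : cmeasurable (comms T (nseq i g ++ nseq j be) f) by exact: comms_meas (lo_meas LO) (lln i j) mf.
pose dl x := be x - g x.
have ldl : lmomc dl := osc_le_lmomc od.
have step i j : (i + j.+1)%N = m ->
    (wint a v q setT (fun x => comms T (nseq i g ++ nseq j.+1 be) f x - comms T (nseq i.+1 g ++ nseq j be) f x)%R <= ka%:E)%E.
  move=> ij; pose bs := nseq i g ++ dl :: nseq j be.
  have li h : h \in nseq i g -> lmomc h by move=> /nseqP[-> _].
  have lj h : h \in nseq j be -> lmomc h by move=> /nseqP[-> _].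
  have lbs : lmomcs bs by move=> h; rewrite mem_cat inE => /or3P[/li//|/eqP ->//|/lj].
  have mbs : cmeasurable (comms T bs f) by exact: comms_meas (lo_meas LO) lbs mf.
  rewrite (wint_ae _ (cmeasurableB (mcm i j.+1) (mcm i.+1 j)) mbs); last first.
    apply: filterS (comms_subst LO li lj lb lg mf) => x.
    rewrite [comms T (nseq i g ++ nseq j.+1 be) f x]/= comms_nseq_cat => ->.
    by rewrite addrC addKr.
  pose Mf (h : X -> C) := if h == dl then de else M1.
  have sz : size bs = m by rewrite size_cat /= !size_nseq.
  have Mfo h : h \in bs -> 0 < Mf h /\ osc_le (Mf h) h.
    rewrite /Mf; case: eqVneq => [-> _|hd]; first by [].
    by rewrite mem_cat inE (negbTE hd) => /orP[] /nseqP[-> _].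
  have := HW bs Mf sz Mfo f 1 mf ler01; rewrite powR1 => /(_ nf) /le_trans; apply.
  rewrite lee_fin mulr1 -[leRHS](powRVK (t := a)) ?gt_eqF ?(ltW ka0)//.
  have Mf0 h : 0 <= Mf h by rewrite /Mf; case: ifP => _; exact: ltW.
  have Mf1 h : Mf h <= M1.
    by rewrite /Mf; case: ifP => // _; apply: le_trans M11; rewrite ge_min lexx.
  apply: (le_powR2r (ltW q0)); first by rewrite mulr_ge0 ?prodr_ge0.
  apply: (@le_trans _ _ (C1 * (M1 ^+ m * de))).
    apply: ler_wpM2l => //; rewrite big_cat big_cons !big_nseq !iter_mulr_1 {2}/Mf eqxx.
    have h1 : Mf g ^+ i <= M1 ^+ i by rewrite lerXn2r ?nnegrE// ltW.
    have h2 : Mf be ^+ j <= M1 ^+ j by rewrite lerXn2r ?nnegrE// ltW.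
    change (Mf g ^+ i * (de * Mf be ^+ j) <= M1 ^+ m * de).
    rewrite mulrCA mulrC; apply: (ler_wpM2r (ltW de0)).
    apply: (@le_trans _ _ (M1 ^+ i * M1 ^+ j)); first by apply: ler_pM; rewrite ?exprn_ge0.
    by rewrite -exprD; apply: ler_weXn2l => //; rewrite -ij addnS.
  have : de <= ka `^ a / (C1 * M1 ^+ m + 1) by rewrite ge_min lexx orbT.
  rewrite ler_pdivlMr// => h; apply: le_trans h; rewrite mulrA mulrC ler_wpM2l ?(ltW de0)//.
  by rewrite lerDl.
have tele j i : (i + j)%N = m ->
    (wint a v q setT (fun x => comms T (nseq i g ++ nseq j be) f x - comms T (nseq m g ++ nseq 0 be) f x)%R <=
      (j%:R * q2 ^+ j * ka)%:E)%E.
  elim: j i => [|j ih] i ij.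
    rewrite addn0 in ij; rewrite ij (_ : (fun _ => _) = fun=> 0); last by apply/funext => x; rewrite subrr.
    by rewrite wint0 ?mul0r ?mul0r// gt_eqF.
  have e1 := step i j ij; have ij' : (i.+1 + j)%N = m by rewrite -ij addSnnS.
  rewrite (_ : (fun x => _ - _) = fun x =>
    (comms T (nseq i g ++ nseq j.+1 be) f x - comms T (nseq i.+1 g ++ nseq j be) f x) +
    (comms T (nseq i.+1 g ++ nseq j be) f x - comms T (nseq m g ++ nseq 0 be) f x)); last first.
    by apply/funext => x; rewrite subrKA.
  apply: le_trans (wintD (ltW q0) (cmeasurableB (mcm _ _) (mcm _ _)) (cmeasurableB (mcm _ _) (mcm _ _))) _.
  apply: le_trans (lee_wpmul2l _ (leeD e1 (ih _ ij'))) _; first by rewrite lee_fin ltW.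
  rewrite -EFinD -EFinM lee_fin -/q2 exprS.
  have : q2 * ka <= q2 * q2 ^+ j * ka.
    by rewrite ler_wpM2r ?(ltW ka0)// ler_peMr ?(ltW q20)// exprn_ege1.
  rewrite -natr1 => h; apply: le_trans (_ : _ <= q2 * q2 ^+ j * ka + j%:R * (q2 * q2 ^+ j) * ka) _.
    by rewrite mulrDr; apply: lerD => //; apply: eq_leW; ring.
  by apply: eq_leW; ring.
have t1 := tele m 0%N (add0n m); rewrite cats0 in t1.
rewrite (_ : (fun x => _ - _) = fun x => (comms T (nseq m be) f x - comms T (nseq m g) f x) +
  (comms T (nseq m g) f x - stepf t L c x)); last by apply/funext => x; rewrite subrKA.
have mg : cmeasurable (comms T (nseq m g) f) by have := mcm m 0%N; rewrite cats0.
have mb : cmeasurable (comms T (nseq m be) f) by exact: (mcm 0%N m).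
apply: le_trans (wintD (ltW q0) (cmeasurableB mb mg) (cmeasurableB mg (cmeasurable_stepf _ _ t0))) _.
apply: le_trans (lee_wpmul2l _ (leeD t1 cI)) _; first by rewrite lee_fin ltW.
rewrite -EFinD -EFinM lee_fin -/q2 /ka mulrCA mulfV ?gt_eqF// mulr1.
by apply: eq_leW; field; rewrite gt_eqF.
Qed.

End cmo_symbols.

(** With [d k] the sum of all allowed later steps, [u k - d k] increases and [u k + d k] decreases
    from [N] on; the first gives the limit, both together the rate. *)
Lemma geo_cvg (u : R^nat) (c : R) N :
  (forall k, (N <= k)%N -> `|u k.+1 - u k| <= c * 2^-1 ^+ k) ->
  exists l : R, u @ \oo --> l /\ forall k, (N <= k)%N -> `|l - u k| <= 2 * c * 2^-1 ^+ k.
Proof.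
move=> H; pose d k : R := 2 * c * 2^-1 ^+ k.
have h20 : 0 < (2^-1 : R) by rewrite invr_gt0.
have c0 : 0 <= c by rewrite -(pmulr_lge0 _ (exprn_gt0 N h20)) (le_trans _ (H N _)).
have d0 k : 0 <= d k by rewrite !mulr_ge0 ?exprn_ge0.
have dS k : d k = d k.+1 + c * 2^-1 ^+ k by rewrite /d exprS; field.
have step k j : (N <= k)%N -> u (k + j)%N - d (k + j)%N >= u k - d k /\ u (k + j)%N + d (k + j)%N <= u k + d k.
  move=> Nk; elim: j => [|j [ih1 ih2]]; first by rewrite addn0.
  have := H (k + j)%N (leq_trans Nk (leq_addr _ _)); rewrite addnS ler_norml => /andP[h1 h2].
  by have := dS (k + j)%N; lra.
pose y j := u (N + j)%N - d (N + j)%N.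
have nd : nondecreasing_seq y.
  apply/nondecreasing_seqP => j; rewrite /y.
  by have [+ _] := step (N + j)%N 1%N (leq_addr _ _); rewrite addn1 addnS.
have ub : has_ubound (range y).
  exists (u N + d N) => _ [j _ <-]; have [_ h] := step N j (leqnn _).
  by rewrite /y; have := d0 (N + j)%N; lra.
have ycv : y @ \oo --> limn y by exact: nondecreasing_is_cvgn nd ub.
pose l := limn y; exists l.
have dcv : (fun j => d (N + j)%N) @ \oo --> (0 : R).
  rewrite (_ : (fun _ => _) = fun j => d N * 2^-1 ^+ j); last by apply/funext => j; rewrite /d exprD mulrA.
  rewrite -[X in _ --> X](mulr0 (d N)); apply: cvgMr; apply: cvg_expr.
  by rewrite ger0_norm ?invr_ge0// invf_lt1// ltr1n.
have ucv : u @ \oo --> l.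
  rewrite -(cvg_shiftn N); rewrite (_ : (fun n => u (n + N)%N) = fun j => y j + d (N + j)%N).
    by have := cvgD ycv dcv; rewrite addr0; apply.
  by apply/funext => j; rewrite /y subrK addnC.
split => // k Nk; have cvk : (fun j => u (k + j)%N) @ \oo --> l.
  by rewrite (_ : (fun _ => _) = fun j => u (j + k)%N); [rewrite cvg_shiftn|apply/funext => j; rewrite addnC].
have h1 : l <= u k + d k.
  rewrite -(cvg_lim _ cvk)//; apply: limr_le; first by apply: cvgP cvk.
  by apply: nearW => j; have [_ h] := step k j Nk; have := d0 (k + j)%N; lra.
have h2 : u k - d k <= l.
  rewrite -(cvg_lim _ cvk)//; apply: limr_ge; first by apply: cvgP cvk.
  by apply: nearW => j; have [h _] := step k j Nk; have := d0 (k + j)%N; lra.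
by rewrite ler_norml -/(d k); apply/andP; split; lra.
Qed.

(** * Completeness of the weighted spaces *)

Section lp_complete.
Implicit Types (f g : X -> C) (x : X).
Variables (p : R) (w : weight R n).
Hypothesis p1 : 1 < p.
Let p0 : 0 < p. Proof. exact: lt_trans p1. Qed.
Let w0 x : 0 <= w x. Proof. exact: weight_ge0. Qed.

Definition wpow f : \bar R := (\int[mu]_x ((cabs (f x) * w x) `^ p)%:E)%E.

Lemma wnorm_wpow f : wnorm p w f = (wpow f `^ p^-1)%E.
Proof.
by congr (_ `^ _)%E; apply: eq_integral => x _; rewrite powRM ?cabs_ge0.
Qed.

Lemma wpow_ge0 f : (0 <= wpow f)%E.
Proof. by apply: integral_ge0 => x _; rewrite lee_fin powR_ge0. Qed.

Lemma measurable_wpow f : cmeasurable f -> measurable_fun setT (fun x => ((cabs (f x) * w x) `^ p)%:E).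
Proof.
move=> mf; apply: measurable_powRE; apply: measurable_funM; first exact: measurable_cabs.
exact: weight_measurable.
Qed.

Lemma wnorm_le f (c : R) : 0 <= c -> (wnorm p w f <= c%:E)%E <-> (wpow f <= (c `^ p)%:E)%E.
Proof.
move=> c0; rewrite wnorm_wpow; split => h.
  have := le_poweR2r (ltW p0) (poweR_ge0 _ _) h.
  by rewrite -poweRrM mulVf ?gt_eqF// poweRe1 ?wpow_ge0// poweR_EFin.
rewrite -[leRHS](_ : ((c `^ p)%:E `^ p^-1)%E = _); last by rewrite poweR_EFin powRVK ?gt_eqF.
by apply: le_poweR2r h; rewrite ?invr_ge0 ?(ltW p0)// wpow_ge0.
Qed.

(** Steps of norm at most [4 ^- k], weighted by [w], exceed [2 ^- k] only on a set of measure at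
    most [2 ^- k], so by Borel-Cantelli the sequence converges almost everywhere at a geometric
    rate. The limit is built from upper limits of real and imaginary parts, which makes it
    measurable. *)
Lemma riesz_fischer (h : nat -> X -> C) : (forall k, cmeasurable (h k)) ->
  (forall k, (wnorm p w (fun x => h k.+1 x - h k x)%R <= (4^-1 ^+ k)%:E)%E) ->
  exists2 g, cmeasurable g & forall k, (wnorm p w (fun x => g x - h k x)%R <= (4 * 4^-1 ^+ k)%:E)%E.
Proof.
move=> mh hk; have mB i j : cmeasurable (fun x => h i x - h j x) by exact: cmeasurableB.
pose dk k x := cabs (h k.+1 x - h k x) * w x.
have mdk k : measurable_fun setT (dk k).
  by apply: measurable_funM; [exact: measurable_cabs|exact: weight_measurable].
have h20 : 0 < (2^-1 : R) by rewrite invr_gt0.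
have h40 : 0 < (4^-1 : R) by rewrite invr_gt0.
have dk0 k x : 0 <= dk k x by rewrite mulr_ge0 ?cabs_ge0.
pose E k := [set x | 2^-1 ^+ k < dk k x].
have mE k : measurable (E k).
  by rewrite -[X in measurable X]setTI; apply: measurable_fun_ltr => //; exact: measurable_cst.
have E_le k : (mu (E k) <= (2^-1 ^+ k)%:E)%E.
  have hh := (wnorm_le _ (exprn_ge0 k (ltW h40))).1 (hk k).
  pose y : R := 2^-1 ^+ k; have y0 : 0 < y by rewrite exprn_gt0.
  have yp : 0 < y `^ p by rewrite powR_gt0.
  have := @cheby _ _ _ mu setT _ (y `^ p) measurableT (measurable_wpow (mB k.+1 k)) (fun x => powR_ge0 _ _) (ltW yp).
  rewrite setTI (_ : [set x | _] = E k); last first.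
    apply/seteqP; split => x; rewrite /E/= lte_fin -/(dk k x) => hx.
      by rewrite ltNge; apply/negP => h'; move: hx; rewrite ltNge le_powR2r// ltW.
    by apply: gt0_ltr_powR => //; rewrite nnegrE ?dk0// ltW.
  move=> /le_trans-/(_ _ hh); rewrite (_ : 4^-1 ^+ k = y * y); last first.
    by rewrite -exprMn; congr (_ ^+ _); field.
  rewrite powRM ?(ltW y0)// EFinM lee_pmul2l ?lte_fin//= => /le_trans; apply.
  rewrite lee_fin -/y -[leRHS](powRr1 (ltW y0)); apply: ger_powR; last exact: ltW.
  by rewrite y0/=; apply: exprn_ile1; rewrite ?(ltW h20)//; apply: ltW; rewrite invf_lt1// ltr1n.
have Nul : mu (lim_sup_set E) = 0%E.
  apply: lim_sup_set_cvg0 => //; apply: (@le_lt_trans _ _ 2%:E); last exact: ltry.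
  apply: lime_le; first exact: is_cvg_nneseries.
  apply: nearW => N; apply: (@le_trans _ _ (\sum_(0 <= k < N) (2^-1 ^+ k)%:E)%E).
    by apply: lee_sum => k _; exact: E_le.
  rewrite sumEFin lee_fin; suff -> : \sum_(0 <= k < N) 2^-1 ^+ k = 2 - 2 * 2^-1 ^+ N :> R.
    by rewrite gerBl mulr_ge0// exprn_ge0// ltW.
  elim: N => [|N ih]; first by rewrite big_geq// expr0; ring.
  by rewrite big_nat_recr//= ih exprS; field.
have mLim : measurable (lim_sup_set E).
  by apply: bigcap_measurable => // k _; apply: bigcup_measurable.
pose lr (r : C -> R) x := fine (limn_esup (fun k => (r (h k x))%:E)).
pose g x : C := Complex (lr (@complex.Re R) x) (lr (@complex.Im R) x).
have mlr r : (forall k, measurable_fun setT (fun x => r (h k x))) -> measurable_fun setT (lr r).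
  move=> mr; apply: measurableT_comp => //; apply: measurable_fun_limn_esup => k.
  exact/measurable_EFinP.
have mg : cmeasurable g by split; apply: mlr => k; case: (mh k).
exists g => // k.
have gap i : (wnorm p w (fun x => h (k + i)%N x - h k x)%R <= ((2 - 2 * 4^-1 ^+ i) * 4^-1 ^+ k)%:E)%E.
  elim: i => [|i ih].
    rewrite addn0 expr0 mulr1 subrr mul0r wnorm_le// powR0 ?gt_eqF// /wpow integral0_eq// => x _.
    by rewrite subrr cabs0 mul0r powR0// gt_eqF.
  rewrite addnS (_ : (fun x => _) = (fun x => h (k + i).+1 x - h (k + i)%N x) \+ (fun x => h (k + i)%N x - h k x)); last first.
    by apply/funext => x /=; rewrite subrKA.
  apply: le_trans (le_wnorm w p1 (mB _ _) (mB _ _)) _; apply: le_trans (leeD (hk _) ih) _.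
  rewrite -EFinD lee_fin exprD exprS.
  have : 0 <= 4^-1 ^+ i * 4^-1 ^+ k :> R by rewrite mulr_ge0 ?exprn_ge0 ?ltW.
  by rewrite [_ ^+ k * _]mulrC; move: (4^-1 ^+ i) (4^-1 ^+ k) => y z yz; nra.
have gap2 j : (k <= j)%N -> (wpow (fun x => h j x - h k x)%R <= ((2 * 4^-1 ^+ k) `^ p)%:E)%E.
  move=> kj; apply/wnorm_le; first by rewrite mulr_ge0 ?exprn_ge0 ?ltW.
  have := gap (j - k)%N; rewrite subnKC// => /le_trans; apply; rewrite lee_fin.
  by rewrite ler_wpM2r ?exprn_ge0 ?(ltW h40)// gerBl mulr_ge0 ?exprn_ge0 ?ltW.
apply/wnorm_le; first by rewrite mulr_ge0 ?exprn_ge0 ?ltW.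
(* On [G N], of finite measure, the weighted difference of [g] and [h j] tends to 0 uniformly, while
   [h j - h k] has norm at most [2 * 4 ^- k]. The constant 4 results from
   [(x + y) ^ p <= 2 ^ p (x ^ p + y ^ p)]. *)
pose G N : set X := [set x | forall j, (N <= j)%N -> ~ E j x] `&` box N%:R.
have mG N : measurable (G N).
  apply: measurableI; last exact: measurable_box.
  rewrite (_ : [set x | _] = \bigcap_(j in [set j | (N <= j)%N]) ~` E j); last first.
    by apply/seteqP; split => x h' j /= /h'.
  by apply: bigcap_measurableType => j _; exact: measurableC.
have mF := measurable_wpow (cmeasurableB mg (mh k)).
rewrite /wpow (@ge0_negligible_integral _ _ _ mu setT (lim_sup_set E))//; last by move=> x _; rewrite lee_fin powR_ge0.
apply: (int_exhaust (G := G)) => //.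
- move=> i j ij; apply/subsetPset => x [h1 h2]; split; last exact: (subsetPset _ _ (box_nd ij)) h2.
  by move=> l jl; apply: h1; exact: leq_trans jl.
- move=> x [_ nx]; have [N1 HN1] : exists N, forall j, (N <= j)%N -> ~ E j x.
    apply: contrapT => /forallNP H; apply: nx => N _; have /existsNP[j] := H N.
    by move=> /not_implyP[Nj /contrapT Ej]; exists j.
  have [N2 _ HN2] := box_cover (Logic.I : setT x).
  exists (maxn N1 N2) => //; split.
    by move=> j Nj; apply: HN1; exact: leq_trans (leq_maxl _ _) Nj.
  exact: (subsetPset _ _ (box_nd (leq_maxr N1 N2))) HN2.
- by move=> x; rewrite lee_fin powR_ge0.
move=> N; have rate x j : G N x -> (N <= j)%N -> cabs (g x - h j x) * w x <= side 4 j.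
  move=> [GN _] Nj; have := w0 x; rewrite le_eqVlt => /predU1P[<-|wx].
    by rewrite mulr0 divr_ge0// exprn_ge0.
  have kb i : (N <= i)%N -> cabs (h i.+1 x - h i x) <= (w x)^-1 * 2^-1 ^+ i.
    move=> Ni; rewrite mulrC ler_pdivlMr// leNgt; apply/negP; exact: GN.
  have lim (r : C -> R) : (forall z z', `|r z - r z'| <= cabs (z - z')) ->
      `|lr r x - r (h j x)| <= 2 * (w x)^-1 * 2^-1 ^+ j.
    move=> rle; have [l [lc lb]] := @geo_cvg (fun i => r (h i x)) (w x)^-1 N
      (fun i Ni => le_trans (rle _ _) (kb i Ni)).
    rewrite (_ : lr r x = l); first exact: lb.
    rewrite /lr; have ec : (fun i => (r (h i x))%:E) @ \oo --> l%:E by apply/fine_cvgP; split => //; exact: nearW.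
    rewrite is_cvg_limn_esupE; last by apply/cvg_ex; exists l%:E.
    by rewrite (cvg_lim _ ec).
  have hR := lim (@complex.Re R) (fun z z' => _); have hI := lim (@complex.Im R) (fun z z' => _).
  rewrite -ler_pdivlMr//; apply: le_trans (cabs_le_ReIm _) _.
  have {}hR : `|complex.Re (g x - h j x)| <= 2 * (w x)^-1 * 2^-1 ^+ j.
    rewrite raddfB/=; apply: hR => z z'; rewrite -raddfB; exact: Re_le_cabs.
  have {}hI : `|complex.Im (g x - h j x)| <= 2 * (w x)^-1 * 2^-1 ^+ j.
    rewrite raddfB/=; apply: hI => z z'; rewrite -raddfB; exact: Im_le_cabs.
  apply: le_trans (lerD hR hI) _; rewrite /side exprVn; apply: eq_leW.
  by move: (2 ^+ j) => y; ring.
apply/lee_addgt0Pr => e e0; pose m := fine (mu (G N)).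
have mGoo : (mu (G N) < +oo)%E.
  by apply: le_lt_trans (box_fin (ler0n R N)); apply: measure_mono => //; [exact: measurable_box|move=> x []].
have mE' : (mu (G N) = m%:E)%E by rewrite fineK// ge0_fin_numE.
have mm0 : 0 <= m by rewrite fine_ge0.
have q20 : 0 < 2 `^ p * (m + 1) :> R by rewrite mulr_gt0 ?powR_gt0// ltr_wpDl.
have ep : 0 < (e / (2 `^ p * (m + 1))) `^ p^-1 by apply: powR_gt0; exact: divr_gt0.
have [J HJ] := side_small (ltr0n R 4) ep.
pose j := maxn J (maxn N k).
have kj : (k <= j)%N by rewrite /j !leq_max leqnn !orbT.
have Nj : (N <= j)%N by rewrite /j !leq_max leqnn orbT.
have sj := HJ j (leq_maxl _ _).
have mfj := measurable_wpow (mB j k).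
apply: (@le_trans _ _ (\int[mu]_(x in G N) ((2 `^ p)%:E * ((e / (2 `^ p * (m + 1)))%:E + ((cabs (h j x - h k x) * w x) `^ p)%:E)))%E).
  have e1 : 0 <= e / (2 `^ p * (m + 1)) by rewrite divr_ge0 ?ltW.
  apply: le_int => //; [by move=> x _; rewrite lee_fin powR_ge0| |move=> x Gx].
    by move=> x _; rewrite -EFinD -EFinM lee_fin mulr_ge0 ?addr_ge0 ?powR_ge0.
  rewrite -EFinD -EFinM lee_fin.
  have q1 : 0 <= cabs (g x - h j x) * w x by rewrite mulr_ge0 ?cabs_ge0.
  have q2 : 0 <= cabs (h j x - h k x) * w x by rewrite mulr_ge0 ?cabs_ge0.
  apply: (@le_trans _ _ ((cabs (g x - h j x) * w x + cabs (h j x - h k x) * w x) `^ p)).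
    apply: (le_powR2r (ltW p0)); first by rewrite mulr_ge0 ?cabs_ge0.
    by rewrite -mulrDl ler_wpM2r//; apply: le_trans (cabsD _ _); rewrite subrKA.
  apply: le_trans (powR_add_le (ltW p0) q1 q2) _; rewrite ler_wpM2l ?powR_ge0// lerD2r.
  rewrite -[leRHS](powRKV (t := p)) ?gt_eqF//; apply: (le_powR2r (ltW p0) q1).
  exact: le_trans (rate x j Gx Nj) sj.
rewrite int_scale ?powR_ge0//; last 2 first.
- by apply: emeasurable_funD => //; exact: measurable_cst.
- by move=> x; rewrite -EFinD lee_fin addr_ge0 ?powR_ge0// divr_ge0 ?ltW.
rewrite int_add//; last 2 first.
- by move=> x; rewrite lee_fin divr_ge0 ?ltW.
- by move=> x; rewrite lee_fin powR_ge0.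
rewrite integral_cst//= mE' -EFinM.
have Ij : (\int[mu]_(x in G N) ((cabs (h j x - h k x) * w x) `^ p)%:E <= ((2 * 4^-1 ^+ k) `^ p)%:E)%E.
  by apply: le_trans (gap2 j kj); apply: le_int => // x _; rewrite lee_fin powR_ge0.
apply: le_trans (lee_wpmul2l _ (leeD2l _ Ij)) _; first by rewrite lee_fin powR_ge0.
rewrite -EFinD -EFinM -EFinD lee_fin mulrDr addrC; apply: lerD.
  rewrite -powRM ?mulr_ge0 ?exprn_ge0 ?(ltW h40)// mulrA.
  by rewrite (_ : 2 * 2 = 4)//; ring.
rewrite [leLHS](_ : _ = e * (m / (m + 1))); last by field; rewrite !gt_eqF ?powR_gt0// ltr_wpDl.
by rewrite ler_piMr ?(ltW e0)// ler_pdivrMr ?ltr_wpDl// mul1r lerDl.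
Qed.

End lp_complete.

(** * Total boundedness and precompactness *)

Section precompactness.
Variables (p : R) (p1 : 1 < p) (w : weight R n).
Local Notation W := (wLp p1 w).
Implicit Types (f g h : X -> C) (F : W).

Lemma wnormB_le f g h (c d : R) : cmeasurable f -> cmeasurable g -> cmeasurable h ->
  (wnorm p w (fun x => f x - g x)%R <= c%:E)%E -> (wnorm p w (fun x => g x - h x)%R <= d%:E)%E ->
  (wnorm p w (fun x => f x - h x)%R <= (c + d)%:E)%E.
Proof.
move=> mf mg mh fg gh; rewrite EFinD; apply: le_trans (leeD fg gh).
rewrite (_ : (fun x => f x - h x) = (fun x => f x - g x) \+ (fun x => g x - h x)); last first.
  by apply/funext => x /=; rewrite subrKA.
by apply: le_wnorm p1 _ _; exact: cmeasurableB.
Qed.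

Lemma wLp_ex f : in_wLp p w f -> exists F, wLp_fun F = f.
Proof. by move=> hf; exists (@WLp _ _ p p1 w f (introT (asboolP _) hf)). Qed.

Lemma wLp_meas F : cmeasurable F.
Proof. by case: (wLpP F). Qed.

Lemma wLp_near F f (c : R) : cmeasurable f -> (wnorm p w (fun x => (F x : C) - f x)%R <= c%:E)%E ->
  in_wLp p w f.
Proof.
move=> mf Ff; split => //; have mF := wLp_meas F.
rewrite (_ : f = (fun x => f x - F x) \+ (F : X -> C)); last by apply/funext => x /=; rewrite subrK.
apply: le_lt_trans (le_wnorm w p1 (cmeasurableB mf mF) mF) _; apply: lte_add_pinfty; last by case: (wLpP F).
by rewrite wnorm_distC; exact: le_lt_trans Ff (ltry _).
Qed.

(** The finitely many cells lie in one box, over which [w ^ p] has a finite integral. *)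
Lemma weight_region (t : R) (L : seq 'rV[int]_n) : 0 < t ->
  (forall r : R, 0 < r -> (\int[mu]_(x in box r) (w x `^ p)%:E < +oo)%E) ->
  exists2 S : R, 0 <= S & forall f (eta : R), 0 <= eta -> cmeasurable f ->
    (forall x, cabs (f x) <= if idx t x \in L then eta else 0) -> (wnorm p w f <= (eta * S)%:E)%E.
Proof.
move=> t0 wb; have p0 : 0 < p by exact: lt_trans p1.
have [r r0 Lr] : exists2 r : R, 0 < r & forall x : X, idx t x \in L -> `|x| <= r.
  elim: L => [|k L [r r0 Lr]]; first by exists 1.
  exists (r + (`|corner t k : X| + t)) => [|x]; first by rewrite addr_gt0// ltr_wpDl.
  rewrite inE => /orP[/eqP xk|/Lr xr]; last by apply: le_trans xr _; rewrite lerDl addr_ge0// ltW.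
  have := ltW (dcube_dist t0 xk (dcube_corner k t0)).
  have : `|x| <= `|x - corner t k| + `|corner t k : X|.
    by rewrite -[X in `|X| <= _](subrK (corner t k : X) x); exact: ler_normD.
  by move: r0; lra.
pose I := fine (\int[mu]_(x in box r) (w x `^ p)%:E)%E.
have I0' : (0 <= \int[mu]_(x in box r) (w x `^ p)%:E)%E by apply: integral_ge0 => x _; rewrite lee_fin powR_ge0.
have IE : (\int[mu]_(x in box r) (w x `^ p)%:E = I%:E)%E by rewrite fineK// ge0_fin_numE// wb.
have I0 : 0 <= I by exact: fine_ge0.
have mwp : measurable_fun setT (fun x => (w x `^ p)%:E) by apply: measurable_powRE; exact: weight_measurable.
exists (I `^ p^-1) => [|f eta eta0 mf fe]; first exact: powR_ge0.
apply/(wnorm_le _ p1); first by rewrite mulr_ge0 ?powR_ge0.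
rewrite powRM ?powR_ge0// powRKV ?gt_eqF// EFinM -IE -int_scale ?powR_ge0//.
- apply: (@le_trans _ _ (\int[mu]_x ((eta `^ p)%:E * (\1_(box r) x * w x `^ p)%:E))%E); last first.
    apply: eq_leW; apply: int_eq_sub => // x xb; rewrite indicE.
      by rewrite mem_set ?mul1r.
    by rewrite memNset ?mul0r ?mule0.
  + rewrite /wpow; apply: le_int => // x _; rewrite -?EFinM lee_fin ?mulr_ge0 ?powR_ge0//.
    have := fe x; case: ifPn => [/Lr xr|_] fx.
      rewrite indicE mem_set ?mul1r; last by apply/boxE => //; exact: ltW.
      rewrite -powRM ?weight_ge0//; apply: le_powR2r; rewrite ?(ltW p0) ?mulr_ge0 ?cabs_ge0 ?weight_ge0//.
      by rewrite ler_wpM2r ?weight_ge0.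
    have -> : cabs (f x) = 0 by apply/eqP; rewrite eq_le fx cabs_ge0.
    by rewrite mul0r powR0 ?gt_eqF// !mulr_ge0 ?powR_ge0.
- exact: measurable_box.
- by move=> x; rewrite lee_fin powR_ge0.
Qed.

Lemma disc_net (M eta : R) : 0 <= M -> 0 < eta -> exists Z : seq C,
  forall z, cabs z <= M -> exists2 z', z' \in Z & cabs (z - z') <= eta.
Proof.
move=> M0 eta0; pose t := eta / 2; have t0 : 0 < t by rewrite divr_gt0.
have [L [Lin _]] := @finite_cells R 2 t M t0 M0.
pose rep (k : 'rV[int]_2) : C := Complex (t * (k ord0 ord0)%:~R) (t * (k ord0 ord_max)%:~R).
exists (map rep L) => z zM.
pose x : 'rV[R]_2 := \row_i (if i == ord0 then complex.Re z else complex.Im z).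
have xM : `|x| <= M.
  apply/rV_norm_le => // i; rewrite mxE; case: ifP => _; apply: le_trans zM; [exact: Re_le_cabs|exact: Im_le_cabs].
exists (rep (idx t x)); first by rewrite map_f// Lin.
have := dcube_dist t0 (dcube_idx t x) (dcube_corner (idx t x) t0).
move=> /(rV_norm_lt _ t0) d; have := d ord0; have := d ord_max; rewrite !mxE/= => d1 d0.
apply: le_trans (cabs_le_ReIm _) _; rewrite !raddfB/=.
rewrite /rep /= !mxE /= in d1 d0 *.
by apply: ltW; rewrite [X in _ < X](_ : _ = t + t); [exact: ltrD|rewrite /t; field].
Qed.

(** Uniform approximation by step functions on finitely many fixed cells with bounded coefficients,
    hence by a bounded part of a finite-dimensional space. *)
Definition approximable (A : set W) := forall e : R, 0 < e -> exists t L Mc, 0 < t /\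
  forall F, A F -> exists c, (forall k, cabs (c k) <= Mc) /\
    (wnorm p w (fun x => (F x : C) - stepf t L c x)%R <= e%:E)%E.

Lemma wLp_ballE F (e : R) G : ball F e G = (wnorm p w (fun x => (F x : C) - G x)%R < e%:E)%E.
Proof. by []. Qed.

Lemma ultra_pigeonhole (T : Type) (J : eqType) (H : set_system T) (P : J -> set T) (s : seq J) :
  UltraFilter H -> H [set x | exists2 j, j \in s & P j x] -> exists j, H (P j).
Proof.
move=> UH; elim: s => [|j s ih] Hs.
  by have [x [?]] := filter_ex Hs.
have [Hj|Hj] := in_ultra_setVsetC (P j) UH; first by exists j.
apply: ih; apply: filterS2 Hs Hj => x [i /=]; rewrite inE => /predU1P[->//|si] Pi _.
by exists i.
Qed.

(** An ultrafilter on the closure is Cauchy: finite nets for the coefficients and [ultra_pigeonhole]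
    place it in small balls. Centres of rapidly shrinking balls converge by [riesz_fischer], and the
    ultrafilter converges to their limit. *)
Lemma approximable_precompact (A : set W) :
  (forall r : R, 0 < r -> (\int[mu]_(x in box r) (w x `^ p)%:E < +oo)%E) ->
  approximable A -> precompact A.
Proof.
move=> wb apA; rewrite precompactE compact_ultra => H UH HA.
have apC : approximable (closure A).
  move=> e e0; have e20 : 0 < e / 2 by rewrite divr_gt0.
  have [t [L [Mc [t0 HL]]]] := apA _ e20; exists t, L, Mc; split => // F cF.
  have [F' [AF' FF']] := cF _ (nbhsx_ballx F (e / 2) e20).
  have [c [cM cF']] := HL F' AF'; exists c; split => //.
  rewrite [e](_ : _ = e / 2 + e / 2); last by field.
  apply: wnormB_le (wLp_meas F) (wLp_meas F') (cmeasurable_stepf _ _ t0) _ cF'.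
  by rewrite wLp_ballE in FF'; exact: ltW.
have cauchy (e : R) : 0 < e -> exists F0, H (ball F0 e).
  move=> e0; have e40 : 0 < e / 4 by rewrite divr_gt0.
  have [t [L [Mc [t0 HL]]]] := apC _ e40.
  have /choice[c cP] : forall F, exists c, closure A F -> (forall k, cabs (c k) <= Mc) /\
      (wnorm p w (fun x => (F x : C) - stepf t L c x)%R <= (e / 4)%:E)%E.
    move=> F; have [/HL[c cF]|nF] := pselect (closure A F); first by exists c.
    by exists (fun=> 0).
  have [S S0 HS] := weight_region L t0 wb.
  pose eta := e / 8 / (S + 1); have S1 : 0 < S + 1 by rewrite ltr_wpDl.
  have eta0 : 0 < eta by rewrite !divr_gt0.
  have M0 : 0 <= Num.max 0 Mc by rewrite le_max lexx.
  have [Z HZ] := disc_net M0 eta0.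
  have /choice[z zP] : forall k, exists z, H [set F | closure A F /\ cabs (c F k - z) <= eta].
    move=> k; have := @ultra_pigeonhole W C H (fun z => [set F | closure A F /\ cabs (c F k - z) <= eta]) Z UH.
    apply; apply: filterS HA => F cF; have [cM _] := cP F cF.
    have [|z' zZ zc] := HZ (c F k); first by rewrite le_max cM orbT.
    by exists z'.
  have HL' : H [set F | closure A F /\ forall k, k \in L -> cabs (c F k - z k) <= eta].
    elim: (L) => [|k L' ih]; first by apply: filterS HA => F cF; split.
    apply: filterS2 ih (zP k) => F [cF h1] [_ h2]; split => // k'.
    by rewrite inE => /predU1P[->|/h1].
  have [F0 [cF0 hF0]] := filter_ex HL'.
  exists F0; apply: filterS HL' => F [cF hF]; rewrite wLp_ballE.
  have [_ a0] := cP F0 cF0; have [_ a1] := cP F cF.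
  have ms c' : cmeasurable (stepf t L c') by exact: cmeasurable_stepf.
  have mid : (wnorm p w (fun x => stepf t L (c F0) x - stepf t L (c F) x)%R <= (2 * eta * S)%:E)%E.
    apply: HS; [by rewrite mulr_ge0// ltW|exact: cmeasurableB|move=> x].
    rewrite /stepf; case: ifPn => xL; last by rewrite subrr cabs0.
    rewrite (_ : _ - _ = (c F0 (idx t x) - z (idx t x)) + - (c F (idx t x) - z (idx t x))); last by ring.
    by apply: le_trans (cabsD _ _) _; rewrite cabsN mulr2n mulrDl mul1r lerD ?hF0 ?hF.
  rewrite wnorm_distC in a1.
  have := wnormB_le (wLp_meas F0) (ms _) (wLp_meas F) a0 (wnormB_le (ms _) (ms _) (wLp_meas F) mid a1).
  move=> /le_lt_trans; apply; rewrite lte_fin.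
  have : eta * S <= e / 8.
    by rewrite /eta mulrAC -mulrA ler_piMr ?divr_ge0 ?(ltW e0)// ler_pdivrMr// mul1r lerDl.
  by rewrite -mulrA; lra.
have q0 k : 0 < (4^-1 ^+ k.+1 : R) by rewrite exprn_gt0 ?invr_gt0.
have /choice[h hP] : forall k : nat, exists F, H (ball F (4^-1 ^+ k.+1)) by move=> k; exact: cauchy.
have hstep k : (wnorm p w (fun x => (h k.+1 x : C) - h k x)%R <= (4^-1 ^+ k)%:E)%E.
  have [F []] := filter_ex (filterI (hP k) (hP k.+1)); rewrite !wLp_ballE => /ltW h1 /ltW h2.
  rewrite wnorm_distC in h1.
  apply: le_trans (wnormB_le (wLp_meas _) (wLp_meas F) (wLp_meas _) h2 h1) _.
  by rewrite lee_fin !exprS; have := exprn_ge0 k (ltW (q0 0%N)); rewrite expr1 => h3; lra.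
have [g mg gh] := riesz_fischer p1 (fun k => wLp_meas (h k)) hstep.
have gW : in_wLp p w g.
  by apply: (wLp_near (F := h 0%N) mg); rewrite wnorm_distC; exact: gh.
have [G GE] := wLp_ex gW.
have cvG : H --> G.
  apply/cvg_ballP => e e0; have e20 : 0 < e / 2 by rewrite divr_gt0.
  have [k /(_ _ (leqnn _)) kP] := side_small (ltr0n R 5) e20.
  apply: filterS (hP k) => F; rewrite !wLp_ballE => /ltW h1.
  have h2 := gh k; rewrite -GE in h2.
  apply: le_lt_trans (wnormB_le (wLp_meas G) (wLp_meas _) (wLp_meas F) h2 h1) _.
  rewrite lte_fin; have : (4^-1 ^+ k : R) <= 2^-1 ^+ k.
    by rewrite lerXn2r ?nnegrE ?invr_ge0// lef_pV2 ?posrE// ler_nat.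
  have : (4^-1 ^+ k.+1 : R) <= 4^-1 ^+ k.
    by rewrite exprS ler_piMl ?exprn_ge0 ?invr_ge0// invf_le1// ler1n.
  by move: kP; rewrite /side -exprVn; lra.
exists G; split => //; rewrite [closure A](closure_id _).1; last exact: closed_closure.
by move=> Y /cvG HY; have [F [h1 h2]] := filter_ex (filterI HA HY); exists F.
Qed.

End precompactness.

(** Zorn's lemma yields a maximal linear part of [G] that contains no [(0, h)] with [h] nonzero; if
    some [f] were outside its domain, adjoining the line through a pair [(f, h0)] of [G] would
    enlarge it. It serves to choose, linearly, among functions that differ by null functions. *)
Lemma linear_selection (K : fieldType) (V W : lmodType K) (G : set (V * W)) :
  (forall z x y, G x -> G y -> G (z *: x + y)) -> (forall f, exists h, G (f, h)) ->
  exists S : {linear V -> W}, forall f, G (f, S f).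
Proof.
(* Adding 0 lets the empty set, which is the union of the empty chain, satisfy [P]. *)
move=> Glin Gtot; pose sub (L : set (V * W)) := [set x | L x \/ x = 0].
have G0 : G 0.
  have [h Gh] := Gtot 0; have := Glin (-1) _ _ Gh Gh.
  by rewrite scaleN1r addNr.
pose P (L : set (V * W)) := [/\ sub L `<=` G,
  forall z x y, sub L x -> sub L y -> sub L (z *: x + y) & forall h, sub L (0, h) -> h = 0].
have [A [PA maxA]] : exists A, P A /\ forall B, A `<` B -> ~ P B.
  apply: Zorn_bigcup => F FP tot; have PX X : F X -> P X by exact: FP.
  have up x y : sub (\bigcup_(X in F) X) x -> sub (\bigcup_(X in F) X) y ->
      x = 0 /\ y = 0 \/ exists2 X, F X & sub X x /\ sub X y.
    move=> [[X FX Xx]|->] [[Y FY Yy]|->]; [right|right|right|by left].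
    - have [XY|YX] := tot _ _ FX FY; [exists Y => //|exists X => //]; split; left => //; [exact: XY|exact: YX].
    - by exists X => //; split; [left|right].
    - by exists Y => //; split; [right|left].
  split => [x [[X FX Xx]|->//]|z x y hx hy|h hh].
  - by have [h _ _] := PX X FX; apply: h; left.
  - have [[-> ->]|[X FX [Xx Xy]]] := up _ _ hx hy; first by right; rewrite scaler0 addr0.
    have [_ lX _] := PX X FX; have [hz|->] := lX z _ _ Xx Xy; [by left; exists X|by right].
  - by have [[[]]|[X FX [Xx _]]] := up _ _ hh hh => //; have [_ _] := PX X FX; apply.
have [subG subL sub0] := PA.
have subZ z x : sub A x -> sub A (z *: x).
  by move=> Ax; rewrite -[z *: x]addr0; apply: subL => //; right.
have total f : exists h, sub A (f, h).
  apply: contrapT => /forallNP nf; have [h0 Gh0] := Gtot f.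
  pose B := [set x | exists a y, sub A y /\ x = a *: ((f, h0) : V * W) + y].
  have B0 : B 0 by exists 0, 0; split; [right|rewrite scale0r addr0].
  have subB : sub B = B by apply/seteqP; split => [x [//|->//]|x]; left.
  apply: (maxA B).
    split; first by move=> x Ax; exists 0, x; split; [left|rewrite scale0r add0r].
    move=> BA; apply: (nf h0); left; apply: BA; exists 1, 0; split; [by right|by rewrite scale1r addr0].
  rewrite /P subB; split.
  - by move=> _ [a [y [/subG Gy ->]]]; exact: Glin.
  - move=> z _ _ [a [y [Ay ->]]] [a' [y' [Ay' ->]]]; exists (z * a + a'), (z *: y + y'); split; first exact: subL.
    by rewrite scalerDr scalerA scalerDl addrACA.
  - move=> h [a [[y1 y2] [Ay [e1 e2]]]]; have [a0|a0] := eqVneq a 0.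
      move: e1 e2; rewrite a0 !scale0r !add0r => e1 ->.
      by apply: sub0; rewrite e1.
    exfalso; apply: (nf (- a^-1 *: y2)); have := subZ (- a^-1) _ Ay; congr (sub A (_, _)).
    have -> : y1 = - (a *: f) by apply/eqP; rewrite -addr_eq0 addrC -[X in X == _]e1.
    by rewrite /= scaleNr scalerN opprK scalerA mulVf// scale1r.
have /choice[S SP] := total.
have linS : linear S.
  move=> z f g; apply/eqP; rewrite -subr_eq0; apply/eqP; apply: sub0.
  have := subL (-1) _ _ (subL z _ _ (SP f) (SP g)) (SP (z *: f + g)).
  congr (sub A _); rewrite scaleN1r; congr pair; first by rewrite /= addNr.
  by rewrite /= [LHS]addrC.
pose SL : {linear V -> W} := HB.pack S (GRing.isLinear.Build _ _ _ _ S linS).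
by exists SL => f; apply: subG; exact: SP.
Qed.

(** * Extension to the whole space *)

Section extension.
Local Open Scope complex_scope.
Variables (p q : R) (p1 : 1 < p) (q1 : 1 < q) (w : weight R n) (U : (X -> C) -> X -> C) (M0 : R).
Implicit Types (f g h : X -> C) (F : wLp p1 w) (H : wLp q1 w).
Hypothesis UM : forall f, mclass f -> cmeasurable (U f).
Hypothesis UL : forall z f g, mclass f -> mclass g ->
  {ae mu, forall x, U (fun y => z * f y + g y) x = z * U f x + U g x}.
Hypothesis M00 : 0 <= M0.
Hypothesis UB : forall f (c : R), mclass f -> 0 <= c -> (wnorm p w f <= c%:E)%E ->
  (wnorm q w (U f) <= (M0 * c)%:E)%E.
Hypothesis UA : forall e : R, 0 < e -> exists t L Mc, 0 < t /\
  forall f, mclass f -> (wnorm p w f <= 1%:E)%E -> exists c, (forall k, cabs (c k) <= Mc) /\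
  (wnorm q w (fun x => U f x - stepf t L c x)%R <= e%:E)%E.
Hypothesis wb : forall r : R, 0 < r -> (\int[mu]_(x in box r) (w x `^ q)%:E < +oo)%E.

Lemma wnorm_ae r f g : 1 < r -> cmeasurable f -> cmeasurable g -> {ae mu, forall x, f x = g x} ->
  wnorm r w f = wnorm r w g.
Proof.
move=> r1 mf mg fg; rewrite !wnorm_wpow; congr (_ `^ _)%E; apply: ae_eq_int => //.
- exact: measurable_wpow.
- exact: measurable_wpow.
- by move=> x; rewrite lee_fin powR_ge0.
- by move=> x; rewrite lee_fin powR_ge0.
by apply: filterS fg => x -> _.
Qed.

Lemma wnorm_lin r z f g (c d : R) : 1 < r -> cmeasurable f -> cmeasurable g ->
  (wnorm r w f <= c%:E)%E -> (wnorm r w g <= d%:E)%E ->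
  (wnorm r w (fun x => z * f x + g x)%R <= (cabs z * c + d)%:E)%E.
Proof.
move=> r1 mf mg fc gd; have mzf : cmeasurable (fun x => z * f x).
  by apply: cmeasurableM => //; exact: cmeasurable_cst.
apply: le_trans (le_wnorm w r1 mzf mg) _; rewrite EFinD; apply: leeD => //.
by rewrite wnormZ// EFinM; apply: lee_wpmul2l => //; rewrite lee_fin cabs_ge0.
Qed.

Lemma mclass_dense F (e : R) : 0 < e ->
  exists2 f, mclass f & (wnorm p w (fun x => (F x : C) - f x)%R <= e%:E)%E.
Proof.
move=> e0; have p0 : 0 < p by exact: lt_trans p1.
have [mF nF] := wLpP F; have mcF := measurable_cabs mF.
pose G (j : nat) : set X := [set x | cabs (F x) <= j%:R] `&` box j%:R.
have mG j : measurable (G j).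
  apply: measurableI; last exact: measurable_box.
  by rewrite -[X in measurable X]setTI; apply: measurable_fun_ler => //; exact: measurable_cst.
have ndG : nondecreasing_seq G.
  move=> i j ij; apply/subsetPset => x [h1 h2]; split; last exact: (subsetPset _ _ (box_nd ij)) h2.
  by apply: le_trans h1 _; rewrite ler_nat.
have GT : [set: X] `<=` \bigcup_j G j.
  move=> x _; have [N _ HN] := box_cover (Logic.I : setT x).
  exists (maxn (Num.bound (cabs (F x))) N) => //; split.
    apply: le_trans (ltW (archi_boundP (cabs_ge0 _))) _; by rewrite ler_nat leq_maxl.
  exact: (subsetPset _ _ (box_nd (leq_maxr _ N))) HN.
have foo : (wpow p w F < +oo)%E.
  rewrite wnorm_wpow in nF; rewrite ltey; apply/eqP => E.
  by move: nF; rewrite E poweRyr// invr_eq0 gt_eqF.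
have ep : 0 < e `^ p by rewrite powR_gt0.
have [j Hj] := int_tail (measurable_wpow p w mF) (fun x => powR_ge0 _ _) foo ndG mG GT ep.
have mf : cmeasurable (crestr (G j) F) by exact: cmeasurable_restr.
exists (crestr (G j) F).
  split.
    split => //; apply: (@lmom_bounded _ _ _ j%:R); first exact: measurable_cabs.
    move=> x; rewrite cabs_ge0/= /crestr; case: ifPn => [/set_mem[]//|_].
    by rewrite cabs0.
  exists j%:R => // x xj; rewrite /crestr memNset// => -[_ /(boxE _ (ler0n R j))].
  by rewrite leNgt xj.
apply/(wnorm_le _ p1); first exact: ltW.
apply: le_trans Hj; apply: eq_leW; apply: int_eq_sub => // x xG; rewrite /crestr.
  by rewrite memNset// subr0.
by rewrite mem_set ?subrr ?cabs0 ?mul0r ?powR0 ?gt_eqF//; exact: contrapT.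
Qed.

Lemma U_lip f g (c : R) : mclass f -> mclass g -> 0 <= c ->
  (wnorm p w (fun x => f x - g x)%R <= c%:E)%E ->
  (wnorm q w (fun x => U f x - U g x)%R <= (M0 * c)%:E)%E.
Proof.
move=> mf mg c0 fg; have mgf : mclass (fun x => -1 * g x + f x) by apply: mclassD => //; exact: mclassZ.
have e : (fun x => f x - g x) = fun x => -1 * g x + f x by apply/funext => x; rewrite mulN1r addrC.
rewrite e in fg; have := UB mgf c0 fg.
rewrite (wnorm_ae q1 (UM mgf) (cmeasurableB (UM mf) (UM mg)))//.
by apply: filterS (UL (-1) mg mf) => x ->; rewrite mulN1r addrC.
Qed.

(** The closure of the graph of [U] over [mclass]: a linear relation and not a function, because
    nonzero functions may have seminorm 0. *)
Definition graph : set (wLp p1 w * wLp q1 w) := [set x : wLp p1 w * wLp q1 w | forall e : R, 0 < e -> exists2 f, mclass f &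
  (wnorm p w (fun y => (x.1 y : C) - f y)%R <= e%:E)%E /\
  (wnorm q w (fun y => (x.2 y : C) - U f y)%R <= e%:E)%E].

Lemma graph_linear (z : C) x y : graph x -> graph y -> graph (z *: x + y).
Proof.
move=> Gx Gy e e0; have z1 : 0 < cabs z + 1 by rewrite ltr_wpDl// cabs_ge0.
have d0 : 0 < e / (cabs z + 1) by rewrite divr_gt0.
have [f mf [f1 f2]] := Gx _ d0; have [g mg [g1 g2]] := Gy _ d0.
have mfg : mclass (fun x => z * f x + g x) by apply: mclassD => //; exact: mclassZ.
have eE : cabs z * (e / (cabs z + 1)) + e / (cabs z + 1) = e by field; rewrite gt_eqF.
have mB r (r1 : 1 < r) (Y : wLp r1 w) k : cmeasurable k -> cmeasurable (fun t => (Y t : C) - k t).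
  by move=> mk; apply: cmeasurableB => //; exact: wLp_meas.
exists (fun x => z * f x + g x) => //; split.
  have h1 := wnorm_lin z p1 (mB _ _ x.1 _ (mclass_meas mf)) (mB _ _ y.1 _ (mclass_meas mg)) f1 g1.
  rewrite eE in h1; apply: le_trans h1; rewrite (_ : (fun y0 => _) =
    fun t => z * ((x.1 t : C) - f t) + ((y.1 t : C) - g t))//.
  apply/funext => t; have -> : ((z *: x + y).1 t : C) = z * (x.1 t : C) + y.1 t by [].
  by ring.
have m1 := mB _ _ x.2 _ (UM mf); have m2 := mB _ _ y.2 _ (UM mg).
have h2 := wnorm_lin z q1 m1 m2 f2 g2; rewrite eE in h2; apply: le_trans h2.
apply: eq_leW.
have m3 : cmeasurable (fun t => z * ((x.2 t : C) - U f t) + ((y.2 t : C) - U g t)).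
  by apply: cmeasurableD m2; apply: cmeasurableM m1; exact: cmeasurable_cst.
apply: (wnorm_ae q1 (mB _ _ (z *: x + y).2 _ (UM mfg)) m3).
apply: filterS (UL z mf mg) => t ->.
have -> : ((z *: x + y).2 t : C) = z * (x.2 t : C) + y.2 t by [].
by ring.
Qed.

(** Approximations of [F] at the rate [4 ^- (k + 1) / (M0 + 1)] have images whose consecutive
    distances suit [riesz_fischer]. *)
Lemma graph_total F : exists H, graph (F, H).
Proof.
have M1 : 0 < M0 + 1 by rewrite ltr_wpDl.
have q40 : 0 < (4^-1 : R) by rewrite invr_gt0.
pose d k : R := 4^-1 ^+ k.+1 / (M0 + 1).
have d0 k : 0 < d k by rewrite divr_gt0 ?exprn_gt0.
have /choice[f fP] : forall k : nat, exists f, mclass f /\ (wnorm p w (fun x => (F x : C) - f x)%R <= (d k)%:E)%E.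
  by move=> k; have [f mf Ff] := mclass_dense F (d0 k); exists f.
have mf k := (fP k).1; have mF := wLp_meas F.
have step k : (wnorm q w (fun x => U (f k.+1) x - U (f k) x)%R <= (4^-1 ^+ k)%:E)%E.
  have := (fP k.+1).2; rewrite wnorm_distC => h1.
  have := U_lip (mf k.+1) (mf k) (ltW (addr_gt0 (d0 k.+1) (d0 k)))
    (wnormB_le p1 (mclass_meas (mf _)) mF (mclass_meas (mf _)) h1 (fP k).2).
  move=> /le_trans; apply; rewrite lee_fin /d -mulrDl mulrA ler_pdivrMr// mulrC.
  have z0 : 0 < (4^-1 ^+ k : R) by rewrite exprn_gt0.
  by rewrite !exprS; apply: ler_pM => //; lra.
have [h mh hh] := riesz_fischer q1 (fun k => UM (mf k)) step.
have hW : in_wLp q w h.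
  split => //; rewrite (_ : h = (fun x => h x - U (f 0%N) x) \+ U (f 0%N)); last by apply/funext => x /=; rewrite subrK.
  apply: le_lt_trans (le_wnorm w q1 (cmeasurableB mh (UM (mf _))) (UM (mf _))) _.
  apply: lte_add_pinfty; first by apply: le_lt_trans (hh 0%N) (ltry _).
  have [_ fin] := wLp_near (mclass_meas (mf 0%N)) (fP 0%N).2.
  have c0 : 0 <= fine (wnorm p w (f 0%N)) by rewrite fine_ge0// poweR_ge0.
  apply: le_lt_trans (UB (mf 0%N) c0 _) (ltry _).
  by rewrite fineK// ge0_fin_numE// poweR_ge0.
have [H HE] := wLp_ex q1 hW; exists H => e e0.
have [k /(_ _ (leqnn _)) kP] := side_small (ltr0n R 5) e0.
have q42 : (4^-1 ^+ k : R) <= 2^-1 ^+ k.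
  by rewrite lerXn2r ?nnegrE ?invr_ge0// lef_pV2 ?posrE// ler_nat.
have z0 : 0 < (4^-1 ^+ k : R) by rewrite exprn_gt0.
rewrite /side -exprVn in kP.
exists (f k) => //; split; [apply: le_trans (fP k).2 _|rewrite HE; apply: le_trans (hh k) _]; rewrite lee_fin; last by lra.
apply: (@le_trans _ _ (4^-1 ^+ k.+1)); last by rewrite exprS; lra.
by rewrite ler_pdivrMr// ler_peMr ?exprn_ge0 ?(ltW q40)// lerDr.
Qed.

(** Compactness: a bounded set is scaled into the unit ball, where the approximation of [U] by step
    functions is transferred to [S] through the closure of the graph. Agreement on [mclass]: the
    pair of [F] and [S F] is a limit of pairs of [f] and [U f], and [U] is Lipschitz, so [S F - U F]
    has norm 0. *)
Lemma compact_extension : exists2 S : {linear wLp p1 w -> wLp q1 w}, compact_operator S &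
  forall F, mclass F -> {ae mu, forall x, S F x = U F x}.
Proof.
have [S SG] := linear_selection graph_linear graph_total; exists S.
  move=> A [M AM]; apply: approximable_precompact wb _ => e e0.
  pose N := `|M| + 1; have N0 : 0 < N by rewrite ltr_wpDl.
  have e2 : 0 < e / 2 by rewrite divr_gt0.
  have [t [L [Mc [t0 HL]]]] := UA (divr_gt0 e2 N0).
  exists t, L, (N * Mc); split => // _ [F AF <-].
  (* The bound 1 keeps the approximant [f] in the ball of radius [N], the bound [e / 2] is half of
     the admissible error. *)
  have m0 : 0 < Num.min 1 (e / 2) by rewrite lt_min ltr01.
  have [f mf [f1 f2]] := SG F _ m0.
  have cF := wLp_meas F; have cf := mclass_meas mf; have UMf := UM mf.
  have fN : (wnorm p w f <= N%:E)%E.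
    have -> : f = (fun x => f x - (F x : C)) \+ F by apply/funext => x /=; rewrite subrK.
    apply: le_trans (le_wnorm w p1 (cmeasurableB cf cF) cF) _.
    rewrite addrC EFinD; apply: leeD.
      by apply: le_trans (AM _ AF) _; rewrite lee_fin ler_norm.
    rewrite wnorm_distC; apply: le_trans f1 _.
    by rewrite lee_fin ge_min lexx.
  have NV : cabs ((N^-1)%:C) = N^-1 by rewrite cabs_real ger0_norm// invr_ge0 ltW.
  have mg : mclass (fun x => (N^-1)%:C * f x) by exact: mclassZ.
  have gN : (wnorm p w (fun x => (N^-1)%:C * f x)%R <= 1%:E)%E.
    rewrite wnormZ// NV; apply: le_trans (lee_wpmul2l _ fN) _; first by rewrite lee_fin invr_ge0 ltW.
    by rewrite -EFinM mulVf ?gt_eqF.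
  have [c [cM cU]] := HL _ mg gN; exists (fun k => N%:C * c k); split.
    move=> k; rewrite cabsM cabs_real ger0_norm ?ler_pM2l//; exact: ltW.
  have cSF := wLp_meas (S F); have ms c0 : cmeasurable (stepf t L c0) by exact: cmeasurable_stepf.
  have h1 : (wnorm q w (fun x => (S F x : C) - U f x)%R <= (e / 2)%:E)%E.
    by apply: le_trans f2 _; rewrite lee_fin ge_min lexx orbT.
  have h2 : (wnorm q w (fun x => U f x - stepf t L (fun k => N%:C * c k) x)%R <= (e / 2)%:E)%E.
    have mU := cmeasurableB (UM mg) (ms c).
    have mN : cmeasurable (fun x => N%:C * (U (fun y => (N^-1)%:C * f y) x - stepf t L c x)).
      by apply: cmeasurableM => //; exact: cmeasurable_cst.
    rewrite (wnorm_ae q1 (cmeasurableB UMf (ms _)) mN).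
      rewrite wnormZ//; apply: le_trans (lee_wpmul2l _ cU) _; first by rewrite lee_fin cabs_ge0.
      by rewrite cabs_real (ger0_norm (ltW N0)) -EFinM lee_fin mulrC divfK // gt_eqF.
    apply: filterS (lin_scale UL (N^-1)%:C mf) => x ->.
    have NN : N%:C * (N^-1)%:C = 1 :> C by rewrite -rmorphM/= mulfV ?gt_eqF.
    rewrite mulrBr mulrA NN mul1r /stepf; case: ifP => //; by rewrite mulr0.
  have -> : (fun x => (S F x : C) - stepf t L (fun k => N%:C * c k) x) =
      (fun x => (S F x : C) - U f x) \+ (fun x => U f x - stepf t L (fun k => N%:C * c k) x).
    by apply/funext => x /=; rewrite subrKA.
  apply: le_trans (le_wnorm w q1 (cmeasurableB cSF UMf) (cmeasurableB UMf (ms _))) _.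
  by apply: le_trans (leeD h1 h2) _; rewrite -EFinD -splitr.
move=> F mF; have cF := wLp_meas F; have cSF := wLp_meas (S F); have UMF := UM mF.
have mD := cmeasurableB cSF UMF.
have small e : 0 < e -> (wnorm q w (fun x => (S F x : C) - U F x)%R <= (e * (1 + M0))%:E)%E.
  move=> e0; have [f mf [f1 f2]] := SG F _ e0; have UMf := UM mf.
  have h2 : (wnorm q w (fun x => U f x - U F x)%R <= (M0 * e)%:E)%E.
    by apply: (U_lip mf mF (ltW e0)); rewrite wnorm_distC; exact: f1.
  have -> : (fun x => (S F x : C) - U F x) =
      (fun x => (S F x : C) - U f x) \+ (fun x => U f x - U F x).
    by apply/funext => x /=; rewrite subrKA.
  apply: le_trans (le_wnorm w q1 (cmeasurableB cSF UMf) (cmeasurableB UMf UMF)) _.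
  by apply: le_trans (leeD f2 h2) _; rewrite -EFinD mulrDr mulr1 (mulrC e).
have q0 : 0 < q by exact: lt_trans q1.
have z : (wnorm q w (fun x => (S F x : C) - U F x)%R <= 0%:E)%E.
  apply/lee_addgt0Pr => e e0; rewrite add0e.
  have M1 : 0 < 1 + M0 by rewrite ltr_pwDl.
  by apply: le_trans (small _ (divr_gt0 e0 M1)) _; rewrite divfK ?gt_eqF.
have {}z : (\int[mu]_x `|((cabs (S F x - U F x) * w x) `^ q)%:E|)%E = 0%E.
  apply/eqP; rewrite eq_le integral_ge0 ?andbT => [|x _ //].
  rewrite (eq_integral (fun x => ((cabs (S F x - U F x) * w x) `^ q)%:E)).
    by move/(wnorm_le w q1 _ (lexx 0)): z; rewrite powR0 ?gt_eqF.
  by move=> x _; rewrite gee0_abs// lee_fin powR_ge0.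
have /ae_eq_integral_abs h := z.
have := h measurableT (measurable_wpow q w mD).
apply: filterS2 (weight_gt0 w) => x w0 /(_ Logic.I)/= [].
move=> /eqP; rewrite powR_eq0 mulf_eq0 (gt_eqF w0) orbF => /andP[/eqP h0 _].
by apply/eqP; rewrite -subr_eq0; apply/eqP; exact: cabs_eq0.
Qed.

End extension.

(** * Test functions, CMO and the weight condition *)

Section symbols.
Implicit Types (f g : X -> C).

Lemma compact_cube (c : X) (l : R) : compact (cube c l).
Proof.
rewrite (_ : cube c l = [set v : X | forall i, `[c ord0 i, c ord0 i + l]%classic (v ord0 i)]).
  apply: (@rV_compact _ n (fun i => `[c ord0 i, c ord0 i + l]%classic)) => i.
  exact: segment_compact.
by apply/seteqP; split => x h i; have := h i; rewrite /= in_itv.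
Qed.

Lemma locally_integrable_cint f (c : X) (l : R) : locally_integrable_rV f -> cint (cube c l) f.
Proof. by move=> [mf foo]; split => //; apply: foo; exact: compact_cube. Qed.

Lemma compactly_supported_bounded f : compactly_supported f ->
  exists2 r : R, 0 <= r & forall x, r < `|x| -> f x = 0.
Proof.
move=> cf; have [M [Mr HM]] := compact_bounded cf.
exists (`|M| + 1); first by rewrite addr_ge0.
move=> x xM; apply: contrapT => /eqP fx.
have := HM (`|M| + 1) (le_lt_trans (ler_norm M) (ltr_pwDr ltr01 (lexx _))) x.
have sx : closure [set x | f x != 0] x by exact: subset_closure.
by move=> /(_ sx)/=; rewrite leNgt xM.
Qed.

Lemma continuous_dist (h : X -> R) (x : X) (e : R) : {for x, continuous h} -> 0 < e ->
  exists2 d : R, 0 < d & forall y, `|x - y| < d -> `|h x - h y| <= e.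
Proof.
move=> ch e0; have /cvgrPdist_le/(_ _ e0)/nbhs_normP[d d0 H] := ch.
by exists d => // y; exact: H.
Qed.

(** The sigma-algebra is generated by coordinates rather than by open sets, so a continuous function
    is written as a limit of functions constant on dyadic cells. *)
Lemma continuous_rV_measurable (h : X -> R) : continuous h -> measurable_fun setT h.
Proof.
move=> ch; pose s (j : nat) : R := side 1 j; have s0 j : 0 < s j by exact: side_gt0.
apply: (@measurable_fun_cvg _ _ _ _ (fun j z => h (corner (s j) (idx (s j) z)))) => //.
  by move=> j; exact: (@measurable_dset_fun _ _ 1 j _ _ (fun k => h (corner (s j) k))).
move=> z _; apply/cvgrPdist_le => e e0; have [d d0 H] := continuous_dist (ch z) e0.
have [N HN] := side_small ltr01 d0.
exists N.+1 => // j /= Nj; apply: H.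
apply: lt_le_trans (dcube_dist (s0 j) (dcube_idx _ _) (dcube_corner _ (s0 j))) _.
by apply: HN; exact: ltnW.
Qed.

(** Compactness of a box is used in covering form, for the bound and for uniform continuity. The box
    exceeds the support by one unit so that, at distances below 1, a point outside it has only
    partners where [g] vanishes. *)
Lemma test_function_unif_supp g : test_function g ->
  exists G r0 : R, [/\ 1 <= G, 0 <= r0 & unif_supp G r0 g].
Proof.
move=> [/(_ [::])[/= cr _] /(_ [::])[/= ci _] sg].
have [r r0 gr] := compactly_supported_bounded sg.
have cont (x : X) (e : R) : 0 < e -> exists2 d : R, 0 < d & forall y, `|x - y| < d -> cabs (g x - g y) <= e.
  move=> e0; have e2 : 0 < e / 2 by rewrite divr_gt0.
  have [d1 d10 H1] := continuous_dist (cr x) e2; have [d2 d20 H2] := continuous_dist (ci x) e2.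
  exists (Num.min d1 d2) => [|y]; first by rewrite lt_min d10.
  rewrite lt_min => /andP[/H1 h1 /H2 h2]; apply: le_trans (cabs_le_ReIm _) _.
  by rewrite [e]splitr !raddfB; exact: lerD.
have /compact_near_coveringP cov : compact (box (r + 1) : set X) by exact: compact_cube.
have r10 : 0 <= r + 1 by rewrite addr_ge0.
have [N _ HN] : \forall i \near \oo, box (r + 1) `<=` (fun x => cabs (g x) <= i%:R).
  apply: cov => x _; have [d d0 H] := cont x 1 ltr01.
  exists (ball x d, [set i | (Num.bound (cabs (g x) + 1) <= i)%N]) => /=.
    by split; [exact: nbhsx_ballx|exists (Num.bound (cabs (g x) + 1))].
  move=> [y i] /= [xy Ni]; have := H y; rewrite -ball_normE in xy => /(_ xy) h.
  have -> : g y = g x - (g x - g y) by rewrite subKr.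
  apply: le_trans (cabsD _ _) _; rewrite cabsN; apply: le_trans (lerD (lexx _) h) _.
  apply: le_trans (ltW (archi_boundP _)) _; last by rewrite ler_nat.
  by rewrite addr_ge0// cabs_ge0.
have mg : cmeasurable g by split; exact: continuous_rV_measurable.
exists (N%:R + 1), r; split => //; first by rewrite lerDr.
split => // [x|e e0].
  have [xr|/gr ->] := leP `|x| r; last by rewrite cabs0 addr_ge0.
  apply: le_trans (HN N (leqnn N) x _) _; last by rewrite lerDl.
  by apply/boxE => //; apply: le_trans xr _; rewrite lerDl.
have : \forall d \near 0^'+, box (r + 1) `<=` (fun x : X => forall y, `|x - y| <= d -> cabs (g x - g y) <= e).
  apply: cov => x _; have e2 : 0 < e / 2 by rewrite divr_gt0.
  have [d d0 H] := cont x _ e2; have d2 : 0 < d / 2 by rewrite divr_gt0.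
  exists (ball x (d / 2), [set t | t < d / 2]) => /=.
    by split; [exact: nbhsx_ballx|exact: nbhs_right_lt].
  move=> [x' t] /= [xx' td] y xy; rewrite -ball_normE in xx'.
  have -> : g x' - g y = (g x - g y) - (g x - g x') by ring.
  apply: le_trans (cabsD _ _) _; rewrite cabsN [e]splitr; apply: lerD; apply: H.
    have -> : x - y = (x - x') + (x' - y) by rewrite subrKA.
    apply: le_lt_trans (ler_normD _ _) _; rewrite [d]splitr; apply: ltr_leD => //.
    by apply: le_trans xy _; exact: ltW.
  by apply: lt_trans xx' _; rewrite ltr_pdivrMr//; lra.
move=> H; have [d [[{}H d0] d1]] := @filter_ex _ _ _ _ (filterI (filterI H (nbhs_right_gt 0)) (nbhs_right_lt (@ltr01 R))).
exists d => // x y xy; have [xr|xr] := leP `|x| (r + 1); first by apply: H => //; exact/boxE.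
have yr : r < `|y|.
  have : `|x| <= `|x - y| + `|y| by rewrite -{1}(subrK y x) ler_normD.
  by lra.
by rewrite !gr ?subrr ?cabs0 ?(ltW e0)//; apply: le_lt_trans xr; rewrite lerDl.
Qed.

Lemma cmo_osc_approx f : cmo f -> (exists2 M : R, 0 < M & osc_le M f) /\
  forall d : R, 0 < d -> exists G r0 g, [/\ 1 <= G, 0 <= r0, unif_supp G r0 g &
    osc_le d (fun x => f x - g x)].
Proof.
move=> [[lf foo] ap]; split.
  have f0 : (0 <= bmo_norm f)%E.
    apply: ereal_sup_ge; exists (((vol (cube (0 : X) 1))^-1)%:E * \int[mu]_(x in cube (0 : X) 1) (cabs (f x - average (cube (0 : X) 1) f))%:E)%E.
      by exists (cube 0 1) => //; exists 0, 1.
    by rewrite mule_ge0 ?integral_ge0// ?lee_fin ?invr_ge0 ?fine_ge0// => x _; rewrite lee_fin cabs_ge0.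
  exists (fine (bmo_norm f) + 1); first by rewrite ltr_wpDl// fine_ge0.
  apply: osc_le_bmo => [c l _|]; first exact: locally_integrable_cint.
  by rewrite EFinD fineK ?ge0_fin_numE// leeDl.
move=> d /ap[g tg fg]; have [G [r0 [G1 r00 ug]]] := test_function_unif_supp tg.
exists G, r0, g; split => //; apply: osc_le_bmo (ltW fg) => c l l0.
have [mg _ gG _] := ug; have mc := @measurable_cube R n c l.
have muc : (mu (cube c l) < +oo)%E by rewrite measure_cube ?(ltW l0)// ltry.
apply: cintD => //; first exact: locally_integrable_cint.
have cG := cint_cst (G%:C)%C mc muc.
apply: (cint_le cG) => [|x _]; first exact: cmeasurableN.
by rewrite cabsN cabs_real; apply: le_trans (gG x) (ler_norm _).
Qed.

Lemma comms_ae (T T' : (X -> C) -> X -> C) bs : lmomcs bs ->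
  (forall f, mclass f -> {ae mu, forall x, T' f x = T f x}) ->
  forall f, mclass f -> {ae mu, forall x, comms T' bs f x = comms T bs f x}.
Proof.
move=> + TT; elim: bs => [_|c bs ih /lmomcs_cons[lc lbs]] f mf; first exact: TT.
apply: filterS2 (ih lbs _ mf) (ih lbs _ (mclassMl lc mf)) => x h1 h2.
by rewrite /= /commutator h1 h2.
Qed.

Lemma iterated_commutatorE m (c : X -> C) T : iterated_commutator m c T = comms T (nseq m c).
Proof. by elim: m => [//|m ih]; rewrite [RHS]/= -ih. Qed.

Lemma bounded_compactly_supported_mclass f : bounded_compactly_supported f -> mclass f.
Proof.
move=> [mf [M fM] cf]; split; last exact: compactly_supported_bounded.
split => //; apply: (@lmom_bounded _ _ _ M); first exact: measurable_cabs.
by move=> x; rewrite cabs_ge0/=.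
Qed.

(** Here [a = 1 / q] and [b = 1 / p']; the defining supremum is normalised by the volume, which
    accounts for the factor [(l ^ n) ^ (a + b)]. *)
Lemma Apq_dual_pair (p q : R) (w : weight R n) : 1 < p -> 1 < q -> (Apq_constant p q w < +oo)%E ->
  exists A, dual_pair q^-1 (1 - p^-1) A (fun x => w x `^ q) (fun x => w x `^ (- (1 - p^-1)^-1)).
Proof.
move=> p1 q1 Aoo; have p0 : 0 < p by exact: lt_trans p1.
have q0 : 0 < q by exact: lt_trans q1.
have b0 : 0 < 1 - p^-1 by rewrite subr_gt0 invf_lt1.
pose b := 1 - p^-1; rewrite -/b; have {}b0 : 0 < b := b0.
exists (fine (Apq_constant p q w)); split => //.
- by rewrite invr_gt0.
- apply: (measurableT_comp (measurable_powR q)); exact: weight_measurable.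
- apply: (measurableT_comp (measurable_powR (- b^-1))); exact: weight_measurable.
- by move=> x; exact: powR_ge0.
- by move=> x; exact: powR_ge0.
- apply: filterS (weight_gt0 w) => x w0.
  rewrite powRVK ?gt_eqF ?(ltW w0)// powRN -powR_inv1 ?powR_ge0//.
  rewrite -!powRrM mulN1r mulrN mulVf ?gt_eqF// powRN powRr1 ?(ltW w0)// mulfV ?gt_eqF//.
move=> c l l0; have L0 : 0 < l ^+ n by rewrite exprn_gt0.
set V := (\int[_]_(x in _) (w x `^ q)%:E)%E; set W := (\int[_]_(x in _) _)%E.
have V0 : (0 <= V)%E by apply: integral_ge0 => x _; rewrite lee_fin powR_ge0.
have W0 : (0 <= W)%E by apply: integral_ge0 => x _; rewrite lee_fin powR_ge0.
have H : ((((l ^+ n)^-1)%:E * V) `^ q^-1 * (((l ^+ n)^-1)%:E * W) `^ b <= Apq_constant p q w)%E.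
  apply: ereal_sup_ubound; exists (cube c l); first by exists c, l.
  by rewrite /= vol_cube ?(ltW l0)// invrK.
have Afin : Apq_constant p q w = (fine (Apq_constant p q w))%:E.
  rewrite fineK// ge0_fin_numE//; apply: le_trans H.
  by apply: mule_ge0; exact: poweR_ge0.
have scal (Y : \bar R) t : (0 <= Y)%E -> (Y `^ t = ((l ^+ n) `^ t)%:E * (((l ^+ n)^-1)%:E * Y) `^ t)%E.
  move=> Y0; have LV : (0 <= ((l ^+ n)^-1)%:E)%E by rewrite lee_fin invr_ge0 ltW.
  by rewrite -poweR_EFin -poweRM ?lee_fin ?(ltW L0) ?mule_ge0// muleA -EFinM mulfV ?gt_eqF// mul1e.
rewrite (scal _ q^-1 V0) (scal _ b W0) muleACA -EFinM -powRD; last by rewrite (gt_eqF L0) implybT.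
rewrite Afin in H; rewrite mulrC EFinM; apply: lee_wpmul2l H.
by rewrite lee_fin powR_ge0.
Qed.

Lemma wint_wpow (p q : R) (w : weight R n) f : 0 < q ->
  wint q^-1 (fun x => w x `^ q) p setT f = wpow p w f.
Proof.
move=> q0; apply: eq_integral => x _; congr ((_ * _) `^ _)%:E.
by rewrite powRVK ?gt_eqF// weight_ge0.
Qed.

End symbols.

End compactness_of_commutators.

Theorem theorem1p5 (R : realType) (n m : nat) (p q alpha : R)
    (p1 : 1 < p) (q1 : 1 < q) (alpha_ge0 : 0 <= alpha) (alpha_lt : alpha < n%:R)
    (pq : q^-1 = p^-1 - alpha / n%:R) (m_gt0 : (0 < m)%N)
    (w : weight R n) (wApq : (Apq_constant p q w < +oo)%E)
    (rho : R -> R) (rho_dini : dini_modulus rho)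
    (K : 'rV[R]_n -> 'rV[R]_n -> R)
    (T : ('rV[R]_n -> R[i]) -> 'rV[R]_n -> R[i])
    (TK : rho_type_operator rho alpha K T)
    (b : 'rV[R]_n -> R[i]) (b_cmo : cmo b)
    (b_real : (2 <= m)%N -> forall x, complex.Im (b x) = 0) :
  exists2 S : {linear wLp p1 w -> wLp q1 w},
    compact_operator S & extends (iterated_commutator m b T) S.
Proof.
have n0 : (0 < n)%N by rewrite -(ltr0n R); exact: le_lt_trans alpha_lt.
have p0 : 0 < p by exact: lt_trans p1.
have q0 : 0 < q by exact: lt_trans q1.
have [A D] := Apq_dual_pair p1 q1 wApq.
have [Ck [So [om [B [T' [KB LO TT]]]]]] := rho_type_local_op alpha_ge0 alpha_lt rho_dini TK.
(* This is [alpha = n (1 / p - 1 / q)] in terms of [a = 1 / q] and [b = 1 - 1 / p]. *)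
have aE : alpha = n%:R * (1 - q^-1 - (1 - p^-1)).
  have nz : n%:R != 0 :> R by rewrite pnatr_eq0 -lt0n.
  by rewrite pq; field; rewrite nz gt_eqF.
have a1 : q^-1 < 1 by rewrite invf_lt1.
have b1 : 1 - p^-1 < 1 by rewrite ltrBlDr ltrDl invr_gt0.
have pE : (1 - (1 - p^-1))^-1 = p by rewrite subKr invrK.
have [[M M0 ob] ap] := cmo_osc_approx b_cmo.
have lb := osc_le_lmomc ob.
have lbs : lmomcs (nseq m b) by move=> c /nseqP[-> _].
pose U := comms T' (nseq m b).
have [C1 C10 WB] := weighted_bound alpha_ge0 (ltW alpha_lt) KB LO D n0 a1 b1 aE m.
rewrite pE invrK in WB.
have P0 : 0 <= \prod_(c <- nseq m b) M by apply: prodr_ge0 => c _; exact: ltW.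
have UM f : mclass f -> cmeasurable (U f) by move=> mf; exact: (comms_meas (lo_meas LO) lbs mf).
have [S cS SU] : exists2 S : {linear wLp p1 w -> wLp q1 w}, compact_operator S &
    forall F : wLp p1 w, mclass F -> {ae lebesgue_rV n, forall x, S F x = U F x}.
  apply: (@compact_extension _ _ _ _ p1 q1 w U (C1 * \prod_(c <- nseq m b) M)) => //.
  - by move=> z f g mf mg; exact: (comms_lin (lo_lin LO) z lbs mf mg).
  - exact: mulr_ge0.
  - move=> f c mf c0 fc; apply/(wnorm_le _ q1); first by rewrite !mulr_ge0.
    have := WB (nseq m b) (fun=> M) (size_nseq _ _) _ f c mf c0.
    rewrite !wint_wpow//; apply; first by move=> d /nseqP[-> _].
    exact/(wnorm_le w p1).
  (* As [wint] is the [q]-th power of the norm, accuracy [e] in norm means accuracy [e ^ q] for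
     it. *)
  - move=> e e0; have eq0 : 0 < e `^ q by rewrite powR_gt0.
    have [t [L [Mc [t0 H]]]] := cmo_finite_rank alpha_ge0 (ltW alpha_lt) KB LO D n0 a1 b1 aE m_gt0 eq0 ob ap.
    rewrite pE invrK in H; exists t, L, Mc; split => // f mf f1.
    have [|c [cM cU]] := H f mf.
      have := (wnorm_le w p1 f ler01).1 f1.
      by rewrite wint_wpow// (_ : (1 : R) `^ p = 1) ?powR1.
    exists c; split => //; apply/(wnorm_le w q1); first exact: ltW.
    by rewrite -(wint_wpow q w _ q0).
  - move=> r r0; apply: (dp_fin D (@measurable_box _ _ r) (@subset_refl _ _)).
    by rewrite mulr_gt0.
exists S => // F /bounded_compactly_supported_mclass mF.
rewrite iterated_commutatorE; apply: filterS2 (SU F mF) (comms_ae lbs TT mF) => x -> //.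
Qed.
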